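(* Let $P_{n,l}\in\widehat C_{n,l}$, $P_{n+2,l+1}\in\widehat C_{n+2,l+1}$ and $g\in U_{\sqrt{-1}}$. If the pair $(P_{n,l},P_{n+2,l+1})$ is a link, then $(g.P_{n,l},\,g.P_{n+2,l+1})$ is also a link.
   Context: **Algebra.** Let $i=\sqrt{-1}$, $[j]=(q^j-q^{-j})/(q-q^{-1})$, $[n]!=\prod_{j=1}^n[j]$, $x^{(r)}=x^r/[r]!$. $U_q(\widetilde{\mathfrak{sl}}_2)$ is the $\mathbb C(q)$-algebra generated by $x_k^\pm$ ($k\in\mathbb Z$), $a_n$ ($n\in\mathbb Z\setminus\{0\}$), $t_1^{\pm1}$ with relations $[t_1,a_n]=0=[a_m,a_n]$, $t_1x_k^\pm t_1^{-1}=q^{\pm2}x_k^\pm$, $[a_n,x_k^\pm]=\pm\frac{[2n]}{n}x^\pm_{k+n}$, $x^\pm_{k+1}x^\pm_l-q^{\pm2}x^\pm_lx^\pm_{k+1}=q^{\pm2}x^\pm_kx^\pm_{l+1}-x^\pm_{l+1}x^\pm_k$, $[x_k^+,x_l^-]=\frac{\varphi^+_{k+l}-\varphi^-_{k+l}}{q-q^{-1}}$, where $\sum_{k}\varphi^\pm_{\pm k}z^k=t_1^{\pm1}\exp(\pm(q-q^{-1})\sum_{n\ge1}a_{\pm n}z^n)$. Put $\tilde a_n=\frac{n}{[n]}a_n$ and ${t_1;n\brack r}=\prod_{s=1}^r\frac{t_1q^{n-s+1}-t_1^{-1}q^{-n+s-1}}{q^s-q^{-s}}$. $U_q^{\rm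 res}$ is the $\mathbb C[q,q^{-1}]$-subalgebra generated by all $(x_n^\pm)^{(r)}$ ($n\in\mathbb Z,r\ge0$), $t_1^{\pm1}$, ${t_1;n\brack r}$, $\tilde a_n$, and $U_{\sqrt{-1}}=U_q^{\rm res}\otimes_{\mathbb C[q,q^{-1}]}\mathbb C$ with $q\mapsto\sqrt{-1}$. Generating series: $\mathcal X^+_{\ge0}(t)=\sum_{n\ge0}x_n^+(q^{-1}t)^n$, $\mathcal X^+_{<0}(t)=\sum_{n<0}x_n^+(q^{-1}t)^n$, $\mathcal X^-_{>0}(t)=\sum_{n>0}x_n^-(q^{-1}t)^n$, $\mathcal X^-_{\le0}(t)=\sum_{n\le0}x_n^-(q^{-1}t)^n$, $a_\pm(t)=\sum_{\pm n>0}\tilde a_nt^n$. $U_{\sqrt{-1}}$ is generated by $t_1^{\pm1}$, ${t_1;n\brack2}$ and the coefficients of $a_\pm(t)$ and of these four series and their divided squares $(\cdot)^{(2)}$. **Action.** $K_n=\mathbb C(z_1,\dots,z_n)$; $A_{n,l}$ is the space of skew-symmetric polynomials in $X_1,\dots,X_l$ over $K_n$ of degree $\le n-1$ in each $X_j$ ($A_{n,l}=0$ for $l<0$ or $l>n$; $A_{n,0}=K_n$); $A_n=\bigoplus_{l=0}^nA_{n,l}$. Wedge: $P_1\wedge P_2=\frac1{l_1!l_2!}{\rm Skew}(P_1(X_1,\dots,X_{l_1})P_2(X_{l_1+1},\dots,X_{l_1+l_2}))$, ${\rm Skew}f=\sum_\sigma({\rm sgn}\,\sigma)f(X_{\sigma(1)},\dots)$.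 Let $\Theta_n(X)=\prod_{j=1}^n(1-z_jX)$, $\Theta_n(X_1,X_2)=\Theta_n(X_1)\Theta_n(X_2)-\Theta_n(-X_1)\Theta_n(-X_2)$, $F_n(t|X)=\frac{t}{2(X-t)}\frac{\Theta_n(t,-X)}{\Theta_n(t)}$, $$F_n^{(2)}(t|X_1,X_2)=\tfrac{t}{X_1+t}\tfrac{t}{X_2+t}\tfrac{X_1-X_2}{X_1+X_2}\Theta_n(X_1,X_2)+\tfrac{t}{X_1-t}\tfrac{t}{X_2+t}\tfrac{\Theta_n(-X_2)}{\Theta_n(t)}\Theta_n(t,-X_1)-\tfrac{t}{X_2-t}\tfrac{t}{X_1+t}\tfrac{\Theta_n(-X_1)}{\Theta_n(t)}\Theta_n(t,-X_2).$$ $U_{\sqrt{-1}}$ acts $K_n$-linearly on $A_n$; for $P\in A_{n,l}$: $t_1^{\pm1}.P=i^{\pm(n-2l)}P$; $\mathcal X^-_{>0}(t).P=F_n(t)\wedge P$; $-4i\,\mathcal X^-_{>0}(t)^{(2)}.P=F^{(2)}_n(t)\wedge P$; $$a_+(t).P=\sum_j\tfrac{z_jt}{1-z_jt}P+\sum_{p=1}^l\Bigl\{\tfrac{t}{X_p-t}\Bigl(\tfrac{\Theta_n(X_p)}{\Theta_n(t)}P|_{X_p\to t}-P\Bigr)+(t\to-t)\Bigr\};$$ $$a_-(t).P=-\sum_j\tfrac1{1-z_jt}P-\sum_{p=1}^l\Bigl\{\tfrac{t}{X_p-t}\Bigl(\tfrac{\Theta_n(X_p)}{\Theta_n(t)}P|_{X_p\to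 t}-\tfrac{X_p}tP\Bigr)+(t\to-t)\Bigr\};$$ $i^{1-n}\mathcal X^+_{\ge0}(t).P=\frac{1}{\Theta_n(t)}P(X_1,\dots,X_{l-1},t)$ (zero if $l=0$); $i(-1)^{n+1}\mathcal X^+_{\ge0}(t)^{(2)}.P=\sum_{a=1}^n{\rm res}_{u=z_a^{-1}}\Bigl(\frac{P(X_1,\dots,X_{l-2},-u,u)}{\Theta_n(-u)\Theta_n(u)}\frac{du}{u-t}\Bigr)$ (zero if $l\le1$). These right-hand sides are expanded in powers of $t$, except that of $a_-(t)$, which is expanded in $t^{-1}$. The actions of $-\mathcal X^-_{\le0}(t)$, $-4i\mathcal X^-_{\le0}(t)^{(2)}$, $-i^{1-n}\mathcal X^+_{<0}(t)$, $i(-1)^{n+1}\mathcal X^+_{<0}(t)^{(2)}$ are the expansions at $t=\infty$ of the right-hand sides for $\mathcal X^-_{>0}(t)$, $-4i\mathcal X^-_{>0}(t)^{(2)}$, $i^{1-n}\mathcal X^+_{\ge0}(t)$, $i(-1)^{n+1}\mathcal X^+_{\ge0}(t)^{(2)}$ respectively. (The elements ${t_1;n\brack2}$ lie in the subalgebra generated by the others, so their action is determined.) **Links.** $\widehat C_{n,l}\subset A_{n,l}$ consists of the elements whose coefficients are symmetric Laurent polynomials in $z_1,\dots,z_n$. A pair $(P_{n,l},P_{n+2,l+1})\in\widehat C_{n,l}\times\widehat C_{n+2,l+1}$ is a link if $$P_{n+2,l+1}(X_1,\dots,X_l,z^{-1}|z_1,\dots,z_n,z,-z)=z^{-n-1}\prod_{a=1}^l(1-X_a^2z^2)\,P_{n,l}(X_1,\dots,X_l|z_1,\dots,z_n).$$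 For sums over several $l$, the condition is understood componentwise: a pair $(\sum_{l'}Q_{n,l'},\sum_{l'}Q_{n+2,l'+1})$ with $Q_{n,l'}\in\widehat C_{n,l'}$, $Q_{n+2,l'+1}\in\widehat C_{n+2,l'+1}$ is a link if $(Q_{n,l'},Q_{n+2,l'+1})$ is a link for each $l'\ge0$ (components with $l'<0$ or $l'>n$ in the first entry are $0$, and there is no condition for $l'=-1$). *)

(* Defs.v *)
From HB Require Import structures.
From mathcomp Require Import all_boot all_order all_fingroup all_algebra.
From mathcomp Require Import generic_quotient.
From mathcomp Require Import finmap.
From mathcomp Require Import -(notations) monalg.
From mathcomp Require Import complex mpoly.
From mathcomp Require Import boolp reals.

Set Implicit Arguments.
Unset Strict Implicit.
Unset Printing Implicit Defensive.

Import GRing.Theory.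
Local Open Scope ring_scope.
Local Open Scope quotient_scope.

(** * Associative algebras by generators and relations *)

(* The free associative algebra K<I>, with basis the words in I. *)
Definition falg (K : comNzRingType) (I : choiceType) : Type := malg (fmonom I) K.

HB.instance Definition _ (K : comNzRingType) (I : choiceType) := GRing.Lalgebra.on (falg K I).

Fact falg_scalerAr (K : comNzRingType) (I : choiceType) (c : K) (x y : falg K I) : c *: (x * y) = x * (c *: y).
Proof.
apply/malgP => m; rewrite monalg.mcoeffZ.
rewrite (monalg.mcoeffMlw _ (fsubset_refl _) (fsubset_refl _)).
rewrite (monalg.mcoeffMlw _ (fsubset_refl _) (monalg.msuppZ_le _ _)).
rewrite mulr_sumr; apply: eq_bigr => k _; rewrite mulr_sumr; apply: eq_bigr => l _.
by rewrite monalg.mcoeffZ mulrnAr mulrCA.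
Qed.

HB.instance Definition _ (K : comNzRingType) (I : choiceType) :=
  GRing.Lalgebra_isAlgebra.Build K (falg K I) (@falg_scalerAr K I).

Definition fgen (K : comNzRingType) (I : choiceType) (x : I) : falg K I :=
  mkmalgU (fmu x) 1.

Section AlgebraQuotient.
Variables (K : comNzRingType) (A : algType K) (S : A -> A -> Prop).

(* The two-sided ideal generated by the differences of related elements;
   it is stable under scaling since c *: x = (c *: 1) * x. *)
Inductive rel_ideal : A -> Prop :=
| RelIdealGen x y of S x y : rel_ideal (x - y)
| RelIdeal0 : rel_ideal 0
| RelIdealB x y of rel_ideal x & rel_ideal y : rel_ideal (x - y)
| RelIdealMl a x of rel_ideal x : rel_ideal (a * x)
| RelIdealMr x a of rel_ideal x : rel_ideal (x * a).

Lemma rel_idealN x : rel_ideal x -> rel_ideal (- x).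
Proof. by move=> xI; rewrite -[- x]add0r; apply: RelIdealB => //; constructor. Qed.

Lemma rel_idealD x y : rel_ideal x -> rel_ideal y -> rel_ideal (x + y).
Proof. by move=> xI yI; rewrite -[y]opprK; apply/RelIdealB/rel_idealN. Qed.

Definition rel_eqv (x y : A) : bool := `[< rel_ideal (x - y) >].

Lemma rel_eqv_refl : reflexive rel_eqv.
Proof. by move=> x; apply/asboolP; rewrite subrr; constructor. Qed.

Lemma rel_eqv_sym : ssrbool.symmetric rel_eqv.
Proof.
by move=> x y; apply/asboolP/asboolP => /rel_idealN; rewrite opprB.
Qed.

Lemma rel_eqv_trans : transitive rel_eqv.
Proof.
move=> y x z /asboolP xy /asboolP yz; apply/asboolP.
by rewrite -[x](subrK y) -addrA; apply: rel_idealD.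
Qed.

Canonical rel_eqv_equiv := EquivRel rel_eqv rel_eqv_refl rel_eqv_sym rel_eqv_trans.

Definition algquot := {eq_quot rel_eqv}.

HB.instance Definition _ := Choice.on algquot.
HB.instance Definition _ := Quotient.on algquot.
HB.instance Definition _ := EqQuotient.on algquot.

Definition algpi (x : A) : algquot := \pi_algquot x.

Lemma algpiP x y : algpi x = algpi y <-> rel_ideal (x - y).
Proof.
by split=> [/eqmodP/asboolP//|xy]; apply/eqmodP/asboolP.
Qed.

Lemma algpi_repr (u : algquot) : algpi (repr u) = u.
Proof. exact: reprK. Qed.

Lemma algpi_ind (P : algquot -> Prop) : (forall x, P (algpi x)) -> forall u, P u.
Proof. by move=> Ppi u; rewrite -[u]algpi_repr. Qed.

Lemma rel_ideal_repr x : rel_ideal (repr (algpi x) - x).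
Proof. by apply/algpiP; rewrite algpi_repr. Qed.

Definition algquot_add (u v : algquot) := algpi (repr u + repr v).
Definition algquot_opp (u : algquot) := algpi (- repr u).
Definition algquot_mul (u v : algquot) := algpi (repr u * repr v).
Definition algquot_scale (c : K) (u : algquot) := algpi (c *: repr u).

Lemma algquot_addE x y : algquot_add (algpi x) (algpi y) = algpi (x + y).
Proof. by apply/algpiP; rewrite opprD addrACA; apply: rel_idealD; apply: rel_ideal_repr. Qed.

Lemma algquot_oppE x : algquot_opp (algpi x) = algpi (- x).
Proof. by apply/algpiP; rewrite -opprD; apply/rel_idealN/rel_ideal_repr. Qed.

Lemma algquot_mulE x y : algquot_mul (algpi x) (algpi y) = algpi (x * y).
Proof.
apply/algpiP; set x' := repr _; set y' := repr _.
have -> : x' * y' - x * y = (x' - x) * y' + x * (y' - y).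
  by rewrite mulrBl mulrBr addrA subrK.
by apply: rel_idealD; [apply: RelIdealMr|apply: RelIdealMl]; apply: rel_ideal_repr.
Qed.

Lemma algquot_scaleE c x : algquot_scale c (algpi x) = algpi (c *: x).
Proof.
apply/algpiP; rewrite -scalerBr -[_ - _]mul1r scalerAl.
exact/RelIdealMl/rel_ideal_repr.
Qed.

Let algquotE := (algquot_addE, algquot_oppE, algquot_mulE, algquot_scaleE).

Fact algquot_addA : associative algquot_add.
Proof.
by elim/algpi_ind=> x; elim/algpi_ind=> y; elim/algpi_ind=> z; rewrite !algquotE addrA.
Qed.
Fact algquot_addC : commutative algquot_add.
Proof. by elim/algpi_ind=> x; elim/algpi_ind=> y; rewrite !algquotE addrC. Qed.
Fact algquot_add0 : left_id (algpi 0) algquot_add.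
Proof. by elim/algpi_ind=> x; rewrite !algquotE add0r. Qed.
Fact algquot_addN : left_inverse (algpi 0) algquot_opp algquot_add.
Proof. by elim/algpi_ind=> x; rewrite !algquotE addNr. Qed.

HB.instance Definition _ := GRing.isZmodule.Build algquot
  algquot_addA algquot_addC algquot_add0 algquot_addN.

Fact algquot_mulA : associative algquot_mul.
Proof.
by elim/algpi_ind=> x; elim/algpi_ind=> y; elim/algpi_ind=> z; rewrite !algquotE mulrA.
Qed.
Fact algquot_mul1 : left_id (algpi 1) algquot_mul.
Proof. by elim/algpi_ind=> x; rewrite !algquotE mul1r. Qed.
Fact algquot_mulr1 : right_id (algpi 1) algquot_mul.
Proof. by elim/algpi_ind=> x; rewrite !algquotE mulr1. Qed.
Fact algquot_mulDl : left_distributive algquot_mul +%R.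
Proof.
elim/algpi_ind=> x; elim/algpi_ind=> y; elim/algpi_ind=> z.
by rewrite /+%R /= !algquotE mulrDl.
Qed.
Fact algquot_mulDr : right_distributive algquot_mul +%R.
Proof.
elim/algpi_ind=> x; elim/algpi_ind=> y; elim/algpi_ind=> z.
by rewrite /+%R /= !algquotE mulrDr.
Qed.

(* No proof of 1 != 0 is given, so the quotient is a pzRingType and an lmodType
   but not an lalgType, which requires a nontrivial ring; the compatibility of
   the two structures is [algquot_scalerAl] and [algquot_scalerAr]. *)
HB.instance Definition _ := GRing.Zmodule_isPzRing.Build algquot
  algquot_mulA algquot_mul1 algquot_mulr1 algquot_mulDl algquot_mulDr.

Fact algquot_scaleA c d u :
  algquot_scale c (algquot_scale d u) = algquot_scale (c * d) u.
Proof. by elim/algpi_ind: u => x; rewrite !algquotE scalerA. Qed.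
Fact algquot_scale1 : left_id 1 algquot_scale.
Proof. by elim/algpi_ind=> x; rewrite !algquotE scale1r. Qed.
Fact algquot_scaleDr : right_distributive algquot_scale +%R.
Proof.
move=> c; elim/algpi_ind=> x; elim/algpi_ind=> y.
by rewrite /+%R /= !algquotE scalerDr.
Qed.
Fact algquot_scaleDl u : {morph algquot_scale^~ u : c d / c + d}.
Proof.
by elim/algpi_ind: u => x c d; rewrite [in RHS]/+%R /= !algquotE scalerDl.
Qed.

HB.instance Definition _ := GRing.Zmodule_isLmodule.Build K algquot
  algquot_scaleA algquot_scale1 algquot_scaleDr algquot_scaleDl.

Lemma algpiD : {morph algpi : x y / x + y}.
Proof. by move=> x y; rewrite [RHS]algquot_addE. Qed.
Lemma algpiN : {morph algpi : x / - x}.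
Proof. by move=> x; rewrite [RHS]algquot_oppE. Qed.
Lemma algpiM : {morph algpi : x y / x * y}.
Proof. by move=> x y; rewrite [RHS]algquot_mulE. Qed.
Lemma algpiZ c : {morph algpi : x / c *: x}.
Proof. by move=> x; rewrite [RHS]algquot_scaleE. Qed.
Lemma algpi1 : algpi 1 = 1. Proof. by []. Qed.
Lemma algpi0 : algpi 0 = 0. Proof. by []. Qed.

Lemma algquot_scalerAl c (u v : algquot) : c *: (u * v) = c *: u * v.
Proof.
by elim/algpi_ind: u => x; elim/algpi_ind: v => y; rewrite -!(algpiM, algpiZ) scalerAl.
Qed.

Lemma algquot_scalerAr c (u v : algquot) : c *: (u * v) = u * (c *: v).
Proof.
by elim/algpi_ind: u => x; elim/algpi_ind: v => y; rewrite -!(algpiM, algpiZ) scalerAr.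
Qed.

End AlgebraQuotient.

(** * The quantum loop algebra and its restricted form at q = sqrt(-1) *)

(* C(q), with C = R[i] and R : realType the real numbers. *)
Definition Cq (R : realType) : fieldType := {fraction {poly R[i]}}.

Inductive loop_gen : Type :=
| GenX of bool & int  (* x_k^+ for true, x_k^- for false *)
| GenA of int         (* a_n; the spurious a_0 is killed by a relation *)
| GenT                (* t_1 *)
| GenTinv.            (* t_1^{-1} *)

HB.instance Definition _ := gen_eqMixin loop_gen.
HB.instance Definition _ := gen_choiceMixin loop_gen.

Section QuantumLoopAlgebra.
Variable R : realType.
Local Notation C := R[i].
Local Notation Cq := (Cq R).

Definition q_ : Cq := tofrac 'X.
Definition qint (j : int) : Cq := (q_ ^ j - q_ ^ (- j)) / (q_ - q_^-1).
Definition qfact (r : nat) : Cq := \prod_(1 <= j < r.+1) qint j.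

Definition loop_free : algType Cq := falg Cq loop_gen.
Local Notation fX s k := (fgen Cq (GenX s k) : loop_free).
Local Notation fA n := (fgen Cq (GenA n) : loop_free).
Local Notation fT := (fgen Cq GenT : loop_free).
Local Notation fT' := (fgen Cq GenTinv : loop_free).

Definition pm (s : bool) : Cq := if s then 1 else - 1.
Definition pmz (s : bool) (n : int) : int := if s then n else - n.

(* The coefficient of z^k in exp (\sum_(n >= 1) b n z^n): only the powers
   r <= k and the terms n <= k contribute. *)
Definition exp_coef (b : nat -> loop_free) (k : nat) : loop_free :=
  \sum_(r < k.+1) (r`!%:R : Cq)^-1 *:
    ((\poly_(n < k.+1) (if n == 0 then 0 else b n)) ^+ r)`_k.

(* phi s m is \varphi^\pm_m, which vanishes when \pm m < 0. *)
Definition phi (s : bool) (m : int) : loop_free :=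
  if pmz s m is Posz k then
    (if s then fT else fT') *
      exp_coef (fun n => (pm s * (q_ - q_^-1)) *: fA (pmz s n)) k
  else 0.

Inductive loop_rel : loop_free -> loop_free -> Prop :=
| rel_TTinv : loop_rel (fT * fT') 1
| rel_TinvT : loop_rel (fT' * fT) 1
| rel_A0 : loop_rel (fA 0) 0
| rel_TA n : loop_rel (fT * fA n) (fA n * fT)
| rel_AA m n : loop_rel (fA m * fA n) (fA n * fA m)
| rel_TX s k : loop_rel (fT * fX s k * fT') (q_ ^ pmz s 2 *: fX s k)
| rel_AX s n k of n != 0 :
    loop_rel (fA n * fX s k - fX s k * fA n)
             ((pm s * (qint (2 * n) / n%:~R)) *: fX s (k + n))
| rel_XX s k l :
    loop_rel (fX s (k + 1) * fX s l - q_ ^ pmz s 2 *: (fX s l * fX s (k + 1)))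
             (q_ ^ pmz s 2 *: (fX s k * fX s (l + 1)) - fX s (l + 1) * fX s k)
| rel_XpXm k l :
    loop_rel (fX true k * fX false l - fX false l * fX true k)
             ((q_ - q_^-1)^-1 *: (phi true (k + l) - phi false (k + l))).

Definition Uq := algquot loop_rel.

Definition Ux (s : bool) (k : int) : Uq := algpi loop_rel (fX s k).
Definition Ua (n : int) : Uq := algpi loop_rel (fA n).
Definition Ut : Uq := algpi loop_rel fT.
Definition Ut' : Uq := algpi loop_rel fT'.

Definition Uta (n : int) : Uq := (n%:~R / qint n) *: Ua n.

Definition Udiv (x : Uq) (r : nat) : Uq := (qfact r)^-1 *: x ^+ r.

Definition Utbin (n : int) (r : nat) : Uq :=
  \prod_(1 <= s < r.+1)
    ((q_ ^ s - q_ ^ (- s%:Z))^-1 *: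
       (q_ ^ (n - s%:Z + 1) *: Ut - q_ ^ (- n + s%:Z - 1) *: Ut')).

(* The Laurent polynomial p / q^k as an element of C(q). *)
Definition laurentq (p : {poly C}) (k : nat) : Cq := tofrac p / q_ ^+ k.

Inductive in_Ures : Uq -> Prop :=
| Ures_X s n r : in_Ures (Udiv (Ux s n) r)
| Ures_T : in_Ures Ut
| Ures_T' : in_Ures Ut'
| Ures_Tbin n r : in_Ures (Utbin n r)
| Ures_A n of n != 0 : in_Ures (Uta n)
| Ures_1 : in_Ures 1
| Ures_D x y of in_Ures x & in_Ures y : in_Ures (x + y)
| Ures_M x y of in_Ures x & in_Ures y : in_Ures (x * y)
| Ures_Z p k x of in_Ures x : in_Ures (laurentq p k *: x).

Record Ures : Type := MkUres { Ures_val : Uq; UresP : in_Ures Ures_val }.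

HB.instance Definition _ := gen_eqMixin Ures.
HB.instance Definition _ := gen_choiceMixin Ures.

(* The base change of the C[q,q^-1]-algebra Ures along C[q,q^-1] -> C, q |-> 'i,
   presented as the C-algebra generated by the symbols u (x) 1, u in Ures,
   subject to the relations making u |-> u (x) 1 a ring morphism over
   C[q,q^-1] -> C. *)
Definition Ui_free : algType C := falg C Ures.
Local Notation fU u := (fgen C (u : Ures) : Ui_free).

Inductive Ui_rel : Ui_free -> Ui_free -> Prop :=
| Ui_rel1 (w : Ures) of Ures_val w = 1 : Ui_rel (fU w) 1
| Ui_relD (u v w : Ures) of Ures_val w = Ures_val u + Ures_val v : Ui_rel (fU w) (fU u + fU v)
| Ui_relM (u v w : Ures) of Ures_val w = Ures_val u * Ures_val v : Ui_rel (fU w) (fU u * fU v)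
| Ui_relZ p k (u w : Ures) of Ures_val w = laurentq p k *: Ures_val u :
    Ui_rel (fU w) ((p.['i] / 'i ^+ k) *: fU u).

Definition Ui := algquot Ui_rel.

Definition Uspec (u : Ures) : Ui := algpi Ui_rel (fU u).

(** ** Generating series

   A series in t is given by its coefficients of t^k, k >= 0; a series in t^-1
   by its coefficients of t^-k, k >= 0. *)

Definition Xp_ge0 (k : nat) : Uq := q_ ^ (- k%:Z) *: Ux true k.
Definition Xp_lt0 (k : nat) : Uq :=
  if k == 0 then 0 else q_ ^ k *: Ux true (- k%:Z).
Definition Xm_gt0 (k : nat) : Uq :=
  if k == 0 then 0 else q_ ^ (- k%:Z) *: Ux false k.
Definition Xm_le0 (k : nat) : Uq := q_ ^ k *: Ux false (- k%:Z).
Definition a_pos (k : nat) : Uq := if k == 0 then 0 else Uta k.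
Definition a_neg (k : nat) : Uq := if k == 0 then 0 else Uta (- k%:Z).

(* The divided square s(t)^2 / [2]! of a series s. *)
Definition div_sq (s : nat -> Uq) (k : nat) : Uq :=
  (qfact 2)^-1 *: \sum_(j < k.+1) s j * s (k - j)%N.

End QuantumLoopAlgebra.

(** * Expansions, residues and values of rational functions *)

Section RationalFunctions.
Variable F : fieldType.
Local Notation Ft := {fraction {poly F}}.
Implicit Types (f g : Ft) (c r : F) (s : nat -> F).

Definition ratX : Ft := tofrac 'X.
Definition ratC c : Ft := tofrac c%:P.

Definition regular_at c f : Prop :=
  exists N D : {poly F}, D.[c] != 0 /\ f = tofrac N / tofrac D.

Definition regular_oo f : Prop :=
  exists N D : {poly F}, [/\ D != 0, (size N <= size D)%N & f = tofrac N / tofrac D].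

(* f = \sum_(k >= 0) s k t^k at t = 0 *)
Definition expands0 f s : Prop :=
  forall m : nat, exists2 g, regular_at 0 g &
    f = \sum_(k < m) ratC (s k) * ratX ^+ k + ratX ^+ m * g.

(* f = \sum_(k >= 0) s k t^-k at t = oo *)
Definition expandsoo f s : Prop :=
  forall m : nat, exists2 g, regular_oo g &
    f = \sum_(k < m) ratC (s k) * ratX ^- k + ratX ^- m * g.

Definition is_residue f c r : Prop :=
  exists (m : nat) (s : nat -> F) (g : Ft),
    [/\ r = s 0%N, regular_at c g &
        f = \sum_(k < m.+1) ratC (s k) / (ratX - ratC c) ^+ k.+1 + g].

Definition residue f c : F :=
  if pselect (exists r, is_residue f c r) is left h then sval (cid h) else 0.

End RationalFunctions.

(* C(z_1, ..., z_n) *)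
Definition Kz (R : realType) (n : nat) : fieldType := {fraction {mpoly R[i][n]}}.
(* C(z_1, ..., z_n)(X_1, ..., X_l) *)
Definition KzX (R : realType) (n l : nat) : fieldType :=
  {fraction {mpoly (Kz R n)[l]}}.
(* C(z_1, ..., z_n)(X_1, ..., X_l)(t) *)
Definition KzXt (R : realType) (n l : nat) : fieldType :=
  {fraction {poly (KzX R n l)}}.

Section Coefficients.
Variable R : realType.
Local Notation C := R[i].

Definition zC n (c : C) : Kz R n := tofrac (c%:MP : {mpoly C[n]}).
Definition zvar n (j : 'I_n) : Kz R n := tofrac ('X_j : {mpoly C[n]}).

(* The value of the rational function c at z_j = v j, when c can be written
   with a denominator not vanishing there. *)
Definition has_value n m (v : 'I_n -> Kz R m) (c : Kz R n) (d : Kz R m) : Prop :=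
  exists N D : {mpoly C[n]},
    [/\ mmap (@zC m) v D != 0, c = tofrac N / tofrac D
      & d = mmap (@zC m) v N / mmap (@zC m) v D].

Definition value n m (v : 'I_n -> Kz R m) (c : Kz R n) : Kz R m :=
  if pselect (exists d, has_value v c d) is left h then sval (cid h) else 0.

Definition sym_laurent n (c : Kz R n) : Prop :=
  exists (p : {mpoly C[n]}) (k : nat),
    p \is mpoly.symmetric /\ c = tofrac p / (\prod_(j < n) zvar j) ^+ k.

End Coefficients.

(** * The spaces A_n *)

Section SkewPolynomials.
Variables (R : realType) (n : nat).
Local Notation K := (Kz R n).

(* The last condition follows from the first two. *)
Definition in_A (l : nat) (P : {mpoly K[l]}) : Prop :=
  [/\ forall s : 'S_l, msym s P = (-1) ^+ s *: P,
      forall m, m \in mpoly.msupp P -> forall j : 'I_l, (m j < n)%N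
    & (n < l)%N -> P = 0].

(* The direct sum of the A_{n,l}: families of components indexed by all l,
   those with l > n being 0. *)
Record skewA : Type := MkSkewA {
  Acomp :> forall l : nat, {mpoly K[l]};
  AcompP : forall l, in_A (Acomp l)
}.

HB.instance Definition _ := gen_eqMixin skewA.
HB.instance Definition _ := gen_choiceMixin skewA.

Lemma A_eq (P Q : skewA) : (forall l, P l = Q l) -> P = Q.
Proof.
case: P Q => [P hP] [Q hQ] /= PQ.
have eqPQ : P = Q by apply: functional_extensionality_dep.
by subst Q; congr MkSkewA; apply: Prop_irrelevance.
Qed.

Fact in_A0 l : in_A (0 : {mpoly K[l]}).
Proof.
split=> // [s|m]; first by rewrite msym0 scaler0.
by rewrite mpoly.msupp0.
Qed.

Fact in_AZD l (c : K) (P Q : {mpoly K[l]}) :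
  in_A P -> in_A Q -> in_A (c *: P + Q).
Proof.
move=> [symP degP outP] [symQ degQ outQ]; split.
- by move=> s; rewrite msymD msymZ symP symQ scalerDr !scalerA mulrC.
- move=> m /mpoly.msuppD_le; rewrite mem_cat => /orP[/mpoly.msuppZ_le|]; first exact: degP.
  exact: degQ.
- by move=> ltnl; rewrite outP // outQ // scaler0 addr0.
Qed.

Definition A0 : skewA := MkSkewA in_A0.
Definition A_lin (c : K) (P Q : skewA) : skewA :=
  MkSkewA (fun l => in_AZD c (AcompP P l) (AcompP Q l)).
Definition A_add := A_lin 1.
Definition A_scale c P := A_lin c P A0.
Definition A_opp := A_scale (- 1).

Fact A_addA : associative A_add.
Proof. by move=> P Q S; apply: A_eq => l; rewrite /= !scale1r addrA. Qed.
Fact A_addC : commutative A_add.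
Proof. by move=> P Q; apply: A_eq => l; rewrite /= !scale1r addrC. Qed.
Fact A_add0 : left_id A0 A_add.
Proof. by move=> P; apply: A_eq => l; rewrite /= scale1r add0r. Qed.
Fact A_addN : left_inverse A0 A_opp A_add.
Proof. by move=> P; apply: A_eq => l; rewrite /= scale1r addr0 scaleN1r addNr. Qed.

HB.instance Definition _ := GRing.isZmodule.Build skewA
  A_addA A_addC A_add0 A_addN.

Fact A_scaleA c d P : A_scale c (A_scale d P) = A_scale (c * d) P.
Proof. by apply: A_eq => l; rewrite /= !addr0 scalerA. Qed.
Fact A_scale1 : left_id 1 A_scale.
Proof. by move=> P; apply: A_eq => l; rewrite /= addr0 scale1r. Qed.
Fact A_scaleDr : right_distributive A_scale +%R.
Proof.
by move=> c P Q; apply: A_eq => l; rewrite /= !scale1r !addr0 scalerDr.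
Qed.
Fact A_scaleDl P : {morph A_scale^~ P : c d / c + d}.
Proof. by move=> c d; apply: A_eq => l; rewrite /= scale1r !addr0 scalerDl. Qed.

HB.instance Definition _ := GRing.Zmodule_isLmodule.Build K skewA
  A_scaleA A_scale1 A_scaleDr A_scaleDl.

Lemma AcompD (P Q : skewA) l : (P + Q) l = P l + Q l.
Proof. by rewrite /= scale1r. Qed.
Lemma AcompZ c (P : skewA) l : (c *: P) l = c *: P l.
Proof. by rewrite /= addr0. Qed.

End SkewPolynomials.

(** * The action

   The right-hand sides of the formulas are evaluated in a field F containing
   K_n = C(z_1, ..., z_n); a polynomial P over K_n is turned into a function of
   its variables by [peval]. *)

Section Formulas.
Variables (R : realType) (n : nat) (F : fieldType) (iota : Kz R n -> F).

Definition peval l (P : {mpoly (Kz R n)[l]}) (x : 'I_l -> F) : F := mmap iota x P.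

Definition zF (j : 'I_n) : F := iota (zvar R j).

Definition Theta (x : F) : F := \prod_(j < n) (1 - zF j * x).
Definition Theta2 (x y : F) : F := Theta x * Theta y - Theta (- x) * Theta (- y).

Definition F1 (t x : F) : F :=
  t / (2 * (x - t)) * (Theta2 t (- x) / Theta t).

Definition F2 (t x y : F) : F :=
  t / (x + t) * (t / (y + t)) * ((x - y) / (x + y)) * Theta2 x y
  + t / (x - t) * (t / (y + t)) * (Theta (- y) / Theta t) * Theta2 t (- x)
  - t / (y - t) * (t / (x + t)) * (Theta (- x) / Theta t) * Theta2 t (- y).

Definition Skew l (f : ('I_l -> F) -> F) (x : 'I_l -> F) : F :=
  \sum_(s : 'S_l) (-1) ^+ s * f (x \o s).

Definition wedge l1 l2 (f1 : ('I_l1 -> F) -> F) (f2 : ('I_l2 -> F) -> F)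
    (x : 'I_(l1 + l2) -> F) : F :=
  (l1`! * l2`!)%:R^-1 *
  Skew (fun y => f1 (y \o @lshift l1 l2) * f2 (y \o @rshift l1 l2)) x.

(* (x_0, ..., x_{l-1}, y) *)
Definition snoc l (x : 'I_l -> F) (y : F) : 'I_l.+1 -> F :=
  fun j => if unlift ord_max j is Some k then x k else y.

(* x with x_p replaced by y *)
Definition subst_at l (x : 'I_l -> F) (p : 'I_l) (y : F) : 'I_l -> F :=
  fun j => if j == p then y else x j.

Definition Xm_rhs l (P : {mpoly (Kz R n)[l]}) (t : F) (x : 'I_l.+1 -> F) : F :=
  @wedge 1 l (fun y => F1 t (y ord0)) (peval P) x.

Definition Xm2_rhs l (P : {mpoly (Kz R n)[l]}) (t : F) (x : 'I_l.+2 -> F) : F :=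
  @wedge 2 l (fun y => F2 t (y ord0) (y ord_max)) (peval P) x.

Definition a_pos_rhs l (P : {mpoly (Kz R n)[l]}) (t : F) (x : 'I_l -> F) : F :=
  let S p t := t / (x p - t) *
    (Theta (x p) / Theta t * peval P (subst_at x p t) - peval P x) in
  (\sum_(j < n) zF j * t / (1 - zF j * t)) * peval P x
  + \sum_(p < l) (S p t + S p (- t)).

Definition a_neg_rhs l (P : {mpoly (Kz R n)[l]}) (t : F) (x : 'I_l -> F) : F :=
  let S p t := t / (x p - t) *
    (Theta (x p) / Theta t * peval P (subst_at x p t) - x p / t * peval P x) in
  - (\sum_(j < n) (1 - zF j * t)^-1) * peval P x
  - \sum_(p < l) (S p t + S p (- t)).

Definition Xp_rhs l (P : {mpoly (Kz R n)[l.+1]}) (t : F) (x : 'I_l -> F) : F :=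
  (Theta t)^-1 * peval P (snoc x t).

Definition Xp2_integrand l (P : {mpoly (Kz R n)[l.+2]}) (t u : F)
    (x : 'I_l -> F) : F :=
  peval P (snoc (snoc x (- u)) u) / (Theta (- u) * Theta u) / (u - t).

End Formulas.

Section Action.
Variables (R : realType) (n : nat).
Local Notation K := (Kz R n).

Definition Lpoly l (P : {mpoly K[l]}) : KzX R n l := tofrac P.

Definition Et l : KzXt R n l := ratX (KzX R n l).
Definition Epoly l (P : {mpoly K[l]}) : KzXt R n l := ratC (Lpoly P).
Definition EX l (j : 'I_l) : KzXt R n l := Epoly 'X_j.
Definition EK l (c : K) : KzXt R n l := Epoly c%:MP.

Definition Xp2_rhs l (P : {mpoly K[l.+2]}) : KzXt R n l :=
  let E := KzXt R n l in
  \sum_(a < n)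
    residue (Xp2_integrand (fun c => ratC (EK l c)) P (ratC (@Et l)) (ratX E)
               (fun j => ratC (EX j)))
            (EK l (zvar R a))^-1.

Section ActsBy.
Variables (act : Ui R -> skewA R n -> skewA R n).

(* The series c * s of elements of Ures maps the component of degree lin to the
   one of degree lout by P |-> rhs P, expanded at t = 0 or t = oo according to
   the predicate [expands]. *)
Definition acts_by (expands : forall l, KzXt R n l -> (nat -> KzX R n l) -> Prop)
    (c : R[i]) (s : nat -> Uq R) (lin lout : nat)
    (rhs : {mpoly K[lin]} -> KzXt R n lout) : Prop :=
  forall u : nat -> Ures R, (forall k, Ures_val (u k) = s k) ->
  forall P : skewA R n,
    expands lout (rhs (P lin))
      (fun k => Lpoly (act (c *: Uspec (u k)) P lout)).

Definition no_comp (s : nat -> Uq R) (lout : nat) : Prop :=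
  forall (u : Ures R) k, Ures_val u = s k ->
  forall P : skewA R n, act (Uspec u) P lout = 0.

Definition acts_by0 := acts_by (fun l => @expands0 (KzX R n l)).
Definition acts_byoo := acts_by (fun l => @expandsoo (KzX R n l)).

Record is_action : Prop := IsAction {
  act_linear g : linear (act g);
  act_1 P : act 1 P = P;
  act_M g h P : act (g * h) P = act g (act h P);
  act_D g h P : act (g + h) P = act g P + act h P;
  act_Z c g P : act (c *: g) P = zC n c *: act g P;

  act_T (u : Ures R) : Ures_val u = Ut R -> forall P l,
    act (Uspec u) P l = zC n ('i ^ (n%:Z - 2 * l%:Z)) *: P l;
  act_T' (u : Ures R) : Ures_val u = Ut' R -> forall P l,
    act (Uspec u) P l = zC n ('i ^ (- (n%:Z - 2 * l%:Z))) *: P l;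

  act_a_pos l :
    acts_by0 1 (@a_pos R) (fun P => a_pos_rhs (@EK l) P (@Et l) (@EX l));
  act_a_neg l :
    acts_byoo 1 (@a_neg R) (fun P => a_neg_rhs (@EK l) P (@Et l) (@EX l));

  act_Xm_gt0 l :
    acts_by0 1 (@Xm_gt0 R)
      (fun P : {mpoly K[l]} => Xm_rhs (@EK l.+1) P (@Et l.+1) (@EX l.+1));
  act_Xm_le0 l :
    acts_byoo (- 1) (@Xm_le0 R)
      (fun P : {mpoly K[l]} => Xm_rhs (@EK l.+1) P (@Et l.+1) (@EX l.+1));
  act_Xm_gt0_0 : no_comp (@Xm_gt0 R) 0;
  act_Xm_le0_0 : no_comp (@Xm_le0 R) 0;

  act_Xm_gt0_sq l :
    acts_by0 (- (4 * 'i)) (div_sq (@Xm_gt0 R))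
      (fun P : {mpoly K[l]} => Xm2_rhs (@EK l.+2) P (@Et l.+2) (@EX l.+2));
  act_Xm_le0_sq l :
    acts_byoo (- (4 * 'i)) (div_sq (@Xm_le0 R))
      (fun P : {mpoly K[l]} => Xm2_rhs (@EK l.+2) P (@Et l.+2) (@EX l.+2));
  act_Xm_gt0_sq01 l : (l < 2)%N -> no_comp (div_sq (@Xm_gt0 R)) l;
  act_Xm_le0_sq01 l : (l < 2)%N -> no_comp (div_sq (@Xm_le0 R)) l;

  act_Xp_ge0 l :
    acts_by0 ('i ^ (1 - n%:Z)) (@Xp_ge0 R)
      (fun P : {mpoly K[l.+1]} => Xp_rhs (@EK l) P (@Et l) (@EX l));
  act_Xp_lt0 l :
    acts_byoo (- 'i ^ (1 - n%:Z)) (@Xp_lt0 R)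
      (fun P : {mpoly K[l.+1]} => Xp_rhs (@EK l) P (@Et l) (@EX l));

  act_Xp_ge0_sq l :
    acts_by0 ('i * (-1) ^+ n.+1) (div_sq (@Xp_ge0 R)) (@Xp2_rhs l);
  act_Xp_lt0_sq l :
    acts_byoo ('i * (-1) ^+ n.+1) (div_sq (@Xp_lt0 R)) (@Xp2_rhs l)
}.

End ActsBy.
End Action.

(** * Links *)

Section Links.
Variable R : realType.

(* The sum over l of the spaces \hat C_{n,l} *)
Definition Chat_sum n (P : skewA R n) : Prop :=
  forall l m, sym_laurent (P l)@_m.

(* \hat C_{n,l}; it is 0 for l < 0 *)
Definition Chat n (l : int) (P : skewA R n) : Prop :=
  Chat_sum P /\ (forall l' : nat, l'%:Z != l -> P l' = 0).

(* The identity P_{n+2,l+1}(X, z^-1 | z_1, ..., z_n, z, -z)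
     = z^(-n-1) \prod_a (1 - X_a^2 z^2) P_{n,l}(X | z_1, ..., z_n)
   between polynomials in X_1, ..., X_l over C(z_1, ..., z_n, z), where z is the
   last of the n + 1 variables. *)
Definition link_eq n l (P : {mpoly (Kz R n)[l]}) (Q : {mpoly (Kz R n.+2)[l.+1]}) :
    Prop :=
  let K' := Kz R n.+1 in
  let z : K' := zvar R ord_max in
  let at_z_mz (j : 'I_n.+2) : K' :=
    if unlift ord_max j is Some k then zvar R k else - z in
  let at_zinv (j : 'I_l.+1) : {mpoly K'[l]} :=
    if unlift ord_max j is Some k then 'X_k else (z^-1)%:MP in
  let widen (j : 'I_n) : K' := zvar R (lift ord_max j) in
  mmap (fun c => (value at_z_mz c)%:MP) at_zinv Q
  = (z ^- n.+1)%:MP * (\prod_(a < l) (1 - 'X_a ^+ 2 * (z ^+ 2)%:MP))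
    * map_mpoly (value widen) P.

Definition link n (P : skewA R n) (Q : skewA R n.+2) : Prop :=
  [/\ Chat_sum P, Chat_sum Q & forall l : nat, link_eq (P l) (Q l.+1)].

End Links.

(* Main.v *)
(** The elements of the algebra preserving links form a subalgebra. The commutators
with the a_n shift the x_k by 2, since 'i ^ 2 + 'i ^ (- 2) is nonzero; the divided
squares, then all divided powers and the binomials of t_1, are obtained likewise by
dividing by q-integers that remain nonzero at 'i. Hence only t_1 and its inverse, the
a_n, x_0^+, x_0^-, x_1^- and the divided squares of x_0^+ and x_0^- matter.

For x_0^+ a variable is set to 0. The operators x_0^-, x_1^- and the divided square of
x_0^- are wedge products with polynomials which acquire the factor (1 - z^2 X^2) in each
variable X when (z, - z) is added to the parameters, and so vanish at X = 1/z. The a_n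
act through the iterates of F |-> (F - F(0) Theta)/X and F |-> X F - lambda Theta,
which commute with multiplication by 1 - z^2 X^2.

The divided square of x_0^+ sends P to the sum over a of - 1/2 P(X, - y_a, y_a) /
prod_(b != a) (1 - z_b^2 y_a^2), with y_a = 1/z_a. For the second member of a link the
poles along z_a = z_b cancel by symmetry, and those along z_a = - z_b because the
numerators vanish there. Specializing this sum at (z, - z) and at X_l = 1/z, the terms of
the new parameters disappear, and the others give the link identity; it in turn shows that the
denominators cancel for the first member. *)

Require Import Defs.
From HB Require Import structures.
From mathcomp Require Import all_boot all_order fingroup perm all_algebra.
From mathcomp Require Import finmap.
From mathcomp Require Import -(notations) monalg.
From mathcomp Require Import complex mpoly.
From mathcomp Require Import boolp reals ring zify.

Set Implicit Arguments.
Unset Strict Implicit.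
Unset Printing Implicit Defensive.

Import Order.TTheory GRing.Theory Num.Theory.
Local Open Scope ring_scope.

(** * Generators of the algebra *)

(** At q = 'i the scalars q^n + q^-n vanish for odd n and the q-integers [r] for even r. Hence the
    a_n only connect indices of equal parity, x_1^+ needs a commutator with the divided square of
    x_0^+, and divided powers are climbed two steps at a time, with [r+1][r+2]/[2] in place of
    [r+1].

    The substitutions of a link and the residues are defined by choice: [value] and [residue] are
    meaningful only where a value or a residue exists. Coefficients are therefore moved into rings
    on which substitution is a ring morphism: the symmetric Laurent polynomials and, for the sum
    over a, whose terms have poles, the local rings along z_a = z_b and z_a = - z_b.

    The action is known only through expansions of rational functions in t. Limits are taken at an
    abstract place, of which t = 0, t = oo and u = 1/z_a are instances.

    The component of degree 0 of the second member has no partner; an operator that adds variables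
    must send it to a polynomial vanishing at X = 1/z. This case is treated apart for each wedge
    product. *)

Lemma expzB_neq0 (F : fieldType) (q : F) (n : int) :
  q != 0 -> (forall n, (0 < n)%N -> q ^+ n != 1) -> n != 0 -> q ^ n - q ^ (- n) != 0.
Proof.
move=> q0 qn1.
have h m : (0 < m)%N -> q ^ m%:Z - q ^ (- m%:Z) != 0.
  move=> m0; rewrite -exprnN subr_eq0; apply/eqP => /(congr1 ( *%R (q ^+ m))).
  rewrite mulfV ?expf_neq0 // -exprD => /eqP; apply/negP/qn1.
  by rewrite addn_gt0 m0.
case: n => [[|n]|n] // _; first exact: h.
by rewrite NegzE opprK -opprB oppr_eq0 h.
Qed.

Section QNumbers.
Variable R : realType.
Local Notation C := R[i].
Local Notation Cq := (Cq R).
Local Notation q := (q_ R).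

Lemma q_neq0 : q != 0.
Proof. by rewrite tofrac_eq0 polyX_eq0. Qed.

Lemma qn_neq1 (n : nat) : (0 < n)%N -> q ^+ n != 1.
Proof.
move=> n0; rewrite -tofracXn -tofrac1 tofrac_eq -subr_eq0.
by rewrite -size_poly_eq0 size_XnsubC.
Qed.

End QNumbers.

(** * Evaluation of Laurent polynomials at q = 'i *)

Section Specialization.
Variable R : realType.
Local Notation C := R[i].
Local Notation Cq := (Cq R).
Local Notation q := (q_ R).

(** A relation, because the numerator and the exponent are not determined by [c]; what the argument
    uses is its closure under sums and products. *)
Definition specializes (c : Cq) (v : C) : Prop :=
  exists p k, c = laurentq p k /\ v = p.['i] / 'i ^+ k.

Lemma specializes_poly (p : {poly C}) : specializes (tofrac p) p.['i].
Proof. by exists p, 0%N; rewrite /laurentq !expr0 !divr1. Qed.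

Lemma specializes_q : specializes q 'i.
Proof. by rewrite -[X in specializes _ X]hornerX; apply: specializes_poly. Qed.

Lemma specializes_qV : specializes q^-1 'i^-1.
Proof. by exists 1, 1%N; rewrite /laurentq rmorph1 hornerC !expr1 !mul1r. Qed.

Lemma specializesD c v d w :
  specializes c v -> specializes d w -> specializes (c + d) (v + w).
Proof.
move=> [p [k [-> ->]]] [r [m [-> ->]]]; exists (p * 'X^m + r * 'X^k), (k + m)%N.
have i0 n : ('i : C) ^+ n != 0 by rewrite expf_neq0 // Num.Theory.neq0Ci.
have q0 n : q ^+ n != 0 by rewrite expf_neq0 // q_neq0.
split.
  by rewrite /laurentq rmorphD !rmorphM !rmorphXn /= addf_div // -exprD.
by rewrite !hornerE ?hornerXn addf_div // -exprD.
Qed.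

Lemma specializesM c v d w :
  specializes c v -> specializes d w -> specializes (c * d) (v * w).
Proof.
move=> [p [k [-> ->]]] [r [m [-> ->]]]; exists (p * r), (k + m)%N.
split.
  rewrite /laurentq rmorphM /= exprD invfM.
  by rewrite mulrACA.
by rewrite hornerM exprD invfM mulrACA.
Qed.

Lemma specializes_nat n : specializes n%:R n%:R.
Proof.
have := specializes_poly n%:R; rewrite rmorph_nat.
by rewrite -polyC_natr hornerC.
Qed.

End Specialization.

Lemma algpi_rel (K : comNzRingType) (A : algType K) (S : A -> A -> Prop) u v :
  S u v -> algpi S u = algpi S v.
Proof. by move=> Suv; apply/algpiP; constructor. Qed.

(** * The loop relations in the quotient algebra *)

Section LoopRelations.
Variable R : realType.
Local Notation Cq := (Cq R).
Local Notation q := (q_ R).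
Local Notation x := (@Ux R).
Local Notation T := (Ut R).
Local Notation T' := (Ut' R).

Lemma UtK : T * T' = 1.
Proof. by rewrite -algpiM (algpi_rel (rel_TTinv _)). Qed.

Lemma Ut'K : T' * T = 1.
Proof. by rewrite -algpiM (algpi_rel (rel_TinvT _)). Qed.

Lemma Ut_x s k : T * x s k * T' = q ^ pmz s 2 *: x s k.
Proof. by have := algpi_rel (rel_TX R s k); rewrite algpiZ !algpiM. Qed.

Lemma Ua_x s (n k : int) : n != 0 ->
  Ua R n * x s k - x s k * Ua R n = (pm R s * (qint R (2 * n) / n%:~R)) *: x s (k + n).
Proof. by move=> n0; rewrite -!algpiM -algpiN -algpiD -algpiZ; apply/algpi_rel/rel_AX. Qed.

Lemma x_x s (k l : int) :
  x s (k + 1) * x s l - q ^ pmz s 2 *: (x s l * x s (k + 1))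
  = q ^ pmz s 2 *: (x s k * x s (l + 1)) - x s (l + 1) * x s k.
Proof.
by have := algpi_rel (rel_XX R s k l); rewrite !(algpiD, algpiN, algpiM, algpiZ).
Qed.

Lemma exp_coef0 (b : nat -> loop_free R) : exp_coef b 0 = 1.
Proof.
by rewrite /exp_coef big_ord1 fact0 invr1 scale1r expr0 coefC.
Qed.

Lemma exp_coef1 (b : nat -> loop_free R) : exp_coef b 1 = b 1%N.
Proof.
rewrite /exp_coef big_ord_recl big_ord1 /= expr0 coefC scaler0 add0r.
by rewrite invr1 scale1r expr1 coef_poly.
Qed.

Lemma phi0 s : phi R s 0 = if s then fgen Cq GenT else fgen Cq GenTinv.
Proof. by case: s; rewrite /phi /= exp_coef0 mulr1. Qed.

Lemma phi_true1 : phi R true 1 = (q - q^-1) *: (fgen Cq GenT * fgen Cq (GenA 1)).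
Proof. by rewrite /phi /= exp_coef1 mul1r scalerAr. Qed.

Lemma x0_x0 : x true 0 * x false 0 - x false 0 * x true 0 = (q - q^-1)^-1 *: (T - T').
Proof.
rewrite -!algpiM -!algpiN -!algpiD -algpiZ.
by have := algpi_rel (rel_XpXm R 0 0); rewrite addr0 !phi0.
Qed.

(** The series of the [phi true] starts with t_1 and (q - q^-1) t_1 a_1, and [phi false 1] is zero.
    The denominator q - q^-1 of the commutator therefore disappears. *)
Lemma x0_x1 : x true 0 * x false 1 - x false 1 * x true 0 = T * Ua R 1.
Proof.
rewrite -!algpiM -!algpiN -!algpiD.
have := algpi_rel (rel_XpXm R 0 1); rewrite add0r phi_true1.
have -> : phi R false 1 = 0 by [].
rewrite subr0 scalerA mulVf ?scale1r //.
by have := @expzB_neq0 _ q 1 (q_neq0 R) (@qn_neq1 R) isT; rewrite expr1z exprN1.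
Qed.

End LoopRelations.

(** * Generation by few elements, for an abstract parameter q *)

Section AbstractLoop.
Variables (F : fieldType) (C : numClosedFieldType) (q : F) (spec : F -> C -> Prop).
Hypotheses (q0 : q != 0) (qn1 : forall n, (0 < n)%N -> q ^+ n != 1).
Hypothesis specD : forall c v d w, spec c v -> spec d w -> spec (c + d) (v + w).
Hypothesis specM : forall c v d w, spec c v -> spec d w -> spec (c * d) (v * w).
Hypothesis spec_nat : forall n, spec n%:R n%:R.
Hypothesis spec_N1 : spec (- 1) (- 1).
Hypothesis spec_half : spec 2^-1 2^-1.
Hypothesis spec_q : spec q 'i.
Hypothesis spec_qV : spec q^-1 'i^-1.

Variables (U : pzRingType) (sc : F -> U -> U).
Local Notation "c *:: u" := (sc c u) (at level 40).
Hypothesis scA : forall c d u, c *:: (d *:: u) = (c * d) *:: u.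
Hypothesis sc1 : forall u, 1 *:: u = u.
Hypothesis scDl : forall c d u, (c + d) *:: u = c *:: u + d *:: u.
Hypothesis scDr : forall c u v, c *:: (u + v) = c *:: u + c *:: v.
Hypothesis scAl : forall c u v, c *:: (u * v) = c *:: u * v.
Hypothesis scAr : forall c u v, c *:: (u * v) = u * (c *:: v).

Variables (x : bool -> int -> U) (T T' : U) (a : int -> U).
Let q2 (s : bool) : F := q ^ (if s then 2 else - 2).
Let pm (s : bool) : F := if s then 1 else - 1.
Definition aqint (j : int) : F := (q ^ j - q ^ (- j)) / (q - q^-1).

Hypothesis TT' : T * T' = 1.
Hypothesis T'T : T' * T = 1.
Hypothesis TxT' : forall s k, T * x s k * T' = q2 s *:: x s k.
Hypothesis ax : forall s n k, n != 0 ->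
  a n * x s k - x s k * a n = (pm s * (aqint (2 * n) / n%:~R)) *:: x s (k + n).
Hypothesis xx : forall s k l,
  x s (k + 1) * x s l - q2 s *:: (x s l * x s (k + 1))
  = q2 s *:: (x s k * x s (l + 1)) - x s (l + 1) * x s k.
Hypothesis xx00 : x true 0 * x false 0 - x false 0 * x true 0 = (q - q^-1)^-1 *:: (T - T').
Hypothesis xx01 : x true 0 * x false 1 - x false 1 * x true 0 = T * a 1.
Hypothesis char0 : forall n : int, n != 0 -> (n%:~R : F) != 0.

Let ta n : U := (n%:~R / aqint n) *:: a n.
Definition adiv (u : U) (r : nat) := (\prod_(1 <= j < r.+1) aqint j)^-1 *:: u ^+ r.
Definition abin (n : int) (r : nat) : U :=
  \prod_(1 <= s < r.+1)
    ((q ^ s - q ^ (- s%:Z))^-1 *::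
       (q ^ (n - s%:Z + 1) *:: T - q ^ (- n + s%:Z - 1) *:: T')).

(** Instantiated twice: by membership in U^res, in the role of [I], and by [goodU], in the role of
    [G]. The scalars are those having a specialization, that is, the Laurent polynomials in q. *)
Definition closed (P : U -> Prop) :=
  [/\ forall u v, P u -> P v -> P (u + v), forall u v, P u -> P v -> P (u * v), P 1
    & forall c v u, spec c v -> P u -> P (c *:: u)].

Lemma scN1 u : (-1) *:: u = - u.
Proof.
have sc0 : 0 *:: u = 0 by apply: (addrI (0 *:: u)); rewrite -scDl !addr0.
by apply/eqP; rewrite -addr_eq0 -{2}[u]sc1 -scDl addNr sc0.
Qed.

Lemma scN c u : c *:: (- u) = - (c *:: u).
Proof. by rewrite -!scN1 !scA mulrC. Qed.

Lemma scNl c u : (- c) *:: u = - (c *:: u).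
Proof. by rewrite -scN1 scA mulN1r. Qed.

Lemma scB c u v : c *:: (u - v) = c *:: u - c *:: v.
Proof. by rewrite scDr scN. Qed.

Lemma closedN P : closed P -> forall u, P u -> P (- u).
Proof. by move=> [_ _ _ Z] u Pu; rewrite -scN1; apply: Z Pu; apply: spec_N1. Qed.

Lemma closedB P : closed P -> forall u v, P u -> P v -> P (u - v).
Proof. by move=> cP u v Pu Pv; case: (cP) => D _ _ _; apply: D => //; apply: closedN. Qed.

Lemma qz0 (k : int) : q ^ k != 0.
Proof. by rewrite expfz_neq0. Qed.

Lemma spec_qz (k : int) : spec (q ^ k) ('i ^ k).
Proof.
have h (c : F) (v : C) (n : nat) : spec c v -> spec (c ^+ n) (v ^+ n).
  move=> cv; elim: n => [|n IHn]; first exact: (spec_nat 1).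
  by rewrite !exprS; apply: specM.
by case: k => n; [apply: h | rewrite !NegzE -!exprnN -!exprVn; apply: h].
Qed.

Let qzz_neq0 (n : int) : n != 0 -> q ^ n - q ^ (- n) != 0.
Proof. exact: expzB_neq0. Qed.

Lemma aqint_neq0 n : n != 0 -> aqint n != 0.
Proof.
move=> n0; rewrite mulf_neq0 ?invr_neq0 ?qzz_neq0 //.
by have := @qzz_neq0 1 isT; rewrite expr1z exprN1.
Qed.

(** The normalization n / [n] turns [2n] / n into [2n] / [n] = q^n + q^-n. At q = 'i this is 2 or -
    2 for even n and 0 for odd n. *)
Lemma tax s n k : n != 0 ->
  ta n * x s k - x s k * ta n = (pm s * (q ^ n + q ^ (- n))) *:: x s (k + n).
Proof.
move=> n0; rewrite /ta -scAl -scAr -scB ax // scA; congr sc.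
rewrite mulrCA; congr (_ * _); rewrite /aqint.
rewrite mulr_natl mulr2n !opprD !expfzDr //.
have h1 := qzz_neq0 n0; have h2 := char0 n0.
have h3 : q - q^-1 != 0 by have := @qzz_neq0 1 isT; rewrite expr1z exprN1.
rewrite -!expr2 subr_sqr.
move: (q - q^-1) h3 (q ^ n - _) h1 (n%:~R) h2 => d d0 A A0 m m0.
by field; rewrite m0 A0 d0.
Qed.

Lemma Tx s k : T * x s k = q2 s *:: (x s k * T).
Proof. by rewrite scAl -TxT' -mulrA T'T mulr1. Qed.

Lemma T'x s k : T' * x s k = (q2 s)^-1 *:: (x s k * T').
Proof.
have := congr1 (fun u => (q2 s)^-1 *:: (T' * u * T')) (Tx s k).
rewrite mulrA T'T mul1r -scAr -scAl scA mulVf ?qz0 // sc1 => ->.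
by rewrite -[in RHS]mulrA -[in RHS]mulrA TT' mulr1.
Qed.

Lemma xx_sym s k l :
  x s (k + 1) * x s l + x s (l + 1) * x s k
  = q2 s *:: (x s l * x s (k + 1) + x s k * x s (l + 1)).
Proof.
rewrite -[X in X + _](subrK (q2 s *:: (x s l * x s (k + 1)))) xx.
by rewrite addrAC subrK addrC -scDr.
Qed.

Lemma aqint1 : aqint 1 = 1.
Proof.
by rewrite /aqint expr1z exprN1 divff //; have := @qzz_neq0 1 isT; rewrite expr1z exprN1.
Qed.

Lemma adiv2 u : adiv u 2 = (aqint 2)^-1 *:: (u * u).
Proof. by rewrite /adiv big_nat_recr //= big_nat1 aqint1 mul1r expr2. Qed.

(** The polarization of the divided square. It lies in U^res although it is not among the
    generators, see [closedE]. *)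
Let E s k l := (aqint 2)^-1 *:: (x s k * x s l + x s l * x s k).

Lemma aqint2 : aqint 2 = q + q^-1.
Proof.
have h3 : q - q^-1 != 0 by have := @qzz_neq0 1 isT; rewrite expr1z exprN1.
by rewrite /aqint -exprnN -exprnP -exprVn subr_sqr mulrAC divff ?mul1r.
Qed.

(** The quadratic relation makes the sum of the four products (q^2 + 1) times, or (q^-2 + 1) times,
    two of them, and the quotient by [2] = q + q^-1 is q or q^-1. The right-hand side is thus free
    of denominators. *)
Lemma E_rel s k l : E s (k + 1) l + E s k (l + 1)
  = q ^ (if s then 1 else - 1) *:: (x s l * x s (k + 1) + x s k * x s (l + 1)).
Proof.
set Y := x s l * _ + _; rewrite /E -scDr.
have -> : x s (k + 1) * x s l + x s l * x s (k + 1) + (x s k * x s (l + 1) + x s (l + 1) * x s k)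
   = (q2 s + 1) *:: Y.
  by rewrite scDl sc1 -xx_sym /Y (AC (2*2) ((1*4)*(2*3)))%AC.
rewrite scA; congr sc.
rewrite aqint2 /q2; case: s {Y}; rewrite -?exprnN -?exprnP ?expr1 ?exprN1.
  have h : q ^+ 2 + 1 != 0.
    have /aqint_neq0 : (2 : int) != 0 by [].
    by rewrite aqint2 => /(mulf_neq0 q0); rewrite mulrDr mulfV // expr2.
  by field; rewrite h q0.
have h : q ^+ 2 + 1 != 0.
  have /aqint_neq0 : (2 : int) != 0 by [].
  by rewrite aqint2 => /(mulf_neq0 q0); rewrite mulrDr mulfV // expr2.
by field; rewrite h q0.
Qed.

Lemma E_sym s k l : E s k l = E s l k.
Proof. by rewrite /E addrC. Qed.

Lemma E_diag s k : E s k k = adiv (x s k) 2 + adiv (x s k) 2.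
Proof. by rewrite adiv2 /E -scDr. Qed.

Lemma closed_half P u : closed P -> P (u + u) -> P u.
Proof.
move=> [_ _ _ Z]; rewrite -[X in X + X]sc1 -scDl => /(Z _ _ _ spec_half).
have two : (1 + 1 : F) != 0 by have := @char0 2 isT.
by rewrite scA mulVf // sc1.
Qed.

(** Induction on the distance of the indices: [E_rel] expresses the case of distance d + 2 by the
    one of distance d with both indices moved inwards, up to products without denominator. *)
Lemma closedE P : closed P -> (forall s k, P (x s k)) ->
  (forall s k, P (adiv (x s k) 2)) -> forall s k l, P (E s k l).
Proof.
move=> cP Px Pd s k l; case: (cP) => D M _ Z.
have PY k' l' : P (q ^ (if s then 1 else - 1) *:: (x s l' * x s (k' + 1) + x s k' * x s (l' + 1))).
  by apply: Z; [apply: spec_qz | apply: D; apply: M].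
have h (d : nat) : forall k, P (E s k (k + d%:Z)).
  elim/ltn_ind: d => -[|[|d]] IH k'.
  - by rewrite addr0 E_diag; apply: D.
  (* For consecutive indices the two terms on the left of [E_rel] coincide by symmetry, and 2 is
     invertible. *)
  - by apply: closed_half cP _; rewrite {1}E_sym E_rel; apply: PY.
  have -> : k' + d.+2%:Z = k' + d.+1%:Z + 1 by rewrite -addrA -PoszD addn1.
  rewrite -[E _ _ _](addKr (E s (k' + 1) (k' + d.+1%:Z))) E_rel addrC.
  apply: closedB => //.
  by rewrite intS addrA; apply: IH.
case: (Order.TotalTheory.leP k l) => kl; [|rewrite E_sym; move/Order.POrderTheory.ltW in kl].
  rewrite -subr_ge0 in kl; rewrite -[l](subrK k) [l - k + k]addrC.
  by case: (l - k) kl => // d _; apply: h.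
rewrite -subr_ge0 in kl; rewrite -[k](subrK l) [k - l + l]addrC.
by case: (k - l) kl => // d _; apply: h.
Qed.

Variables (I G : U -> Prop).
Hypotheses (cI : closed I) (cG : closed G).
Hypothesis Gdiv : forall c v u, spec c v -> v != 0 -> I u -> G (c *:: u) -> G u.
Hypotheses (Ix : forall s k r, I (adiv (x s k) r)) (Ibin : forall n r, I (abin n r)).
Hypotheses (GT : G T) (GT' : G T') (Gta : forall n, n != 0 -> G (ta n)).
Hypotheses (Gx0 : forall s, G (x s 0)) (Gx1 : G (x false 1)) (Gd0 : forall s, G (adiv (x s 0) 2)).

Lemma adiv1 u : adiv u 1 = u.
Proof. by rewrite /adiv big_nat1 aqint1 invr1 sc1 expr1. Qed.

Lemma Ix1 s k : I (x s k).
Proof. by rewrite -[x s k]adiv1. Qed.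

(** This provides x_1^+, which the commutator of a_1 with x_0^+ cannot, because its coefficient [2]
    vanishes at 'i. Here that [2] is cancelled by the denominator of the divided square. *)
Lemma x01_comm : adiv (x true 0) 2 * x false 1 - x false 1 * adiv (x true 0) 2
  = q *:: (x true 0 * (T * a 1)) + T * x true 1.
Proof.
set e := x true 0; set f := x false 1; set b := T * a 1.
have ef : e * f = f * e + b by rewrite -[LHS](subrK (f * e)) xx01 addrC.
have ae : a 1 * e = e * a 1 + aqint 2 *:: x true 1.
  by rewrite -[LHS](subrK (e * a 1)) ax // mul1r add0r divr1 addrC.
have be : b * e = q2 true *:: (e * b) + aqint 2 *:: (T * x true 1).
  have Te : T * e = q2 true *:: (e * T) by exact: Tx.
  by rewrite /b -mulrA ae mulrDr mulrA -scAr Te -scAl -mulrA.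
have eef : e * e * f - f * (e * e) = (q2 true + 1) *:: (e * b) + aqint 2 *:: (T * x true 1).
  rewrite -mulrA ef mulrDr mulrA ef mulrDl be (mulrA f) scDl sc1.
  by rewrite addrAC [X in X - _]addrC addrK addrAC.
rewrite adiv2 -scAl -scAr -scB eef scDr !scA; congr (_ *:: _ + _).
  have /aqint_neq0 : (2 : int) != 0 by [].
  rewrite aqint2 /q2 -exprnP => h.
  have h' : q ^+ 2 + 1 != 0 by have := mulf_neq0 q0 h; rewrite mulrDr mulfV // expr2.
  by field; rewrite h' q0.
by rewrite mulVf ?sc1 // aqint_neq0.
Qed.

Lemma ta1 : ta 1 = a 1.
Proof. by rewrite /ta aqint1 divr1 sc1. Qed.

Lemma Gx11 : G (x true 1).
Proof.
case: (cG) => D M _ Z.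
rewrite -[x true 1]mul1r -T'T -mulrA; apply: (M) => //.
have -> : T * x true 1 = adiv (x true 0) 2 * x false 1 - x false 1 * adiv (x true 0) 2
    - q *:: (x true 0 * (T * a 1)) by rewrite x01_comm addrAC subrr add0r.
apply: (closedB cG); first by apply: (closedB cG); apply: (M).
by apply: (Z) spec_q _; apply: (M) => //; apply: (M) => //; rewrite -ta1; apply: Gta.
Qed.

Lemma spec_pm s : spec (pm s) (if s then 1 else -1).
Proof. by case: s => //; apply: (spec_nat 1). Qed.

(** As 'i^2 = 'i^-2 = - 1, the coefficient of the commutator with a_2 or a_-2 becomes 2 up to
    sign. *)
Lemma spec_shift s (n : int) : n = 2 \/ n = - 2 ->
  exists2 v, spec (pm s * (q ^ n + q ^ (- n))) v & v != 0.
Proof.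
move=> n2; exists ((if s then 1 else -1) * ('i ^ n + 'i ^ (- n))).
  by apply: specM; [apply: spec_pm | apply: specD; apply: spec_qz].
have -> : 'i ^ n + 'i ^ (- n) = - 2 :> C.
  have i2 : 'i ^ 2 = - 1 :> C by rewrite -exprnP Num.Theory.sqrCi.
  have i2' : 'i ^ (- 2) = - 1 :> C by rewrite -exprnN Num.Theory.sqrCi invrN1.
  by case: n2 => ->; rewrite ?opprK i2 i2' -opprD.
by rewrite mulf_neq0 //; [case: s | ]; rewrite ?oppr_eq0 ?oner_eq0 // Num.Theory.pnatr_eq0.
Qed.

Lemma Gx_shift s (k n : int) : n = 2 \/ n = - 2 -> G (x s k) -> G (x s (k + n)).
Proof.
move=> n2 Gx; case: (cG) => _ M _ _.
have n0 : n != 0 by case: n2 => ->.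
case: (spec_shift s n2) => v sv v0; apply: Gdiv sv v0 (Ix1 _ _) _.
by rewrite -tax //; apply: closedB cG _ _ _ _; apply: M => //; apply: Gta.
Qed.

Lemma Gx s k : G (x s k).
Proof.
have Gs1 : G (x s 1) by case: s; [apply: Gx11 | apply: Gx1].
(* Two consecutive indices are carried along, since the available shifts are by 2 and preserve
   parity. *)
suff: G (x s k) /\ G (x s (k + 1)) by case.
elim/int_rect: k => [|n [IH1 IH2]|n [IH1 IH2]]; first by [].
- rewrite intS [1 + _]addrC; split => //.
  by rewrite -addrA; apply: Gx_shift => //; left.
have -> : - (n.+1%:Z) = - n%:Z + 1 + - 2 by rewrite intS opprD addrC -addrA.
split; first by apply: Gx_shift => //; right.
by rewrite -addrA -addrA addr0.
Qed.

(** Up to sign, the commutator of a_n with the divided square of x_k is (q^n + q^-n)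
    [E s k (k + n)]. For n = 2 or - 2 this gives the polarized square at distance two, and [E_rel]
    turns it into the divided square at the index in between. The index thus moves by one, and one
    initial divided square suffices for each sign. *)
Lemma Gadiv2 s k : G (adiv (x s k) 2).
Proof.
case: (cG) => D M _ Z.
have hE (n k' : int) : n = 2 \/ n = - 2 -> G (adiv (x s k') 2) -> G (E s k' (k' + n)).
  move=> n2 Gk'; have n0 : n != 0 by case: n2 => ->.
  case: (spec_shift s n2) => v sv v0; apply: Gdiv sv v0 _ _.
    by apply: closedE cI _ _ _ _ _ => // s' k''; apply: Ix1.
  have -> : (pm s * (q ^ n + q ^ (- n))) *:: E s k' (k' + n)
      = ta n * adiv (x s k') 2 - adiv (x s k') 2 * ta n.
    rewrite /E scA mulrC -scA scDr scAr scAl -tax // adiv2 -scAr -scAl -scB.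
    congr sc; rewrite mulrBr mulrBl !mulrA.
    by rewrite addrC addrA subrK.
  by apply: closedB cG _ _ _ _; apply: M => //; apply: Gta.
(* [E_rel] with l = k' + 1: the two polarized squares with index sum 2 k' + 2 add up to products
   without denominator. *)
have hd (k' : int) : G (E s k' (k' + 2)) -> G (adiv (x s (k' + 1)) 2).
  move=> GE; apply: closed_half cG _; rewrite -E_diag.
  have -> : E s (k' + 1) (k' + 1) = E s (k' + 1) (k' + 1) + E s k' (k' + 1 + 1) - E s k' (k' + 2).
    by have -> : k' + 2 = k' + 1 + 1 by [rewrite -addrA]; rewrite addrK.
  rewrite E_rel; apply: closedB cG _ _ _ _ => //; apply: Z (spec_qz _) _.
  by apply: D; apply: M; apply: Gx.
elim/int_rect: k => [|n IH|n IH]; first exact: Gd0.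
  by rewrite intS addrC; apply: hd; apply: hE => //; left.
rewrite intS opprD addrC.
have -> : - n%:Z - 1 = - n%:Z - 2 + 1 by rewrite -addrA.
apply: hd; rewrite E_sym subrK; apply: hE => //; by right.
Qed.

Lemma qpow (w : F) (n : nat) : w ^ (- n%:Z) = (w ^+ n)^-1.
Proof. by rewrite -exprnN. Qed.

Lemma qdiff0 : q - q^-1 != 0.
Proof. by have := @qzz_neq0 1 isT; rewrite expr1z exprN1. Qed.

(** From [2m+3] = [2m+1] + q^(2m+2) + q^-(2m+2), whose last two terms are 2 (-1)^(m+1) in total at
    'i. *)
Lemma spec_odd m : spec (aqint (2 * m).+1) ((-1) ^+ m).
Proof.
elim: m => [|m IH]; first by rewrite muln0 aqint1; apply: (spec_nat 1).
have -> : aqint (2 * m.+1).+1 = aqint (2 * m).+1 + (q ^ (2 * m.+1)%N + q ^ (- (2 * m.+1)%N%:Z)).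
  rewrite /aqint mulnS addSn add1n !qpow -!exprnP.
  rewrite !exprS; set w := q ^+ (2 * m).
  have w0 : w != 0 by rewrite expf_neq0.
  have := qdiff0; have -> : q - q^-1 = (q ^+ 2 - 1) / q by field.
  move=> h; have h' : q ^+ 2 - 1 != 0 by apply: contraNneq h => ->; rewrite mul0r.
  by field; rewrite h' w0 q0.
have -> : (-1) ^+ m.+1 = (-1) ^+ m + ('i ^ (2 * m.+1)%N + 'i ^ (- (2 * m.+1)%N%:Z)) :> C.
  rewrite -exprnN -exprnP exprM Num.Theory.sqrCi invr_sign.
  by rewrite exprS mulN1r addrA subrr sub0r.
by apply: specD => //; apply: specD; apply: spec_qz.
Qed.

(** Numerator and denominator both vanish at 'i. The recursion [2m+4]/[2] = q^2 [2m+2]/[2] +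
    q^-(2m+2) exhibits the quotient as a Laurent polynomial and gives its value. *)
Lemma spec_even m : spec (aqint (2 * m.+1)%N / aqint 2) ((-1) ^+ m * m.+1%:R).
Proof.
elim: m => [|m IH].
  by rewrite muln1 divff ?aqint_neq0 // mulr1; apply: (spec_nat 1).
have -> : aqint (2 * m.+2)%N / aqint 2 =
    q * q * (aqint (2 * m.+1)%N / aqint 2) + q ^ (- (2 * m.+1)%N%:Z).
  have -> : (2 * m.+2 = 4 + 2 * m)%N by rewrite !mulnS.
  have -> : (2 * m.+1 = 2 + 2 * m)%N by rewrite mulnS.
  have e0 : q ^ 2 - q ^ (- 2) != 0 by exact: qzz_neq0.
  have divd X : X / (q - q^-1) / ((q ^ 2 - q ^ (- 2)) / (q - q^-1)) = X / (q ^ 2 - q ^ (- 2)).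
    by move: (q - q^-1) qdiff0 (_ - _) e0 => d d0 e e0; field; rewrite d0 e0.
  rewrite /aqint !divd; apply: (mulIf e0).
  rewrite divfK // mulrDl -[_ * _ * (q ^ 2 - _)]mulrA divfK //.
  move: (2 * m)%N => k; rewrite !qpow -!exprnP !exprD; set w := q ^+ k.
  have w0 : w != 0 by rewrite expf_neq0.
  by field; rewrite w0 q0.
have -> : (-1) ^+ m.+1 * m.+2%:R = 'i * 'i * ((-1) ^+ m * m.+1%:R) + 'i ^ (- (2 * m.+1)%N%:Z) :> C.
  rewrite -exprnN exprM -expr2 Num.Theory.sqrCi invr_sign.
  by rewrite mulrA -exprS -[m.+2]addn1 natrD mulrDr mulr1.
by apply: specD; [apply: specM => //; apply: specM | apply: spec_qz].
Qed.

(** Of r + 1 and r + 2 exactly one is even; the zero of its q-integer is the one removed by [2], and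
    the other q-integer becomes 1 or - 1. *)
Lemma spec_binom r : exists2 v, spec (aqint r.+1 * aqint r.+2 / aqint 2) v & v != 0.
Proof.
have n1 m : (-1) ^+ m != 0 :> C by rewrite expf_neq0 // oppr_eq0 oner_neq0.
have nn m : m.+1%:R != 0 :> C by rewrite Num.Theory.pnatr_eq0.
rewrite -[r]odd_double_half; set m := r./2; case: (odd r); rewrite -mul2n.
  exists ((-1) ^+ m.+1 * ((-1) ^+ m * m.+1%:R)); last by rewrite !mulf_neq0.
  have -> : (1 + 2 * m).+1 = (2 * m.+1)%N by rewrite mulnS.
  by rewrite mulrAC mulrC; apply: specM; [apply: spec_odd | apply: spec_even].
exists ((-1) ^+ m * ((-1) ^+ m * m.+1%:R)); last by rewrite !mulf_neq0.
have -> : (0 + 2 * m).+2 = (2 * m.+1)%N by rewrite mulnS.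
by rewrite -mulrA; apply: specM; [apply: spec_odd | apply: spec_even].
Qed.

(** One step at a time would require dividing by [r+1], which vanishes at 'i for odd r. Multiplying
    the divided power of order r by the divided square instead brings in [r+1][r+2]/[2], which does
    not. *)
Lemma Gadiv s k r : G (adiv (x s k) r).
Proof.
case: (cG) => D M G1 Z.
elim/ltn_ind: r => -[|[|r]] IH.
- by rewrite /adiv big_geq // invr1 sc1 expr0.
- by rewrite adiv1; apply: Gx.
case: (spec_binom r) => v sv v0; apply: Gdiv sv v0 (Ix _ _ _) _.
have -> : (aqint r.+1 * aqint r.+2 / aqint 2) *:: adiv (x s k) r.+2
    = adiv (x s k) r * adiv (x s k) 2.
  rewrite adiv2 /adiv -scAr -scAl !scA -expr2 -exprD addn2.
  congr sc; rewrite [in LHS]big_nat_recr //= [in LHS]big_nat_recr //=.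
  move: (aqint_neq0 (isT : r.+1%:Z != 0)) (aqint_neq0 (isT : r.+2%:Z != 0)).
  move: (aqint r.+1) (aqint r.+2) (aqint 2) (\prod_(_ <= _ < _) _) => A B D' p A0 B0.
  by rewrite !invfM; move: (p^-1) (D'^-1) => u w; field; rewrite A0 B0.
by apply: M; [apply: IH; apply: ltnW | apply: Gadiv2].
Qed.

Definition numT (n : int) := q ^ n *:: T - q ^ (- n) *:: T'.

Lemma abin1 n : abin n 1 = (q - q^-1)^-1 *:: numT n.
Proof.
rewrite /abin big_nat1 expr1z exprN1; congr (_ *:: (_ *:: _ - _ *:: _)).
  by rewrite subrK.
by rewrite addrK.
Qed.

Lemma abin2 n : abin n 2 = ((q - q^-1) * (q ^ 2 - q ^ (- 2)))^-1 *:: (numT n * numT (n - 1)).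
Proof.
rewrite /abin big_nat_recr //= big_nat1 -scAl -scAr scA -invfM expr1z exprN1.
congr (_ *:: (_ * _)).
  by congr (_ *:: _ - _ *:: _); rewrite ?subrK ?addrK.
congr (_ *:: _ - _ *:: _); congr (_ ^ _).
  by rewrite -addrA.
by rewrite opprB -addrA addrC.
Qed.

Lemma numTM m k : numT m * numT k
  = q ^ (m + k) *:: (T * T) - (q ^ (m - k) + q ^ (k - m)) *:: 1 + q ^ (- m - k) *:: (T' * T').
Proof.
have e (c d : int) u v : (q ^ c *:: u) * (q ^ d *:: v) = q ^ (c + d) *:: (u * v).
  by rewrite -scAl -scAr scA expfzDr.
rewrite /numT mulrBl !mulrBr opprB !e TT' T'T scDl opprD [- m + k]addrC.
by rewrite (AC (2*2) ((1*(2*4))*3))%AC.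
Qed.

Lemma abinD n r :
  (aqint r.+1 * aqint r.+2 / aqint 2) *:: abin n r.+2 = abin n r * abin (n - r%:Z) 2.
Proof.
rewrite abin2 /abin big_nat_recr //= big_nat_recr //=.
have mul3 c d u v w : u * (c *:: v) * (d *:: w) = (c * d) *:: (u * (v * w)).
  by rewrite -scAr -[u * _]scAr -scAl scA [d * c]mulrC -mulrA.
set p := \prod_(_ <= _ < _) _; rewrite mul3 scA -[in RHS]scAr.
have e1 : r.+1%:Z = r%:Z + 1 by rewrite -addn1 PoszD.
have e2 : r.+2%:Z = r%:Z + 1 + 1 by rewrite -addn1 PoszD e1.
have -> : n - r.+1%:Z + 1 = n - r%:Z by rewrite e1; ring.
have -> : n - r.+2%:Z + 1 = n - r%:Z - 1 by rewrite e2; ring.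
have -> : - n + r.+1%:Z - 1 = - (n - r%:Z) by rewrite e1; ring.
have -> : - n + r.+2%:Z - 1 = - (n - r%:Z - 1) by rewrite e2; ring.
congr (_ *:: _).
have a2 : q ^ 2 - q ^ (- 2) != 0 by exact: qzz_neq0.
have a3 : q ^ r.+1%:Z - q ^ (- r.+1%:Z) != 0 by exact: qzz_neq0.
have a4 : q ^ r.+2%:Z - q ^ (- r.+2%:Z) != 0 by exact: qzz_neq0.
rewrite /aqint; move: (q - q^-1) qdiff0 (_ - q ^ (- 2)) a2 (_ - q ^ (- r.+1%:Z)) a3 (_ - q ^ (- r.+2%:Z)) a4.
by move=> d d0 A A0 B B0 D D0; field; rewrite d0 A0 B0 D0.
Qed.

(** A q-Pascal rule. It moves n by one, with a correction involving only the first binomial, whose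
    denominator q - q^-1 is 2 'i after specialization. *)
Lemma abin2S n : abin (n + 1) 2 = q ^ 2 *:: abin n 2 + q ^ (1 - n) *:: (T' * abin n 1).
Proof.
have TN : T' * numT n = q ^ n *:: 1 - q ^ (- n) *:: (T' * T') by rewrite /numT mulrBr -!scAr T'T.
rewrite !abin2 abin1 -scAr !scA TN addrK !numTM.
set c := (_ * _)^-1.
have -> : (q - q^-1)^-1 = c * (q ^ 2 - q ^ (- 2)).
  by rewrite /c invfM -mulrA mulVf ?mulr1 ?qzz_neq0.
have eL k (al be ga : F) : k *:: (al *:: (T * T) - be *:: 1 + ga *:: (T' * T'))
  = (k * al) *:: (T * T) - (k * be) *:: 1 + (k * ga) *:: (T' * T').
  by rewrite scDr scB !scA.
have eS (a1 b1 g1 b2 g2 : F) :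
  a1 *:: (T * T) - b1 *:: 1 + g1 *:: (T' * T') + (b2 *:: 1 - g2 *:: (T' * T'))
  = a1 *:: (T * T) - (b1 - b2) *:: 1 + (g1 - g2) *:: (T' * T').
  rewrite !scDl !scNl opprD opprK.
  by rewrite (AC (3*2) ((1*(2*4))*(3*5)))%AC.
rewrite !eL scB !scA eS.
have qw : q ^ (- n) = (q ^ n)^-1 by rewrite invr_expz.
have w0 := qz0 n; set w := q ^ n in qw w0 *.
have q2E : q ^ 2 = q * q by rewrite -exprnP expr2.
have qN2E : q ^ (- 2) = q^-1 * q^-1 by rewrite -exprnN expr2 invfM.
have qN1 : q ^ (-1) = q^-1 by rewrite exprN1.
move: c => c.
congr (_ *:: _ - _ *:: _ + _ *:: _).
- by rewrite q2E !expfzDr // -/w qN1 expr1z; field; rewrite q0.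
- rewrite q2E qN2E !(expfzDr, opprD, opprK) // -/w qw qN1 expr1z.
  by field; rewrite q0 w0.
rewrite q2E qN2E !(expfzDr, opprD, opprK) // -/w qw qN1 expr1z.
by field; rewrite q0 w0.
Qed.

Let e := x true 0.
Let f := x false 0.

(** The sl_2 formula for commuting the two divided squares, solved for its weight term. It yields
    the second binomial at n = 0 without a division by [2]. *)
Lemma abin02 : abin 0 2
  = adiv e 2 * adiv f 2 - adiv f 2 * adiv e 2 - f * (e * abin 0 1).
Proof.
pose h n := (q - q^-1)^-1 *:: numT n.
have numTe n : numT n * e = e * numT (n + 2).
  rewrite /numT mulrBl mulrBr -!scAl -!scAr Tx T'x !scA /q2 invr_expz -!expfzDr //.
  by rewrite [- (n + 2)]opprD.
have numTf n : numT n * f = f * numT (n - 2).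
  rewrite /numT mulrBl mulrBr -!scAl -!scAr Tx T'x !scA /q2 invr_expz -!expfzDr //.
  by rewrite [- (n - 2)]opprD.
have he n : h n * e = e * h (n + 2) by rewrite /h -scAl -scAr numTe.
have hf n : h n * f = f * h (n - 2) by rewrite /h -scAl -scAr numTf.
have ef : e * f = f * e + h 0.
  by rewrite -[LHS](subrK (f * e)) xx00 addrC /h /numT !expr0z !sc1.
(* Moving e past f f produces two neighbouring values of h; this relation merges them into one
   multiple of [2], which the denominators then absorb. *)
have hh n : h (n + 1) + h (n - 1) = aqint 2 *:: h n.
  rewrite /h -scDr scA mulrC -scA /numT; congr sc.
  rewrite scB !scA aqint2 !mulrDl !scDl.
  have -> : q * q ^ n = q ^ (n + 1) by rewrite expfzDr // expr1z mulrC.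
  have -> : q^-1 * q ^ n = q ^ (n - 1) by rewrite expfzDr // exprN1 mulrC.
  have -> : q * q ^ (- n) = q ^ (- (n - 1)) by rewrite opprB addrC expfzDr // expr1z mulrC.
  have -> : q^-1 * q ^ (- n) = q ^ (- (n + 1)) by rewrite opprD expfzDr // exprN1 mulrC.
  by rewrite [- (_ *:: _ + _)]opprD [- (q ^ (- (n - 1)) *:: _) + _]addrC addrACA.
have h0E : abin 0 1 = h 0 by exact: abin1.
have h1E : abin 0 2 = (aqint 2)^-1 *:: (h 0 * h (- 1)).
  rewrite abin2 add0r /h -scAl -scAr !scA.
  congr sc; rewrite /aqint.
  have e0 : q ^ 2 - q ^ (- 2) != 0 by exact: qzz_neq0.
  by move: (q - q^-1) qdiff0 (_ - _) e0 => d d0 b b0; field; rewrite d0 b0.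
rewrite h0E h1E !adiv2; clearbody h; clear h0E h1E.
have a2 : aqint 2 != 0 by exact: aqint_neq0.
move: (aqint 2) a2 hh => k k0 hh.
have eff : e * (f * f) = f * f * e + k *:: (f * h (- 1)).
  rewrite mulrA ef mulrDl -mulrA ef mulrDr mulrA -addrA hf -mulrDr.
  by have := hh (- 1); rewrite scAr => <-.
have eeff : e * e * (f * f) = f * f * (e * e)
   + (k * k) *:: (f * (e * h 0)) + k *:: (h 0 * h (- 1)).
  rewrite -mulrA eff mulrDr mulrA eff mulrDl -!mulrA -!scAl -!scAr -!addrA; congr (_ + _).
  rewrite [e * (f * _)]mulrA ef mulrDl scDr addrA; congr (_ + _).
  rewrite -!mulrA he -scDr -!mulrDr -scA; congr sc.
  by rewrite !scAr -hh.
rewrite -!scAl -!scAr !scA eeff !scDr !scA.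
have -> : (k)^-1 / k * (k * k) = 1 by field; rewrite k0.
have -> : (k)^-1 / k * k = (k)^-1 by field; rewrite k0.
rewrite sc1 [_ - _ *:: _]addrAC [_ *:: _ + _]addrC addrK.
by rewrite [f * _ + _]addrC addrK.
Qed.

Lemma Gabin1 n : G (abin n 1).
Proof.
case: (cG) => D M _ Z.
have s1 : spec (q - q^-1) ('i - 'i^-1).
  by apply: specD => //; rewrite -mulN1r -[- 'i^-1]mulN1r; apply: specM.
apply: Gdiv s1 _ (Ibin _ _) _.
  by rewrite invCi opprK -mulr2n -mulr_natl mulf_neq0 ?neq0Ci // pnatr_eq0.
by rewrite abin1 scA mulfV ?qdiff0 // sc1; apply: (closedB cG); apply: Z => //; apply: spec_qz.
Qed.

(** The case n = 0 comes from [abin02], the others from the q-Pascal rule used in both directions, q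
    being invertible. *)
Lemma Gabin2 n : G (abin n 2).
Proof.
case: (cG) => D M _ Z.
have G0 : G (abin 0 2).
  rewrite abin02; apply: (closedB cG); first apply: (closedB cG); do ?[apply: (M) => //]; do ?[exact: Gadiv2 | exact: Gabin1 | exact: Gx0].
have hb m : G (T' * abin m 1) by apply: M => //; apply: Gabin1.
elim/int_rect: n => [|n IH|n IH] //.
  rewrite intS addrC abin2S; apply: D; apply: Z => //; exact: spec_qz.
have := abin2S (- n.+1%:Z).
have -> : - n.+1%:Z + 1 = - n%:Z by rewrite intS opprD addrAC addNr add0r.
move/(congr1 (fun u => q ^ (- 2) *:: u)); rewrite scDr !scA -expfzDr // sc1 => /eqP.
rewrite -subr_eq => /eqP <-; apply: (closedB cG).
  by apply: Z => //; apply: spec_qz.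
by rewrite -expfzDr //; apply: Z => //; apply: spec_qz.
Qed.

Lemma Gabin n r : G (abin n r).
Proof.
case: (cG) => D M G1 Z.
elim/ltn_ind: r => -[|[|r]] IH; [by rewrite /abin big_geq | exact: Gabin1 |].
case: (spec_binom r) => v sv v0; apply: Gdiv sv v0 (Ibin _ _) _.
by rewrite abinD; apply: M; [apply: IH; apply: ltnW | apply: Gabin2].
Qed.

End AbstractLoop.

Lemma scaleVK (F : fieldType) (V : lmodType F) (c : F) (u : V) :
  c != 0 -> c^-1 *: (c *: u) = u.
Proof. by move=> c0; rewrite scalerA mulVf // scale1r. Qed.

Lemma falg_ind (K : comNzRingType) (I : choiceType) (P : falg K I -> Prop) :
  (forall x y, P x -> P y -> P (x + y)) -> (forall c x, P x -> P (c *: x)) ->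
  (forall x y, P x -> P y -> P (x * y)) -> P 1 -> (forall i, P (fgen K i)) ->
  forall x, P x.
Proof.
move=> PD PZ PM P1 Pgen x; have P0 : P 0 by rewrite -(scale0r 1); apply: PZ.
rewrite [x]monalg.monalgE; elim/big_ind: _ => // k _.
have -> : mkmalgU k (monalg.mcoeff k x) = monalg.mcoeff k x *: (mkmalgU k 1 : falg K I).
  by apply/monalg.malgP => m; rewrite monalg.mcoeffZ !monalg.mcoeffU mulrnAr mulr1.
apply: PZ; case: k => s; elim: s => [|i s IH].
  by rewrite -fmoneE.
have -> : mkmalgU (FMonom (i :: s)) 1 = fgen K i * (mkmalgU (FMonom s) 1 : falg K I).
  by rewrite /fgen monalg.malgM_def fgmulUU mulr1; congr mkmalgU; rewrite fmuE /mmul /= fmmulE.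
exact: PM.
Qed.

(** * From the integral form to the algebra at q = 'i *)

Section Generation.
Variable R : realType.
Local Notation C := R[i].
Local Notation Cq := (Cq R).
Local Notation q := (q_ R).
Variable good : Ui R -> Prop.
Hypothesis goodD : forall g h, good g -> good h -> good (g + h).
Hypothesis goodM : forall g h, good g -> good h -> good (g * h).
Hypothesis goodZ : forall (c : C) g, good g -> good (c *: g).
Hypothesis good1 : good 1.

(** Membership in U^res is part of the definition, because outside U^res the second condition holds
    vacuously. *)
Definition goodU (x : Uq R) : Prop :=
  in_Ures x /\ forall u : Ures R, Ures_val u = x -> good (Uspec u).

Lemma Uspec1 (w : Ures R) : Ures_val w = 1 -> Uspec w = 1.
Proof. by move=> h; rewrite /Uspec (algpi_rel (Ui_rel1 h)). Qed.

Lemma UspecD (u v w : Ures R) : Ures_val w = Ures_val u + Ures_val v ->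
  Uspec w = Uspec u + Uspec v.
Proof. by move=> h; rewrite /Uspec (algpi_rel (Ui_relD h)) algpiD. Qed.

Lemma UspecM (u v w : Ures R) : Ures_val w = Ures_val u * Ures_val v ->
  Uspec w = Uspec u * Uspec v.
Proof. by move=> h; rewrite /Uspec (algpi_rel (Ui_relM h)) algpiM. Qed.

Lemma UspecZ c v (u w : Ures R) : specializes c v -> Ures_val w = c *: Ures_val u ->
  Uspec w = v *: Uspec u.
Proof.
by move=> [p [k [-> ->]]] h; rewrite /Uspec (algpi_rel (Ui_relZ h)) algpiZ.
Qed.

Lemma Ures_spec c v (x : Uq R) : specializes c v -> in_Ures x -> in_Ures (c *: x).
Proof. by move=> [p [k [-> _]]]; apply: Ures_Z. Qed.

Lemma closed_Ures : closed (@specializes R) (@GRing.scale _ (Uq R)) (@in_Ures R).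
Proof.
split; [exact: Ures_D | exact: Ures_M | exact: Ures_1 |].
by move=> c v u cv; apply: Ures_spec cv.
Qed.

Lemma closed_goodU : closed (@specializes R) (@GRing.scale _ (Uq R)) goodU.
Proof.
split.
- move=> x y [Ix Gx] [Iy Gy]; split=> [|w hw]; first exact: Ures_D.
  by rewrite (@UspecD (MkUres Ix) (MkUres Iy)) //; apply: goodD; [apply: Gx | apply: Gy].
- move=> x y [Ix Gx] [Iy Gy]; split=> [|w hw]; first exact: Ures_M.
  by rewrite (@UspecM (MkUres Ix) (MkUres Iy)) //; apply: goodM; [apply: Gx | apply: Gy].
- by split=> [|w hw]; [exact: Ures_1 | rewrite Uspec1].
move=> c v x cv [Ix Gx]; split=> [|w hw]; first exact: Ures_spec cv Ix.
by rewrite (@UspecZ c v (MkUres Ix)) //; apply: goodZ; apply: Gx.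
Qed.

(** After specialization the image of c x is v times that of x, and v is invertible in C. That x
    lies in U^res has to be known beforehand, since the inverse of c need not be a Laurent
    polynomial. *)
Lemma goodU_div c v x : specializes c v -> v != 0 -> in_Ures x -> goodU (c *: x) -> goodU x.
Proof.
move=> cv v0 Ix [Icx Gcx]; split=> // w hw.
have e : c *: x = c *: Ures_val w by rewrite hw.
have := Gcx (MkUres Icx) erefl; rewrite (UspecZ (w := MkUres Icx) cv e).
by move/(@goodZ v^-1); rewrite (scaleVK _ v0).
Qed.

Lemma Cq_int_neq0 (n : int) : n != 0 -> (n%:~R : Cq) != 0.
Proof.
by move=> n0; rewrite -(rmorph_int (@tofrac _)) tofrac_eq0 -(rmorph_int (@polyC _)) polyC_eq0 intr_eq0.
Qed.

Lemma specializesN1 : specializes (R := R) (-1) (-1).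
Proof. by have := specializes_poly (-1 : {poly C}); rewrite rmorphN1 hornerN hornerC. Qed.

Lemma specializes_half : specializes (R := R) 2^-1 2^-1.
Proof.
have := specializes_poly ((2^-1)%:P : {poly C}); rewrite hornerC.
suff -> : tofrac ((2^-1)%:P : {poly C}) = 2^-1 by [].
have two : (2 : Cq) != 0 by exact: (@Cq_int_neq0 2).
apply: (mulfI two); rewrite mulfV // -(rmorph_nat (@tofrac _)) -rmorphM /=.
by rewrite -(rmorph_nat (@polyC _)) -rmorphM /= mulfV ?rmorph1 // pnatr_eq0.
Qed.

Let hx s k := Ut_x R s k.

Lemma goodU_gen :
  goodU (Ut R) -> goodU (Ut' R) -> (forall n : int, n != 0 -> goodU (Uta R n)) ->
  (forall s, goodU (Ux R s 0)) -> goodU (Ux R false 1) ->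
  (forall s, goodU (Udiv (Ux R s 0) 2)) ->
  forall g, good g.
Proof.
move=> GT GT' Ga Gx0 Gx1 Gd0.
have Gd s k r : goodU (Udiv (Ux R s k) r).
  exact: (Gadiv (q_neq0 R) (@qn_neq1 R) (@specializesD R) (@specializesM R)
    (@specializes_nat R) specializesN1 specializes_half (specializes_q R) (specializes_qV R)
    (@scalerA _ (Uq R)) (@scale1r _ (Uq R)) (fun c d u => scalerDl u c d)
    (fun c u v => scalerDr c u v)
    (@algquot_scalerAl _ _ _) (@algquot_scalerAr _ _ _) (Ut'K R) (@Ut_x R) (@Ua_x R)
    (@x_x R) (x0_x1 R) Cq_int_neq0 closed_Ures closed_goodU goodU_div (@Ures_X R) GT GT' Ga
    Gx0 Gx1 Gd0 s k r).
have Gb n r : goodU (Utbin R n r).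
  exact: (Gabin (q_neq0 R) (@qn_neq1 R) (@specializesD R) (@specializesM R)
    (@specializes_nat R) specializesN1 specializes_half (specializes_q R) (specializes_qV R)
    (@scalerA _ (Uq R)) (@scale1r _ (Uq R)) (fun c d u => scalerDl u c d)
    (fun c u v => scalerDr c u v)
    (@algquot_scalerAl _ _ _) (@algquot_scalerAr _ _ _) (UtK R) (Ut'K R) (@Ut_x R) (@Ua_x R)
    (@x_x R) (x0_x0 R) (x0_x1 R) Cq_int_neq0 closed_Ures closed_goodU goodU_div (@Ures_X R)
    (@Ures_Tbin R) GT GT' Ga Gx0 Gx1 Gd0 n r).
have GU x : in_Ures x -> goodU x.
  case: closed_goodU => D M G1 Z.
  elim=> //; do ?[by move=> *; auto].
  by move=> p k u _ Gu; apply: (Z _ (p.['i] / 'i ^+ k)) Gu; exists p, k.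
elim/algpi_ind => a; elim/falg_ind: a => [x y Gx Gy|c x Gx|x y Gx Gy||i].
- by rewrite algpiD; apply: goodD.
- by rewrite algpiZ; apply: goodZ.
- by rewrite algpiM; apply: goodM.
- by rewrite algpi1.
by have [_] := GU _ (UresP i); apply.
Qed.

End Generation.

Lemma half_scale (F : fieldType) (V : lmodType F) (c d : F) (w : V) :
  (2 : F) != 0 -> (2^-1 * c) *: (d *: (w + w)) = d *: (c *: w).
Proof.
by move=> two; rewrite -mulr2n -scaler_nat !scalerA; congr (_ *: _); field.
Qed.

(** Only anticommutators are known to be divisible by [2] in U^res, so the coefficients of the
    square of a series are written as half a sum of them. *)
Lemma sum_anticomm (V : pzRingType) (x : nat -> V) k :
  \sum_(j < k.+1) (x j * x (k - j)%N + x (k - j)%N * x j)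
  = \sum_(j < k.+1) x j * x (k - j)%N + \sum_(j < k.+1) x j * x (k - j)%N.
Proof.
rewrite big_split; congr (_ + _); rewrite (reindex_inj rev_ord_inj) /=.
by apply: eq_bigr => j _; rewrite !subSS subKn // -ltnS.
Qed.

Section DividedSquares.
Variable R : realType.
Local Notation C := R[i].
Local Notation Cq := (Cq R).
Local Notation q := (q_ R).

Lemma qint1 : qint R 1 = 1.
Proof. exact: (aqint1 (q_neq0 R) (@qn_neq1 R)). Qed.

Lemma qfact2 : qfact R 2 = qint R 2.
Proof. by rewrite /qfact big_nat_recr //= big_nat1 qint1 mul1r. Qed.

Lemma Ures_x s k : in_Ures (Ux R s k).
Proof.
have := Ures_X R s k 1; rewrite /Udiv /qfact big_nat1 expr1.
by rewrite qint1 invr1 scale1r.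
Qed.

Lemma anticomm_Ures s j l :
  in_Ures ((qint R 2)^-1 *: (Ux R s j * Ux R s l + Ux R s l * Ux R s j)).
Proof.
exact: (closedE (q_neq0 R) (@qn_neq1 R) (@specializesM R)
  (@specializes_nat R) (specializesN1 R) (specializes_half R) (specializes_q R) (specializes_qV R)
  (@scalerA _ (Uq R)) (@scale1r _ (Uq R)) (fun c d u => scalerDl u c d)
  (fun c u v => scalerDr c u v) (@x_x R) (@Cq_int_neq0 R) (closed_Ures R) Ures_x
  (fun s k => @Ures_X R s k 2) s j l).
Qed.

(** The formulas of the action concern families that lift all coefficients of a series at once. The
    whole divided square has to be placed in U^res, even where only its coefficient 0 is used. [sg]
    selects the sign of the indices, and [c] is q or its inverse in the applications. *)
Lemma div_sq_Ures (s : bool) (sg : bool) (c : Cq) v (y : nat -> Uq R) k :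
  specializes c v ->
  (forall j : nat, y j = c ^+ j *: Ux R s (if sg then j%:Z else - j%:Z)) ->
  in_Ures (div_sq y k).
Proof.
move=> cv yE; pose x (j : nat) := Ux R s (if sg then j%:Z else - j%:Z).
pose w := \sum_(j < k.+1) x j * x (k - j)%N.
have -> : div_sq y k = (qint R 2)^-1 *: (c ^+ k *: w).
  rewrite /div_sq qfact2.
  congr (_ *: _); rewrite scaler_sumr; apply: eq_bigr => j _.
  rewrite !yE -algquot_scalerAl -algquot_scalerAr scalerA -exprD subnKC //.
  by rewrite -ltnS.
rewrite -half_scale ?(@Cq_int_neq0 _ 2) // -sum_anticomm scaler_sumr.
case: (closed_Ures R) => D M G1 Z.
have cX n : exists b, specializes (c ^+ n) b.
  elim: n => [|n [b hb]]; first by exists 1; apply: (@specializes_nat _ 1).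
  by exists (v * b); rewrite exprS; apply: specializesM.
have [b cb] := cX k.
apply: (Z _ _ _ (specializesM (specializes_half R) cb)).
elim/big_ind: _ => [|u u' Iu Iu'|j _]; last exact: anticomm_Ures.
  by have := Z _ _ 1 (specializes_nat _ 0) (@Ures_1 R); rewrite scale0r.
exact: D.
Qed.

Lemma Xp_ge0_sq_Ures k : in_Ures (div_sq (@Xp_ge0 R) k).
Proof.
apply: (@div_sq_Ures true true _ _ _ k (specializes_qV R)) => j.
by rewrite /Xp_ge0 exprVn -exprnN.
Qed.

Lemma Xm_le0_sq_Ures k : in_Ures (div_sq (@Xm_le0 R) k).
Proof. exact: (@div_sq_Ures false false _ _ _ k (specializes_q R)). Qed.

End DividedSquares.

(** * Values of rational functions *)

Lemma rmorph_mmap (S A B : comNzRingType) l (h : {rmorphism A -> B}) (f : {rmorphism S -> A})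
  (x : 'I_l -> A) (P : {mpoly S[l]}) :
  h (mmap f x P) = mmap (h \o f) (h \o x) P.
Proof.
rewrite /mmap rmorph_sum; apply: eq_bigr => m _; rewrite rmorphM /=; congr (_ * _).
by rewrite /mmap1 rmorph_prod; apply: eq_bigr => i _; rewrite rmorphXn.
Qed.

Lemma eq_mmap (S A : comNzRingType) l (f g : S -> A) (x y : 'I_l -> A) (P : {mpoly S[l]}) :
  f =1 g -> x =1 y -> mmap f x P = mmap g y P.
Proof.
move=> fg xy; rewrite /mmap; apply: eq_bigr => m _; rewrite fg; congr (_ * _).
by apply: eq_bigr => i _; rewrite xy.
Qed.

Lemma mmap_mmap (S A B : comNzRingType) l k (g : {rmorphism A -> B}) (f : {rmorphism S -> A})
  (x : 'I_l -> B) (h : 'I_k -> {mpoly A[l]}) (P : {mpoly S[k]}) :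
  mmap g x (mmap (@mpolyC l A \o f) h P) = mmap (g \o f) (fun i => mmap g x (h i)) P.
Proof. by rewrite rmorph_mmap; apply: eq_mmap => // c /=; rewrite mmapC. Qed.

Lemma mmap_map_mpoly (S A B : comNzRingType) l (g : {rmorphism A -> B}) (f : {rmorphism S -> A})
  (x : 'I_l -> B) (P : {mpoly S[l]}) :
  mmap g x (map_mpoly f P) = mmap (g \o f) x P.
Proof. by rewrite /map_mpoly mmap_mmap; apply: eq_mmap => // i; rewrite mmapX mmap1U. Qed.

Lemma fraction_exists (A : idomainType) (c : {fraction A}) :
  exists N D, D != 0 /\ c = tofrac N / tofrac D.
Proof.
elim/quotW: c => x; have x0 : \d_x != 0 by case: x.
exists \n_x, \d_x; split=> //; apply: (canRL (mulfK _)); first by rewrite tofrac_eq0.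
unlock tofrac; rewrite -[LHS]FracField.pi_mul.
apply/eqmodP; rewrite /= FracField.equivfE /FracField.mulf !numden_Ratio ?mulr1 ?oner_eq0 //.
by rewrite mulrC.
Qed.

Lemma mmap_id (S : comNzRingType) l (P : {mpoly S[l]}) :
  mmap (@mpolyC l S) (fun i => 'X_i) P = P.
Proof.
rewrite [RHS]mpolyE /mmap; apply: eq_bigr => m _.
by rewrite mmap1_id mul_mpolyC.
Qed.

(* The local ring of A at the kernel of ev, with its residue morphism. *)
Section Values.
Variables (A : idomainType) (K F : fieldType) (t : {rmorphism A -> K}) (ev : {rmorphism A -> F}).
Hypothesis t_eq0 : forall p, (t p == 0) = (p == 0).

Definition hv (c : K) (d : F) : Prop :=
  exists N D, [/\ ev D != 0, c = t N / t D & d = ev N / ev D].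

Lemma ev_neq0 D : ev D != 0 -> t D != 0.
Proof. by rewrite t_eq0; apply: contraNneq => ->; rewrite rmorph0. Qed.

Lemma hv_unique c d d' : hv c d -> hv c d' -> d = d'.
Proof.
move=> [N [D [D0 -> ->]]] [N' [D' [D'0 /eqP + ->]]].
rewrite eqr_div ?ev_neq0 // -!rmorphM -subr_eq0 -rmorphB t_eq0 subr_eq0 => /eqP e.
by apply/eqP; rewrite eqr_div // -!rmorphM e.
Qed.

Lemma hv_embed p : hv (t p) (ev p).
Proof. by exists p, 1; rewrite !rmorph1 oner_neq0 !divr1. Qed.

Lemma hv0 : hv 0 0.
Proof. by have := hv_embed 0; rewrite !rmorph0. Qed.

Lemma hv1 : hv 1 1.
Proof. by have := hv_embed 1; rewrite !rmorph1. Qed.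

Lemma hvD c d c' d' : hv c d -> hv c' d' -> hv (c + c') (d + d').
Proof.
move=> [N [D [D0 -> ->]]] [N' [D' [D'0 -> ->]]].
exists (N * D' + N' * D), (D * D'); split; first by rewrite rmorphM mulf_neq0.
  by rewrite addf_div ?ev_neq0 // rmorphD !rmorphM.
by rewrite addf_div // rmorphD !rmorphM.
Qed.

Lemma hvM c d c' d' : hv c d -> hv c' d' -> hv (c * c') (d * d').
Proof.
move=> [N [D [D0 -> ->]]] [N' [D' [D'0 -> ->]]].
exists (N * N'), (D * D'); split; first by rewrite rmorphM mulf_neq0.
  by rewrite mulf_div !rmorphM.
by rewrite mulf_div !rmorphM.
Qed.

Lemma hvN c d : hv c d -> hv (- c) (- d).
Proof.
move=> h; rewrite -mulN1r -[- d]mulN1r; apply: hvM => //.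
by have := hv_embed (-1); rewrite !rmorphN1.
Qed.

Lemma hvB c d c' d' : hv c d -> hv c' d' -> hv (c - c') (d - d').
Proof. by move=> h h'; apply: hvD => //; apply: hvN. Qed.

Lemma hvV c d : d != 0 -> hv c d -> hv c^-1 d^-1.
Proof.
move=> d0 [N [D [D0 -> e]]]; have N0 : ev N != 0.
  by apply: contraNneq d0 => N0; rewrite e N0 mul0r.
by exists D, N; split=> //; rewrite ?e invf_div.
Qed.

Lemma hvX c d k : hv c d -> hv (c ^+ k) (d ^+ k).
Proof.
by move=> h; elim: k => [|k IH]; [exact: hv1 | rewrite !exprS; apply: hvM].
Qed.

Lemma hv_sum (I : Type) (r : seq I) (Pr : pred I) (c : I -> K) d :
  (forall i, Pr i -> hv (c i) (d i)) ->
  hv (\sum_(i <- r | Pr i) c i) (\sum_(i <- r | Pr i) d i).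
Proof.
move=> h; elim/big_rec2: _ => [|i x y Pi hxy]; first exact: hv0.
exact: hvD (h _ Pi) hxy.
Qed.

Lemma hv_prod (I : Type) (r : seq I) (Pr : pred I) (c : I -> K) d :
  (forall i, Pr i -> hv (c i) (d i)) ->
  hv (\prod_(i <- r | Pr i) c i) (\prod_(i <- r | Pr i) d i).
Proof.
move=> h; elim/big_rec2: _ => [|i x y Pi hxy]; first exact: hv1.
exact: hvM (h _ Pi) hxy.
Qed.

Lemma hv_total c : (forall c, exists N D, D != 0 /\ c = t N / t D) ->
  (forall p, (ev p == 0) = (p == 0)) -> exists d, hv c d.
Proof.
move=> frac inj; have [N [D [D0 ->]]] := frac c.
by exists (ev N / ev D), N, D; rewrite inj.
Qed.

End Values.

Section KzValues.
Variable R : realType.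
Local Notation C := R[i].

HB.instance Definition _ n := GRing.RMorphism.copy (@zC R n) (@tofrac _ \o @mpolyC n C).

Definition tz n : {rmorphism {mpoly C[n]} -> Kz R n} := @tofrac {mpoly C[n]}.

Lemma tz_eq0 n p : (tz n p == 0) = (p == 0).
Proof. exact: tofrac_eq0. Qed.

Definition evz n m (v : 'I_n -> Kz R m) : {rmorphism {mpoly C[n]} -> Kz R m} :=
  mmap (@zC R m) v.

Lemma valueE n m (v : 'I_n -> Kz R m) c d : hv (tz n) (evz v) c d -> value v c = d.
Proof.
move=> h; rewrite /value; case: pselect => [e|[]]; last by exists d.
by apply: (hv_unique (@tz_eq0 n)) h; case: (cid e).
Qed.

Lemma value_exists n m (v : 'I_n -> Kz R m) c :
  (exists d, hv (tz n) (evz v) c d) -> hv (tz n) (evz v) c (value v c).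
Proof. by move=> [d h]; rewrite (valueE h). Qed.

Lemma hv_zC n m (v : 'I_n -> Kz R m) c : hv (tz n) (evz v) (zC n c) (zC m c).
Proof. by have := hv_embed (tz n) (evz v) c%:MP; rewrite /evz /= mmapC. Qed.

Lemma hv_zvar n m (v : 'I_n -> Kz R m) j : hv (tz n) (evz v) (zvar R j) (v j).
Proof. by have := hv_embed (tz n) (evz v) 'X_j; rewrite /evz /= mmapX mmap1U. Qed.

(* A coordinate change with a polynomial retraction gives an everywhere defined value. *)
Lemma hv_retract n m (w : 'I_n -> {mpoly C[m]}) (h : {rmorphism {mpoly C[m]} -> {mpoly C[n]}}) :
  (forall c, h c%:MP = c%:MP) -> (forall j, h (w j) = 'X_j) ->
  forall c, hv (tz n) (evz (fun j => tz m (w j))) c (value (fun j => tz m (w j)) c).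
Proof.
move=> hC hw c; apply: value_exists; apply: hv_total => [|p].
  exact: fraction_exists.
have -> : evz (fun j => tz m (w j)) p = tz m (mmap (@mpolyC m C) w p).
  by rewrite [RHS]rmorph_mmap.
rewrite tz_eq0; apply/eqP/eqP => [/(congr1 h)|->]; last by rewrite rmorph0.
rewrite rmorph0 rmorph_mmap => <-; rewrite -[LHS]mmap_id.
by apply: eq_mmap => [c'|i] /=; rewrite ?hC ?hw.
Qed.

End KzValues.

(** * Symmetric Laurent polynomials *)

Section SymmetricLaurent.
Variable R : realType.
Local Notation C := R[i].
Variable n : nat.
Local Notation K := (Kz R n).

Definition laurent (c : K) : Prop :=
  exists (p : {mpoly C[n]}) (k : nat), c = tz R n p / (tz R n (\prod_j 'X_j)) ^+ k.

(** The automorphism permuting the parameters, encoded as a [value] so that the rules for [hv] make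
    it a ring morphism on all of K_n. *)
Definition Kperm (s : {perm 'I_n}) (c : K) : K := value (fun j => tz R n 'X_(s j)) c.

Lemma hv_Kperm (s : {perm 'I_n}) c : hv (tz R n) (evz (fun j => tz R n 'X_(s j))) c (Kperm s c).
Proof.
apply: (@hv_retract _ _ _ _ (mmap (@mpolyC n C) (fun i => 'X_((s^-1)%g i)))) => [d|j].
  by rewrite /= mmapC.
by rewrite /= mmapX mmap1U perm.permK.
Qed.

Lemma KpermE (s : {perm 'I_n}) c d : hv (tz R n) (evz (fun j => tz R n 'X_(s j))) c d -> Kperm s c = d.
Proof. exact: valueE. Qed.

Lemma Kperm_is_zmod s : zmod_morphism (Kperm s).
Proof. by move=> c d; apply: KpermE; apply: hvB; try exact: tz_eq0; apply: hv_Kperm. Qed.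

Lemma Kperm_is_monoid s : monoid_morphism (Kperm s).
Proof.
split=> [|c d]; first exact: KpermE (hv1 _ _).
by apply: KpermE; apply: hvM; try exact: tz_eq0; apply: hv_Kperm.
Qed.

HB.instance Definition _ s := GRing.isZmodMorphism.Build K K (Kperm s) (Kperm_is_zmod s).
HB.instance Definition _ s := GRing.isMonoidMorphism.Build K K (Kperm s) (Kperm_is_monoid s).

Lemma Kperm_tz s p : Kperm s (tz R n p) = tz R n (msym s p).
Proof.
rewrite (KpermE (hv_embed _ _ p)) /evz /= /msym [RHS](rmorph_mmap (tz R n)).
exact: eq_mmap.
Qed.

Lemma Kperm_zvar s j : Kperm s (zvar R j) = zvar R (s j).
Proof. exact: KpermE (hv_zvar _ _). Qed.

Lemma Kperm_zC s c : Kperm s (zC n c) = zC n c.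
Proof. exact: KpermE (hv_zC _ _). Qed.

Definition zprod : K := \prod_j zvar R j.

Lemma zprodE : zprod = tz R n (\prod_j 'X_j).
Proof. by rewrite rmorph_prod. Qed.

Lemma zvar_neq0 (j : 'I_n) : zvar R j != 0.
Proof.
rewrite tz_eq0; apply/eqP => /(congr1 (mcoeff U_(j))).
by rewrite mcoeffX eqxx mcoeff0 => /eqP; rewrite oner_eq0.
Qed.

Lemma zprod_neq0 : zprod != 0.
Proof. by apply/prodf_neq0 => j _; apply: zvar_neq0. Qed.

Lemma Kperm_zprod s : Kperm s zprod = zprod.
Proof.
rewrite rmorph_prod [RHS](reindex_inj (@perm_inj _ s)).
by apply: eq_bigr => j _; apply: Kperm_zvar.
Qed.

Lemma laurent_hv m (v : 'I_n -> Kz R m) c : (forall j, v j != 0) -> laurent c ->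
  exists d, hv (tz R n) (evz v) c d.
Proof.
move=> v0 [p [k ->]]; exists (evz v p / evz v (\prod_j 'X_j) ^+ k).
apply: hvM (hv_embed _ _ _) (hvV _ (hvX _ (hv_embed _ _ _))); try exact: tz_eq0.
rewrite expf_neq0 // rmorph_prod; apply/prodf_neq0 => j _.
by rewrite /evz /= mmapX mmap1U.
Qed.

Lemma laurent_poly p : laurent (tz R n p).
Proof. by exists p, 0%N; rewrite expr0 divr1. Qed.

Lemma laurentM c d : laurent c -> laurent d -> laurent (c * d).
Proof.
move=> [p [k ->]] [r [m ->]]; exists (p * r), (k + m)%N.
by rewrite rmorphM exprD invfM mulrACA.
Qed.

Lemma laurentD c d : laurent c -> laurent d -> laurent (c + d).
Proof.
move=> [p [k ->]] [r [m ->]].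
exists (p * (\prod_j 'X_j) ^+ m + r * (\prod_j 'X_j) ^+ k), (k + m)%N.
have e0 i : tz R n (\prod_j 'X_j) ^+ i != 0 by rewrite expf_neq0 // -zprodE zprod_neq0.
by rewrite rmorphD !rmorphM !rmorphXn /= addf_div // -exprD.
Qed.

Lemma laurent_zC c : laurent (zC n c).
Proof. exact: laurent_poly. Qed.

Lemma laurentB c d : laurent c -> laurent d -> laurent (c - d).
Proof.
move=> hc hd; apply: laurentD => //; rewrite -mulN1r; apply: laurentM => //.
by rewrite -(rmorphN1 (@zC R n)); apply: laurent_zC.
Qed.

Lemma laurent_sum (I : Type) (r : seq I) (Pr : pred I) (F : I -> K) :
  (forall i, Pr i -> laurent (F i)) -> laurent (\sum_(i <- r | Pr i) F i).
Proof.
move=> h; elim/big_ind: _ => //; last exact: laurentD.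
by rewrite -(rmorph0 (@zC R n)); apply: laurent_zC.
Qed.

Lemma laurent_prod (I : Type) (r : seq I) (Pr : pred I) (F : I -> K) :
  (forall i, Pr i -> laurent (F i)) -> laurent (\prod_(i <- r | Pr i) F i).
Proof.
move=> h; elim/big_ind: _ => //; last exact: laurentM.
by rewrite -(rmorph1 (@zC R n)); apply: laurent_zC.
Qed.

Lemma laurentX c k : laurent c -> laurent (c ^+ k).
Proof.
move=> h; elim: k => [|k IH]; last by rewrite exprS; apply: laurentM.
by rewrite expr0 -(rmorph1 (@zC R n)); apply: laurent_zC.
Qed.

Lemma laurent_zvarV j : laurent (zvar R j)^-1.
Proof.
exists (\prod_(i | i != j) 'X_i), 1%N; rewrite expr1 [X in _ / tz R n X](bigD1 j) //= rmorphM.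
rewrite invfM mulrC -mulrA mulVf ?mulr1 //; rewrite rmorph_prod.
by apply/prodf_neq0 => i _; apply: zvar_neq0.
Qed.

(** The denominator, a power of the product of the z_j, is itself symmetric. This separates two
    requirements that are proved by different means: the absence of other poles and the
    invariance. *)
Lemma sym_laurentP c : sym_laurent c <-> laurent c /\ forall s, Kperm s c = c.
Proof.
split=> [[p [k [/issymP ps ->]]]|[[p [k cE]] cs]].
  split; first by exists p, k; rewrite -zprodE.
  by move=> s; rewrite fmorph_div rmorphXn /= Kperm_zprod (Kperm_tz s p) ps.
exists p, k; rewrite cE -zprodE; split=> //; apply/issymP => s.
have := cs s; rewrite cE fmorph_div rmorphXn /= -zprodE Kperm_zprod Kperm_tz.
have e0 : zprod ^+ k != 0 by rewrite expf_neq0 // zprod_neq0.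
by move/(divIf e0)/eqP; rewrite -subr_eq0 -rmorphB tz_eq0 subr_eq0 => /eqP.
Qed.

Definition SLpred : {pred K} := fun c => `[< sym_laurent c >].

Lemma SLpredP c : reflect (sym_laurent c) (c \in SLpred).
Proof. exact: asboolP. Qed.

Lemma SLpred_subring : subring_closed SLpred.
Proof.
split.
- apply/SLpredP/sym_laurentP; rewrite -(rmorph1 (@zC R n)); split; first exact: laurent_zC.
  by move=> s; rewrite Kperm_zC.
- move=> c d /SLpredP/sym_laurentP[cl cs] /SLpredP/sym_laurentP[dl ds].
  apply/SLpredP/sym_laurentP; split; first exact: laurentB.
  by move=> s; rewrite (rmorphB (Kperm s)) /= cs ds.
move=> c d /SLpredP/sym_laurentP[cl cs] /SLpredP/sym_laurentP[dl ds].
apply/SLpredP/sym_laurentP; split; first exact: laurentM.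
by move=> s; rewrite (rmorphM (Kperm s)) /= cs ds.
Qed.

HB.instance Definition _ := GRing.isSubringClosed.Build K SLpred SLpred_subring.

(** [value] respects sums and products only for arguments having a value at the point. A Laurent
    polynomial has one wherever the coordinates are nonzero, so on this ring the substitutions of a
    link become ring morphisms. *)
Record SL : Type := MkSL { SLval : K; SLvalP : SLval \in SLpred }.

HB.instance Definition _ := [isSub for SLval].
HB.instance Definition _ := [Choice of SL by <:].
HB.instance Definition _ := [SubChoice_isSubComNzRing of SL by <:].

Lemma SLval_zmod : zmod_morphism SLval.
Proof. exact: (rmorphB (\val : SL -> K)). Qed.

Lemma SLval_monoid : monoid_morphism SLval.
Proof. by split; [exact: (rmorph1 (\val : SL -> K)) | exact: (rmorphM (\val : SL -> K))]. Qed.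

HB.instance Definition _ := GRing.isZmodMorphism.Build SL K SLval SLval_zmod.
HB.instance Definition _ := GRing.isMonoidMorphism.Build SL K SLval SLval_monoid.

End SymmetricLaurent.

Section Theta.
Variable R : realType.
Local Notation C := R[i].

Definition liftSL n (c : Kz R n) : SL R n := insubd 0 c.

Lemma liftSLK n (c : Kz R n) : sym_laurent c -> SLval (liftSL c) = c.
Proof. by move=> h; rewrite /liftSL [LHS]insubdK //; apply/SLpredP. Qed.

Lemma liftSL0 n : liftSL 0 = 0 :> SL R n.
Proof. by apply: val_inj; rewrite /= liftSLK ?rmorph0 //; apply/SLpredP; rewrite rpred0. Qed.

Lemma SLval_inj n : injective (@SLval R n).
Proof. exact: val_inj. Qed.

Lemma SLvalP' n (c : SL R n) : sym_laurent (SLval c).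
Proof. by apply/SLpredP; case: c. Qed.

Definition liftP n l (P : {mpoly (Kz R n)[l]}) : {mpoly (SL R n)[l]} :=
  \sum_(m <- mpoly.msupp P) liftSL P@_m *: 'X_[m].

Lemma liftPK n l (P : {mpoly (Kz R n)[l]}) :
  (forall m, sym_laurent P@_m) -> map_mpoly (@SLval R n) (liftP P) = P.
Proof.
move=> h; rewrite [RHS]mpolyE /liftP rmorph_sum; apply: eq_bigr => m _ /=.
by rewrite map_mpolyZ map_mpolyX /= liftSLK.
Qed.

Lemma map_mpolyP n l (P : {mpoly (SL R n)[l]}) m : sym_laurent (map_mpoly (@SLval R n) P)@_m.
Proof. by rewrite mcoeff_map_mpoly; apply: SLvalP'. Qed.

Definition thetaK n : {poly Kz R n} := \prod_(j < n) (1 - zvar R j *: 'X).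
Definition theta n : {poly SL R n} := map_poly (@liftSL n) (thetaK n).

Lemma thetaK_sym n k : sym_laurent (thetaK n)`_k.
Proof.
apply/sym_laurentP; split.
  have -> : thetaK n = map_poly (tz R n) (\prod_(j < n) (1 - 'X_j *: 'X)).
    rewrite rmorph_prod; apply: eq_bigr => j _ /=.
    by rewrite rmorphB rmorph1 /= map_polyZ map_polyX.
  by rewrite coef_map; apply: laurent_poly.
move=> s; rewrite -coef_map.
suff -> : map_poly (Kperm s) (thetaK n) = thetaK n by [].
rewrite rmorph_prod /thetaK [RHS](reindex_inj (@perm_inj _ s)); apply: eq_bigr => j _ /=.
by rewrite rmorphB rmorph1 /= map_polyZ map_polyX /= Kperm_zvar.
Qed.

Lemma map_theta n : map_poly (@SLval R n) (theta n) = thetaK n.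
Proof.
apply/polyP => k; rewrite coef_map /= /theta coef_map_id0 ?liftSL0 //.
exact/liftSLK/thetaK_sym.
Qed.

End Theta.

Section ValueSL.
Variables (R : realType) (n m : nat) (v : 'I_n -> Kz R m).
Hypothesis v0 : forall j, v j != 0.

Definition valueSL (c : SL R n) : Kz R m := value v (SLval c).

Lemma hv_SL (c : SL R n) : hv (tz R n) (evz v) (SLval c) (valueSL c).
Proof.
apply: value_exists; apply: laurent_hv v0 _.
by case: (sym_laurentP (SLval c)) => /(_ (SLvalP' c)) [].
Qed.

Lemma valueSL_zmod : zmod_morphism valueSL.
Proof.
by move=> c d; apply: valueE; rewrite rmorphB; apply: hvB; try exact: tz_eq0; apply: hv_SL.
Qed.

Lemma valueSL_monoid : monoid_morphism valueSL.
Proof.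
split=> [|c d]; apply: valueE; first by rewrite rmorph1; apply: hv1.
by rewrite rmorphM; apply: hvM; try exact: tz_eq0; apply: hv_SL.
Qed.

End ValueSL.

Section Specialization.
Variables (R : realType) (n : nat).
Local Notation K' := (Kz R n.+1).
Local Notation z := (zvar R (@ord_max n)).

Definition vspec (j : 'I_n.+2) : K' :=
  if unlift ord_max j is Some k then zvar R k else - z.

Definition vwid (j : 'I_n) : K' := zvar R (lift ord_max j).

Lemma vspec_neq0 j : vspec j != 0.
Proof. by rewrite /vspec; case: unliftP => [k|] _; rewrite ?oppr_eq0 zvar_neq0. Qed.

Lemma vwid_neq0 j : vwid j != 0.
Proof. exact: zvar_neq0. Qed.

Definition spec : SL R n.+2 -> K' := valueSL vspec.
Definition wid : SL R n -> K' := valueSL vwid.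

HB.instance Definition _ := GRing.isZmodMorphism.Build _ _ spec (valueSL_zmod vspec_neq0).
HB.instance Definition _ := GRing.isMonoidMorphism.Build _ _ spec (valueSL_monoid vspec_neq0).
HB.instance Definition _ := GRing.isZmodMorphism.Build _ _ wid (valueSL_zmod vwid_neq0).
HB.instance Definition _ := GRing.isMonoidMorphism.Build _ _ wid (valueSL_monoid vwid_neq0).

Lemma hv_spec c : hv (tz R n.+2) (evz vspec) (SLval c) (spec c).
Proof. exact: hv_SL vspec_neq0 c. Qed.

End Specialization.

Lemma map_theta_value (R : realType) n m (v : 'I_n -> Kz R m) :
  (forall j, v j != 0) ->
  map_poly (valueSL v) (theta R n) = \prod_(j < n) (1 - v j *: 'X).
Proof.
move=> v0; apply/polyP => k; rewrite coef_map_id0; last first.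
  by apply: valueE; rewrite rmorph0; apply: hv0.
have -> : \prod_(j < n) (1 - v j *: 'X) = map_poly (evz v) (\prod_(j < n) (1 - 'X_j *: 'X)).
  rewrite rmorph_prod; apply: eq_bigr => j _ /=.
  by rewrite rmorphB rmorph1 /= map_polyZ map_polyX /evz /= mmapX mmap1U.
rewrite coef_map; apply: valueE.
have -> : SLval (theta R n)`_k = (map_poly (@SLval R n) (theta R n))`_k by rewrite coef_map.
rewrite map_theta.
have -> : thetaK R n = map_poly (tz R n) (\prod_(j < n) (1 - 'X_j *: 'X)).
  rewrite rmorph_prod; apply: eq_bigr => j _ /=.
  by rewrite rmorphB rmorph1 /= map_polyZ map_polyX.
by rewrite coef_map; apply: hv_embed.
Qed.

(** The two new factors are 1 - zX and 1 + zX. This is the source of the factor that the kernels of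
    all wedge operators acquire. *)
Lemma spec_theta (R : realType) n :
  map_poly (@spec R n) (theta R n.+2) = (1 - (zvar R (@ord_max n)) ^+ 2 *: 'X^2)
    * map_poly (@wid R n) (theta R n).
Proof.
rewrite [LHS](map_theta_value (@vspec_neq0 R n)) [X in _ * X](map_theta_value (@vwid_neq0 R n)).
rewrite big_ord_recr big_ord_recr /= -mulrA mulrC.
have e1 : vspec R (@ord_max n.+1) = - zvar R (@ord_max n) by rewrite /vspec unlift_none.
have e2 (j : 'I_n.+1) : vspec R (widen_ord (leqnSn _) j) = zvar R j.
  have -> : widen_ord (leqnSn _) j = lift ord_max j by apply: ord_inj; rewrite lift_max.
  by rewrite /vspec liftK.
rewrite e1 e2; congr (_ * _).
  by rewrite scaleNr opprK -subr_sqr expr1n exprZn.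
apply: eq_bigr => j _; rewrite e2 /vwid; congr (1 - zvar R _ *: _).
by apply: ord_inj; rewrite lift_max.
Qed.

(** * Expansions at a place *)

(** A valuation ring [preg] with uniformizer [pu] and constants [pc], reduced to the properties on
    which limits and expansions rest. The instances are the points t = 0 and t = oo and the poles u
    = 1/z_a of the integrand. *)
Record place (F E : fieldType) := Place {
  pc : {rmorphism F -> E};
  pu : E;
  preg : E -> Prop;
  preg_c : forall a, preg (pc a);
  preg_u : preg pu;
  pregD : forall f g, preg f -> preg g -> preg (f + g);
  pregM : forall f g, preg f -> preg g -> preg (f * g);
  preg_nonunit : forall a, a != 0 -> ~ preg (pc a / pu);
  pregV : forall a g, a != 0 -> preg g -> preg (pc a + pu * g)^-1;
  pu_neq0 : pu != 0 }.

Section Place.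
Variables (F E : fieldType) (p : place F E).
Local Notation c := (pc p).
Local Notation u := (pu p).
Local Notation reg := (preg p).

Lemma preg0 : reg 0.
Proof. by rewrite -(rmorph0 c); apply: preg_c. Qed.

Lemma preg1 : reg 1.
Proof. by rewrite -(rmorph1 c); apply: preg_c. Qed.

Lemma pregN f : reg f -> reg (- f).
Proof. by move=> h; rewrite -mulN1r -(rmorphN1 c); apply: pregM => //; apply: preg_c. Qed.

Lemma pregB f g : reg f -> reg g -> reg (f - g).
Proof. by move=> hf hg; apply: pregD => //; apply: pregN. Qed.

Lemma pregX f k : reg f -> reg (f ^+ k).
Proof. by move=> h; elim: k => [|k IH]; [apply: preg1 | rewrite exprS; apply: pregM]. Qed.

Lemma preg_sum (I : Type) (r : seq I) (P : pred I) (G : I -> E) :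
  (forall i, P i -> reg (G i)) -> reg (\sum_(i <- r | P i) G i).
Proof. by move=> h; elim/big_ind: _ => //; [apply: preg0 | apply: pregD]. Qed.

Definition lim (f : E) (a : F) : Prop := exists2 g, reg g & f = c a + u * g.

Definition expands (f : E) (s : nat -> F) : Prop := forall m : nat,
  exists2 g, reg g & f = \sum_(k < m) c (s k) * u ^+ k + u ^+ m * g.

Lemma lim_reg f a : lim f a -> reg f.
Proof.
move=> [g rg ->]; apply: pregD; first exact: preg_c.
by apply: pregM => //; apply: preg_u.
Qed.

Lemma lim_c a : lim (c a) a.
Proof. by exists 0; [exact: preg0 | rewrite mulr0 addr0]. Qed.

Lemma lim1 : lim 1 1.
Proof. by have := lim_c 1; rewrite rmorph1. Qed.

Lemma lim0 : lim 0 0.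
Proof. by have := lim_c 0; rewrite rmorph0. Qed.

Lemma lim_u : lim u 0.
Proof. by exists 1; [exact: preg1 | rewrite rmorph0 add0r mulr1]. Qed.

Lemma limD f a g b : lim f a -> lim g b -> lim (f + g) (a + b).
Proof.
move=> [f' rf ->] [g' rg ->]; exists (f' + g'); first exact: pregD.
by rewrite rmorphD mulrDr addrACA.
Qed.

Lemma limM f a g b : lim f a -> lim g b -> lim (f * g) (a * b).
Proof.
move=> [f' rf ->] [g' rg ->]; exists (c a * g' + f' * c b + u * f' * g').
  by repeat (apply: pregD || apply: pregM || apply: preg_c || apply: preg_u || assumption).
by rewrite rmorphM; ring.
Qed.

Lemma limN f a : lim f a -> lim (- f) (- a).
Proof.
by move=> h; rewrite -mulN1r -[- a]mulN1r; apply: limM => //; have := lim_c (-1); rewrite rmorphN1.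
Qed.

Lemma limB f a g b : lim f a -> lim g b -> lim (f - g) (a - b).
Proof. by move=> hf hg; apply: limD => //; apply: limN. Qed.

Lemma limV f a : a != 0 -> lim f a -> lim f^-1 a^-1.
Proof.
(* From 1/f - 1/a = - u g / (a f), where f = a + u g. *)
move=> a0 [g rg fE]; exists (- g * c a^-1 * f^-1).
  apply: pregM; last by rewrite fE; apply: pregV.
  by apply: pregM; [apply: pregN | apply: preg_c].
have ca0 : c a != 0 by rewrite fmorph_eq0.
have f0 : f != 0.
  apply/eqP => f0; move: fE; rewrite f0 => /eqP; rewrite eq_sym addr_eq0 => /eqP cE.
  apply: (preg_nonunit (p := p) a0); rewrite cE mulNr mulrAC mulfV ?pu_neq0 // mul1r.
  exact: pregN.
apply: (mulIf f0); rewrite mulVf // mulrDl fmorphV -!mulrA mulVf // mulr1.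
by rewrite fE; field.
Qed.

Lemma lim_sum (I : Type) (r : seq I) (P : pred I) (G : I -> E) a :
  (forall i, P i -> lim (G i) (a i)) -> lim (\sum_(i <- r | P i) G i) (\sum_(i <- r | P i) a i).
Proof.
by move=> h; elim/big_rec2: _ => [|i x y Pi]; [exact: lim0 | apply: limD; apply: h].
Qed.

Lemma lim_prod (I : Type) (r : seq I) (P : pred I) (G : I -> E) a :
  (forall i, P i -> lim (G i) (a i)) -> lim (\prod_(i <- r | P i) G i) (\prod_(i <- r | P i) a i).
Proof.
by move=> h; elim/big_rec2: _ => [|i x y Pi]; [exact: lim1 | apply: limM; apply: h].
Qed.

Lemma lim_unique f a b : lim f a -> lim f b -> a = b.
Proof.
move=> [g rg fE] [g' rg' fE']; apply/eqP; rewrite -subr_eq0; apply/negP => /negP ab.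
apply: (preg_nonunit (p := p) ab).
have -> : c (a - b) = u * (g' - g).
  apply/eqP; rewrite -subr_eq0 rmorphB.
  rewrite (_ : _ - _ = c a + u * g - (c b + u * g')); last by ring.
  by rewrite -fE -fE' subrr.
by rewrite mulrAC mulfV ?pu_neq0 // mul1r; apply: pregB.
Qed.

Lemma expands_lim f s : expands f s -> lim f (s 0%N).
Proof.
by move=> /(_ 1%N) [g rg ->]; exists g => //; rewrite big_ord1 expr0 mulr1 expr1.
Qed.

Lemma expands_unique f s s' : expands f s -> expands f s' -> s =1 s'.
Proof.
move=> hs hs' k; elim/ltn_ind: k => k IH.
have [g rg fE] := hs k.+1; have [g' rg' fE'] := hs' k.+1.
rewrite big_ord_recr /= in fE; rewrite big_ord_recr /= in fE'.
have uk0 : u ^+ k != 0 by rewrite expf_neq0 // pu_neq0.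
have h (x : nat -> F) h' (gx : E) : f = h' + c (x k) * u ^+ k + u ^+ k.+1 * gx ->
   (f - h') / u ^+ k = c (x k) + u * gx.
  by move=> ->; rewrite exprSr; move: (u ^+ k) uk0 => v v0; field.
have Seq : \sum_(i < k) c (s i) * u ^+ i = \sum_(i < k) c (s' i) * u ^+ i.
  by apply: eq_bigr => i _; rewrite IH.
rewrite Seq in fE.
apply: (@lim_unique ((f - \sum_(i < k) c (s' i) * u ^+ i) / u ^+ k)).
  by exists g => //; apply: h.
by exists g' => //; apply: h.
Qed.

(** Serves for a_+ and a_-, whose remainders are given explicitly, up to constants, by the summands
    at the iterates of [tau] and [sig]. *)
Lemma expands_iter (f : nat -> E) (s : nat -> F) :
  (forall k, reg (f k)) -> (forall k, f k = c (s k) + u * f k.+1) -> expands (f 0%N) s.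
Proof.
move=> rf fE m; exists (f m) => //.
elim: m => [|m IH]; first by rewrite big_ord0 expr0 mul1r add0r.
by rewrite big_ord_recr /= -addrA exprSr -mulrA -[c _ * _]mulrC -mulrDr -fE.
Qed.

Lemma expandsD f s g r : expands f s -> expands g r -> expands (f + g) (fun k => s k + r k).
Proof.
move=> hf hg m; have [f' rf ->] := hf m; have [g' rg ->] := hg m.
exists (f' + g'); first exact: pregD.
rewrite addrACA -mulrDr -big_split; congr (_ + _); apply: eq_bigr => k _.
by rewrite rmorphD mulrDl.
Qed.

Lemma expandsZ f s a : expands f s -> expands (c a * f) (fun k => a * s k).
Proof.
move=> hf m; have [f' rf ->] := hf m; exists (c a * f').
  by apply: pregM => //; apply: preg_c.
rewrite mulrDr mulr_sumr mulrCA; congr (_ + _); apply: eq_bigr => k _.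
by rewrite rmorphM mulrA.
Qed.

(** For a series without constant term, such as that of the x_n^- with n > 0: its formula is t times
    a function that has a limit, and the limit is the first coefficient. *)
Lemma expands_shift f s a : lim f a -> expands (u * f) s -> s 1%N = a.
Proof.
move=> [g rg fE] h; have [g' rg' e] := h 2.
have [g2 rg2 e0] := expands_lim h.
have s0 : s 0%N = 0.
  apply: (@lim_unique (u * f)); first exact: expands_lim.
  by exists f; [apply: (lim_reg (a := a)); exists g | rewrite rmorph0 add0r].
apply: (@lim_unique f); last by exists g.
exists g' => //; apply: (mulfI (pu_neq0 p)).
by rewrite e big_ord_recl big_ord1 s0 rmorph0 mul0r add0r expr1 mulrDr mulrA -expr2 mulrC.
Qed.

End Place.

(** * The places of F(t) *)

Section Places.
Variable F : fieldType.
Local Notation E := {fraction {poly F}}.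
Local Notation tf := (@tofrac {poly F}).

Definition cst : {rmorphism F -> E} := (tf \o polyC)%FUN.

Lemma ratX_neq0 : ratX F != 0.
Proof. by rewrite tofrac_eq0 polyX_eq0. Qed.

Lemma nz_at (D : {poly F}) a : D.[a] != 0 -> D != 0.
Proof. by apply: contraNneq => ->; rewrite horner0. Qed.

Lemma reg_poly a (P : {poly F}) : regular_at a (tf P).
Proof. by exists P, 1; rewrite hornerC oner_neq0 rmorph1 divr1. Qed.

Lemma regD a (f g : E) : regular_at a f -> regular_at a g -> regular_at a (f + g).
Proof.
move=> [N [D [D0 ->]]] [N' [D' [D'0 ->]]]; exists (N * D' + N' * D), (D * D').
rewrite hornerM mulf_neq0 //; split=> //.
by rewrite rmorphD !rmorphM /= addf_div ?tofrac_eq0 //; [exact: nz_at D0 | exact: nz_at D'0].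
Qed.

Lemma regM a (f g : E) : regular_at a f -> regular_at a g -> regular_at a (f * g).
Proof.
move=> [N [D [D0 ->]]] [N' [D' [D'0 ->]]]; exists (N * N'), (D * D').
by rewrite hornerM mulf_neq0 // !rmorphM /= mulf_div.
Qed.

Lemma reg_nonunit a b : b != 0 -> ~ regular_at a (cst b / (ratX F - cst a)).
Proof.
move=> b0 [N [D [D0 e]]]; have D0' := nz_at D0.
have Xa : ratX F - cst a = tf ('X - a%:P) by rewrite rmorphB.
have Xa0 : 'X - a%:P != 0 :> {poly F} by rewrite polyXsubC_eq0.
move/eqP: e; rewrite Xa -[cst b]/(tf b%:P) eqr_div ?tofrac_eq0 // -!rmorphM tofrac_eq => /eqP/(congr1 (horner^~ a)).
rewrite !hornerE subrr mulr0 => /eqP.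
by rewrite mulf_eq0 (negPf b0) (negPf D0).
Qed.

Lemma regV a b (g : E) : b != 0 -> regular_at a g -> regular_at a (cst b + (ratX F - cst a) * g)^-1.
Proof.
move=> b0 [N [D [D0 ->]]]; exists D, (b%:P * D + ('X - a%:P) * N).
rewrite !hornerE subrr mul0r addr0 mulf_neq0 //; split=> //.
have D0' : tf D != 0 by rewrite tofrac_eq0 (nz_at D0).
rewrite -[RHS]invf_div; congr (_^-1); rewrite rmorphD !rmorphM rmorphB /= [RHS]mulrDl.
by rewrite mulfK // mulrA.
Qed.

(** Closed by Defined, because later limits identify [pc] and [pu] with the constants and the linear
    uniformizer by conversion. *)
Definition place_at (a : F) : place F E.
Proof.
apply: (@Place F E cst (ratX F - cst a) (regular_at a)).
- by move=> b; apply: reg_poly.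
- have -> : ratX F - cst a = tf ('X - a%:P) by rewrite rmorphB.
  exact: reg_poly.
- exact: regD.
- exact: regM.
- exact: reg_nonunit.
- exact: regV.
have -> : ratX F - cst a = tf ('X - a%:P) by rewrite rmorphB.
by rewrite tofrac_eq0 polyXsubC_eq0.
Defined.

Lemma reg_ooP (N D : {poly F}) : D != 0 -> (size N <= size D)%N -> regular_oo (tf N / tf D).
Proof. by move=> D0 s; exists N, D. Qed.

Lemma size_mul_le (N D N' D' : {poly F}) : D != 0 -> D' != 0 ->
  (size N <= size D)%N -> (size N' <= size D')%N -> (size (N * N')%R <= size (D * D')%R)%N.
Proof.
move=> D0 D'0 h h'; apply: leq_trans (size_polyMleq _ _) _.
by rewrite size_mul // -!subn1 leq_sub2r // leq_add.
Qed.

Lemma ooD (f g : E) : regular_oo f -> regular_oo g -> regular_oo (f + g).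
Proof.
move=> [N [D [D0 s ->]]] [N' [D' [D'0 s' ->]]].
rewrite addf_div ?tofrac_eq0 // -!rmorphM -rmorphD; apply: reg_ooP; first by rewrite mulf_neq0.
apply: leq_trans (size_polyD _ _) _; rewrite geq_max; apply/andP; split.
  exact: size_mul_le.
by rewrite [D * D']mulrC; apply: size_mul_le.
Qed.

Lemma ooM (f g : E) : regular_oo f -> regular_oo g -> regular_oo (f * g).
Proof.
move=> [N [D [D0 s ->]]] [N' [D' [D'0 s' ->]]].
rewrite mulf_div -!rmorphM; apply: reg_ooP; first by rewrite mulf_neq0.
exact: size_mul_le.
Qed.

Lemma oo_c b : regular_oo (cst b).
Proof.
rewrite -[cst b]divr1 -(rmorph1 tf); apply: reg_ooP; first exact: oner_neq0.
by rewrite size_poly1 size_polyC; case: (b != 0).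
Qed.

Lemma oo_u : regular_oo (ratX F)^-1.
Proof.
rewrite -[_^-1]mul1r -(rmorph1 tf); apply: reg_ooP; first by rewrite polyX_eq0.
by rewrite size_poly1 size_polyX.
Qed.

Lemma oo_nonunit b : b != 0 -> ~ regular_oo (cst b / (ratX F)^-1).
Proof.
move=> b0 [N [D [D0 s]]]; rewrite invrK => e.
have D0' : tf D != 0 by rewrite tofrac_eq0.
have /eqP : tf (b%:P * 'X * D) = tf N.
  by rewrite !rmorphM /= -[tf b%:P]/(cst b) -[tf 'X]/(ratX F) e divfK.
rewrite tofrac_eq => /eqP e'; move: s; rewrite -e' -mulrA mul_polyC size_scale //.
by rewrite mulrC size_mulX // ltnn.
Qed.

Lemma ooV b (g : E) : b != 0 -> regular_oo g -> regular_oo (cst b + (ratX F)^-1 * g)^-1.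
Proof.
move=> b0 [N [D [D0 s ->]]].
have sz : size (b%:P * ('X * D) + N) = (size D).+1.
  by rewrite size_polyDl mul_polyC size_scale // mulrC size_mulX // ltnS.
exists ('X * D), (b%:P * ('X * D) + N); split.
- by rewrite -size_poly_eq0 sz.
- by rewrite sz mulrC size_mulX.
have D0' : tf D != 0 by rewrite tofrac_eq0.
have X0 := ratX_neq0.
rewrite -[RHS]invf_div; congr (_^-1).
have -> : tf (b%:P * ('X * D) + N) = cst b * (ratX F * tf D) + tf N.
  by rewrite rmorphD !rmorphM.
have XD0 : tf ('X * D) != 0 by rewrite tofrac_eq0 mulf_neq0 // polyX_eq0.
have XD : tf ('X * D) = ratX F * tf D by rewrite rmorphM.
rewrite mulrDl -XD (mulfK XD0); congr (_ + _).
by rewrite XD invfM mulrCA.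
Qed.

Definition place_oo : place F E.
Proof.
apply: (@Place F E cst (ratX F)^-1 (@regular_oo F)).
- exact: oo_c.
- exact: oo_u.
- exact: ooD.
- exact: ooM.
- exact: oo_nonunit.
- exact: ooV.
by rewrite invr_eq0 ratX_neq0.
Defined.

Definition place_0 := place_at 0.

Lemma place_0_u : pu place_0 = ratX F.
Proof. by rewrite /= rmorph0 subr0. Qed.

Lemma expands0P f s : expands0 f s <-> expands place_0 f s.
Proof.
split=> h m; have [g rg ->] := h m; exists g => //; rewrite place_0_u; congr (_ + _);
by apply: eq_bigr.
Qed.

Lemma expandsooP f s : expandsoo f s <-> expands place_oo f s.
Proof.
split=> h m; have [g rg ->] := h m; exists g => //; rewrite /= exprVn; congr (_ + _);
by apply: eq_bigr => k _; rewrite exprVn.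
Qed.

End Places.

(** * Links *)

Definition snocr (T : Type) l (x : 'I_l -> T) (y : T) : 'I_l.+1 -> T :=
  fun j => if unlift ord_max j is Some k then x k else y.

Lemma mmap_SLval (R : realType) n l (A : comNzRingType) (f : Kz R n -> A) (h : 'I_l -> A)
  (P : {mpoly (SL R n)[l]}) :
  mmap f h (map_mpoly (@SLval R n) P) = mmap (f \o @SLval R n) h P.
Proof.
rewrite /mmap (perm_big (mpoly.msupp P)) /=.
  by apply: eq_bigr => m _; rewrite mcoeff_map_mpoly.
apply: uniq_perm; rewrite ?msupp_uniq // => m.
by rewrite !mcoeff_msupp mcoeff_map_mpoly /= -(rmorph0 (@SLval R n)) (inj_eq (@SLval_inj R n)).
Qed.

Section Link.
Variables (R : realType) (n : nat).
Local Notation K' := (Kz R n.+1).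
Local Notation z := (zvar R (@ord_max n)).

(* link_eq with the coefficients lifted to the ring SL of symmetric Laurent
   polynomials, on which the substitutions of a link are ring morphisms. *)
Definition flink l (P : {mpoly (SL R n)[l]}) (Q : {mpoly (SL R n.+2)[l.+1]}) : Prop :=
  mmap (@mpolyC l K' \o @spec R n) (snocr (fun a => 'X_a) (z^-1)%:MP) Q
  = (z ^- n.+1)%:MP * (\prod_(a < l) (1 - 'X_a ^+ 2 * (z ^+ 2)%:MP)) * map_mpoly (@wid R n) P.

Lemma link_eqE l (P : {mpoly (SL R n)[l]}) (Q : {mpoly (SL R n.+2)[l.+1]}) :
  link_eq (map_mpoly (@SLval R n) P) (map_mpoly (@SLval R n.+2) Q) <-> flink P Q.
Proof.
by rewrite /link_eq /flink mmap_SLval [in X in _ = _ * X <-> _]/map_mpoly mmap_SLval.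
Qed.

(** A link is an identity between polynomials, so the X_a may be replaced by elements of any ring
    over [K']: by 0, by - 1/z, or by new indeterminates. *)
Lemma flink_eval l (P : {mpoly (SL R n)[l]}) (Q : {mpoly (SL R n.+2)[l.+1]})
    (A : comNzRingType) (i : {rmorphism K' -> A}) (x : 'I_l -> A) :
  flink P Q ->
  mmap (i \o @spec R n) (snocr x (i z^-1)) Q
  = i (z ^- n.+1) * (\prod_(a < l) (1 - x a ^+ 2 * i z ^+ 2)) * mmap (i \o @wid R n) x P.
Proof.
have e a : mmap i x (1 - 'X_a ^+ 2 * (z ^+ 2)%:MP) = 1 - x a ^+ 2 * i z ^+ 2.
  have -> : (z ^+ 2)%:MP_[l] = z%:MP_[l] ^+ 2 by rewrite rmorphXn.
  by rewrite rmorphB rmorph1 rmorphM !rmorphXn /= mmapX mmap1U mmapC.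
move=> /(congr1 (mmap i x)); rewrite mmap_mmap [RHS]rmorphM [X in X * _]rmorphM /= mmap_map_mpoly mmapC.
rewrite rmorph_prod /= (eq_bigr _ (fun a _ => e a)) => <-.
apply: eq_mmap => // j; rewrite /snocr.
by case: unliftP => [k|] _; rewrite ?mmapX ?mmap1U ?mmapC.
Qed.

Lemma linkP (P : skewA R n) (Q : skewA R n.+2) :
  link P Q <-> exists P' Q', [/\ forall l, map_mpoly (@SLval R n) (P' l) = P l,
    forall l, map_mpoly (@SLval R n.+2) (Q' l) = Q l & forall l, flink (P' l) (Q' l.+1)].
Proof.
split=> [[CP CQ PQ]|[P' [Q' [hP hQ h]]]].
  exists (fun l => liftP (P l)), (fun l => liftP (Q l)).
  have hP l : map_mpoly (@SLval R n) (liftP (P l)) = P l by apply: liftPK.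
  have hQ l : map_mpoly (@SLval R n.+2) (liftP (Q l)) = Q l by apply: liftPK.
  by split=> [||l]; [exact: hP | exact: hQ | apply/link_eqE; rewrite (hP l) (hQ l.+1)].
split=> [l m|l m|l]; first by rewrite -(hP l); apply: map_mpolyP.
  by rewrite -(hQ l); apply: map_mpolyP.
by rewrite -(hP l) -(hQ l.+1); apply/link_eqE.
Qed.

Lemma flinkD l (P P' : {mpoly (SL R n)[l]}) Q Q' :
  flink P Q -> flink P' Q' -> flink (P + P') (Q + Q').
Proof. by rewrite /flink => h h'; rewrite !rmorphD /= h h' mulrDr. Qed.

Lemma flinkZ l (P : {mpoly (SL R n)[l]}) Q c d :
  spec d = wid c -> flink P Q -> flink (c *: P) (d *: Q).
Proof.
rewrite /flink => cd h; rewrite map_mpolyZ mmapZ /= h cd -mul_mpolyC /=.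
by rewrite mulrCA.
Qed.

Lemma flink0 l : flink (0 : {mpoly (SL R n)[l]}) 0.
Proof. by rewrite /flink !rmorph0 mulr0. Qed.

End Link.

Definition SLc (R : realType) n (c : R[i]) : SL R n := liftSL (zC n c).

Lemma SLcK (R : realType) n c : SLval (SLc n c) = zC n c :> Kz R n.
Proof.
apply: liftSLK; apply/sym_laurentP; split; first exact: laurent_zC.
by move=> s; apply: Kperm_zC.
Qed.

Lemma spec_SLc (R : realType) n c : spec (SLc n.+2 c) = zC n.+1 c :> Kz R n.+1.
Proof. by apply: valueE; rewrite SLcK; apply: hv_zC. Qed.

Lemma wid_SLc (R : realType) n c : wid (SLc n c) = zC n.+1 c :> Kz R n.+1.
Proof. by apply: valueE; rewrite SLcK; apply: hv_zC. Qed.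

Section LinkGood.
Variables (R : realType) (n : nat).
Variables (act : Ui R -> skewA R n -> skewA R n) (act2 : Ui R -> skewA R n.+2 -> skewA R n.+2).
Hypotheses (act_action : is_action act) (act2_action : is_action act2).

Definition good (g : Ui R) : Prop := forall P Q, link P Q -> link (act g P) (act2 g Q).

Lemma linkD (P P' : skewA R n) (Q Q' : skewA R n.+2) :
  link P Q -> link P' Q' -> link (P + P') (Q + Q').
Proof.
move=> /linkP[P1 [Q1 [hP hQ h]]] /linkP[P2 [Q2 [hP' hQ' h']]]; apply/linkP.
exists (fun l => P1 l + P2 l), (fun l => Q1 l + Q2 l); split=> l.
- by rewrite AcompD rmorphD /= hP hP'.
- by rewrite AcompD rmorphD /= hQ hQ'.
exact: flinkD.
Qed.

Lemma linkZ c (P : skewA R n) (Q : skewA R n.+2) :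
  link P Q -> link (zC n c *: P) (zC n.+2 c *: Q).
Proof.
move=> /linkP[P1 [Q1 [hP hQ h]]]; apply/linkP.
exists (fun l => SLc n c *: P1 l), (fun l => SLc n.+2 c *: Q1 l); split=> l.
- by rewrite AcompZ map_mpolyZ /= hP SLcK.
- by rewrite AcompZ map_mpolyZ /= hQ SLcK.
by apply: flinkZ => //; rewrite spec_SLc wid_SLc.
Qed.

Lemma goodD g h : good g -> good h -> good (g + h).
Proof.
by move=> hg hh P Q PQ; rewrite (act_D act_action) (act_D act2_action); apply: linkD; [apply: hg | apply: hh].
Qed.

Lemma goodM g h : good g -> good h -> good (g * h).
Proof.
by move=> hg hh P Q PQ; rewrite (act_M act_action) (act_M act2_action); apply/hg/hh.
Qed.

Lemma goodZ c g : good g -> good (c *: g).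
Proof.
by move=> hg P Q PQ; rewrite (act_Z act_action) (act_Z act2_action); apply/linkZ/hg.
Qed.

Lemma good1 : good 1.
Proof. by move=> P Q PQ; rewrite (act_1 act_action) (act_1 act2_action). Qed.

End LinkGood.

(** * Skew-symmetrization and the action *)

Section Skew.
Variable F : fieldType.

Lemma sum_perm_lift l (G : {perm 'I_l.+1} -> F) :
  \sum_s G s = \sum_(p < l.+1) \sum_(s : {perm 'I_l}) G (lift_perm ord0 p s).
Proof.
rewrite pair_big /=.
pose h (u : 'I_l.+1 * {perm 'I_l}) := lift_perm ord0 u.1 u.2.
have inj_h : injective h.
  move=> [p s] [p' s'] /= e; rewrite /h /= in e.
  have ep : p = p' by have := congr1 (fun t : {perm 'I_l.+1} => t ord0) e; rewrite /= !lift_perm_id.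
  subst p'; congr (_, _); apply/permP => k.
  have := congr1 (fun t : {perm 'I_l.+1} => t (lift ord0 k)) e; rewrite /= !lift_perm_lift.
  exact: lift_inj.
have [h' hK h'K] : bijective h.
  apply: inj_card_bij => //.
  by rewrite card_prod !card_Sn card_ord factS.
by rewrite (reindex h) //=; exists h' => u _.
Qed.

(** Laplace expansion: a permutation amounts to the image p of the first index and a permutation of
    the remaining ones, and its sign is (-1)^p times the sign of the latter. *)
Lemma Skew_rec l (g : F -> ('I_l -> F) -> F) (x : 'I_l.+1 -> F) :
  Skew (fun y => g (y ord0) (y \o lift ord0)) x
  = \sum_(p < l.+1) (-1) ^+ p * Skew (g (x p)) (x \o lift p).
Proof.
rewrite /Skew sum_perm_lift; apply: eq_bigr => p _.
rewrite mulr_sumr; apply: eq_bigr => s _.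
rewrite odd_lift_perm /= signr_addb signr_odd -mulrA; congr (_ * (_ * g _ _)).
  by rewrite /= lift_perm_id.
by apply: functional_extensionality_dep => k /=; rewrite lift_perm_lift.
Qed.

Definition skewf l (f : ('I_l -> F) -> F) : Prop :=
  forall (s : {perm 'I_l}) x, f (x \o s) = (-1) ^+ s * f x.

Lemma Skew_skew l (f : ('I_l -> F) -> F) x : skewf f -> Skew f x = l`!%:R * f x.
Proof.
move=> sf; rewrite /Skew (eq_bigr (fun=> f x)).
  rewrite sumr_const (_ : #|_| = l`!) ?mulr_natl //.
  by rewrite -(card_Sn l); apply: eq_card.
by move=> s _; rewrite sf mulrA -expr2 sqrr_sign mul1r.
Qed.

(** By skew-symmetry of [f2] the l! terms with the same p are equal, which cancels the normalization
    of the wedge product. *)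
Lemma wedge1E l (f1 : F -> F) (f2 : ('I_l -> F) -> F) (x : 'I_l.+1 -> F) :
  skewf f2 -> l`!%:R != 0 :> F ->
  wedge (l1 := 1) (l2 := l) (fun y => f1 (y ord0)) f2 x
  = \sum_(p < l.+1) (-1) ^+ p * (f1 (x p) * f2 (x \o lift p)).
Proof.
move=> sf l0; rewrite /wedge (_ : (1`! * l`!)%N = l`!); last by rewrite mul1n.
have -> : Skew (fun y : 'I_(1 + l) -> F => f1 ((y \o @lshift 1 l) ord0) * f2 (y \o @rshift 1 l)) x
   = Skew (l := l.+1) (fun y => (fun a u => f1 a * f2 u) (y ord0) (y \o lift ord0)) x.
  apply: eq_bigr => s _ /=; congr (_ * (f1 (x (s _)) * f2 _)); first exact: ord_inj.
  apply: functional_extensionality_dep => k /=; congr (x (s _)); exact: ord_inj.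
rewrite (Skew_rec (fun a u => f1 a * f2 u)) mulr_sumr; apply: eq_bigr => p _; rewrite mulrCA; congr (_ * _).
have sk : skewf (fun u => f1 (x p) * f2 u) by move=> s y; rewrite sf mulrCA.
by rewrite (Skew_skew _ sk) mulKf.
Qed.

Lemma wedge2E l (f1 : F -> F -> F) (f2 : ('I_l -> F) -> F) (x : 'I_l.+2 -> F) :
  skewf f2 -> l`!%:R != 0 :> F ->
  wedge (l1 := 2) (l2 := l) (fun y => f1 (y ord0) (y ord_max)) f2 x
  = 2^-1 * \sum_(p < l.+2) (-1) ^+ p * \sum_(r < l.+1) (-1) ^+ r *
      (f1 (x p) (x (lift p r)) * f2 (x \o lift p \o lift r)).
Proof.
move=> sf l0; rewrite /wedge.
have -> : Skew (fun y : 'I_(2 + l) -> F =>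
      f1 ((y \o @lshift 2 l) ord0) ((y \o @lshift 2 l) ord_max) * f2 (y \o @rshift 2 l)) x
   = Skew (l := l.+2) (fun y => (fun a u => f1 a (u ord0) * f2 (u \o lift ord0))
      (y ord0) (y \o lift ord0)) x.
  apply: eq_bigr => s _ /=; congr (_ * (f1 (x (s _)) (x (s _)) * f2 _)); try exact: ord_inj.
  apply: functional_extensionality_dep => k /=; congr (x (s _)); exact: ord_inj.
rewrite natrM invfM -mulrA; congr (_ * _).
rewrite (Skew_rec (fun a u => f1 a (u ord0) * f2 (u \o lift ord0))).
rewrite mulr_sumr; apply: eq_bigr => p _; rewrite mulrCA; congr (_ * _).
rewrite (Skew_rec (fun a u => f1 (x p) a * f2 u)) mulr_sumr; apply: eq_bigr => r _.
rewrite mulrCA; congr (_ * _).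
have sk : skewf (fun u => f1 (x p) (x (lift p r)) * f2 u) by move=> s y; rewrite sf mulrCA.
by rewrite (Skew_skew _ sk) mulKf.
Qed.

End Skew.

Lemma lim_mmap (F E : fieldType) (p : place F E) (S : comNzRingType) l
  (f : S -> E) (f0 : S -> F) (x : 'I_l -> E) x0 (P : {mpoly S[l]}) :
  (forall c, lim p (f c) (f0 c)) -> (forall j, lim p (x j) (x0 j)) ->
  lim p (mmap f x P) (mmap f0 x0 P).
Proof.
move=> hf hx; apply: lim_sum => m _; apply: limM => //; apply: lim_prod => j _.
by elim: (m j) => [|k IH]; [exact: lim1 | rewrite !exprS; apply: limM].
Qed.

Lemma ThetaE (R : realType) n (F : fieldType) (iota : {rmorphism Kz R n -> F}) x :
  Theta iota x = (map_poly (iota \o @SLval R n) (theta R n)).[x].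
Proof.
rewrite map_poly_comp map_theta /thetaK rmorph_prod horner_prod; apply: eq_bigr => j _ /=.
by rewrite rmorphB rmorph1 /= map_polyZ map_polyX !hornerE.
Qed.

(** * The action read off from expansions *)

Section ActionFormulas.
Variables (R : realType) (n l : nat).
Local Notation K := (Kz R n).
Local Notation L := (KzX R n l).
Local Notation E := (KzXt R n l).

Definition tofr : {rmorphism {mpoly K[l]} -> L} := @tofrac {mpoly K[l]}.
Definition cK : {rmorphism K -> L} := (tofr \o @mpolyC l K)%FUN.
Definition mu : {rmorphism {mpoly (SL R n)[l]} -> L} := (tofr \o map_mpoly (@SLval R n))%FUN.

Lemma tofr_inj : injective tofr.
Proof. by move=> p q /eqP; rewrite tofrac_eq => /eqP. Qed.

Lemma EK_cst c : EK l c = cst L (cK c).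
Proof. by []. Qed.

Lemma EX_cst j : EX R n (j : 'I_l) = cst L (mu 'X_j).
Proof. by rewrite /mu /= map_mpolyX. Qed.

Variables (act : Ui R -> skewA R n -> skewA R n).
Hypothesis act_action : is_action act.

Definition lifts k (P : skewA R n) (P' : {mpoly (SL R n)[k]}) : Prop :=
  map_mpoly (@SLval R n) P' = P k.

Lemma peval_lift k (P : {mpoly (SL R n)[k]}) (x : 'I_k -> E) :
  peval (EK l) (map_mpoly (@SLval R n) P) x = mmap (EK l \o @SLval R n) x P.
Proof. exact: mmap_SLval. Qed.

Lemma EK_lim c : lim (place_0 L) (EK l c) (cK c).
Proof. exact: (lim_c (place_0 L)). Qed.

Lemma EX_lim (j : 'I_l) : lim (place_0 L) (EX R n j) (mu 'X_j).
Proof. by rewrite EX_cst; apply: (lim_c (place_0 L)). Qed.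

Lemma Et_lim : lim (place_0 L) (Et R n l) 0.
Proof. by rewrite /Et -place_0_u; apply: lim_u. Qed.

Lemma Theta_lim0 : lim (place_0 L) (Theta (EK l) (Et R n l)) 1.
Proof.
have -> : (1 : L) = \prod_(j < n) (1 - cK (zvar R j) * 0).
  by rewrite big1 // => j _; rewrite mulr0 subr0.
apply: lim_prod => j _; apply: limB; first exact: lim1.
by apply: limM; [apply: EK_lim | apply: Et_lim].
Qed.

Definition opXp (P : {mpoly (SL R n)[l.+1]}) : {mpoly (SL R n)[l]} :=
  mmap (@mpolyC l (SL R n)) (snocr (fun j => 'X_j) 0) P.

Lemma Uspec_eq (u v : Ures R) : Ures_val u = Ures_val v -> Uspec u = Uspec v.
Proof.
case: u v => [u hu] [v hv] /= e; rewrite /Uspec; congr (algpi _ (fgen _ _)).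
by subst v; congr MkUres; apply: Prop_irrelevance.
Qed.

Lemma act_xp0 (u : Ures R) (P : skewA R n) (P' : {mpoly (SL R n)[l.+1]}) :
  Ures_val u = Ux R true 0 -> lifts P P' ->
  act ('i ^ (1 - n%:Z) *: Uspec u) P l = map_mpoly (@SLval R n) (opXp P').
Proof.
move=> uE hP.
(* The formula for the action requires a lift of the whole series to U^res, although only its
   constant coefficient is extracted. *)
have IU k : in_Ures (Xp_ge0 R k).
  have [_ _ _ Z] := closed_Ures R.
  have [b hb] : exists b, specializes ((q_ R)^-1 ^+ k) b.
    elim: k => [|k [b hb]]; first by exists 1; apply: (@specializes_nat _ 1).
    by exists ('i^-1 * b); rewrite exprS; apply: specializesM => //; apply: specializes_qV.
  by rewrite /Xp_ge0 -exprnN -exprVn; apply: Z hb _; apply: Ures_x.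
have := @act_Xp_ge0 _ _ _ act_action l (fun k => MkUres (IU k)) (fun k => erefl) P.
move/expands0P/expands_lim => h.
have -> : Uspec u = Uspec (MkUres (IU 0%N)).
  by apply: Uspec_eq; rewrite uE /= /Xp_ge0 expr0z scale1r.
apply: (@tofr_inj); apply: lim_unique h _; rewrite -hP /Xp_rhs peval_lift.
have -> : tofr (map_mpoly (@SLval R n) (opXp P')) = 1^-1 * mmap (cK \o @SLval R n) (snocr (fun j => mu 'X_j) 0) P'.
  rewrite invr1 mul1r /opXp -[LHS]/(mu (mmap _ _ P')) rmorph_mmap; apply: eq_mmap => [c|j] /=.
    by rewrite /mu /= map_mpolyC.
  by rewrite /snocr; case: unliftP => [k|] _ //; rewrite rmorph0.
apply: limM; first by apply: limV; rewrite ?oner_neq0 //; apply: Theta_lim0.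
apply: lim_mmap => [c|j]; first exact: EK_lim.
by rewrite /snoc /snocr; case: unliftP => [k|] _; [apply: EX_lim | apply: Et_lim].
Qed.

End ActionFormulas.

Lemma map_mpoly_inj (S A : comNzRingType) l (f : {rmorphism S -> A}) :
  injective f -> injective (map_mpoly f : {mpoly S[l]} -> {mpoly A[l]}).
Proof.
move=> fi P Q e; apply/mpolyP => m; apply: fi.
by have := congr1 (mcoeff m) e; rewrite !mcoeff_map_mpoly.
Qed.

Lemma map_mpoly_msym (S A : comNzRingType) l (f : {rmorphism S -> A}) s (P : {mpoly S[l]}) :
  map_mpoly f (msym s P) = msym s (map_mpoly f P).
Proof. by apply/mpolyP => m; rewrite mcoeff_map_mpoly !mcoeff_sym mcoeff_map_mpoly. Qed.

Section SkewLift.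
Variables (R : realType) (n : nat).

Definition mskew l (P : {mpoly (SL R n)[l]}) : Prop :=
  forall s : {perm 'I_l}, msym s P = (-1) ^+ s *: P.

Lemma map_SLval_inj l : injective (map_mpoly (@SLval R n) : {mpoly (SL R n)[l]} -> _).
Proof. exact: map_mpoly_inj (@SLval_inj R n). Qed.

Lemma lifts_skew l (P : skewA R n) (P' : {mpoly (SL R n)[l]}) : lifts P P' -> mskew P'.
Proof.
move=> hP s; apply: map_SLval_inj; rewrite map_mpolyZ rmorph_sign hP.
by have [skP _ _] := AcompP P l; rewrite -skP -hP map_mpoly_msym.
Qed.

Lemma mmap_skew (A : comNzRingType) l (f : {rmorphism SL R n -> A}) (x : 'I_l -> A) P s :
  mskew P -> mmap f (x \o (s : {perm 'I_l})) P = (-1) ^+ s * mmap f x P.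
Proof.
move=> /(_ s)/(congr1 (mmap f x)); rewrite mmapZ rmorph_sign => <-.
rewrite /msym rmorph_mmap; apply: eq_mmap => [c|j] /=; first by rewrite mmapC.
by rewrite mmapX mmap1U.
Qed.

End SkewLift.

Lemma lim_neq0 (F E : fieldType) (p : place F E) f a : a != 0 -> lim p f a -> f != 0.
Proof.
move=> a0 h; apply: contraNneq a0 => f0; move: h; rewrite f0 => h.
by apply/eqP; apply: lim_unique h (lim0 p).
Qed.

Lemma snocr_lift (T : Type) l (x : 'I_l.+1 -> T) (y : T) (p : 'I_l.+1) :
  snocr x y \o lift (lift ord_max p) = snocr (x \o lift p) y.
Proof.
apply: functional_extensionality_dep => k; rewrite /= /snocr.
case: (unliftP ord_max k) => [j|] ->.
  have -> : lift (lift ord_max p) (lift ord_max j) = lift ord_max (lift p j).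
    by apply: ord_inj; case: p j => p hp [j hj] /=; rewrite /bump; lia.
  by rewrite liftK.
have -> : lift (lift ord_max p) ord_max = ord_max.
  by apply: ord_inj; case: p => p hp /=; rewrite /bump; lia.
by rewrite unlift_none.
Qed.

Lemma snocr_lift_max (T : Type) l (x : 'I_l -> T) (y : T) j : snocr x y (lift ord_max j) = x j.
Proof. by rewrite /snocr liftK. Qed.

Lemma snocr_max (T : Type) l (x : 'I_l -> T) (y : T) : snocr x y ord_max = y.
Proof. by rewrite /snocr unlift_none. Qed.

(** * The operators [x_0^+], [x_0^-] and [x_1^-] *)

Section LoweringOperators.

(* The wedge product of w and f, expanded along its first factor. *)
Definition lowerF (A : comNzRingType) l (w : A -> A) (f : ('I_l -> A) -> A) (x : 'I_l.+1 -> A) : A :=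
  \sum_(p < l.+1) (-1) ^+ p * (w (x p) * f (x \o lift p)).

Lemma big_ord_max (V : zmodType) m (G : 'I_m.+1 -> V) :
  \sum_p G p = \sum_p G (lift ord_max p) + G ord_max.
Proof.
rewrite big_ord_recr /=; congr (_ + _); apply: eq_bigr => p _; congr G.
by apply: ord_inj; rewrite lift_max.
Qed.

(** The term in which the kernel takes the new variable y drops out. In the term of p the kernel
    supplies the factor b (x p), which f' lacks because it does not see that variable. *)
Lemma lowerF_snoc (A : comNzRingType) l (w w' : A -> A) (f : ('I_l -> A) -> A)
  (f' : ('I_l.+1 -> A) -> A) (b : A -> A) (y k : A) (x : 'I_l.+1 -> A) :
  w' y = 0 -> (forall v, w' v = b v * w v) ->
  (forall v, f' (snocr v y) = k * (\prod_a b (v a)) * f v) ->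
  lowerF w' f' (snocr x y) = k * (\prod_a b (x a)) * lowerF w f x.
Proof.
move=> wy wb ff; rewrite /lowerF big_ord_max snocr_max wy mul0r mulr0 addr0 mulr_sumr.
apply: eq_bigr => p _; rewrite snocr_lift snocr_lift_max ff wb lift_max.
rewrite [in RHS](bigD1_ord p) //=.
by ring.
Qed.

(** For the component of degree 0 of the second member, which has no partner: its image must vanish
    at y. *)
Lemma lowerF_snoc0 (A : comNzRingType) (w : A -> A) (f : ('I_0 -> A) -> A) y x :
  w y = 0 -> lowerF w f (@snocr A 0 x y) = 0.
Proof. by move=> wy; rewrite /lowerF big_ord_max snocr_max big_ord0 wy mul0r mulr0 addr0. Qed.

Variable R : realType.

(** The wedge formula applied to the indeterminates, so that its value at any point follows from
    compatibility with ring morphisms alone. *)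
Definition opXm n l (w : {poly SL R n}) (P : {mpoly (SL R n)[l]}) : {mpoly (SL R n)[l.+1]} :=
  lowerF (fun x => (map_poly (@mpolyC l.+1 (SL R n)) w).[x])
    (fun y => mmap (@mpolyC l.+1 (SL R n)) y P) (fun j => 'X_j).

Lemma rmorph_lower (A B : comNzRingType) (h : {rmorphism A -> B}) l
  (w : A -> A) (w' : B -> B) (f : ('I_l -> A) -> A) f' x :
  (forall a, h (w a) = w' (h a)) -> (forall y, h (f y) = f' (h \o y)) ->
  h (lowerF w f x) = lowerF w' f' (h \o x).
Proof.
move=> hw hf; rewrite /lowerF rmorph_sum; apply: eq_bigr => p _.
by rewrite rmorphM rmorph_sign rmorphM hw hf.
Qed.

Lemma mmap_opXm n l (A : comNzRingType) (f : {rmorphism SL R n -> A}) (x : 'I_l.+1 -> A) w P :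
  mmap f x (opXm w P) = lowerF (fun a => (map_poly f w).[a]) (fun y => mmap f y P) x.
Proof.
pose h : {rmorphism {mpoly (SL R n)[l.+1]} -> A} := mmap f x.
have hx : h \o (fun j => 'X_j) = x.
  by apply: functional_extensionality_dep => j; rewrite /h /= mmapX mmap1U.
rewrite -[in RHS]hx -[LHS]/(h (opXm w P)) /opXm.
apply: rmorph_lower => [a|y] /=.
  rewrite -[mmap f x _]/(h _) -horner_map /= -map_poly_comp /=; congr (_.[_]); apply: eq_map_poly => c /=.
  by rewrite /h /= mmapC.
by rewrite /h /= rmorph_mmap; apply: eq_mmap => // c /=; rewrite mmapC.
Qed.

End LoweringOperators.

Section GoodOperators.
Variables (R : realType) (n : nat).
Variables (act : Ui R -> skewA R n -> skewA R n) (act2 : Ui R -> skewA R n.+2 -> skewA R n.+2).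
Hypotheses (act_action : is_action act) (act2_action : is_action act2).

Lemma goodI g (A : (forall l, {mpoly (SL R n)[l]}) -> forall l, {mpoly (SL R n)[l]})
    (B : (forall l, {mpoly (SL R n.+2)[l]}) -> forall l, {mpoly (SL R n.+2)[l]}) :
  (forall (P : skewA R n) P', (forall l, lifts P (P' l)) -> forall l, lifts (act g P) (A P' l)) ->
  (forall (Q : skewA R n.+2) Q', (forall l, lifts Q (Q' l)) -> forall l, lifts (act2 g Q) (B Q' l)) ->
  (forall (P' : forall l, {mpoly (SL R n)[l]}) (Q' : forall l, {mpoly (SL R n.+2)[l]}),
    (forall l, mskew (P' l)) -> (forall l, mskew (Q' l)) ->
    (forall l, flink (P' l) (Q' l.+1)) -> forall l, flink (A P' l) (B Q' l.+1)) ->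
  good act act2 g.
Proof.
move=> hA hB hAB P Q /linkP[P' [Q' [hP hQ h]]]; apply/linkP; exists (A P'), (B Q'); split.
- exact: hA.
- exact: hB.
by apply: hAB => // l; [apply: lifts_skew (hP l) | apply: lifts_skew (hQ l)].
Qed.

End GoodOperators.

Section RaisingOperator.
Variables (R : realType) (n : nat).

Lemma snocr_tperm (T : Type) l (x : 'I_l -> T) (a b : T) :
  snocr (snocr x a) b = snocr (snocr x b) a \o tperm ord_max (lift ord_max ord_max).
Proof.
apply: functional_extensionality_dep => j /=.
case: (unliftP ord_max j) => [k|] ->; last by rewrite snocr_max tpermL snocr_lift_max snocr_max.
case: (unliftP ord_max k) => [i|] ->; last by rewrite snocr_lift_max snocr_max tpermR snocr_max.
rewrite tpermD ?neq_lift // ?(inj_eq (@lift_inj _ _)) ?neq_lift //.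
by rewrite !snocr_lift_max.
Qed.

Lemma big_snocr (A : comNzRingType) (G : A -> A) l (x : 'I_l -> A) y :
  \prod_a G (snocr x y a) = \prod_a G (x a) * G y.
Proof.
rewrite big_ord_recr /= -[ord_max]/(@ord_max l) snocr_max; congr (_ * _); apply: eq_bigr => a _.
by rewrite (_ : widen_ord _ a = lift ord_max a) ?snocr_lift_max //; apply: ord_inj; rewrite lift_max.
Qed.

Lemma big_snocr0 (A : comNzRingType) (c : A) l (x : 'I_l -> A) :
  \prod_a (1 - snocr x 0 a ^+ 2 * c) = \prod_a (1 - x a ^+ 2 * c).
Proof. by rewrite (big_snocr (fun v => 1 - v ^+ 2 * c)) expr0n mul0r subr0 mulr1. Qed.

Definition Cm l : {rmorphism Kz R n.+1 -> {mpoly (Kz R n.+1)[l]}} := @mpolyC l (Kz R n.+1).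
Definition specX l : {rmorphism SL R n.+2 -> {mpoly (Kz R n.+1)[l]}} := Cm l \o @spec R n.
Definition widX l : {rmorphism SL R n -> {mpoly (Kz R n.+1)[l]}} := Cm l \o @wid R n.
Definition zX l : {mpoly (Kz R n.+1)[l]} := Cm l (zvar R ord_max).
Definition zVX l : {mpoly (Kz R n.+1)[l]} := Cm l (zvar R ord_max)^-1.

Lemma zVXK l : zVX l * zX l = 1.
Proof. by rewrite -rmorphM mulVf ?rmorph1 //; apply: zvar_neq0. Qed.

Lemma flinkE l (P : {mpoly (SL R n)[l]}) (Q : {mpoly (SL R n.+2)[l.+1]}) :
  flink P Q <-> mmap (specX l) (snocr (fun a => 'X_a) (zVX l)) Q
    = Cm l (zvar R ord_max ^- n.+1) * (\prod_a (1 - 'X_a ^+ 2 * zX l ^+ 2)) * mmap (widX l) (fun a => 'X_a) P.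
Proof.
have e : \prod_(a < l) (1 - 'X_a ^+ 2 * (zvar R ord_max ^+ 2)%:MP)
  = \prod_a (1 - 'X_a ^+ 2 * zX l ^+ 2) :> {mpoly (Kz R n.+1)[l]}.
  by apply: eq_bigr => a _; rewrite -(rmorphXn (Cm l) 2 (zvar R ord_max)).
by rewrite /flink e.
Qed.

Lemma flinkX l k (P : {mpoly (SL R n)[l]}) (Q : {mpoly (SL R n.+2)[l.+1]}) (x : 'I_l -> {mpoly (Kz R n.+1)[k]}) :
  flink P Q ->
  mmap (specX k) (snocr x (zVX k)) Q
    = Cm k (zvar R ord_max ^- n.+1) * (\prod_a (1 - x a ^+ 2 * zX k ^+ 2)) * mmap (widX k) x P.
Proof. exact: flink_eval. Qed.

Lemma mmap_opXp (A : comNzRingType) m l (f : {rmorphism SL R m -> A}) (x : 'I_l -> A) P :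
  mmap f x (opXp P) = mmap f (snocr x 0) P.
Proof.
pose h : {rmorphism {mpoly (SL R m)[l]} -> A} := mmap f x.
rewrite /opXp -[LHS]/(h _) rmorph_mmap; apply: eq_mmap => [c|j] /=; first by rewrite /h /= mmapC.
by rewrite /snocr; case: unliftP => [k|] _; rewrite ?rmorph0 // /h /= mmapX mmap1U.
Qed.

(** A link puts 1/z into the last variable, whereas [opXp] puts 0 there. Exchanging the two costs
    the sign, and the variable set to 0 contributes the factor 1 to the product of the 1 - X_a^2
    z^2. *)
Lemma flink_Xp l (P : {mpoly (SL R n)[l.+1]}) (Q : {mpoly (SL R n.+2)[l.+2]}) :
  mskew Q -> flink P Q -> flink (opXp P) (- opXp Q).
Proof.
move=> sQ PQ; apply/flinkE; rewrite rmorphN /= !mmap_opXp.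
rewrite snocr_tperm mmap_skew // odd_tperm neq_lift expr1 mulN1r opprK.
by rewrite (flinkX _ PQ) big_snocr0.
Qed.

End RaisingOperator.

Section LoweringLink.
Variables (R : realType) (n : nat).
Local Notation z := (zvar R (@ord_max n)).

Definition wlink (w : {poly SL R n}) (w' : {poly SL R n.+2}) : Prop :=
  map_poly (@spec R n) w' = (1 - z ^+ 2 *: 'X^2) * map_poly (@wid R n) w.

Lemma wlink_eval w w' (A : comNzRingType) (i : {rmorphism Kz R n.+1 -> A}) x : wlink w w' ->
  (map_poly (i \o @spec R n) w').[x] = (1 - x ^+ 2 * i z ^+ 2) * (map_poly (i \o @wid R n) w).[x].
Proof.
rewrite /wlink !map_poly_comp => ->; rewrite rmorphM hornerM; congr (_ * _).
by rewrite rmorphB rmorph1 /= map_polyZ map_polyXn hornerD hornerN hornerZ hornerXn hornerC rmorphXn /= mulrC.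
Qed.

Lemma wlink_evalX w w' l (x : {mpoly (Kz R n.+1)[l]}) : wlink w w' ->
  (map_poly (specX R n l) w').[x] = (1 - x ^+ 2 * zX R n l ^+ 2) * (map_poly (widX R n l) w).[x].
Proof. exact: wlink_eval. Qed.

Lemma zVX2 l : zVX R n l ^+ 2 * zX R n l ^+ 2 = 1.
Proof. by rewrite -exprMn zVXK expr1n. Qed.

Lemma flink_Xm w w' l (P : {mpoly (SL R n)[l]}) (Q : {mpoly (SL R n.+2)[l.+1]}) :
  wlink w w' -> flink P Q -> flink (opXm w P) (opXm w' Q).
Proof.
move=> hw PQ; apply/flinkE; rewrite !mmap_opXm.
apply: (lowerF_snoc (b := fun x => 1 - x ^+ 2 * zX R n l.+1 ^+ 2)) => [|v|v].
- by rewrite (wlink_evalX _ hw) zVX2 subrr mul0r.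
- exact: wlink_evalX.
exact: flinkX.
Qed.

Lemma flink_Xm0 w w' (Q : {mpoly (SL R n.+2)[0]}) : wlink w w' -> flink 0 (opXm w' Q).
Proof.
move=> hw; apply/flinkE; rewrite mmap_opXm rmorph0 mulr0; apply: lowerF_snoc0.
by rewrite (wlink_evalX _ hw) zVX2 subrr mul0r.
Qed.

End LoweringLink.

Section Limits.
Variables (R : realType) (n l : nat).
Local Notation K := (Kz R n).
Local Notation L := (KzX R n l).
Local Notation E := (KzXt R n l).

Definition cS : {rmorphism SL R n -> L} := cK R n l \o @SLval R n.
Definition xL (j : 'I_l) : L := mu R n l 'X_j.
Definition eS : {rmorphism SL R n -> E} := cst L \o cS.
Lemma eSE : @EK R n l \o @SLval R n = eS.
Proof. by []. Qed.
Definition thL (x : L) : L := (map_poly cS (theta R n)).[x].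

Lemma muE P : mu R n l P = mmap cS xL P.
Proof.
rewrite -[in LHS](mmap_id P) rmorph_mmap; apply: eq_mmap => // c.
by rewrite /mu /= map_mpolyC.
Qed.

Lemma mu_neq0 P : P != 0 -> mu R n l P != 0.
Proof.
apply: contraNneq => /eqP; rewrite /mu /= -[0](rmorph0 (tofr R n l)).
by move=> /eqP/(@tofr_inj R n l)/eqP; rewrite -(rmorph0 (map_mpoly (@SLval R n))) => /eqP/map_SLval_inj->.
Qed.

Lemma thL_prod x : thL x = \prod_(j < n) (1 - cK R n l (zvar R j) * x).
Proof. by rewrite /thL -ThetaE. Qed.

Lemma fact_neq0 k : k`!%:R != 0 :> E.
Proof.
have -> : (k`!%:R : E) = EK l (zC n k`!%:R) by rewrite EK_cst !rmorph_nat.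
rewrite EK_cst fmorph_eq0 fmorph_eq0.
have -> : zC n k`!%:R = tz R n (k`!%:R%:MP) by [].
by rewrite tz_eq0 mpolyC_eq0 pnatr_eq0 -lt0n fact_gt0.
Qed.

Lemma two_neq0L : 2 != 0 :> L.
Proof.
have -> : (2 : L) = cK R n l (zC n 2) by rewrite !rmorph_nat.
rewrite fmorph_eq0.
have -> : zC n 2 = tz R n (2%:MP) by [].
by rewrite tz_eq0 mpolyC_eq0 pnatr_eq0.
Qed.

Variable pl : place L E.
Hypothesis lim_cst : forall a, lim pl (cst L a) a.

Lemma lim_EK c : lim pl (EK l c) (cK R n l c).
Proof. exact: lim_cst. Qed.

Lemma lim_EX j : lim pl (EX R n j) (xL j).
Proof. by rewrite EX_cst; apply: lim_cst. Qed.

Lemma lim_Theta x x0 : lim pl x x0 -> lim pl (Theta (EK l) x) (thL x0).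
Proof.
move=> h; rewrite thL_prod; apply: lim_prod => j _; apply: limB; first exact: lim1.
by apply: limM => //; apply: lim_EK.
Qed.

Lemma lim_lower k (w : E -> E) (w0 : L -> L) f f0 (x : 'I_k.+1 -> E) (x0 : 'I_k.+1 -> L) :
  (forall p, lim pl (w (x p)) (w0 (x0 p))) ->
  (forall p, lim pl (f (x \o lift p)) (f0 (x0 \o lift p))) ->
  lim pl (lowerF w f x) (lowerF w0 f0 x0).
Proof.
move=> hw hf; apply: lim_sum => p _; apply: limM; last exact: limM.
elim: (nat_of_ord p) => [|m IH]; first exact: lim1.
by rewrite !exprS; apply: limM => //; apply: limN; apply: lim1.
Qed.

End Limits.

Section LoweringAction.
Variables (R : realType) (n l : nat).
Local Notation L := (KzX R n l.+1).
Local Notation E := (KzXt R n l.+1).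
Local Notation x_ := (@EX R n l.+1).

Lemma Xm_rhsE (P : {mpoly (SL R n)[l]}) (t : E) : mskew P ->
  Xm_rhs (@EK R n l.+1) (map_mpoly (@SLval R n) P) t x_
  = lowerF (F1 (@EK R n l.+1) t) (fun y => mmap (eS R n l.+1) y P) x_.
Proof.
move=> sP; rewrite /Xm_rhs wedge1E; last exact: fact_neq0.
  by apply: eq_bigr => p _; rewrite /peval mmap_SLval eSE.
by move=> s x; rewrite /peval !mmap_SLval eSE mmap_skew.
Qed.

Lemma mu_opXm (w : {poly SL R n}) (P : {mpoly (SL R n)[l]}) :
  mu R n l.+1 (opXm w P) = lowerF (fun x => (map_poly (cS R n l.+1) w).[x])
    (fun y => mmap (cS R n l.+1) y P) (@xL R n l.+1).
Proof. by rewrite muE mmap_opXm. Qed.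

End LoweringAction.

(** * The kernels of x_0^- and x_1^- *)

Section OddQuotient.

(** This is (p(- X) - p(X)) / (2 X), expressed through the odd part so that no division takes
    place. *)
Definition oddq (A : comNzRingType) (p : {poly A}) : {poly A} := - (odd_poly p \Po 'X^2).

Lemma oddqE (A : comNzRingType) (p : {poly A}) : oddq p * ('X *+ 2) = (p \Po (- 'X)) - p.
Proof.
have X2 : 'X^2 \Po (- 'X) = 'X^2 :> {poly A} by rewrite comp_Xn_poly sqrrN.
rewrite -[in RHS](poly_even_odd p) comp_polyD comp_polyM comp_polyX -!comp_polyA X2 /oddq.
by ring.
Qed.

Lemma map_negX (A B : comNzRingType) (f : {rmorphism A -> B}) p :
  map_poly f (p \Po (- 'X)) = map_poly f p \Po (- 'X).
Proof. by rewrite map_comp_poly rmorphN /= map_polyX. Qed.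

Lemma map_oddq (A B : comNzRingType) (f : {rmorphism A -> B}) p :
  map_poly f (oddq p) * ('X *+ 2) = (map_poly f p \Po (- 'X)) - map_poly f p.
Proof.
by have /(congr1 (map_poly f)) := oddqE p; rewrite rmorphM rmorphB /= map_negX rmorphMn /= map_polyX.
Qed.

Lemma oddq_eval (A B : comNzRingType) (f : {rmorphism A -> B}) (p : {poly A}) x :
  (map_poly f (oddq p)).[x] * (2 * x) = (map_poly f p).[- x] - (map_poly f p).[x].
Proof.
have : (map_poly f (oddq p) * ('X *+ 2)).[x] = ((map_poly f p \Po (- 'X)) - map_poly f p).[x].
  by rewrite map_oddq.
by rewrite hornerM hornerMn hornerD horner_comp !hornerN !hornerX mulr_natl.
Qed.

End OddQuotient.

Section LoweringPolynomials.
Variables (R : realType) (n : nat).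

(** The limit of F_n(t|X) / t at t = 0, where Theta(t) and Theta(- t) tend to 1. *)
Definition wm1 : {poly SL R n} := oddq (theta R n).
(** The limit of F_n(t|X) at t = oo: t / (2 (X - t)) tends to - 1/2 and Theta(- t) / Theta(t) to
    (-1)^n. *)
Definition wm0 : {poly SL R n} :=
  SLc n 2^-1 *: ((-1) ^+ n *: theta R n - (theta R n \Po (- 'X))).

Lemma eval_halfdiff (A B : comNzRingType) (f : {rmorphism A -> B}) (c : A) m (p : {poly A}) x :
  (map_poly f (c *: ((-1) ^+ m *: p - (p \Po (- 'X))))).[x]
  = f c * ((-1) ^+ m * (map_poly f p).[x] - (map_poly f p).[- x]).
Proof.
rewrite map_polyZ hornerZ rmorphB /= map_polyZ rmorph_sign map_negX hornerD hornerN hornerZ.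
by rewrite horner_comp hornerN hornerX.
Qed.

Lemma wm0_eval (A : comNzRingType) (f : {rmorphism SL R n -> A}) x :
  (map_poly f wm0).[x]
  = f (SLc n 2^-1) * ((-1) ^+ n * (map_poly f (theta R n)).[x] - (map_poly f (theta R n)).[- x]).
Proof. exact: eval_halfdiff. Qed.
End LoweringPolynomials.

Section LoweringPolynomialsLink.
Variables (R : realType) (n : nat).
Local Notation z := (zvar R (@ord_max n)).

Lemma two_neq0K m : 2 != 0 :> Kz R m.
Proof.
have -> : (2 : Kz R m) = zC m 2 by rewrite rmorph_nat.
by rewrite fmorph_eq0 pnatr_eq0.
Qed.

Lemma wlink_theta : wlink (theta R n) (theta R n.+2).
Proof. exact: spec_theta. Qed.

Lemma evenfactor (A : comNzRingType) (c : A) : (1 - c *: 'X^2) \Po (- 'X) = 1 - c *: 'X^2.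
Proof. by rewrite rmorphB rmorph1 /= comp_polyZ comp_Xn_poly sqrrN. Qed.

Lemma wlink_negX (w : {poly SL R n}) (w' : {poly SL R n.+2}) :
  wlink w w' -> wlink (w \Po (- 'X)) (w' \Po (- 'X)).
Proof. by rewrite /wlink !map_negX => ->; rewrite comp_polyM evenfactor. Qed.

Lemma wlinkB (w v : {poly SL R n}) w' v' : wlink w w' -> wlink v v' -> wlink (w - v) (w' - v').
Proof. by rewrite /wlink !rmorphB /= => -> ->; rewrite mulrBr. Qed.

Lemma wlinkZ c d (w : {poly SL R n}) w' : spec d = wid c -> wlink w w' -> wlink (c *: w) (d *: w').
Proof. by rewrite /wlink !map_polyZ /= => -> ->; rewrite -scalerAr. Qed.

Lemma spec_sign : spec ((-1) ^+ n.+2) = wid ((-1) ^+ n : SL R n) :> Kz R n.+1.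
Proof. by rewrite !rmorph_sign !exprS !mulN1r opprK. Qed.

Lemma wlink_wm0 : wlink (wm0 R n) (wm0 R n.+2).
Proof.
apply: wlinkZ; first by rewrite spec_SLc wid_SLc.
by apply: wlinkB; [apply: wlinkZ spec_sign _|apply: wlink_negX]; apply: wlink_theta.
Qed.

Lemma wlink_wm1 : wlink (wm1 R n) (wm1 R n.+2).
Proof.
have X2 : ('X *+ 2 : {poly Kz R n.+1}) != 0.
  by rewrite -scaler_nat scaler_eq0 polyX_eq0 orbF two_neq0K.
apply: (mulIf X2); rewrite -mulrA /wm1 !map_oddq -!map_negX -!rmorphB.
by apply: wlinkB; [apply: wlink_negX|]; apply: wlink_theta.
Qed.

End LoweringPolynomialsLink.

Section LoweringGood.
Variables (R : realType) (n : nat).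
Variables (act : Ui R -> skewA R n -> skewA R n).
Hypotheses (act_action : is_action act).

Lemma xL_neq0 l j : xL R n j != 0 :> KzX R n l.
Proof. apply: mu_neq0; apply/eqP => /(congr1 (mcoeff U_(j))).
by rewrite mcoeffX eqxx mcoeff0 => /eqP; rewrite oner_eq0. Qed.

Lemma in_Xm_gt0 k : in_Ures (Xm_gt0 R k).
Proof.
have [_ _ _ Z] := closed_Ures R.
have Z0 : in_Ures (0 : Uq R).
  by rewrite -(scale0r (Ux R false 0)); apply: Z (specializes_nat R 0) _; apply: Ures_x.
have [b hb] : exists b, specializes ((q_ R)^-1 ^+ k) b.
  elim: k => [|k [b hb]]; first by exists 1; apply: (@specializes_nat _ 1).
  by exists ('i^-1 * b); rewrite exprS; apply: specializesM => //; apply: specializes_qV.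
rewrite /Xm_gt0; case: eqP => _; first exact: Z0.
by rewrite -exprnN -exprVn; apply: Z hb _; apply: Ures_x.
Qed.

Lemma in_Xm_le0 k : in_Ures (Xm_le0 R k).
Proof.
have [_ _ _ Z] := closed_Ures R.
have [b hb] : exists b, specializes ((q_ R) ^+ k) b.
  elim: k => [|k [b hb]]; first by exists 1; apply: (@specializes_nat _ 1).
  by exists ('i * b); rewrite exprS; apply: specializesM => //; apply: specializes_q.
by rewrite /Xm_le0 -exprnP; apply: Z hb _; apply: Ures_x.
Qed.

Lemma xm1_val (F : fieldType) (x a b : F) : 2 != 0 :> F -> x != 0 ->
  forall w, w * (2 * x) = a - b -> (2 * (x - 0))^-1 * ((1 * a - 1 * b) / 1) = w.
Proof.
move=> h2 x0 w e; rewrite !mul1r divr1 -e subr0 mulrC mulfK //.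
by rewrite mulf_neq0.
Qed.

Lemma mul2_neq0 (F : fieldType) (x : F) : 2 != 0 :> F -> x != 0 -> 2 * (x - 0) != 0.
Proof. by move=> h2 x0; rewrite subr0 mulf_neq0. Qed.

Lemma lim_nat (F E : fieldType) (p : place F E) m : lim p m%:R m%:R.
Proof. by have := lim_c p m%:R; rewrite rmorph_nat. Qed.

Lemma lim_F1_0 (F E : fieldType) (p : place F E) (t x a b c d : E) (x0 c0 d0 : F) :
  2 != 0 :> F -> x0 != 0 -> lim p t 0 -> lim p x x0 -> lim p a 1 -> lim p b 1 -> lim p c c0 -> lim p d d0 ->
  lim p ((2 * (x - t))^-1 * ((a * d - b * c) / a)) ((2 * (x0 - 0))^-1 * ((1 * d0 - 1 * c0) / 1)).
Proof.
move=> h2 h0 ht hx ha hb hc hd; apply: limM.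
  by apply: (limV (mul2_neq0 h2 h0)); apply: limM; [apply: lim_nat | apply: limB].
by apply: limM; [apply: limB; apply: limM | apply: limV => //; apply: oner_neq0].
Qed.

Lemma thL0 l : @thL R n l 0 = 1.
Proof. by rewrite thL_prod big1 // => j _; rewrite mulr0 subr0. Qed.

Lemma act_Xm_gt0_E (u : Ures R) l (P : skewA R n) (P' : {mpoly (SL R n)[l]}) :
  Ures_val u = Xm_gt0 R 1 -> lifts P P' ->
  act (Uspec u) P l.+1 = map_mpoly (@SLval R n) (opXm (wm1 R n) P').
Proof.
move=> uE hP; pose L := KzX R n l.+1; pose E := KzXt R n l.+1.
have := @act_Xm_gt0 _ _ _ act_action l (fun k => MkUres (in_Xm_gt0 k)) (fun k => erefl) P.
rewrite -hP => /expands0P.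
rewrite (Xm_rhsE _ (lifts_skew hP)).
(* This is [F1] divided by t: x_1^- belongs to the coefficient of t, so the factor t is split off
   before the limit at t = 0 is taken. *)
pose w' (x : E) := (2 * (x - Et R n l.+1))^-1 *
   (Theta2 (@EK R n l.+1) (Et R n l.+1) (- x) / Theta (@EK R n l.+1) (Et R n l.+1)).
rewrite (_ : lowerF _ _ _ = pu (place_0 L) *
   lowerF w' (fun y => mmap (eS R n l.+1) y P') (@EX R n l.+1)); last first.
  rewrite /lowerF mulr_sumr; apply: eq_bigr => p _; rewrite [RHS]mulrCA; congr (_ * _).
  by rewrite place_0_u [RHS]mulrA; congr (_ * _); rewrite /F1 -mulrA.
have cl a : lim (place_0 L) (cst L a) a := lim_c (place_0 L) a.
have tl : lim (place_0 L) (Et R n l.+1) 0 by rewrite /Et -place_0_u; apply: lim_u.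
have h : lim (place_0 L) (lowerF w' (fun y => mmap (eS R n l.+1) y P') (@EX R n l.+1))
   (mu R n l.+1 (opXm (wm1 R n) P')).
  rewrite mu_opXm; apply: (lim_lower (x0 := @xL R n l.+1)) => p; last first.
    by apply: lim_mmap => [c|j]; [apply: cl | apply: (lim_EX cl)].
  have h2 := two_neq0L R n l.+1.
  have x0 : xL R n p != 0 := xL_neq0 p.
  have xl := lim_EX cl p.
  rewrite -(xm1_val h2 x0 (oddq_eval (cS R n l.+1) (theta R n) _)).
  rewrite -[(map_poly _ _).[- _]]/(thL _) -[(map_poly _ _).[xL _ _ _]]/(thL _).
  have t1 := lim_Theta cl tl; rewrite thL0 in t1.
  have t2 := lim_Theta cl (limN tl); rewrite oppr0 thL0 in t2.
  have t3 := lim_Theta cl xl.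
  have t4 := lim_Theta cl (limN xl).
  rewrite /w' /Theta2 opprK.
  exact: (lim_F1_0 h2 x0 tl xl t1 t2 t3 t4).
move=> /(expands_shift h); rewrite scale1r => e.
apply: (@tofr_inj R n l.+1); rewrite -[RHS]e.
by congr (tofr _ _ _ (act _ P _)); apply: Uspec_eq; rewrite uE.
Qed.

End LoweringGood.

(** * Limits at t = oo *)

Section LimitsAtInfinity.
Variables (F E : fieldType) (p : place F E) (t : E).
Hypothesis tu : t^-1 = pu p.

Lemma t_neq0 : t != 0.
Proof. by rewrite -invr_eq0 tu; apply: pu_neq0. Qed.

(** Only quotients have limits here: t / (2 (x - t)) is rewritten through 1/t, and [a] and [b],
    which stand for Theta(t) and Theta(- t), enter only by their ratio. *)
Lemma lim_F1_oo (x a b c d : E) (s x0 c0 d0 : F) :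
  2 != 0 :> F -> lim p x x0 -> a != 0 -> lim p (b / a) s -> lim p c c0 -> lim p d d0 ->
  lim p (t / (2 * (x - t)) * ((a * d - b * c) / a)) (2^-1 * (s * c0 - d0)).
Proof.
move=> h2 hx a0 hb hc hd.
have -> : t / (2 * (x - t)) = (2 * (x * pu p - 1))^-1.
  have t0 := t_neq0; rewrite -tu -[X in X / _]invrK -invfM mulrC; congr (_^-1).
  by rewrite -mulrA mulrBl divff.
have -> : (a * d - b * c) / a = d - b / a * c.
  by rewrite mulrBl mulrAC divff // mul1r mulrAC.
have -> : 2^-1 * (s * c0 - d0) = (2 * (x0 * 0 - 1))^-1 * (d0 - s * c0).
  by rewrite mulr0 sub0r mulrN1 invrN mulNr -mulrN opprB.
apply: limM; last by apply: limB => //; apply: limM.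
apply: limV; first by rewrite mulr0 sub0r mulrN1 oppr_eq0.
apply: limM; first exact: lim_nat.
by apply: limB; [apply: limM => //; apply: lim_u | apply: lim1].
Qed.

Lemma linear_factor_neq0 (z : E) z0 : z0 != 0 -> lim p z z0 -> 1 - z * t != 0.
Proof.
move=> z0n hz; have t0 := t_neq0.
have : pu p - z != 0.
  by apply: (@lim_neq0 _ _ p _ (0 - z0)); [rewrite sub0r oppr_eq0 | apply: limB => //; apply: lim_u].
by apply: contraNneq => e; rewrite -tu -[z](mulfK t0) (_ : z * t = 1) ?mul1r ?subrr //; apply/eqP; rewrite eq_sym -subr_eq0 e.
Qed.

Lemma lim_linear_ratio (z : E) z0 : z0 != 0 -> lim p z z0 -> lim p ((1 - z * - t) / (1 - z * t)) (-1).
Proof.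
move=> z0n hz; have t0 := t_neq0.
have -> : (1 - z * - t) / (1 - z * t) = (pu p + z) / (pu p - z).
  have u1 : pu p * t = 1 by rewrite -tu mulVf.
  have -> : 1 - z * - t = (pu p + z) * t by rewrite mulrN opprK mulrDl u1.
  have -> : 1 - z * t = (pu p - z) * t by rewrite mulrBl u1.
  by rewrite -mulf_div divff // mulr1.
have -> : -1 = (0 + z0) / (0 - z0) by rewrite add0r sub0r invrN mulrN divff.
apply: limM; first by apply: limD => //; apply: lim_u.
by apply: limV; [rewrite sub0r oppr_eq0 | apply: limB => //; apply: lim_u].
Qed.

End LimitsAtInfinity.

Section ThetaAtInfinity.
Variables (R : realType) (n l : nat).
Local Notation L := (KzX R n l).
Local Notation E := (KzXt R n l).
Local Notation t := (Et R n l).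

Lemma Et_inv : t^-1 = pu (place_oo L). Proof. by []. Qed.

Lemma cst_oo a : lim (place_oo L) (cst L a) a. Proof. exact: (lim_c (place_oo L)). Qed.
Lemma cst_0 a : lim (place_0 L) (cst L a) a. Proof. exact: (lim_c (place_0 L)). Qed.

Lemma cK_zvar_neq0 j : cK R n l (zvar R j) != 0.
Proof. by rewrite fmorph_eq0; apply: zvar_neq0. Qed.

Lemma Theta_t_neq0 : Theta (@EK R n l) t != 0.
Proof.
apply/prodf_neq0 => j _.
exact: (linear_factor_neq0 Et_inv (cK_zvar_neq0 j) (lim_EK cst_oo _)).
Qed.

Lemma Theta_ratio : lim (place_oo L) (Theta (@EK R n l) (- t) / Theta (@EK R n l) t) ((-1) ^+ n).
Proof.
have -> : (-1) ^+ n = \prod_(j < n) (-1 : L) by rewrite prodr_const card_ord.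
rewrite /Theta -prodf_div; apply: lim_prod => j _.
exact: (lim_linear_ratio Et_inv (cK_zvar_neq0 j) (lim_EK cst_oo _)).
Qed.

End ThetaAtInfinity.

Section LoweringGood0.
Variables (R : realType) (n : nat).
Variables (act : Ui R -> skewA R n -> skewA R n).
Hypotheses (act_action : is_action act).

Lemma cS_half l : cS R n l (SLc n 2^-1) = 2^-1.
Proof. have -> : cS R n l (SLc n 2^-1) = cK R n l (zC n 2^-1) by rewrite /cS /= SLcK.
by rewrite -[zC n _]/((@zC R n : {rmorphism _ -> _}) _) !fmorphV !rmorph_nat. Qed.

Lemma act_Xm_le0_E (u : Ures R) l (P : skewA R n) (P' : {mpoly (SL R n)[l]}) :
  Ures_val u = Xm_le0 R 0 -> lifts P P' ->
  act (- 1 *: Uspec u) P l.+1 = map_mpoly (@SLval R n) (opXm (wm0 R n) P').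
Proof.
move=> uE hP; pose L := KzX R n l.+1; pose E := KzXt R n l.+1.
have := @act_Xm_le0 _ _ _ act_action l (fun k => MkUres (in_Xm_le0 R k)) (fun k => erefl) P.
rewrite -hP => /expandsooP.
rewrite (Xm_rhsE _ (lifts_skew hP)) => /expands_lim h1.
have h : lim (place_oo L) (lowerF (F1 (@EK R n l.+1) (Et R n l.+1)) (fun y => mmap (eS R n l.+1) y P') (@EX R n l.+1))
   (mu R n l.+1 (opXm (wm0 R n) P')).
  rewrite mu_opXm.
  apply: (lim_lower (x0 := @xL R n l.+1)) => p; last first.
    by apply: lim_mmap => [c|j]; [apply: cst_oo | apply: (lim_EX (@cst_oo R n l.+1))].
  have xl := lim_EX (@cst_oo R n l.+1) p.
  rewrite wm0_eval cS_half.
  have t3 := lim_Theta (@cst_oo R n l.+1) xl.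
  have t4 := lim_Theta (@cst_oo R n l.+1) (limN xl).
  rewrite /F1 /Theta2 opprK.
  exact: (lim_F1_oo (Et_inv R n l.+1) (two_neq0L R n l.+1) xl (Theta_t_neq0 R n l.+1) (Theta_ratio R n l.+1) t3 t4).
have e := lim_unique h1 h.
apply: (@tofr_inj R n l.+1); rewrite -[RHS]e.
by congr (tofr _ _ _ (act (_ *: _) P _)); apply: Uspec_eq; rewrite uE.
Qed.

End LoweringGood0.

(** * Generators that preserve links *)

Section GoodGenerators.
Variables (R : realType) (n : nat).
Variables (act : Ui R -> skewA R n -> skewA R n) (act2 : Ui R -> skewA R n.+2 -> skewA R n.+2).
Hypotheses (act_action : is_action act) (act2_action : is_action act2).
Local Notation good := (good act act2).

Lemma goodZ_inv c g : c != 0 -> good (c *: g) -> good g.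
Proof.
move=> c0 h; rewrite -[g]scale1r -(mulVf c0) -scalerA.
exact: (goodZ act_action act2_action).
Qed.

Lemma skewA_opp m (c : R[i]) (P A B : skewA R m) l :
  A = zC m (- c) *: P -> B = zC m c *: P -> A l = - B l.
Proof. by move=> -> ->; rewrite !AcompZ rmorphN scaleNr. Qed.

Lemma actN m (act' : Ui R -> skewA R m -> skewA R m) (c : R[i]) (g : Ui R) (P : skewA R m) l :
  is_action act' -> act' (- c *: g) P l = - act' (c *: g) P l.
Proof. by move=> a; apply: (skewA_opp l (act_Z a (- c) g P) (act_Z a c g P)). Qed.

Lemma opp_eq (V : zmodType) (x b c : V) : c = x -> b = - c -> - x = b.
Proof. by move=> -> ->. Qed.

Lemma iz_neq0 (m : int) : 'i ^ m != 0 :> R[i].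
Proof. by rewrite expfz_neq0 // neq0Ci. Qed.

(** This change of sign between the normalizations for n and n + 2 compensates the one in
    [flink_Xp]. *)
Lemma iz_shift : 'i ^ (1 - n%:Z) = - 'i ^ (1 - n.+2%:Z) :> R[i].
Proof.
have -> : 1 - n%:Z = (1 - n.+2%:Z) + 2 by lia.
by rewrite expfzDr ?neq0Ci // -exprnP sqrCi mulrN1.
Qed.

Lemma good_Xp0 (u : Ures R) : Ures_val u = Ux R true 0 -> good (Uspec u).
Proof.
move=> uE; apply: (goodZ_inv (iz_neq0 (1 - n%:Z))).
apply: (@goodI R n act act2 _ (fun P' l => opXp (P' l.+1)) (fun Q' l => - opXp (Q' l.+1))).
- by move=> P P' hP l; rewrite /lifts (act_xp0 act_action uE (hP l.+1)).
- move=> Q Q' hQ l; have := act_xp0 act2_action uE (hQ l.+1).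
  move=> h; have := actN ('i ^ (1 - n.+2%:Z)) (Uspec u) Q l act2_action.
  rewrite /lifts -iz_shift rmorphN /=.
  by move/esym; move/esym/(opp_eq h)/esym.
by move=> P' Q' _ sQ PQ l; apply: flink_Xp.
Qed.

Definition opXmA m (w : {poly SL R m}) (P' : forall l, {mpoly (SL R m)[l]}) l : {mpoly (SL R m)[l]} :=
  if l is l'.+1 then opXm w (P' l') else 0.

Lemma good_opXm g w w' : wlink w w' ->
  (forall P, act g P 0%N = 0) -> (forall Q, act2 g Q 0%N = 0) ->
  (forall P l P', lifts P P' -> lifts (act g P) (opXm w P' : {mpoly _[l.+1]})) ->
  (forall Q l Q', lifts Q Q' -> lifts (act2 g Q) (opXm w' Q' : {mpoly _[l.+1]})) ->
  good g.
Proof.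
move=> hw h1 h2 h3 h4; apply: (@goodI R n act act2 _ (opXmA w) (opXmA w')).
- by move=> P P' hP [|l] /=; [rewrite /lifts h1 rmorph0 | apply: h3].
- by move=> P P' hP [|l] /=; [rewrite /lifts h2 rmorph0 | apply: h4].
by move=> P' Q' _ _ PQ [|l] /=; [apply: flink_Xm0 hw | apply: flink_Xm].
Qed.

Lemma good_Xm1 (u : Ures R) : Ures_val u = Ux R false 1 -> good (Uspec u).
Proof.
move=> uE; pose v := MkUres (in_Xm_gt0 R 1).
have vE : Ures_val v = (q_ R)^-1 *: Ures_val u.
  by rewrite uE /= /Xm_gt0 /= -invr_expz expr1z.
have e : Uspec v = 'i^-1 *: Uspec u by apply: UspecZ vE; apply: specializes_qV.
apply: (@goodZ_inv 'i^-1); first by rewrite invr_eq0 neq0Ci.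
rewrite -e; apply: (good_opXm (wlink_wm1 R n)).
- by move=> P; apply: (act_Xm_gt0_0 act_action) (erefl : Ures_val v = _) P.
- by move=> P; apply: (act_Xm_gt0_0 act2_action) (erefl : Ures_val v = _) P.
- by move=> P l P' hP; rewrite /lifts (act_Xm_gt0_E act_action (erefl : Ures_val v = _) hP).
by move=> P l P' hP; rewrite /lifts (act_Xm_gt0_E act2_action (erefl : Ures_val v = _) hP).
Qed.

Lemma good_Xm0 (u : Ures R) : Ures_val u = Ux R false 0 -> good (Uspec u).
Proof.
move=> uE; have vE : Ures_val u = Xm_le0 R 0.
  by rewrite uE /Xm_le0 expr0z scale1r oppr0.
apply: (@goodZ_inv (-1)); first by rewrite oppr_eq0 oner_eq0.
apply: (good_opXm (wlink_wm0 R n)).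
- by move=> P; rewrite (act_Z act_action) AcompZ (act_Xm_le0_0 act_action vE) scaler0.
- by move=> P; rewrite (act_Z act2_action) AcompZ (act_Xm_le0_0 act2_action vE) scaler0.
- by move=> P l P' hP; rewrite /lifts (act_Xm_le0_E act_action vE hP).
by move=> P l P' hP; rewrite /lifts (act_Xm_le0_E act2_action vE hP).
Qed.

(** [d] concerns the component of degree 0 of the second member, on which a link puts no condition.
    For t_1 the other scalars agree, because n - 2 l does not change when n grows by 2 and l by
    1. *)
Lemma good_scal (g : Ui R) (c : nat -> R[i]) :
  (forall P l, act g P l = zC n (c l) *: P l) ->
  (forall Q l, act2 g Q l.+1 = zC n.+2 (c l) *: Q l.+1) ->
  (exists d, forall Q, act2 g Q 0%N = zC n.+2 d *: Q 0%N) -> good g.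
Proof.
move=> h1 h2 [d h3].
apply: (@goodI R n act act2 _ (fun P' l => SLc n (c l) *: P' l)
  (fun Q' l => SLc n.+2 (if l is l'.+1 then c l' else d) *: Q' l)).
- by move=> P P' hP l; rewrite /lifts map_mpolyZ /= SLcK (hP l) h1.
- move=> P P' hP l; rewrite /lifts map_mpolyZ /= SLcK (hP l).
  by case: l => [|l]; [rewrite h3 | rewrite h2].
by move=> P' Q' _ _ PQ l; apply: flinkZ => //; rewrite spec_SLc wid_SLc.
Qed.

Lemma good_T (u : Ures R) : Ures_val u = Ut R -> good (Uspec u).
Proof.
move=> uE; apply: (good_scal (c := fun l => 'i ^ (n%:Z - 2 * l%:Z))).
- by move=> P l; apply: (act_T act_action uE).
- move=> P l; rewrite (act_T act2_action uE); congr (zC _ ('i ^ _) *: _); lia.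
by exists ('i ^ (n.+2%:Z - 2 * 0%:Z)) => Q; apply: (act_T act2_action uE).
Qed.

Lemma good_T' (u : Ures R) : Ures_val u = Ut' R -> good (Uspec u).
Proof.
move=> uE; apply: (good_scal (c := fun l => 'i ^ (- (n%:Z - 2 * l%:Z)))).
- by move=> P l; apply: (act_T' act_action uE).
- move=> P l; rewrite (act_T' act2_action uE); congr (zC _ ('i ^ _) *: _); lia.
by exists ('i ^ (- (n.+2%:Z - 2 * 0%:Z))) => Q; apply: (act_T' act2_action uE).
Qed.

End GoodGenerators.

(** * The divided square of [x_0^-] *)

Section DoubleLowering.

Definition lower2F (A : comNzRingType) l (W : A -> A -> A) (f : ('I_l -> A) -> A) (x : 'I_l.+2 -> A) : A :=
  \sum_(p < l.+2) (-1) ^+ p * lowerF (W (x p)) f (x \o lift p).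

Lemma lowerFZ (A : comNzRingType) l (c : A) w (f : ('I_l -> A) -> A) x :
  lowerF (fun v => c * w v) f x = c * lowerF w f x.
Proof. by rewrite /lowerF mulr_sumr; apply: eq_bigr => p _; rewrite -mulrA mulrCA. Qed.

Lemma lowerF0 (A : comNzRingType) l (w : A -> A) (f : ('I_l -> A) -> A) x :
  (forall v, w v = 0) -> lowerF w f x = 0.
Proof. by move=> h; rewrite /lowerF big1 // => p _; rewrite h mul0r mulr0. Qed.

Lemma lower2F_snoc (A : comNzRingType) l (W W' : A -> A -> A) (f : ('I_l -> A) -> A)
  (f' : ('I_l.+1 -> A) -> A) (b : A -> A) (y k : A) (x : 'I_l.+2 -> A) :
  (forall v, W' y v = 0) -> (forall v, W' v y = 0) -> (forall u v, W' u v = b u * b v * W u v) ->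
  (forall v, f' (snocr v y) = k * (\prod_a b (v a)) * f v) ->
  lower2F W' f' (snocr x y) = k * (\prod_a b (x a)) * lower2F W f x.
Proof.
move=> Wy0 Wy Wb ff; rewrite /lower2F big_ord_max snocr_max lowerF0 // mulr0 addr0 mulr_sumr.
apply: eq_bigr => p _; rewrite snocr_lift snocr_lift_max lift_max.
rewrite (lowerF_snoc (w := fun v => b (x p) * W (x p) v) (b := b) (f := f) (k := k)) //; last first.
  by move=> v; rewrite Wb mulrA [b v * _]mulrC.
by rewrite lowerFZ [in RHS](bigD1_ord p) //=; ring.
Qed.

Lemma lower2F_snoc0 (A : comNzRingType) (W : A -> A -> A) (f : ('I_0 -> A) -> A) (y : A) (x : 'I_1 -> A) :
  (forall v, W y v = 0) -> (forall v, W v y = 0) -> lower2F W f (snocr x y) = 0.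
Proof.
move=> Wy0 Wy; rewrite /lower2F big_ord_max snocr_max lowerF0 // mulr0 addr0 big1 // => p _.
by rewrite snocr_lift snocr_lift_max lowerF_snoc0 // mulr0.
Qed.

Lemma rmorph_lower2 (A B : comNzRingType) (h : {rmorphism A -> B}) l
  (W : A -> A -> A) (W' : B -> B -> B) (f : ('I_l -> A) -> A) f' x :
  (forall a b, h (W a b) = W' (h a) (h b)) -> (forall y, h (f y) = f' (h \o y)) ->
  h (lower2F W f x) = lower2F W' f' (h \o x).
Proof.
move=> hW hf; rewrite /lower2F rmorph_sum; apply: eq_bigr => p _.
by rewrite rmorphM rmorph_sign; congr (_ * _); apply: rmorph_lower.
Qed.

Definition pairf (A : Type) (x y : A) : 'I_2 -> A := fun i => if i == ord0 then x else y.

Lemma comp_pairf (A B : Type) (h : A -> B) x y : h \o pairf x y = pairf (h x) (h y).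
Proof. by apply: functional_extensionality_dep => i; rewrite /= /pairf; case: ifP. Qed.

Variable R : realType.

Definition opXm2 n l (W : {mpoly (SL R n)[2]}) (P : {mpoly (SL R n)[l]}) : {mpoly (SL R n)[l.+2]} :=
  lower2F (fun x y => mmap (@mpolyC l.+2 (SL R n)) (pairf x y) W)
    (fun y => mmap (@mpolyC l.+2 (SL R n)) y P) (fun j => 'X_j).

Lemma mmap_opXm2 n l (A : comNzRingType) (f : {rmorphism SL R n -> A}) (x : 'I_l.+2 -> A) W P :
  mmap f x (opXm2 W P) = lower2F (fun a b => mmap f (pairf a b) W) (fun y => mmap f y P) x.
Proof.
pose h : {rmorphism {mpoly (SL R n)[l.+2]} -> A} := mmap f x.
have hx : h \o (fun j => 'X_j) = x.
  by apply: functional_extensionality_dep => j; rewrite /h /= mmapX mmap1U.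
rewrite -[in RHS]hx -[LHS]/(h (opXm2 W P)) /opXm2.
apply: rmorph_lower2 => [a b|y].
  rewrite rmorph_mmap; apply: eq_mmap => [c|j]; first by rewrite /h /= mmapC.
  by rewrite comp_pairf.
by rewrite rmorph_mmap; apply: eq_mmap => // c /=; rewrite /h /= mmapC.
Qed.

End DoubleLowering.

Section DoubleKernel.

Definition X0 (A : comNzRingType) : {mpoly A[2]} := 'X_ord0.
Definition X1 (A : comNzRingType) : {mpoly A[2]} := 'X_(lift ord0 ord0).
Definition pX (A : comNzRingType) (p : {poly A}) (x : {mpoly A[2]}) := (map_poly (@mpolyC 2 A) p).[x].

Lemma factor_diff (A : comNzRingType) (p : {poly A}) (a b : A) : exists q, p.[a] - p.[b] = (a - b) * q.
Proof.
have : root (p - p.[b]%:P) b by rewrite /root hornerD hornerN hornerC subrr.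
move=> /factor_theorem[q hq]; exists q.[a].
have := congr1 (horner^~ a) hq; rewrite hornerM hornerD hornerN hornerC hornerXsubC => ->.
by rewrite mulrC.
Qed.

(* The two-variable Theta vanishes on X_0 + X_1 = 0, which makes the kernel of
   the divided square of x_0^- a polynomial. *)
Lemma Dquot_ex (A : comNzRingType) (p : {poly A}) : exists D,
  (X0 A + X1 A) * D = pX p (X0 A) * pX p (X1 A) - pX p (- X0 A) * pX p (- X1 A).
Proof.
have [q1 h1] := factor_diff (map_poly (@mpolyC 2 A) p) (X1 A) (- X0 A).
have [q2 h2] := factor_diff (map_poly (@mpolyC 2 A) p) (X0 A) (- X1 A).
(* With x = X_0 and y = X_1, the difference p(x) p(y) - p(- x) p(- y) is p(x) (p(y) - p(- x)) + p(-
   x) (p(x) - p(- y)), and both inner differences are multiples of x + y. *)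
exists (pX p (X0 A) * q1 + pX p (- X0 A) * q2).
rewrite mulrDr [X in X + _]mulrCA [X in _ + X]mulrCA.
have -> : (X0 A + X1 A) * q1 = pX p (X1 A) - pX p (- X0 A) by rewrite {}/pX h1; ring.
have -> : (X0 A + X1 A) * q2 = pX p (X0 A) - pX p (- X1 A) by rewrite {}/pX h2; ring.
ring.
Qed.

Definition Dquot (A : comNzRingType) (p : {poly A}) : {mpoly A[2]} := sval (cid (Dquot_ex p)).

Lemma DquotE (A : comNzRingType) (p : {poly A}) :
  (X0 A + X1 A) * Dquot p = pX p (X0 A) * pX p (X1 A) - pX p (- X0 A) * pX p (- X1 A).
Proof. by rewrite /Dquot; case: cid. Qed.

(** The limit at t = oo of the kernel of the divided square, in the variables X_0 and X_1. Its
    second and third summands contribute opposite multiples of Theta(- X_0) Theta(- X_1), which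
    cancel; what is left of them carries the limit (-1)^n of Theta(- t) / Theta(t). *)
Definition W2 (A : comNzRingType) (n : nat) (p : {poly A}) : {mpoly A[2]} :=
  (X0 A - X1 A) * Dquot p + (-1) ^+ n * (pX p (- X1 A) * pX p (X0 A) - pX p (- X0 A) * pX p (X1 A)).

Variables (A B : comNzRingType) (f : {rmorphism A -> B}).

Lemma mmap_X0 x y : mmap f (pairf x y) (X0 A) = x.
Proof. by rewrite mmapX mmap1U. Qed.
Lemma mmap_X1 x y : mmap f (pairf x y) (X1 A) = y.
Proof. by rewrite mmapX mmap1U. Qed.

Lemma mmap_pX (p : {poly A}) x y v :
  mmap f (pairf x y) (pX p v) = (map_poly f p).[mmap f (pairf x y) v].
Proof.
pose h : {rmorphism {mpoly A[2]} -> B} := mmap f (pairf x y).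
rewrite /pX -[LHS]/(h _) -horner_map /= -map_poly_comp /=; congr (_.[_]); apply: eq_map_poly => c.
by rewrite /h /= mmapC.
Qed.

Lemma Dquot_eval p x y : (x + y) * mmap f (pairf x y) (Dquot p)
  = (map_poly f p).[x] * (map_poly f p).[y] - (map_poly f p).[- x] * (map_poly f p).[- y].
Proof.
have := congr1 (mmap f (pairf x y)) (DquotE p).
by rewrite rmorphM rmorphB rmorphD !rmorphM /= !mmap_pX !rmorphN /= mmap_X0 mmap_X1.
Qed.

Lemma W2_eval n p x y : mmap f (pairf x y) (W2 n p) = (x - y) * mmap f (pairf x y) (Dquot p)
  + (-1) ^+ n * ((map_poly f p).[- y] * (map_poly f p).[x] - (map_poly f p).[- x] * (map_poly f p).[y]).
Proof.
rewrite /W2 rmorphD !rmorphM !rmorphB !rmorphM rmorph_sign /= !mmap_pX !rmorphN /=.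
by rewrite mmap_X0 mmap_X1.
Qed.

End DoubleKernel.

Section DoubleLink.
Variables (R : realType) (n : nat).
Local Notation z := (zvar R (@ord_max n)).
Local Notation K' := (Kz R n.+1).

Definition wl2 (W : {mpoly (SL R n)[2]}) (W' : {mpoly (SL R n.+2)[2]}) : Prop :=
  forall (A : comNzRingType) (i : {rmorphism K' -> A}) (x y : A),
  mmap (i \o @spec R n) (pairf x y) W'
  = (1 - x ^+ 2 * i z ^+ 2) * (1 - y ^+ 2 * i z ^+ 2) * mmap (i \o @wid R n) (pairf x y) W.

Lemma alg_W2_link (B : comNzRingType) (x y bx b_y D D' s a b c d : B) :
  (x + y) * D = a * b - c * d ->
  (x + y) * D' = (bx * a) * (b_y * b) - (bx * c) * (b_y * d) ->
  injective ( *%R (x + y)) ->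
  (x - y) * D' + s * ((b_y * d) * (bx * a) - (bx * c) * (b_y * b))
  = bx * b_y * ((x - y) * D + s * (d * a - c * b)).
Proof.
move=> h1 h2 canc; have -> : D' = bx * b_y * D.
  by apply: canc; rewrite h2 [RHS]mulrCA h1; ring.
by ring.
Qed.

Lemma rmorph_factor2 (A B : comNzRingType) (h : {rmorphism A -> B}) (a b c w : A) :
  h ((1 - a ^+ 2 * c ^+ 2) * (1 - b ^+ 2 * c ^+ 2) * w)
  = (1 - h a ^+ 2 * h c ^+ 2) * (1 - h b ^+ 2 * h c ^+ 2) * h w.
Proof. by rewrite !rmorphM !rmorphB !rmorphM rmorph1. Qed.

Lemma wl2_W2 : wl2 (W2 n (theta R n)) (W2 n.+2 (theta R n.+2)).
Proof.
pose M := {mpoly K'[2]}; pose C : {rmorphism K' -> M} := @mpolyC 2 K'.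
(* [Dquot] is characterized only after multiplication by X_0 + X_1. The identity is therefore proved
   for two indeterminates, where this factor can be cancelled, and then evaluated in [A]. *)
suff key : mmap (C \o @spec R n) (pairf (X0 K') (X1 K')) (W2 n.+2 (theta R n.+2))
  = (1 - X0 K' ^+ 2 * C z ^+ 2) * (1 - X1 K' ^+ 2 * C z ^+ 2)
    * mmap (C \o @wid R n) (pairf (X0 K') (X1 K')) (W2 n (theta R n)).
  move=> A i x y; pose h : {rmorphism M -> A} := mmap i (pairf x y).
  have hC c : h (C c) = i c by rewrite /h /= mmapC.
  have hX0 : h (X0 K') = x by rewrite /h /= mmap_X0.
  have hX1 : h (X1 K') = y by rewrite /h /= mmap_X1.
  have e m (g : {rmorphism SL R m -> K'}) (W : {mpoly (SL R m)[2]}) :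
      h (mmap (C \o g) (pairf (X0 K') (X1 K')) W) = mmap (i \o g) (pairf x y) W.
    rewrite rmorph_mmap; apply: eq_mmap => [c|j]; first exact: hC.
    by rewrite comp_pairf hX0 hX1.
  have := congr1 h key.
  by rewrite (e _ (@spec R n)) rmorph_factor2 (e _ (@wid R n)) hC hX0 hX1.
rewrite !W2_eval.
have th x : (map_poly (C \o @spec R n) (theta R n.+2)).[x]
   = (1 - x ^+ 2 * C z ^+ 2) * (map_poly (C \o @wid R n) (theta R n)).[x].
  exact: (wlink_eval C x (wlink_theta R n)).
have := Dquot_eval (C \o @spec R n) (theta R n.+2) (X0 K') (X1 K').
have := Dquot_eval (C \o @wid R n) (theta R n) (X0 K') (X1 K').
rewrite !th !sqrrN !exprS !mulN1r opprK => h1 h2.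
apply: (alg_W2_link ((-1) ^+ n) h1 h2).
apply: mulfI; apply/eqP => /(congr1 (mcoeff U_(ord0))).
rewrite mcoeffD !mcoeffX eqxx mcoeff0 eq_mnm1 /= addr0 => /eqP.
by rewrite oner_eq0.
Qed.

Lemma wl2X W W' l (x y : {mpoly K'[l]}) : wl2 W W' ->
  mmap (specX R n l) (pairf x y) W'
  = (1 - x ^+ 2 * zX R n l ^+ 2) * (1 - y ^+ 2 * zX R n l ^+ 2) * mmap (widX R n l) (pairf x y) W.
Proof. by move=> h; apply: (h _ (Cm R n l)). Qed.

Lemma wl2_0l W W' l (v : {mpoly K'[l]}) : wl2 W W' -> mmap (specX R n l) (pairf (zVX R n l) v) W' = 0.
Proof. by move=> /wl2X->; rewrite zVX2 subrr !mul0r. Qed.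

Lemma wl2_0r W W' l (v : {mpoly K'[l]}) : wl2 W W' -> mmap (specX R n l) (pairf v (zVX R n l)) W' = 0.
Proof. by move=> /wl2X->; rewrite zVX2 subrr mulr0 mul0r. Qed.

Lemma flink_Xm2 W W' l (P : {mpoly (SL R n)[l]}) (Q : {mpoly (SL R n.+2)[l.+1]}) :
  wl2 W W' -> flink P Q -> flink (opXm2 W P) (opXm2 W' Q).
Proof.
move=> hw PQ; apply/flinkE; rewrite !mmap_opXm2.
apply: (lower2F_snoc (b := fun x => 1 - x ^+ 2 * zX R n l.+2 ^+ 2)) => [v|v|u v|v].
- exact: wl2_0l hw.
- exact: wl2_0r hw.
- exact: wl2X.
exact: flinkX.
Qed.

Lemma flink_Xm20 W W' (Q : {mpoly (SL R n.+2)[0]}) :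
  wl2 W W' -> flink (0 : {mpoly (SL R n)[1]}) (opXm2 W' Q).
Proof.
move=> hw; apply/flinkE; rewrite mmap_opXm2 rmorph0 mulr0; apply: lower2F_snoc0 => v.
  exact: wl2_0l hw.
exact: wl2_0r hw.
Qed.

End DoubleLink.

Section DoubleLimit.
Variables (F E : fieldType) (p : place F E) (t : E).
Hypothesis tu : t^-1 = pu p.

Lemma lim_tfrac x x0 (e : F) (e' : E) : e' ^+ 2 = 1 -> lim p e' e -> e != 0 -> lim p x x0 ->
  lim p (t / (x + e' * t)) e^-1.
Proof.
move=> e2 he e0 hx; have t0 := t_neq0 tu.
have -> : t / (x + e' * t) = (x * pu p + e')^-1.
  by rewrite -tu -[X in X / _]invrK -invfM mulrC; congr (_^-1); rewrite mulrDl mulfK.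
apply: limV => //; have -> : e = x0 * 0 + e by rewrite mulr0 add0r.
by apply: limD => //; apply: limM => //; apply: lim_u.
Qed.

Lemma lim_tD x x0 : lim p x x0 -> lim p (t / (x + t)) 1.
Proof.
move=> hx; have := @lim_tfrac x x0 1 1 (expr1n _ _) (lim1 p) (oner_neq0 _) hx.
by rewrite mul1r invr1.
Qed.

Lemma lim_tB x x0 : lim p x x0 -> lim p (t / (x - t)) (-1).
Proof.
move=> hx; have := @lim_tfrac x x0 (-1) (-1) _ (limN (lim1 p)) _ hx.
by rewrite mulN1r invrN1; apply; rewrite ?sqrrN ?expr1n // oppr_eq0 oner_eq0.
Qed.

Lemma lim_F2_oo (x y a b c c' d d' : E) (s x0 y0 c0 c0' d0 d0' D : F) :
  x0 + y0 != 0 -> (x0 + y0) * D = c0 * d0 - c0' * d0' ->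
  lim p x x0 -> lim p y y0 -> a != 0 -> lim p (b / a) s ->
  lim p c c0 -> lim p c' c0' -> lim p d d0 -> lim p d' d0' ->
  lim p (t / (x + t) * (t / (y + t)) * ((x - y) / (x + y)) * (c * d - c' * d')
    + t / (x - t) * (t / (y + t)) * (d' / a) * (a * c' - b * c)
    - t / (y - t) * (t / (x + t)) * (c' / a) * (a * d' - b * d))
   ((x0 - y0) * D + s * (d0' * c0 - c0' * d0)).
Proof.
move=> xy0 hD hx hy a0 hb hc hc' hd hd'.
have e A B u v w : A * B * (u / a) * (a * v - b * w) = A * (B * (u * (v - b / a * w))) by field.
have e1 (A B u v w : E) : A * B * (u / v) * w = A * (B * (u * (v^-1 * w))) by rewrite !mulrA.
rewrite !e e1.
have -> : (x0 - y0) * D + s * (d0' * c0 - c0' * d0)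
  = 1 * (1 * ((x0 - y0) * ((x0 + y0)^-1 * (c0 * d0 - c0' * d0'))))
    + (-1) * (1 * (d0' * (c0' - s * c0))) - (-1) * (1 * (c0' * (d0' - s * d0))).
  by rewrite -hD mulKf //; ring.
apply: limB; [apply: limD|].
- apply: limM; first exact: lim_tD hx.
  apply: limM; first exact: lim_tD hy.
  apply: limM; first exact: limB.
  by apply: limM; [apply: limV => //; apply: limD | apply: limB; apply: limM].
- apply: limM; first exact: lim_tB hx.
  apply: limM; first exact: lim_tD hy.
  by apply: limM => //; apply: limB => //; apply: limM.
apply: limM; first exact: lim_tB hy.
apply: limM; first exact: lim_tD hx.
by apply: limM => //; apply: limB => //; apply: limM.
Qed.

Lemma lim_lower2 k (W : E -> E -> E) (W0 : F -> F -> F) f f0 (x : 'I_k.+2 -> E) (x0 : 'I_k.+2 -> F) :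
  (forall i j, i != j -> lim p (W (x i) (x j)) (W0 (x0 i) (x0 j))) ->
  (forall i j, lim p (f (x \o lift i \o lift j)) (f0 (x0 \o lift i \o lift j))) ->
  lim p (lower2F W f x) (lower2F W0 f0 x0).
Proof.
have hs m : lim p ((-1) ^+ m) ((-1) ^+ m).
  by elim: m => [|m IH]; [exact: lim1 | rewrite !exprS; apply: limM => //; apply: limN; apply: lim1].
move=> hW hf; apply: lim_sum => i _; apply: limM; first exact: hs.
apply: lim_sum => j _; apply: limM; first exact: hs.
by apply: limM => //; apply: hW; apply: neq_lift.
Qed.

End DoubleLimit.

Lemma wedge2L (F : fieldType) l (f1 : F -> F -> F) (f2 : ('I_l -> F) -> F) (x : 'I_l.+2 -> F) :
  skewf f2 -> l`!%:R != 0 :> F ->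
  wedge (l1 := 2) (l2 := l) (fun y => f1 (y ord0) (y ord_max)) f2 x = 2^-1 * lower2F f1 f2 x.
Proof. exact: wedge2E. Qed.

Lemma F2E (R : realType) n (F : fieldType) (iota : Kz R n -> F) (t x y : F) :
  F2 iota t x y = t / (x + t) * (t / (y + t)) * ((x - y) / (x + y))
      * (Theta iota x * Theta iota y - Theta iota (- x) * Theta iota (- y))
    + t / (x - t) * (t / (y + t)) * (Theta iota (- y) / Theta iota t)
      * (Theta iota t * Theta iota (- x) - Theta iota (- t) * Theta iota x)
    - t / (y - t) * (t / (x + t)) * (Theta iota (- x) / Theta iota t)
      * (Theta iota t * Theta iota (- y) - Theta iota (- t) * Theta iota y).
Proof. by rewrite /F2 /Theta2 !opprK. Qed.

Section DoubleAction.
Variables (R : realType) (n : nat).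
Variables (act : Ui R -> skewA R n -> skewA R n).
Hypotheses (act_action : is_action act).

Lemma xLD_neq0 l (i j : 'I_l) : i != j -> xL R n i + xL R n j != 0.
Proof.
move=> ij; rewrite /xL -rmorphD; apply: mu_neq0; apply/eqP => /(congr1 (mcoeff U_(i))).
rewrite mcoeffD !mcoeffX eqxx mcoeff0 eq_mnm1 (negbTE (_ : j != i)) 1?eq_sym //= addr0 => /eqP.
by rewrite oner_eq0.
Qed.

Lemma Xm2_rhsE l (P : {mpoly (SL R n)[l]}) (t : KzXt R n l.+2) : mskew P ->
  Xm2_rhs (@EK R n l.+2) (map_mpoly (@SLval R n) P) t (@EX R n l.+2)
  = 2^-1 * lower2F (F2 (@EK R n l.+2) t) (fun y => mmap (eS R n l.+2) y P) (@EX R n l.+2).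
Proof.
move=> sP; have e : peval (@EK R n l.+2) (map_mpoly (@SLval R n) P) = fun y => mmap (eS R n l.+2) y P.
  by apply: functional_extensionality_dep => y; rewrite /peval mmap_SLval.
have sk : skewf (fun y : 'I_l -> KzXt R n l.+2 => mmap (eS R n l.+2) y P).
  by move=> s x; rewrite mmap_skew.
rewrite /Xm2_rhs e.
exact: (wedge2L (F2 (@EK R n l.+2) t) (@EX R n l.+2) sk (fact_neq0 R n l.+2 l)).
Qed.

Lemma mu_opXm2 l (W : {mpoly (SL R n)[2]}) (P : {mpoly (SL R n)[l]}) :
  mu R n l.+2 (opXm2 W P) = lower2F (fun x y => mmap (cS R n l.+2) (pairf x y) W)
    (fun y => mmap (cS R n l.+2) y P) (@xL R n l.+2).
Proof. by rewrite muE mmap_opXm2. Qed.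

Lemma act_Xm_le0_sq_E (u : Ures R) l (P : skewA R n) (P' : {mpoly (SL R n)[l]}) :
  Ures_val u = div_sq (@Xm_le0 R) 0 -> lifts P P' ->
  act (- (4 * 'i) *: Uspec u) P l.+2
  = map_mpoly (@SLval R n) (SLc n 2^-1 *: opXm2 (W2 n (theta R n)) P').
Proof.
move=> uE hP; pose L := KzX R n l.+2; pose E := KzXt R n l.+2.
have := @act_Xm_le0_sq _ _ _ act_action l (fun k => MkUres (Xm_le0_sq_Ures R k)) (fun k => erefl) P.
rewrite -hP => /expandsooP.
rewrite (Xm2_rhsE _ (lifts_skew hP)) => /expands_lim h1.
pose x_ := @EX R n l.+2; pose cl := @cst_oo R n l.+2.
have h : lim (place_oo L) (2^-1 * lower2F (F2 (@EK R n l.+2) (Et R n l.+2)) (fun y => mmap (eS R n l.+2) y P') x_)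
   (mu R n l.+2 (SLc n 2^-1 *: opXm2 (W2 n (theta R n)) P')).
  have -> : mu R n l.+2 (SLc n 2^-1 *: opXm2 (W2 n (theta R n)) P')
     = 2^-1 * mu R n l.+2 (opXm2 (W2 n (theta R n)) P').
    by rewrite !muE mmapZ cS_half.
  apply: limM; first by apply: limV (two_neq0L _ _ _) _; apply: lim_nat.
  rewrite mu_opXm2; apply: (lim_lower2 (x0 := @xL R n l.+2)) => p r; last first.
    by apply: lim_mmap => [c|j]; [apply: cst_oo | apply: (lim_EX cl)].
  move=> pr; rewrite W2_eval.
  have xl := lim_EX cl p; have yl := lim_EX cl r.
  have t1 := lim_Theta cl xl; have t2 := lim_Theta cl (limN xl).
  have t3 := lim_Theta cl yl; have t4 := lim_Theta cl (limN yl).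
  rewrite F2E.
  exact: (lim_F2_oo (Et_inv R n l.+2) (xLD_neq0 pr)
    (Dquot_eval (cS R n l.+2) (theta R n) (xL R n p) (xL R n r)) xl yl
    (Theta_t_neq0 R n l.+2) (Theta_ratio R n l.+2) t1 t2 t3 t4).
have e := lim_unique h1 h.
apply: (@tofr_inj R n l.+2); rewrite -[RHS]e.
by congr (tofr _ _ _ (act (_ *: _) P _)); apply: Uspec_eq; rewrite uE.
Qed.

End DoubleAction.

Section DoubleGood.
Variables (R : realType) (n : nat).
Variables (act : Ui R -> skewA R n -> skewA R n) (act2 : Ui R -> skewA R n.+2 -> skewA R n.+2).
Hypotheses (act_action : is_action act) (act2_action : is_action act2).

Definition opXm2A m (P' : forall l, {mpoly (SL R m)[l]}) l : {mpoly (SL R m)[l]} :=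
  match l with
  | l'.+2 => SLc m 2^-1 *: opXm2 (W2 m (theta R m)) (P' l')
  | _ => 0
  end.

Lemma lifts_Xm2 m (act' : Ui R -> skewA R m -> skewA R m) (u : Ures R) (P : skewA R m) P' :
  is_action act' -> Ures_val u = div_sq (@Xm_le0 R) 0 ->
  (forall l, lifts P (P' l)) ->
  forall l, lifts (act' (- (4 * 'i) *: Uspec u) P) (opXm2A P' l).
Proof.
move=> a uE hP; have lo l : (l < 2)%N -> act' (- (4 * 'i) *: Uspec u) P l = 0.
  move=> hl; have -> := act_Z a (- (4 * 'i)) (Uspec u) P.
  by rewrite AcompZ (act_Xm_le0_sq01 a hl uE) scaler0.
case=> [|[|l]] /=; rewrite /lifts; first by rewrite lo ?rmorph0.
  by rewrite lo ?rmorph0.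
by rewrite (act_Xm_le0_sq_E a uE (hP l)).
Qed.

Lemma good_Xm2 (u : Ures R) : Ures_val u = Udiv (Ux R false 0) 2 -> good act act2 (Uspec u).
Proof.
move=> uE; have vE : Ures_val u = div_sq (@Xm_le0 R) 0.
  have e0 : Xm_le0 R 0 = Ux R false 0 by rewrite /Xm_le0 expr0z scale1r oppr0.
  by rewrite uE /div_sq big_ord1 -[(0 - _)%N]/0%N -[nat_of_ord _]/0%N e0 /Udiv expr2.
apply: (goodZ_inv act_action act2_action (c := - (4 * 'i))).
  by rewrite oppr_eq0 mulf_neq0 ?neq0Ci // pnatr_eq0.
apply: (@goodI R n act act2 _ (@opXm2A n) (@opXm2A n.+2)).
- by move=> P P'; apply: lifts_Xm2.
- by move=> P P'; apply: lifts_Xm2.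
move=> P' Q' _ _ PQ [|[|l]] /=; first exact: flink0.
  have -> : (0 : {mpoly (SL R n)[1]}) = SLc n 2^-1 *: 0 by rewrite scaler0.
  apply: flinkZ; first by rewrite spec_SLc wid_SLc.
  exact: (flink_Xm20 (Q' 0%N) (@wl2_W2 R n)).
apply: flinkZ; first by rewrite spec_SLc wid_SLc.
exact: flink_Xm2 (@wl2_W2 R n) (PQ l).
Qed.

End DoubleGood.

(** * The operators [a_n] *)

Section Steps.
Variable A : comNzRingType.
Implicit Types (th F : {poly A}).

(* The expansions of the summands of a_+ and a_- consist of the values of the
   iterates of tau and sig; here il is the inverse of the leading coefficient
   of th. *)
Definition tau th F : {poly A} := drop_poly 1 (F - F`_0 *: th).
Definition sig th (il : A) n F : {poly A} := 'X * F - (F`_n.-1 * il) *: th.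

Lemma tauX th F : th`_0 = 1 -> F - F`_0 *: th = tau th F * 'X^1.
Proof.
move=> th0; apply/polyP => i; rewrite /tau coefMXn coef_drop_poly; case: i => [|i] /=.
  by rewrite coefB coefZ th0 mulr1 subrr.
by rewrite subn1 addn1.
Qed.

Lemma tauE th F : th`_0 = 1 -> F = F`_0 *: th + tau th F * 'X.
Proof. by move=> /(tauX F); rewrite expr1 => <-; rewrite addrC subrK. Qed.

Lemma sigE th il n F : 'X * F = (F`_n.-1 * il) *: th + sig th il n F.
Proof. by rewrite /sig addrC subrK. Qed.

Lemma size_sig th il n F : (0 < n)%N -> (size th <= n.+1)%N -> il * th`_n = 1 ->
  (size F <= n)%N -> (size (sig th il n F) <= n)%N.
Proof.
move=> n0 sth hil sF; apply/leq_sizeP => j; rewrite leq_eqVlt => /orP[/eqP<-|nj].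
  rewrite /sig coefB coefXM coefZ -mulrA hil mulr1 -[n]prednK //= subrr //.
rewrite /sig coefB coefXM coefZ; have -> : th`_j = 0 by apply: (leq_sizeP _ _ sth).
case: j nj => //= j nj; rewrite mulr0 subr0; exact: (leq_sizeP _ _ sF).
Qed.

(** Since b(0) = 1, multiplication by b does not change the constant term, so the multiple of [th]
    to be subtracted is the same on both sides. *)
Lemma tau_factor th (b : {poly A}) (c : A) F : b`_0 = 1 -> th`_0 = 1 ->
  tau (b * th) (c *: (b * F)) = c *: (b * tau th F).
Proof.
move=> b0 th0; rewrite -[RHS](drop_polyMXn_id 1) /tau; congr drop_poly.
rewrite -scalerAl -mulrA -tauX // coefZ coef0M b0 mul1r mulrBr scalerBr; congr (_ - _).
by rewrite -scalerA -scalerAr.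
Qed.

Lemma coef_bM (a : A) F k : ((1 - a *: 'X^2) * F)`_k.+2 = F`_k.+2 - a * F`_k.
Proof. by rewrite mulrBl mul1r coefB -scalerAl coefZ coefXnM !subSS subn0. Qed.

(** Multiplication by 1 - a X^2 raises degrees by 2 and multiplies the top coefficients of F and of
    [th] by - a. Their quotient, which [sig] uses, is unchanged. *)
Lemma sig_factor th (a c il il' : A) n F : (0 < n)%N -> (size F <= n)%N -> - a * il' = il ->
  sig ((1 - a *: 'X^2) * th) il' n.+2 (c *: ((1 - a *: 'X^2) * F)) = c *: ((1 - a *: 'X^2) * sig th il n F).
Proof.
case: n => // n _ sF hil; rewrite /sig /= coefZ coef_bM (_ : F`_n.+2 = 0); last first.
  by apply: (leq_sizeP _ _ sF).
rewrite sub0r mulrBr -scalerAr mulrCA scalerBr; congr (_ - _).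
by rewrite -scalerAr scalerA -hil; congr (_ *: _); ring.
Qed.

Lemma iter_tau_factor th (b : {poly A}) (c : A) F k : b`_0 = 1 -> th`_0 = 1 ->
  iter k (tau (b * th)) (c *: (b * F)) = c *: (b * iter k (tau th) F).
Proof. by move=> b0 th0; elim: k => //= k ->; apply: tau_factor. Qed.

Lemma size_iter_sig th il n F k : (0 < n)%N -> (size th <= n.+1)%N -> il * th`_n = 1 ->
  (size F <= n)%N -> (size (iter k (sig th il n) F) <= n)%N.
Proof. by move=> *; elim: k => //= k IH; apply: size_sig. Qed.

Lemma iter_sig_factor th (a c il il' : A) n F k : (0 < n)%N -> (size th <= n.+1)%N -> il * th`_n = 1 ->
  (size F <= n)%N -> - a * il' = il ->
  iter k (sig ((1 - a *: 'X^2) * th) il' n.+2) (c *: ((1 - a *: 'X^2) * F))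
  = c *: ((1 - a *: 'X^2) * iter k (sig th il n) F).
Proof.
move=> n0 sth hil sF ha; elim: k => //= k ->; apply: sig_factor => //; exact: size_iter_sig.
Qed.

(** At a root y of [th] the relation F = F(0) th + X tau(F) says that [tau] multiplies the value by
    1/y. In this way the variable set to 1/z contributes powers of z; [sig] contributes powers of
    1/z. *)
Lemma iter_tau_root th y w F k : th`_0 = 1 -> th.[y] = 0 -> w * y = 1 -> (iter k (tau th) F).[y] = w ^+ k * F.[y].
Proof.
move=> th0 thy wy; elim: k => [|k IH] /=; first by rewrite mul1r.
have /(congr1 (horner^~ y)) := tauE (iter k (tau th) F) th0.
rewrite hornerD hornerZ thy mulr0 add0r hornerMX exprS -mulrA -IH => ->.
by rewrite [_ * y]mulrC mulrA wy mul1r.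
Qed.

Lemma iter_sig_root th il n y F k : th.[y] = 0 -> (iter k (sig th il n) F).[y] = y ^+ k * F.[y].
Proof.
move=> thy; elim: k => [|k IH] /=; first by rewrite mul1r.
by rewrite /sig hornerD hornerN hornerZ thy mulr0 subr0 hornerM hornerX IH exprS mulrA.
Qed.

End Steps.

Section StepsMap.
Variables (A B : comNzRingType) (f : {rmorphism A -> B}).

Lemma map_tau th F : map_poly f (tau th F) = tau (map_poly f th) (map_poly f F).
Proof. by apply/polyP => i; rewrite /tau !(coef_map, coef_drop_poly, coefB, coefZ) /= rmorphB rmorphM. Qed.

Lemma map_sig th il n F : map_poly f (sig th il n F) = sig (map_poly f th) (f il) n (map_poly f F).
Proof. by rewrite /sig rmorphB rmorphM /= map_polyX map_polyZ /= rmorphM coef_map. Qed.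

End StepsMap.

Section TraceOperators.
Variable R : realType.

Definition Fp n l (A : comNzRingType) (f : SL R n -> A) (x : 'I_l -> A) p (P : {mpoly (SL R n)[l]}) : {poly A} :=
  mmap (polyC \o f) (fun j => if j == p then 'X else (x j)%:P) P.

Definition trF n l (A : comNzRingType) (st : {poly A} -> {poly A}) k (f : SL R n -> A) x (P : {mpoly (SL R n)[l]}) : A :=
  \sum_p (iter k st (Fp f x p P)).[x p].

Lemma map_Fp n l (A B : comNzRingType) (h : {rmorphism A -> B}) (f : {rmorphism SL R n -> A}) (x : 'I_l -> A) p P :
  map_poly h (Fp f x p P) = Fp (h \o f) (h \o x) p P.
Proof.
rewrite rmorph_mmap; apply: eq_mmap => [c|j] /=; first by rewrite map_polyC.
by case: ifP => _; rewrite ?map_polyX ?map_polyC.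
Qed.

Lemma rmorph_trF n l (A B : comNzRingType) (h : {rmorphism A -> B}) st st' k (f : {rmorphism SL R n -> A}) (x : 'I_l -> A) P :
  (forall F, map_poly h (st F) = st' (map_poly h F)) ->
  h (trF st k f x P) = trF st' k (h \o f) (h \o x) P.
Proof.
move=> hst; rewrite rmorph_sum; apply: eq_bigr => p _; rewrite -horner_map /=; congr (_.[_]).
by rewrite -map_Fp; elim: k => //= k IH; rewrite hst IH.
Qed.

Lemma Fp_eval n l (A : comNzRingType) (f : {rmorphism SL R n -> A}) (x : 'I_l -> A) p P t :
  (Fp f x p P).[t] = mmap f (fun j => if j == p then t else x j) P.
Proof.
rewrite -[LHS]/(horner_eval t (Fp f x p P)) rmorph_mmap; apply: eq_mmap => [c|j] /=.
  by rewrite /horner_eval hornerC.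
by case: ifP => _; rewrite /horner_eval ?hornerX ?hornerC.
Qed.

Lemma size_Fp n l (A : comNzRingType) (f : {rmorphism SL R n -> A}) (x : 'I_l -> A) p P d :
  (forall m, m \in mpoly.msupp P -> (m p < d)%N) -> (size (Fp f x p P) <= d)%N.
Proof.
move=> h; apply: leq_trans (size_sum _ _ _) _; apply/bigmax_leqP_seq => m mP _.
rewrite /mmap1 (bigD1 p) //= eqxx mulrCA.
have [c ->] : exists c : A, \prod_(j | j != p) (if j == p then 'X else (x j)%:P) ^+ m j = c%:P.
  exists (\prod_(j | j != p) x j ^+ m j); rewrite rmorph_prod; apply: eq_bigr => j /negbTE-> /=.
  by rewrite rmorphXn.
rewrite -polyCM mulrC mul_polyC; apply: leq_trans (size_scale_leq _ _) _.
by rewrite size_polyXn; apply: h.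
Qed.

End TraceOperators.

Section TraceLink.
Variables (R : realType) (n l : nat).
Local Notation z := (zvar R (@ord_max n)).
Local Notation A := {mpoly (Kz R n.+1)[l]}.
Local Notation X := (fun a : 'I_l => 'X_a : A).
Variables (P : {mpoly (SL R n)[l]}) (Q : {mpoly (SL R n.+2)[l.+1]}).
Hypothesis PQ : flink P Q.

Definition bX : {poly A} := 1 - zX R n l ^+ 2 *: 'X^2.

Lemma bX_eval v : bX.[v] = 1 - v ^+ 2 * zX R n l ^+ 2.
Proof. by rewrite /bX hornerD hornerC hornerN hornerZ hornerXn mulrC. Qed.

Lemma Fp_link p : exists2 c : A,
  Fp (specX R n l) (snocr X (zVX R n l)) (lift ord_max p) Q = c *: (bX * Fp (widX R n l) X p P)
  & c * bX.['X_p] = Cm R n l (z ^- n.+1) * (\prod_a (1 - 'X_a ^+ 2 * zX R n l ^+ 2)).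
Proof.
pose k := Cm R n l (z ^- n.+1); pose i : {rmorphism Kz R n.+1 -> {poly A}} := polyC \o Cm R n l.
pose c := k * \prod_(a | a != p) (1 - ('X_a : A) ^+ 2 * zX R n l ^+ 2).
exists c; last first.
  by rewrite bX_eval /c -mulrA; congr (_ * _); rewrite [RHS](bigD1 p) //=; apply: mulrC.
pose y : 'I_l -> {poly A} := fun a => if a == p then 'X else ('X_a)%:P.
have -> : Fp (specX R n l) (snocr X (zVX R n l)) (lift ord_max p) Q
  = mmap (i \o @spec R n) (snocr y (i z^-1)) Q.
  apply: eq_mmap => // j; rewrite /snocr.
  case: (unliftP ord_max j) => [a|] ->; first by rewrite (inj_eq (@lift_inj _ _)).
  by rewrite (negbTE (neq_lift _ _)).
rewrite (flink_eval i y PQ) (bigD1 p) //= {1}/y eqxx.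
have -> : \prod_(a | a != p) (1 - y a ^+ 2 * i z ^+ 2)
   = (\prod_(a | a != p) (1 - ('X_a : A) ^+ 2 * zX R n l ^+ 2))%:P.
  rewrite rmorph_prod; apply: eq_bigr => a /negbTE ap; rewrite /y ap.
  by rewrite rmorphB rmorph1 rmorphM /= !rmorphXn.
have -> : 1 - 'X ^+ 2 * i z ^+ 2 = bX.
  by rewrite /bX -mul_polyC rmorphXn mulrC.
rewrite -[X in _ = X]mul_polyC /c rmorphM -!mulrA; congr (_ * _).
by rewrite mulrCA.
Qed.

Lemma Fp_max t : (Fp (specX R n l) (snocr X (zVX R n l)) ord_max Q).[t]
  = mmap (specX R n l) (snocr X t) Q.
Proof.
rewrite Fp_eval; apply: eq_mmap => // j.
rewrite /snocr; case: (unliftP ord_max j) => [a|] ->; last by rewrite eqxx.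
by rewrite eq_sym (negbTE (neq_lift _ _)).
Qed.

(** For the old variables the factor 1 - z^2 X^2 passes through the iteration, by [h1]. The new
    variable sits at 1/z, where the iteration only multiplies the value, by [h2]. *)
Lemma trF_link (st st' : {poly A} -> {poly A}) k w :
  (forall p c, iter k st' (c *: (bX * Fp (widX R n l) X p P)) = c *: (bX * iter k st (Fp (widX R n l) X p P))) ->
  (forall F, (iter k st' F).[zVX R n l] = w * F.[zVX R n l]) ->
  trF st' k (specX R n l) (snocr X (zVX R n l)) Q
  = Cm R n l (z ^- n.+1) * (\prod_a (1 - 'X_a ^+ 2 * zX R n l ^+ 2))
    * (trF st k (widX R n l) X P + w * mmap (widX R n l) X P).
Proof.
move=> h1 h2; rewrite /trF big_ord_max snocr_max h2 Fp_max (flinkX _ PQ) mulrDr.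
congr (_ + _); last exact: mulrCA.
rewrite [RHS]mulr_sumr; apply: eq_bigr => p _; rewrite snocr_lift_max.
have [c -> <-] := Fp_link p; rewrite h1 hornerZ hornerM; ring.
Qed.

End TraceLink.

(** * Power sums and the leading coefficient of Theta *)

Section PowerSums.
Variables (R : realType).

Definition zpow n (inv : bool) (j : 'I_n) : Kz R n := if inv then (zvar R j)^-1 else zvar R j.
Definition powsumK n inv k : Kz R n := \sum_j zpow inv j ^+ k.
Definition powsum n inv k : SL R n := liftSL (powsumK n inv k).

Lemma laurent_zpow n inv (j : 'I_n) : laurent (zpow inv j).
Proof. by rewrite /zpow; case: inv; [apply: laurent_zvarV | apply: (laurent_poly 'X_j)]. Qed.

Lemma Kperm_zpow n inv (s : {perm 'I_n}) j : Kperm s (zpow inv j) = zpow inv (s j).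
Proof. by rewrite /zpow; case: inv; rewrite ?fmorphV /= Kperm_zvar. Qed.

Lemma powsumE n inv k : SLval (powsum n inv k) = powsumK n inv k.
Proof.
apply: liftSLK; apply/sym_laurentP; split.
  by apply: laurent_sum => j _; apply: laurentX; apply: laurent_zpow.
move=> s; rewrite rmorph_sum [RHS](reindex_inj (@perm_inj _ s)) /=; apply: eq_bigr => j _.
by rewrite rmorphXn /= Kperm_zpow.
Qed.

Definition vpow n m inv (v : 'I_n -> Kz R m) j := if inv then (v j)^-1 else v j.

Lemma hv_zpow n m inv (v : 'I_n -> Kz R m) j : (forall j, v j != 0) ->
  hv (tz R n) (evz v) (zpow inv j) (vpow inv v j).
Proof.
by move=> v0; rewrite /zpow /vpow; case: inv; [apply: hvV (v0 j) _ |]; apply: hv_zvar.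
Qed.

Lemma hv_powsum n m inv k (v : 'I_n -> Kz R m) : (forall j, v j != 0) ->
  hv (tz R n) (evz v) (powsumK n inv k) (\sum_j vpow inv v j ^+ k).
Proof.
move=> v0; apply: hv_sum => [p|j _]; first exact: tz_eq0.
by apply: hvX; apply: hv_zpow.
Qed.

Variable n : nat.
Local Notation z := (zvar R (@ord_max n)).

Definition zw (inv : bool) : Kz R n.+1 := if inv then z^-1 else z.

Lemma spec_powsum inv k :
  spec (powsum n.+2 inv k) = wid (powsum n inv k) + zw inv ^+ k + (- zw inv) ^+ k.
Proof.
have h1 : spec (powsum n.+2 inv k) = \sum_j vpow inv (@vspec R n) j ^+ k.
  by apply: valueE; rewrite powsumE; apply: hv_powsum; apply: vspec_neq0.
have h2 : wid (powsum n inv k) = \sum_j vpow inv (@vwid R n) j ^+ k.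
  by apply: valueE; rewrite powsumE; apply: hv_powsum; apply: vwid_neq0.
rewrite h1 h2 !big_ord_max.
have e1 : vspec R (@ord_max n.+1) = - z by rewrite /vspec unlift_none.
have e2 j : vspec R (lift (@ord_max n.+1) j) = zvar R j by rewrite /vspec liftK.
congr (_ + _ + _); last 2 first.
- by rewrite /vpow e2 /zw.
- by rewrite /vpow e1 /zw; case: (inv); rewrite ?invrN.
by apply: eq_bigr => j _; rewrite /vpow e2.
Qed.

End PowerSums.

Section LeadCoefficient.

Lemma coef_prod_lin (F : comNzRingType) n (c : 'I_n -> F) :
  let q : {poly F} := \prod_j (1 - c j *: 'X) in (size q <= n.+1)%N /\ q`_n = \prod_j (- c j).
Proof.
elim: n c => [|n IH] c /=; first by rewrite !big_ord0 coef1 size_poly1.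
rewrite !big_ord_recr /=; have [s h] := IH (fun j => c (widen_ord (leqnSn n) j)).
set q := \prod_(_ < n) _ in s h *; rewrite mulrBr mulr1 -scalerAr; split.
  apply: leq_trans (size_polyD _ _) _; rewrite geq_max size_polyN; apply/andP; split.
    exact: leq_trans s _.
  apply: leq_trans (size_scale_leq _ _) _; apply: leq_trans (size_polyMleq _ _) _.
  by rewrite size_polyX addn2.
rewrite coefB coefZ coefMX /= h (leq_sizeP _ _ s) // sub0r mulrN; congr (- _).
exact: mulrC.
Qed.

Lemma coef0_prod_lin (F : comNzRingType) n (c : 'I_n -> F) :
  (\prod_j (1 - c j *: 'X) : {poly F})`_0 = 1.
Proof. by rewrite coef0_prod big1 // => j _; rewrite coefB coefZ coefX coef1 mulr0 subr0. Qed.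

Variables (R : realType) (n : nat).

Definition ilK : Kz R n := \prod_j - (zvar R j)^-1.
Definition il : SL R n := liftSL ilK.

Lemma ilE : SLval il = ilK.
Proof.
apply: liftSLK; apply/sym_laurentP; split.
  apply: laurent_prod => j _; rewrite -sub0r; apply: laurentB; last exact: laurent_zvarV.
  by rewrite -(rmorph0 (tz R n)); apply: laurent_poly.
move=> s; rewrite rmorph_prod [RHS](reindex_inj (@perm_inj _ s)) /=; apply: eq_bigr => j _.
by rewrite rmorphN fmorphV /= Kperm_zvar.
Qed.

Lemma coef_thetaK k : SLval (theta R n)`_k = (thetaK R n)`_k.
Proof. by rewrite -map_theta coef_map. Qed.

Lemma theta_lead : il * (theta R n)`_n = 1.
Proof.
apply: SLval_inj; rewrite rmorphM rmorph1 /= ilE coef_thetaK.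
have [_ ->] := coef_prod_lin (@zvar R n); rewrite /ilK -big_split big1 // => j _ /=.
by rewrite mulrNN mulVf // zvar_neq0.
Qed.

Lemma theta_coef0 : (theta R n)`_0 = 1.
Proof. by apply: SLval_inj; rewrite rmorph1 coef_thetaK coef0_prod_lin. Qed.

Lemma size_theta : (size (theta R n) <= n.+1)%N.
Proof.
apply/leq_sizeP => k nk; apply: SLval_inj; rewrite rmorph0 coef_thetaK.
by have [s _] := coef_prod_lin (@zvar R n); apply: (leq_sizeP _ _ s).
Qed.

End LeadCoefficient.

Section SpecIl.
Variables (R : realType) (n : nat).
Local Notation z := (zvar R (@ord_max n)).

Lemma spec_il : - z ^+ 2 * spec (il R n.+2) = wid (il R n).
Proof.
have e : spec (theta R n.+2)`_n.+2 = - z ^+ 2 * wid (theta R n)`_n.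
  have := congr1 (fun p : {poly _} => p`_n.+2) (spec_theta R n).
  rewrite coef_bM !coef_map /= => ->.
  by rewrite (leq_sizeP _ _ (size_theta R n)) ?rmorph0 ?sub0r ?mulNr.
have h1 := congr1 (@spec R n) (theta_lead R n.+2); rewrite rmorphM rmorph1 /= e in h1.
have h2 := congr1 (@wid R n) (theta_lead R n); rewrite rmorphM rmorph1 /= in h2.
rewrite -[LHS]mulr1 -h2 mulrC -[RHS]mulr1 -mulrA -h1; congr (_ * _).
by rewrite [RHS]mulrCA mulrC mulrA.
Qed.

End SpecIl.

Section TraceOperator.
Variable R : realType.

Definition stA n (A : comNzRingType) (f : {rmorphism SL R n -> A}) (inv : bool) (F : {poly A}) : {poly A} :=
  if inv then sig (map_poly f (theta R n)) (f (il R n)) n F else tau (map_poly f (theta R n)) F.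

Lemma map_stA n (A B : comNzRingType) (f : {rmorphism SL R n -> A}) (h : {rmorphism A -> B}) inv F :
  map_poly h (stA f inv F) = stA (h \o f) inv (map_poly h F).
Proof. by rewrite /stA; case: inv; rewrite ?map_sig ?map_tau -map_poly_comp. Qed.

Definition mC n l : {rmorphism SL R n -> {mpoly (SL R n)[l]}} := @mpolyC l (SL R n).

Definition trM n l inv k (P : {mpoly (SL R n)[l]}) : {mpoly (SL R n)[l]} :=
  trF (stA (mC n l) inv) k (mC n l) (fun j => 'X_j) P.

Definition sgc n k : SL R n := 1 + (-1) ^+ k.

(** For k > 0, the coefficient of t^k in the formula for a_+, or of t^-k in that for a_- when [inv]
    holds. The prefactor gives the power sum, and the terms in t and - t together give the factor 1
    + (-1)^k of the trace. *)
Definition opA n l inv k (P : {mpoly (SL R n)[l]}) : {mpoly (SL R n)[l]} :=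
  powsum R n inv k *: P - sgc n k *: trM inv k P.

Lemma trF_eq n l (A : comNzRingType) (st st' : {poly A} -> {poly A}) k (f f' : SL R n -> A)
   (x x' : 'I_l -> A) (P : {mpoly (SL R n)[l]}) : st =1 st' -> f =1 f' -> x =1 x' ->
   trF st k f x P = trF st' k f' x' P.
Proof.
move=> h1 h2 h3; rewrite (functional_extensionality_dep h1).
by rewrite (functional_extensionality_dep h2) (functional_extensionality_dep h3).
Qed.

Lemma mmap_trM n l (A : comNzRingType) (f : {rmorphism SL R n -> A}) (x : 'I_l -> A) inv k P :
  mmap f x (trM inv k P) = trF (stA f inv) k f x P.
Proof.
pose h : {rmorphism {mpoly (SL R n)[l]} -> A} := mmap f x.
have hx : h \o (fun j => 'X_j) =1 x by move=> j; rewrite /h /= mmapX mmap1U.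
have hf : h \o mC n l =1 f by move=> c; rewrite /h /= mmapC.
have hst F : map_poly h (stA (mC n l) inv F) = stA f inv (map_poly h F).
  rewrite map_stA /stA (eq_map_poly hf); case: (inv) => //.
  by rewrite -[X in sig _ X]/((h \o mC n l) (il R n)) hf.
rewrite -[LHS]/(h (trM inv k P)) (rmorph_trF k (mC n l) (fun j => 'X_j) P hst).
exact: trF_eq.
Qed.

Lemma mmap_ZBZ (S A : comNzRingType) l (f : {rmorphism S -> A}) (x : 'I_l -> A) (a b : S) P T :
  mmap f x (a *: P - b *: T) = f a * mmap f x P - f b * mmap f x T.
Proof. by rewrite rmorphB /= !mmapZ. Qed.

Lemma mmap_opA n l (A : comNzRingType) (f : {rmorphism SL R n -> A}) (x : 'I_l -> A) inv k P :
  mmap f x (opA inv k P) = f (powsum R n inv k) * mmap f x P - f (sgc n k) * trF (stA f inv) k f x P.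
Proof. by rewrite mmap_ZBZ mmap_trM. Qed.

Lemma rmorph_sgc n (A : comNzRingType) (f : {rmorphism SL R n -> A}) k : f (sgc n k) = 1 + (-1) ^+ k.
Proof. by rewrite rmorphD rmorph1 rmorph_sign. Qed.

Lemma map_factor (S S' A B : comNzRingType) (f : {rmorphism S -> A}) (f' : {rmorphism S' -> A})
  (g : {rmorphism A -> B}) p p' (c : A) :
  map_poly f' p' = (1 - c *: 'X^2) * map_poly f p ->
  map_poly (g \o f') p' = (1 - g c *: 'X^2) * map_poly (g \o f) p.
Proof.
move=> h; rewrite !map_poly_comp h rmorphM; congr (_ * _).
by rewrite rmorphB rmorph1 /= map_polyZ map_polyXn.
Qed.

Lemma horner_mul0 (A : comNzRingType) (p q : {poly A}) y : p.[y] = 0 -> (p * q).[y] = 0.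
Proof. by move=> h; rewrite hornerM h mul0r. Qed.

Lemma bX_root n l : (bX R n l).[zVX R n l] = 0.
Proof.
have e := bX_eval (zVX R n l); have e2 := zVX2 R n l.
rewrite e e2; exact: subrr.
Qed.

Lemma sig0 (A : comNzRingType) (th : {poly A}) il n : sig th il n 0 = 0.
Proof. by rewrite /sig mulr0 coef0 mul0r scale0r subr0. Qed.

Lemma iter_sig0 (A : comNzRingType) (th : {poly A}) il n k : iter k (sig th il n) 0 = 0.
Proof. by elim: k => //= k ->; apply: sig0. Qed.

Definition step (A : comNzRingType) (th : {poly A}) il n (inv : bool) F : {poly A} :=
  if inv then sig th il n F else tau th F.

Lemma step_factor (A : comNzRingType) (th : {poly A}) (a il il' c : A) n inv k (F : {poly A}) :
  th`_0 = 1 -> (size th <= n.+1)%N -> il * th`_n = 1 -> - a * il' = il -> (size F <= n)%N ->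
  iter k (step ((1 - a *: 'X^2) * th) il' n.+2 inv) (c *: ((1 - a *: 'X^2) * F))
  = c *: ((1 - a *: 'X^2) * iter k (step th il n inv) F).
Proof.
move=> th0 ths hil ha sF; case: inv; rewrite /step; last first.
  by apply: iter_tau_factor => //; rewrite coefB coefZ coefXn coef1 mulr0 subr0.
(* For n = 0 the index [n.-1] in [sig] is not that of a top coefficient, but the bound on the size
   then forces F = 0. *)
case: (posnP n) => [n0|n0]; last exact: iter_sig_factor.
have -> : F = 0 by apply/eqP; rewrite -size_poly_leq0 -[X in (_ <= X)%N]n0.
by rewrite mulr0 scaler0 !iter_sig0 mulr0 scaler0.
Qed.

Lemma step_root (A : comNzRingType) (th : {poly A}) (il : A) n inv k (F : {poly A}) y w :
  th`_0 = 1 -> th.[y] = 0 -> w * y = 1 ->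
  (iter k (step th il n inv) F).[y] = (if inv then y else w) ^+ k * F.[y].
Proof.
by move=> th0 thy wy; case: inv; [apply: iter_sig_root | apply: iter_tau_root].
Qed.

Lemma opA_link_alg (A : comNzRingType) (C p p' m t t' w s q : A) :
  p' = p + w + s * w -> q = 1 + s -> t' = C * (t + w * m) ->
  p' * (C * m) - q * t' = C * (p * m - q * t).
Proof. by move=> -> -> ->; ring. Qed.

Lemma rmorph_wpow (A B : comNzRingType) (h : {rmorphism A -> B}) (a w : A) k :
  h (a + w ^+ k + (- w) ^+ k) = h a + h w ^+ k + (-1) ^+ k * h w ^+ k.
Proof. by rewrite !rmorphD !rmorphXn rmorphN [in LHS]exprNn. Qed.

Lemma Cm_spec_powsum n l inv k : specX R n l (powsum R n.+2 inv k)
  = widX R n l (powsum R n inv k) + Cm R n l (zw R n inv) ^+ k + (-1) ^+ k * Cm R n l (zw R n inv) ^+ k.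
Proof.
have -> : specX R n l (powsum R n.+2 inv k) = Cm R n l (spec (powsum R n.+2 inv k)) by [].
by rewrite spec_powsum; apply: rmorph_wpow.
Qed.

Lemma spec_thetaX n l : map_poly (specX R n l) (theta R n.+2)
  = (1 - zX R n l ^+ 2 *: 'X^2) * map_poly (widX R n l) (theta R n).
Proof.
rewrite -(rmorphXn (Cm R n l)).
exact: (map_factor (Cm R n l) (spec_theta R n)).
Qed.

Lemma wid_theta0 n l : (map_poly (widX R n l) (theta R n))`_0 = 1.
Proof. by rewrite coef_map -[X in _ = X](rmorph1 (widX R n l)); congr (widX _ _ _ _); apply: theta_coef0. Qed.

Lemma spec_theta0 n l : (map_poly (specX R n l) (theta R n.+2))`_0 = 1.
Proof. by rewrite coef_map -[X in _ = X](rmorph1 (specX R n l)); congr (specX _ _ _ _); apply: theta_coef0. Qed.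

Lemma wid_theta_lead n l : widX R n l (il R n) * (map_poly (widX R n l) (theta R n))`_n = 1.
Proof. by rewrite coef_map -[X in _ = X](rmorph1 (widX R n l)) -rmorphM; congr (widX _ _ _ _); apply: theta_lead. Qed.

Lemma spec_ilX n l : - zX R n l ^+ 2 * specX R n l (il R n.+2) = widX R n l (il R n).
Proof. by have := congr1 (Cm R n l) (spec_il R n); rewrite rmorphM rmorphN rmorphXn. Qed.

Lemma spec_theta_root n l : (map_poly (specX R n l) (theta R n.+2)).[zVX R n l] = 0.
Proof. by rewrite spec_thetaX; exact: (horner_mul0 _ (bX_root n l)). Qed.

Lemma Cm_zw n l inv : Cm R n l (zw R n inv) = if inv then zVX R n l else zX R n l.
Proof. by case: inv. Qed.

Lemma stA_specE n l inv : stA (specX R n l) inv =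
  step ((1 - zX R n l ^+ 2 *: 'X^2) * map_poly (widX R n l) (theta R n)) (specX R n l (il R n.+2)) n.+2 inv.
Proof. by rewrite -spec_thetaX. Qed.

Lemma trF_opA_link n l inv k (P : {mpoly (SL R n)[l]}) (Q : {mpoly (SL R n.+2)[l.+1]}) :
  (forall m, m \in mpoly.msupp P -> forall j, (m j < n)%N) -> flink P Q ->
  trF (stA (specX R n l) inv) k (specX R n l) (snocr (fun a => 'X_a) (zVX R n l)) Q
  = Cm R n l (zvar R (@ord_max n) ^- n.+1) * (\prod_a (1 - 'X_a ^+ 2 * zX R n l ^+ 2))
    * (trF (stA (widX R n l) inv) k (widX R n l) (fun a => 'X_a) P
       + Cm R n l (zw R n inv) ^+ k * mmap (widX R n l) (fun a => 'X_a) P).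
Proof.
move=> degP PQ; apply: (trF_link PQ).
  move=> p c; rewrite stA_specE.
  apply: (step_factor _ inv k (wid_theta0 n l) _ (wid_theta_lead n l) (spec_ilX n l)).
    exact: leq_trans (size_poly _ _) (size_theta R n).
  exact: size_Fp (fun m hm => degP m hm p).
move=> F; rewrite Cm_zw.
exact: (step_root _ _ inv k _ (spec_theta0 n l) (spec_theta_root n l) (etrans (mulrC _ _) (zVXK R n l))).
Qed.

(** With w = z or 1/z, the parameters z and - z add w^k + (- w)^k to the power sum, and the new
    variable at 1/z adds w^k to the trace, which is weighted by 1 + (-1)^k and subtracted. The two
    contributions cancel. *)
Lemma flink_opA n l inv k (P : {mpoly (SL R n)[l]}) (Q : {mpoly (SL R n.+2)[l.+1]}) :
  (forall m, m \in mpoly.msupp P -> forall j, (m j < n)%N) ->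
  flink P Q -> flink (opA inv k P) (opA inv k Q).
Proof.
move=> degP PQ; apply/flinkE; rewrite !mmap_opA.
rewrite (flinkX _ PQ).
rewrite (trF_opA_link _ _ degP PQ).
rewrite Cm_spec_powsum.
rewrite (rmorph_sgc (specX R n l)) (rmorph_sgc (widX R n l)).
exact: opA_link_alg.
Qed.

End TraceOperator.

(** * Expansions of a_+ and a_- *)

Section StepExpansions.
Variables (F E : fieldType) (pl : place F E).
Local Notation c := (pc pl).
Local Notation u := (pu pl).
Implicit Types (f g : E) (s : nat -> F) (G th : {poly F}).

(* Equality of expansions up to the constant term. *)
Definition expands1 f s := exists2 s', expands pl f s' & forall k, s' k.+1 = s k.+1.

Lemma expands1_of f s : expands pl f s -> expands1 f s.
Proof. by move=> h; exists s. Qed.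

Lemma expands_c a : expands pl (c a) (fun k => if k == 0%N then a else 0).
Proof.
have h : expands pl (c a) (fun k => (if k == 0%N then a else 0)).
  apply: (@expands_iter _ _ _ (fun k => if k == 0%N then c a else 0)) => [|k].
    by case=> [|k]; [apply: preg_c | apply: preg0].
  by case: k => [|k] /=; rewrite ?rmorph0 mulr0 addr0.
exact: h.
Qed.

Lemma expands1_c a : expands1 (c a) (fun=> 0).
Proof. by exists (fun k => if k == 0%N then a else 0); [exact: expands_c |]. Qed.

Lemma expands1D f s g r : expands1 f s -> expands1 g r -> expands1 (f + g) (fun k => s k + r k).
Proof.
move=> [s' hf es] [r' hg er]; exists (fun k => s' k + r' k); first exact: expandsD.
by move=> k; rewrite es er.
Qed.

Lemma expands1_sum (I : Type) (r : seq I) (f : I -> E) (s : I -> nat -> F) :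
  (forall i, expands1 (f i) (s i)) -> expands1 (\sum_(i <- r) f i) (fun k => \sum_(i <- r) s i k).
Proof.
move=> h; elim: r => [|i r [s' hs es]].
  by rewrite big_nil -(rmorph0 c); have [s' hs es] := expands1_c 0; exists s' => // k; rewrite big_nil.
rewrite big_cons; have [s1 h1 e1] := h i; exists (fun k => s1 k + s' k); first exact: expandsD.
by move=> k; rewrite big_cons e1 es.
Qed.

Lemma expands1Z f s a : expands1 f s -> expands1 (c a * f) (fun k => a * s k).
Proof.
by move=> [s' hf es]; exists (fun k => a * s' k); [exact: expandsZ | move=> k; rewrite es].
Qed.

Lemma expands1_eq f s s' : (forall k, s k.+1 = s' k.+1) -> expands1 f s -> expands1 f s'.
Proof. by move=> e [r hr er]; exists r => // k; rewrite er e. Qed.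

Lemma expands_geom a : expands pl (1 - c a * u)^-1 (fun k => a ^+ k).
Proof.
have l1 : lim pl (1 - c a * u) (1 - a * 0).
  by apply: limB; [apply: lim1 | apply: limM; [apply: lim_c | apply: lim_u]].
rewrite mulr0 subr0 in l1.
have n0 := lim_neq0 (oner_neq0 _) l1.
have r1 := lim_reg (limV (oner_neq0 _) l1).
have := @expands_iter _ _ pl (fun k => c (a ^+ k) * (1 - c a * u)^-1) (fun k => a ^+ k).
rewrite expr0 rmorph1 mul1r; apply => k; first by apply: pregM => //; apply: preg_c.
rewrite exprSr rmorphM -!mulrA mulrCA -{2}[c (a ^+ k)]mulr1 -mulrDr; congr (_ * _).
rewrite -{2}(divff n0) mulrA [u * c a]mulrC -mulrDl subrK mul1r //.
Qed.

Lemma lim_horner G T a : lim pl T a -> lim pl (map_poly c G).[T] G.[a].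
Proof.
move=> hT; rewrite !horner_coef size_map_poly; apply: lim_sum => i _.
apply: limM; first by rewrite coef_map; apply: lim_c.
by elim: (nat_of_ord i) => [|k IH]; [apply: lim1 | rewrite !exprS; apply: limM].
Qed.

(* A summand of a_+ at X_p = x and t = T, where G is P as a polynomial in X_p
   and th is Theta. *)
Definition Spos th x G T : E :=
  T / (c x - T) * (c th.[x] / (map_poly c th).[T] * (map_poly c G).[T] - c G.[x]).

(** The summand is linear in G and vanishes for G = th, so G(0) th may be subtracted. What remains
    is X times tau(G), and comparing the factors T and x gives the recursion. *)
Lemma Spos_step th x G T : th`_0 = 1 -> c x - T != 0 -> (map_poly c th).[T] != 0 ->
  Spos th x G T = T * (Spos th x (tau th G) T - c (tau th G).[x]).
Proof.
move=> th0 xT thT; have e := tauE G th0.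
have eT : (map_poly c G).[T] = c G`_0 * (map_poly c th).[T] + (map_poly c (tau th G)).[T] * T.
  by rewrite {1}e rmorphD rmorphM /= map_polyZ map_polyX hornerD hornerZ hornerMX.
have ex : c G.[x] = c G`_0 * c th.[x] + c (tau th G).[x] * c x.
  by rewrite {1}e hornerD hornerZ hornerMX rmorphD !rmorphM.
by rewrite /Spos eT ex; field; rewrite xT thT.
Qed.

Lemma expands_Spos th x G e T : th`_0 = 1 -> x != 0 -> T = c e * u ->
  expands1 (Spos th x G T) (fun k => - (e ^+ k * (iter k (tau th) G).[x])).
Proof.
move=> th0 x0 TE.
have hT : lim pl T 0 by rewrite TE -(mulr0 e); apply: limM; [apply: lim_c | apply: lim_u].
have hxT : lim pl (c x - T) x by rewrite -[x in lim _ _ x]subr0; apply: limB => //; apply: lim_c.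
have hth : lim pl (map_poly c th).[T] 1 by rewrite -th0 -horner_coef0; apply: lim_horner.
have xT := lim_neq0 x0 hxT; have thT := lim_neq0 (oner_neq0 _) hth.
(* The subtracted constant makes the recursion of [expands_iter] close. It only affects the
   coefficient of degree 0, which [expands1] ignores. *)
pose h k := c (e ^+ k) * (Spos th x (iter k (tau th) G) T - c (iter k (tau th) G).[x]).
have hr k : preg pl (h k).
  apply: pregM; first exact: preg_c.
  apply: pregB; last exact: preg_c.
  apply: pregM; first by apply: pregM; [apply: (lim_reg hT) | apply: (lim_reg (limV x0 hxT))].
  apply: pregB; last exact: preg_c.
  apply: pregM; last exact: (lim_reg (lim_horner _ hT)).
  by apply: pregM; [apply: preg_c | apply: (lim_reg (limV (oner_neq0 _) hth))].
have hE k : h k = c (- (e ^+ k * (iter k (tau th) G).[x])) + u * h k.+1.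
  rewrite /h iterS (Spos_step _ th0 xT thT) {1}TE rmorphN exprSr !rmorphM; ring.
have := expands1D (expands1_of (expands_iter hr hE)) (expands1_c G.[x]).
rewrite /h /= rmorph1 mul1r subrK; apply: expands1_eq => k; exact: addr0.
Qed.

Definition Sneg th x G T : E :=
  T / (c x - T) * (c th.[x] / (map_poly c th).[T] * (map_poly c G).[T] - c x / T * c G.[x]).

(** X G and sig(G) differ by a multiple of [th], for which Theta(x) / Theta(T) times the value at T
    equals the value at x. Hence T times the summand of G is that of sig(G), up to a constant in
    T. *)
Lemma Sneg_step th il n x G T : T != 0 -> c x - T != 0 -> (map_poly c th).[T] != 0 ->
  Sneg th x G T = T^-1 * (Sneg th x (sig th il n G) T + c (sig th il n G).[x]).
Proof.
move=> T0 xT thT; have [lam e] : exists lam, 'X * G = lam *: th + sig th il n G := ex_intro _ _ (sigE th il n G).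
have eT : (map_poly c G).[T] = (c lam * (map_poly c th).[T] + (map_poly c (sig th il n G)).[T]) / T.
  have := congr1 (fun p => (map_poly c p).[T]) e.
  rewrite rmorphM rmorphD /= map_polyZ map_polyX hornerD hornerZ hornerM hornerX => <-.
  by rewrite mulrC mulKf.
have ex : c (sig th il n G).[x] = c x * c G.[x] - c lam * c th.[x].
  have := congr1 (fun p => c p.[x]) e; rewrite hornerM hornerX hornerD hornerZ rmorphD !rmorphM => ->.
  by rewrite addrAC subrr add0r.
by rewrite /Sneg eT ex; field; rewrite ?T0 ?xT ?thT.
Qed.

Lemma expf_sub (T : E) i n : T != 0 -> (i <= n)%N -> T ^+ i * T ^- n = T^-1 ^+ (n - i).
Proof.
move=> T0 le_in; have -> : T ^+ n = T ^+ i * T ^+ (n - i) by rewrite -exprD subnKC.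
by rewrite invfM mulrA divff ?mul1r ?exprVn // expf_neq0.
Qed.

(** After division by T^n every term except the one of degree n becomes a positive power of 1/T. *)
Lemma lim_horner_top G n (T : E) : T != 0 -> lim pl T^-1 0 -> (size G <= n.+1)%N ->
  lim pl ((map_poly c G).[T] * T ^- n) G`_n.
Proof.
move=> T0 hT sG; rewrite (@horner_coef_wide _ n.+1); last by rewrite size_map_poly.
rewrite mulr_suml; have -> : G`_n = \sum_(i < n.+1) G`_i * 0 ^+ (n - i).
  rewrite (bigD1 ord_max) //= subnn expr0 mulr1 big1 ?addr0 // => i ni.
  rewrite expr0n subn_eq0 leqNgt (_ : (i < n)%N) ?mulr0 //.
  by move: ni; rewrite -val_eqE /= => ni; rewrite ltn_neqAle ni -ltnS ltn_ord.
apply: lim_sum => i _; rewrite coef_map -mulrA; apply: limM; first exact: lim_c.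
have -> : T ^+ i * T ^- n = T^-1 ^+ (n - i).
  have le_in : (i <= n)%N by rewrite -ltnS ltn_ord.
  exact: expf_sub.
by elim: (n - i)%N => [|k IH]; [apply: lim1 | rewrite !exprS; apply: limM].
Qed.

Lemma expands_Sneg th il n x G e T : (0 < n)%N -> (size th <= n.+1)%N -> il * th`_n = 1 ->
  (size G <= n)%N -> T != 0 -> T^-1 = c e * u ->
  expands1 (Sneg th x G T) (fun k => e ^+ k * (iter k (sig th il n) G).[x]).
Proof.
move=> n0 ths hil sG T0 TE.
have hT : lim pl T^-1 0 by rewrite TE -(mulr0 e); apply: limM; [apply: lim_c | apply: lim_u].
have thn : th`_n != 0 by apply: contra_eq_neq hil => ->; rewrite mulr0 eq_sym oner_neq0.
have hth := lim_horner_top T0 hT ths.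
have thT : (map_poly c th).[T] != 0.
  by have := lim_neq0 thn hth; apply: contraNneq => ->; rewrite mul0r.
have hxT : lim pl (c x * T^-1 - 1) (x * 0 - 1).
  by apply: limB; [apply: limM => //; apply: lim_c | apply: lim1].
rewrite mulr0 sub0r in hxT.
have m10 : (-1 : F) != 0 by rewrite oppr_eq0 oner_eq0.
have xT' := lim_neq0 m10 hxT.
have xTE : c x - T = (c x * T^-1 - 1) * T by rewrite mulrBl divfK // mul1r.
have xT : c x - T != 0 by rewrite xTE mulf_neq0.
pose h k := c (e ^+ k) * (Sneg th x (iter k (sig th il n) G) T + c (iter k (sig th il n) G).[x]).
have hr k : preg pl (h k).
  apply: pregM; first exact: preg_c.
  apply: pregD; last exact: preg_c.
  apply: pregM.
    have -> : T / (c x - T) = (c x * T^-1 - 1)^-1 by rewrite xTE invfM mulrCA divff // mulr1.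
    exact: (lim_reg (limV m10 hxT)).
  apply: pregB; last first.
    by apply: pregM; [apply: pregM; [apply: preg_c | apply: (lim_reg hT)] | apply: preg_c].
  rewrite -mulrA; apply: pregM; first exact: preg_c.
  set G' := iter k _ G; have sG' : (size G' <= n.+1)%N by apply: leqW; apply: size_iter_sig.
  (* Both values are divided by T^n: the one of [th] then tends to the nonzero coefficient of degree
     n, and the one of [G'] is regular since its degree is less than n. *)
  have -> : (map_poly c th).[T]^-1 * (map_poly c G').[T]
     = ((map_poly c th).[T] * T ^- n)^-1 * ((map_poly c G').[T] * T ^- n).
    by rewrite invfM invrK; field; rewrite thT expf_neq0.
  apply: pregM; first exact: (lim_reg (limV thn hth)).
  exact: (lim_reg (lim_horner_top T0 hT sG')).
have hE k : h k = c (e ^+ k * (iter k (sig th il n) G).[x]) + u * h k.+1.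
  rewrite /h iterS (Sneg_step il n _ T0 xT thT) TE exprSr !rmorphM; ring.
have := expands1D (expands1_of (expands_iter hr hE)) (expands1_c (- G.[x])).
rewrite /h /= rmorph1 mul1r rmorphN addrK; apply: expands1_eq => k; exact: addr0.
Qed.

End StepExpansions.

Lemma Spos_eq (F E : fieldType) (pl : place F E) (th G : {poly F}) (x : F) (T a b d g m : E) :
  a = pc pl x -> b = pc pl th.[x] -> d = (map_poly (pc pl) th).[T] -> g = (map_poly (pc pl) G).[T] ->
  m = pc pl G.[x] -> T / (a - T) * (b / d * g - m) = Spos pl th x G T.
Proof. by move=> -> -> -> -> ->. Qed.

Lemma Sneg_eq (F E : fieldType) (pl : place F E) (th G : {poly F}) (x : F) (T a b d g m : E) :
  a = pc pl x -> b = pc pl th.[x] -> d = (map_poly (pc pl) th).[T] -> g = (map_poly (pc pl) G).[T] ->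
  m = pc pl G.[x] -> T / (a - T) * (b / d * g - a / T * m) = Sneg pl th x G T.
Proof. by move=> -> -> -> -> ->. Qed.

Lemma eval_comp (A B C : comNzRingType) (f : {rmorphism A -> B}) (g : {rmorphism B -> C}) p T :
  (map_poly (g \o f) p).[T] = (map_poly g (map_poly f p)).[T].
Proof. by rewrite map_poly_comp. Qed.

Lemma Fp_eval_map (R : realType) n l (A B : comNzRingType) (f : {rmorphism SL R n -> A}) (h : {rmorphism A -> B})
    (x : 'I_l -> A) p P T :
  (map_poly h (Fp f x p P)).[T] = mmap (h \o f) (fun j => if j == p then T else h (x j)) P.
Proof. by rewrite map_Fp Fp_eval. Qed.

Section TraceAction.
Variables (R : realType) (n l : nat).
Local Notation L := (KzX R n l).
Local Notation E := (KzXt R n l).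
Local Notation t := (Et R n l).
Variable (P : {mpoly (SL R n)[l]}).
Local Notation th := (map_poly (cS R n l) (theta R n)).
Local Notation G := (fun p => Fp (cS R n l) (@xL R n l) p P).
Local Notation mP := (mmap (cS R n l) (@xL R n l) P).

Lemma Theta_cst (a : L) : Theta (@EK R n l) (cst L a) = cst L th.[a].
Proof.
have -> : th.[a] = thL a by [].
rewrite thL_prod rmorph_prod; apply: eq_bigr => j _.
by rewrite rmorphB rmorph1 rmorphM.
Qed.

Lemma ThetaT (T : E) : Theta (@EK R n l) T = (map_poly (cst L) th).[T].
Proof.
exact: (etrans (ThetaE (cst L \o cK R n l) T) (eval_comp (cS R n l) (cst L) _ T)).
Qed.

Lemma peval_subst (T : E) p :
  peval (@EK R n l) (map_mpoly (@SLval R n) P) (subst_at (@EX R n l) p T) = (map_poly (cst L) (G p)).[T].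
Proof.
apply: etrans (mmap_SLval (@EK R n l) _ P) _.
apply: etrans (esym (Fp_eval_map (cS R n l) (cst L) (@xL R n l) p P T)).
have e1 : @EK R n l \o @SLval R n =1 cst L \o cS R n l := fun c => erefl _.
have e2 j : subst_at (@EX R n l) p T j = (if j == p then T else cst L (xL R n j)).
  by rewrite /subst_at EX_cst.
exact: (eq_mmap P e1 e2).
Qed.

Lemma Fp_x p : (G p).[xL R n p] = mP.
Proof. by rewrite Fp_eval; apply: eq_mmap => // j; case: eqP => [->|]. Qed.

Lemma peval_x : peval (@EK R n l) (map_mpoly (@SLval R n) P) (@EX R n l) = cst L mP.
Proof.
apply: etrans (mmap_SLval (@EK R n l) _ P) _.
apply: etrans (esym (rmorph_mmap (cst L) (cS R n l) (@xL R n l) P)).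
have e1 : @EK R n l \o @SLval R n =1 cst L \o cS R n l := fun c => erefl _.
exact: (eq_mmap P e1 (@EX_cst R n l)).
Qed.

Lemma Spos_E p (T : E) : T / (EX R n p - T) *
    (Theta (@EK R n l) (EX R n p) / Theta (@EK R n l) T
      * peval (@EK R n l) (map_mpoly (@SLval R n) P) (subst_at (@EX R n l) p T)
     - peval (@EK R n l) (map_mpoly (@SLval R n) P) (@EX R n l))
  = Spos (place_0 L) th (xL R n p) (G p) T.
Proof.
exact: (@Spos_eq L E (place_0 L) th (G p) (xL R n p) T _ _ _ _ _ (EX_cst R n p)
  (etrans (congr1 (Theta (@EK R n l)) (EX_cst R n p)) (Theta_cst _)) (ThetaT T) (peval_subst T p) (etrans peval_x (congr1 (cst L) (esym (Fp_x p))))).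
Qed.

Lemma Sneg_E p (T : E) : T / (EX R n p - T) *
    (Theta (@EK R n l) (EX R n p) / Theta (@EK R n l) T
      * peval (@EK R n l) (map_mpoly (@SLval R n) P) (subst_at (@EX R n l) p T)
     - EX R n p / T * peval (@EK R n l) (map_mpoly (@SLval R n) P) (@EX R n l))
  = Sneg (place_oo L) th (xL R n p) (G p) T.
Proof.
exact: (@Sneg_eq L E (place_oo L) th (G p) (xL R n p) T _ _ _ _ _ (EX_cst R n p)
  (etrans (congr1 (Theta (@EK R n l)) (EX_cst R n p)) (Theta_cst _)) (ThetaT T) (peval_subst T p) (etrans peval_x (congr1 (cst L) (esym (Fp_x p))))).
Qed.

End TraceAction.

Section PrefactorExpansions.
Variables (F E : fieldType) (pl : place F E).
Local Notation c := (pc pl).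
Local Notation u := (pu pl).

Lemma expands1_geom a : expands1 pl (c a * u / (1 - c a * u)) (fun k => a ^+ k).
Proof.
have l1 : lim pl (1 - c a * u) (1 - a * 0).
  by apply: limB; [apply: lim1 | apply: limM; [apply: lim_c | apply: lim_u]].
rewrite mulr0 subr0 in l1; have n0 := lim_neq0 (oner_neq0 _) l1.
have -> : c a * u / (1 - c a * u) = (1 - c a * u)^-1 + c (-1).
  by rewrite rmorphN1; field.
have := expands1D (expands1_of (expands_geom pl a)) (expands1_c pl (-1)).
by apply: expands1_eq => k; rewrite addr0.
Qed.

Lemma expands1_geom_inv (t : E) a : t^-1 = u -> a != 0 ->
  expands1 pl (- (1 - c a * t)^-1) (fun k => (a^-1) ^+ k).
Proof.
move=> tu a0; have := expands1_geom a^-1.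
have t0 := t_neq0 tu; have ca0 : c a != 0 by rewrite fmorph_eq0.
have n0 := linear_factor_neq0 tu a0 (lim_c pl a).
have -> // : c a^-1 * u / (1 - c a^-1 * u) = - (1 - c a * t)^-1.
rewrite -tu fmorphV; field.
by rewrite n0 t0 ca0 -oppr_eq0 opprB n0.
Qed.

Lemma Sneg0 th x T : Sneg pl th x 0 T = 0.
Proof. by rewrite /Sneg rmorph0 !horner0 rmorph0 !mulr0 subr0 mulr0. Qed.

Lemma expands_Sneg' (th : {poly F}) il n x (G : {poly F}) e T : (size th <= n.+1)%N -> il * th`_n = 1 ->
  (size G <= n)%N -> T != 0 -> T^-1 = c e * u ->
  expands1 pl (Sneg pl th x G T) (fun k => e ^+ k * (iter k (sig th il n) G).[x]).
Proof.
case: (posnP n) => [n0 _ _|n0]; last exact: expands_Sneg.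
rewrite {1}n0 size_poly_leq0 => /eqP-> _ _; rewrite Sneg0 -(rmorph0 c).
by apply: expands1_eq (expands1_c pl 0) => k; rewrite iter_sig0 horner0 mulr0.
Qed.

Lemma expands1_prod_sum (I J : finType) (f : I -> E) (s : I -> nat -> F) (g g' : J -> E) r r' (m : F) :
  (forall i, expands1 pl (f i) (s i)) -> (forall j, expands1 pl (g j) (r j)) -> (forall j, expands1 pl (g' j) (r' j)) ->
  expands1 pl ((\sum_i f i) * c m + \sum_j (g j + g' j))
    (fun k => (\sum_i s i k) * m + \sum_j (r j k + r' j k)).
Proof.
move=> h1 h2 h3; apply: expands1D.
  rewrite mulrC; apply: expands1_eq (expands1Z m (expands1_sum _ h1)) => k.
  exact: mulrC.
by apply: expands1_sum => j; apply: expands1D.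
Qed.

End PrefactorExpansions.

Section TraceActionExpansions.
Variables (R : realType) (n l : nat).
Local Notation L := (KzX R n l).
Local Notation E := (KzXt R n l).
Local Notation t := (Et R n l).
Variable (P : {mpoly (SL R n)[l]}).
Local Notation th := (map_poly (cS R n l) (theta R n)).
Local Notation G := (fun p => Fp (cS R n l) (@xL R n l) p P).
Local Notation mP := (mmap (cS R n l) (@xL R n l) P).
Local Notation PK := (map_mpoly (@SLval R n) P).

Lemma th0L : th`_0 = 1.
Proof. by rewrite coef_map -[X in _ = X](rmorph1 (cS R n l)); congr (cS _ _ _ _); apply: theta_coef0. Qed.

Lemma thnL : cS R n l (il R n) * th`_n = 1.
Proof. by rewrite coef_map -[X in _ = X](rmorph1 (cS R n l)) -rmorphM; congr (cS _ _ _ _); apply: theta_lead. Qed.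

Lemma thsL : (size th <= n.+1)%N.
Proof. exact: leq_trans (size_poly _ _) (size_theta R n). Qed.

Lemma a_pos_rhsE : a_pos_rhs (@EK R n l) PK t (@EX R n l)
  = (\sum_j (cst L (cK R n l (zvar R j)) * t / (1 - cst L (cK R n l (zvar R j)) * t))) * cst L mP
    + \sum_p (Spos (place_0 L) th (xL R n p) (G p) t + Spos (place_0 L) th (xL R n p) (G p) (- t)).
Proof.
apply: (congr2 +%R); first exact: (congr2 *%R (erefl _) (peval_x P)).
by apply: eq_bigr => p _; apply: (congr2 +%R (Spos_E P p t) (Spos_E P p (- t))).
Qed.

Lemma sumN1 (A : comNzRingType) (I : finType) (a b : I -> A) :
  \sum_i (-1 * a i + -1 * b i) = \sum_i (- a i - b i).
Proof. by apply: eq_bigr => i _; rewrite !mulN1r. Qed.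

Lemma a_neg_alg (A : comNzRingType) (I J : finType) (f : I -> A) (m : A) (g : J -> A) :
  - (\sum_i f i) * m - \sum_j g j = (\sum_i - f i) * m + \sum_j (- 1) * g j.
Proof. by rewrite sumrN -mulr_sumr mulN1r. Qed.

Lemma expands1_pos : expands1 (place_0 L) (a_pos_rhs (@EK R n l) PK t (@EX R n l))
  (fun k => (\sum_j (cK R n l (zvar R j)) ^+ k) * mP
     + \sum_p (- (1 ^+ k * (iter k (tau th) (G p)).[xL R n p]) + - ((-1) ^+ k * (iter k (tau th) (G p)).[xL R n p]))).
Proof.
rewrite a_pos_rhsE; apply: expands1_prod_sum => [j|p|p].
- have := @expands1_geom _ _ (place_0 L) (cK R n l (zvar R j)).
  by rewrite place_0_u.
- apply: expands_Spos; [exact: th0L | exact: xL_neq0 |].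
  by rewrite rmorph1 mul1r place_0_u.
apply: expands_Spos; [exact: th0L | exact: xL_neq0 |].
by rewrite rmorphN1 mulN1r place_0_u.
Qed.

Lemma a_neg_rhsE : a_neg_rhs (@EK R n l) PK t (@EX R n l)
  = (\sum_j (- (1 - cst L (cK R n l (zvar R j)) * t)^-1)) * cst L mP
    + \sum_p (cst L (-1) * Sneg (place_oo L) th (xL R n p) (G p) t
              + cst L (-1) * Sneg (place_oo L) th (xL R n p) (G p) (- t)).
Proof.
transitivity (- (\sum_j (1 - cst L (cK R n l (zvar R j)) * t)^-1) * cst L mP
  - \sum_p (Sneg (place_oo L) th (xL R n p) (G p) t + Sneg (place_oo L) th (xL R n p) (G p) (- t))).
  apply: (congr2 +%R); first exact: (congr2 *%R (erefl _) (peval_x P)).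
  apply: (congr1 -%R).
  by apply: eq_bigr => p _; apply: (congr2 +%R (Sneg_E P p t) (Sneg_E P p (- t))).
rewrite a_neg_alg; apply: (congr2 +%R (erefl _)); apply: eq_bigr => p _.
by rewrite rmorphN1 mulrDr.
Qed.

Lemma Et_neq0 : t != 0.
Proof. exact: (t_neq0 (Et_inv R n l)). Qed.

Lemma expands1_neg : (forall m, m \in mpoly.msupp P -> forall j, (m j < n)%N) ->
  expands1 (place_oo L) (a_neg_rhs (@EK R n l) PK t (@EX R n l))
  (fun k => (\sum_j (cK R n l (zvar R j))^-1 ^+ k) * mP
     + \sum_p (-1 * (1 ^+ k * (iter k (sig th (cS R n l (il R n)) n) (G p)).[xL R n p])
               + -1 * ((-1) ^+ k * (iter k (sig th (cS R n l (il R n)) n) (G p)).[xL R n p]))).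
Proof.
move=> degP.
have sG p : (size (G p) <= n)%N by apply: size_Fp => m hm; apply: degP.
rewrite a_neg_rhsE; apply: expands1_prod_sum => [j|p|p].
- exact: (expands1_geom_inv (pl := place_oo L) (Et_inv R n l) (@cK_zvar_neq0 R n l j)).
- apply: (expands1Z (-1) (@expands_Sneg' L E (place_oo L) th _ n (xL R n p) (G p) 1 t thsL thnL (sG p) Et_neq0 _)).
  by rewrite rmorph1 mul1r.
apply: (expands1Z (-1) (@expands_Sneg' L E (place_oo L) th _ n (xL R n p) (G p) (-1) (- t) thsL thnL (sG p) _ _)).
  by rewrite oppr_eq0; exact: Et_neq0.
by rewrite rmorphN1 mulN1r invrN.
Qed.

Definition cz inv j : L := if inv then (cK R n l (zvar R j))^-1 else cK R n l (zvar R j).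

Lemma cS_powsum inv k : cS R n l (powsum R n inv k) = \sum_j cz inv j ^+ k.
Proof.
have -> : cS R n l (powsum R n inv k) = cK R n l (powsumK R n inv k) by rewrite -powsumE.
rewrite rmorph_sum; apply: eq_bigr => j _; rewrite rmorphXn; congr (_ ^+ k).
by rewrite /zpow /cz; case: inv; rewrite ?fmorphV.
Qed.

Lemma mu_opA inv k (v : L) :
  v = (\sum_j cz inv j ^+ k) * mP
    + \sum_p (- (1 ^+ k * (iter k (stA (cS R n l) inv) (G p)).[xL R n p])
              + - ((-1) ^+ k * (iter k (stA (cS R n l) inv) (G p)).[xL R n p])) ->
  v = mu R n l (opA inv k P).
Proof.
move=> ->; rewrite muE mmap_opA cS_powsum rmorph_sgc; congr (_ + _).
rewrite /trF mulr_sumr -sumrN; apply: eq_bigr => p _.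
by rewrite -opprD -mulrDl expr1n.
Qed.

End TraceActionExpansions.

Section TraceGood.
Variables (R : realType).

Lemma in_Ures0 : in_Ures (0 : Uq R).
Proof.
have [_ _ _ Z] := closed_Ures R.
by rewrite -(scale0r (Ux R false 0)); apply: Z (specializes_nat R 0) _; apply: Ures_x.
Qed.

Lemma in_a_pos k : in_Ures (a_pos R k).
Proof. by rewrite /a_pos; case: eqP => [_|/eqP k0]; [exact: in_Ures0 | apply: Ures_A]. Qed.

Lemma in_a_neg k : in_Ures (a_neg R k).
Proof.
rewrite /a_neg; case: eqP => [_|/eqP k0]; [exact: in_Ures0 | apply: Ures_A].
by rewrite oppr_eq0.
Qed.

Lemma lifts_deg n l (P : skewA R n) (P' : {mpoly (SL R n)[l]}) : lifts P P' ->
  forall m, m \in mpoly.msupp P' -> forall j, (m j < n)%N.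
Proof.
move=> hP m hm; have [_ degP _] := AcompP P l; apply: degP; rewrite -hP mcoeff_msupp mcoeff_map_mpoly.
by rewrite -(rmorph0 (@SLval R n)) (inj_eq (@SLval_inj R n)) -mcoeff_msupp.
Qed.

Lemma expands1_coef (F E : fieldType) (pl : place F E) f s s' k :
  expands pl f s -> expands1 pl f s' -> s k.+1 = s' k.+1.
Proof. by move=> h [r hr er]; rewrite -er; apply: (expands_unique h hr). Qed.

Variables (n : nat) (act : Ui R -> skewA R n -> skewA R n).
Hypothesis act_action : is_action act.

Lemma act_ta_pos (u : Ures R) l k (P : skewA R n) (P' : {mpoly (SL R n)[l]}) :
  Ures_val u = Uta R k.+1%:Z -> lifts P P' ->
  act (Uspec u) P l = map_mpoly (@SLval R n) (opA false k.+1 P').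
Proof.
move=> uE hP.
have := @act_a_pos _ _ _ act_action l (fun k => MkUres (in_a_pos k)) (fun k => erefl) P.
rewrite -hP => /expands0P h.
have := expands1_coef k h (expands1_pos P'); rewrite scale1r => e.
apply: (@tofr_inj R n l).
apply: etrans (@mu_opA R n l P' false k.+1 _ e).
by congr (tofr _ _ _ (act _ P _)); apply: Uspec_eq; rewrite uE.
Qed.

Lemma act_ta_neg (u : Ures R) l k (P : skewA R n) (P' : {mpoly (SL R n)[l]}) :
  Ures_val u = Uta R (- k.+1%:Z) -> lifts P P' ->
  act (Uspec u) P l = map_mpoly (@SLval R n) (opA true k.+1 P').
Proof.
move=> uE hP.
have := @act_a_neg _ _ _ act_action l (fun k => MkUres (in_a_neg k)) (fun k => erefl) P.
rewrite -hP => /expandsooP h.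
have := expands1_coef k h (expands1_neg (lifts_deg hP)); rewrite scale1r => e.
have e2 : tofr R n l (act (Uspec u) P l) = mu R n l (opA true k.+1 P').
  apply: (@mu_opA R n l P' true k.+1).
  rewrite -sumN1 -[RHS]e.
  by congr (tofr _ _ _ (act _ P _)); apply: Uspec_eq; rewrite uE.
exact: (@tofr_inj R n l _ _ e2).
Qed.

End TraceGood.

Lemma good_Uta (R : realType) n (act : Ui R -> skewA R n -> skewA R n) (act2 : Ui R -> skewA R n.+2 -> skewA R n.+2)
  (act_action : is_action act) (act2_action : is_action act2) (k : int) (u : Ures R) :
  k != 0 -> Ures_val u = Uta R k -> good act act2 (Uspec u).
Proof.
move=> k0 uE P Q /linkP[P' [Q' [hP hQ PQ]]]; apply/linkP.
have [inv [m [h1 h2]]] : exists inv m, (forall l, lifts (act (Uspec u) P) (opA inv m (P' l)))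
    /\ (forall l, lifts (act2 (Uspec u) Q) (opA inv m (Q' l))).
  case: k k0 uE => [[|m]|m] // _ uE; [exists false, m.+1 | exists true, m.+1]; split=> l.
  - exact: (esym (act_ta_pos act_action uE (hP l))).
  - exact: (esym (act_ta_pos act2_action uE (hQ l))).
  - exact: (esym (act_ta_neg act_action uE (hP l))).
  exact: (esym (act_ta_neg act2_action uE (hQ l))).
have hf l : flink (opA inv m (P' l)) (opA inv m (Q' l.+1)).
  exact: (flink_opA inv m (lifts_deg (hP l)) (PQ l)).
exists (fun l => opA inv m (P' l)), (fun l => opA inv m (Q' l)).
exact: (And3 h1 h2 hf).
Qed.

(** * The divided square of [x_0^+] *)

Section PolarParts.
Variables (F E : fieldType) (pl : place F E).
Local Notation c := (pc pl).
Local Notation u := (pu pl).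

(** [residue] is chosen among all admissible values, so it is determined only because principal
    parts are unique. The coefficient of the highest pole is isolated first, by multiplying with a
    power of u. *)
Lemma polar_unique m (d : nat -> F) : preg pl (\sum_(k < m) c (d k) / u ^+ k.+1) ->
  forall k, (k < m)%N -> d k = 0.
Proof.
have u0 : u != 0 := pu_neq0 pl.
elim: m => // m IH rg k; rewrite ltnS leq_eqVlt.
have dm : d m = 0.
  apply: (@lim_unique _ _ pl (c (d m))); first exact: lim_c.
  exists (u ^+ m * (\sum_(k < m.+1) c (d k) / u ^+ k.+1) - \sum_(k < m) c (d k) * u ^+ (m.-1 - k)).
    apply: pregB; first by apply: pregM => //; apply: pregX; apply: preg_u.
    by apply: preg_sum => i _; apply: pregM; [exact: preg_c | apply: pregX; apply: preg_u].
  rewrite rmorph0 add0r mulrBr mulrA -exprS mulr_sumr big_ord_recr /= addrAC.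
  rewrite [X in X - _](_ : _ = u * (\sum_(k0 < m) c (d k0) * u ^+ (m.-1 - k0))); last first.
    rewrite mulr_sumr; apply: eq_bigr => i _; rewrite mulrCA [RHS]mulrCA; congr (_ * _).
    have {1}-> : m.+1 = ((m.-1 - i).+1 + i.+1)%N by have := ltn_ord i; lia.
    by rewrite exprD exprS mulfK // expf_neq0.
  by rewrite subrr add0r mulrCA divff ?mulr1 // expf_neq0.
case/orP => [/eqP->|]; first exact: dm.
by apply: IH; move: rg; rewrite big_ord_recr /= dm rmorph0 mul0r addr0.
Qed.

Lemma polar_pad (s : nat -> F) m M : (m <= M)%N ->
  \sum_(k < m) c (s k) / u ^+ k.+1
  = \sum_(k < M) c (if (k < m)%N then s k else 0) / u ^+ k.+1.
Proof.
move=> le; rewrite (big_ord_widen M (fun k => c (s k) / u ^+ k.+1) le) big_mkcond.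
by apply: eq_bigr => i _ /=; case: ifP => // _; rewrite rmorph0 mul0r.
Qed.

Lemma polar_head (f g g' : E) m m' (s s' : nat -> F) : preg pl g -> preg pl g' ->
  f = \sum_(k < m.+1) c (s k) / u ^+ k.+1 + g ->
  f = \sum_(k < m'.+1) c (s' k) / u ^+ k.+1 + g' -> s 0%N = s' 0%N.
Proof.
move=> rg rg' fE fE'; pose M := (maxn m m').+1.
rewrite (@polar_pad s m.+1 M) ?ltnS ?leq_maxl // in fE.
rewrite (@polar_pad s' m'.+1 M) ?ltnS ?leq_maxr // in fE'.
pose d k := (if (k < m.+1)%N then s k else 0) - (if (k < m'.+1)%N then s' k else 0).
suff h : d 0%N = 0 by apply/eqP; rewrite -subr_eq0; apply/eqP; exact: h.
apply: (@polar_unique M d) => //.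
rewrite (eq_bigr (fun k : 'I_M => c (if (k < m.+1)%N then s k else 0) / u ^+ k.+1
   - c (if (k < m'.+1)%N then s' k else 0) / u ^+ k.+1)); last first.
  by move=> k _; rewrite /d rmorphB mulrBl.
rewrite sumrB.
have -> : \sum_(i < M) c (if (i < m.+1)%N then s i else 0) / u ^+ i.+1 = f - g by rewrite fE addrK.
have -> : \sum_(i < M) c (if (i < m'.+1)%N then s' i else 0) / u ^+ i.+1 = f - g' by rewrite fE' addrK.
by rewrite (_ : _ - _ = g' - g); [apply: pregB | ring].
Qed.

Lemma polar_simple (f : E) r : lim pl (f * u) r -> exists2 g, preg pl g & f = c r / u + g.
Proof.
move=> [g rg fE]; have u0 : u != 0 := pu_neq0 pl; exists g => //.
by rewrite -[LHS](mulfK u0) fE mulrDl [in X in _ + X]mulrAC divff ?mul1r.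
Qed.

End PolarParts.

Section Residues.
Variables (F : fieldType).
Local Notation E := {fraction {poly F}}.

Lemma residue_simple (f : E) a r : lim (place_at a) (f * (ratX F - cst F a)) r -> residue f a = r.
Proof.
move=> /polar_simple[g rg fE].
have h : is_residue f a r.
  by exists 0%N, (fun=> r), g; split=> //; rewrite big_ord1 expr1.
rewrite /residue; case: pselect => [h'|[]]; last by exists r.
have [m [s [g1 [-> rg1 fE1]]]] := svalP (cid h').
have [m2 [s2 [g2 [-> rg2 fE2]]]] := h.
exact: (@polar_head F E (place_at a) f g1 g2 m m2 s s2 rg1 rg2 fE1 fE2).
Qed.

End Residues.

Lemma oneB_div_neq0 (F : fieldType) (a b : F) : a != 0 -> a - b != 0 -> 1 - b * a^-1 != 0.
Proof. by move=> a0 ab; rewrite -(divff a0) -mulrBl mulf_neq0 ?invr_eq0. Qed.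

Lemma cancel_pole (F : fieldType) (v D C w : F) : w != 0 -> v * (D^-1 / w) / C * w = v / D / C.
Proof. by move=> w0; rewrite mulrAC mulrA divfK. Qed.

(** * The residue of the integrand at u = 1/z_a *)

Section IntegrandLimit.
Variables (R : realType) (n l : nat).

Lemma zvarB_neq0 (a b : 'I_n) : b != a -> zvar R a - zvar R b != 0.
Proof.
move=> ba; rewrite -[X in X != 0](rmorphB (tz R n)) tz_eq0; apply/eqP => /(congr1 (mcoeff U_(a))).
rewrite mcoeffB !mcoeffX eqxx eq_mnm1 (negbTE ba) subr0 mcoeff0 => /eqP.
by rewrite oner_eq0.
Qed.

Lemma zvarD_neq0 (a b : 'I_n) : zvar R a + zvar R b != 0.
Proof.
rewrite -[X in X != 0](rmorphD (tz R n)) tz_eq0; apply/eqP => /(congr1 (mcoeff U_(a))).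
rewrite mcoeffD !mcoeffX eqxx mcoeff0 => /eqP.
by rewrite -natrD pnatr_eq0.
Qed.

Variables (F E : fieldType) (p : place F E) (k : {rmorphism Kz R n -> F}).
Variables (P : {mpoly (SL R n)[l.+2]}) (x : 'I_l -> F) (t : F) (a : 'I_n) (u : E).
Local Notation c := (pc p).
Local Notation y := (k (zvar R a)^-1).
Hypothesis uE : pu p = u - c y.
Hypothesis ty : y - t != 0.

Lemma factorB_neq0 b : b != a -> 1 - k (zvar R b) * y != 0.
Proof.
move=> ba; rewrite fmorphV; apply: oneB_div_neq0; first by rewrite fmorph_eq0 zvar_neq0.
by rewrite -rmorphB fmorph_eq0 zvarB_neq0.
Qed.

Lemma factorD_neq0 b : 1 - k (zvar R b) * - y != 0.
Proof.
rewrite fmorphV mulrN -mulNr; apply: oneB_div_neq0; first by rewrite fmorph_eq0 zvar_neq0.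
by rewrite opprK -rmorphD fmorph_eq0 zvarD_neq0.
Qed.

(** The residue at the simple pole u = y. The vanishing factor of Theta(u) is 1 - z_a u = - z_a (u -
    y), whence the factor - z_a and the product over b other than a. *)
Definition integrand_lim : F :=
  mmap (k \o @SLval R n) (snocr (snocr x (- y)) y) P
     / (Theta k (- y) * (- k (zvar R a) * \prod_(b < n | b != a) (1 - k (zvar R b) * y))) / (y - t).

Lemma lim_ThetaP v v0 : lim p v v0 -> lim p (Theta (c \o k) v) (Theta k v0).
Proof.
move=> h; apply: lim_prod => j _; apply: limB; first exact: lim1.
by apply: limM => //; apply: lim_c.
Qed.

Lemma lim_integrand :
  lim p (Xp2_integrand (c \o k) (map_mpoly (@SLval R n) P) (c t) u (c \o x) * pu p) integrand_lim.
Proof.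
have za0 : k (zvar R a) != 0 by rewrite fmorph_eq0 zvar_neq0.
have yE : y = (k (zvar R a))^-1 by rewrite fmorphV.
have u0 := pu_neq0 p.
have lu : lim p u y.
  have -> : u = c y + pu p * 1 by rewrite uE mulr1 addrC subrK.
  by exists 1; first exact: preg1.
pose Th := \prod_(b < n | b != a) (1 - c (k (zvar R b)) * u).
have fE : Theta (c \o k) u = (- c (k (zvar R a)) * Th) * pu p.
  rewrite /Theta (bigD1 a) //= [RHS]mulrAC; congr (_ * _).
  by rewrite uE mulrBr !mulNr opprK -rmorphM yE divff // rmorph1 addrC.
rewrite /Xp2_integrand fE mulrA invfM.
set pv := peval _ _ _; rewrite (_ : _ * pu p = pv / (Theta (c \o k) (- u) * (- c (k (zvar R a)) * Th)) / (u - c t)); last first.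
  exact: cancel_pole.
apply: limM; last first.
  by apply: limV => //; apply: limB => //; apply: lim_c.
apply: limM; last first.
  apply: limV.
    rewrite mulf_neq0 //; first by apply/prodf_neq0 => b _; apply: factorD_neq0.
    by rewrite mulf_neq0 ?oppr_eq0 //; apply/prodf_neq0 => b ba; apply: factorB_neq0.
  apply: limM; first by apply: lim_ThetaP; apply: limN.
  apply: limM; first by apply: limN; apply: lim_c.
  apply: lim_prod => b _; apply: limB; first exact: lim1.
  by apply: limM => //; apply: lim_c.
rewrite /pv /peval mmap_SLval; apply: lim_mmap => [d|j]; first exact: lim_c.
rewrite /snoc /snocr; case: unliftP => [i|] _ //.
by case: unliftP => [i'|] _; [apply: lim_c | apply: limN].
Qed.

(** A second limit, in t instead of u: it extracts from the computed residues their constant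
    coefficient at t = 0. *)
Lemma lim_integrand_lim (x' : 'I_l -> E) t' : (forall j, lim p (x' j) (x j)) -> lim p t' t ->
  lim p (mmap (c \o (k \o @SLval R n)) (snocr (snocr x' (- c y)) (c y)) P
     / (Theta (c \o k) (- c y) * (- c (k (zvar R a)) * \prod_(b < n | b != a) (1 - c (k (zvar R b)) * c y))) / (c y - t'))
    integrand_lim.
Proof.
move=> hx ht; have za0 : k (zvar R a) != 0 by rewrite fmorph_eq0 zvar_neq0.
have ly := lim_c p y.
apply: limM; last by apply: limV => //; apply: limB.
apply: limM; last first.
  apply: limV.
    rewrite mulf_neq0 //; first by apply/prodf_neq0 => b _; apply: factorD_neq0.
    by rewrite mulf_neq0 ?oppr_eq0 //; apply/prodf_neq0 => b ba; apply: factorB_neq0.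
  apply: limM; first by apply: lim_ThetaP; apply: limN.
  apply: limM; first by apply: limN; apply: lim_c.
  apply: lim_prod => b _; apply: limB; first exact: lim1.
  by apply: limM => //; apply: lim_c.
apply: lim_mmap => [d|j]; first exact: lim_c.
rewrite /snocr; case: unliftP => [i|] _ //.
by case: unliftP => [i'|] _ //; apply: limN.
Qed.

End IntegrandLimit.

Section ResidueOperator.
Variables (R : realType) (n : nat).
Local Notation K := (Kz R n).

Definition yv (a : 'I_n) : K := (zvar R a)^-1.
Definition Eden (a : 'I_n) : K := \prod_(b < n | b != a) (1 - zvar R b ^+ 2 * yv a ^+ 2).

(* The sum of the residues at u = 1/z_a defining the divided square of
   x_0^+, at t = 0. *)
Definition RK l (P : {mpoly (SL R n)[l.+2]}) : {mpoly K[l]} :=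
  \sum_a (- 2^-1 * (Eden a)^-1) *:
    mmap (@mpolyC l K \o @SLval R n) (snocr (snocr (fun j => 'X_j) (- (yv a)%:MP)) (yv a)%:MP) P.

Lemma k_Eden (F : comNzRingType) (k : {rmorphism K -> F}) a :
  k (Eden a) = (\prod_(b < n | b != a) (1 - k (zvar R b) * - k (zvar R a)^-1))
    * \prod_(b < n | b != a) (1 - k (zvar R b) * k (zvar R a)^-1).
Proof.
rewrite /Eden rmorph_prod -big_split; apply: eq_bigr => b _ /=.
by rewrite rmorphB rmorph1 rmorphM !rmorphXn; rewrite -/(yv a); ring.
Qed.

Lemma rmorph_scalar (F : fieldType) (k : {rmorphism K -> F}) e : k (- 2^-1 * e^-1) = - 2^-1 * (k e)^-1.
Proof. by rewrite rmorphM rmorphN !fmorphV rmorph_nat. Qed.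

(** The origin of - 1/2: the factor of Theta(- y) at b = a is 1 + z y = 2, and the - z left by the
    simple zero combines with 1 / (y - 0) to give the sign. *)
Lemma residue_scalar_alg (F : fieldType) (z y A B : F) : z * y = 1 -> 2 != 0 :> F -> A != 0 -> B != 0 ->
  ((1 - z * - y) * A * (- z * B))^-1 / (y - 0) = - 2^-1 * (A * B)^-1.
Proof.
move=> zy h2 A0 B0; have z0 : z != 0 by apply: contra_eq_neq zy => ->; rewrite mul0r eq_sym oner_neq0.
have y0 : y != 0 by apply: contra_eq_neq zy => ->; rewrite mulr0 eq_sym oner_neq0.
have -> : 1 - z * - y = 2 by rewrite mulrN opprK zy.
rewrite -invfM (_ : 2 * A * (- z * B) * (y - 0) = - 2 * (A * B)); last first.
  by rewrite subr0 -[RHS]mulr1 -zy; ring.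
by rewrite invfM invrN.
Qed.

Variable l : nat.
Local Notation L := (KzX R n l).

Lemma integrand_limE (P : {mpoly (SL R n)[l.+2]}) a :
  integrand_lim (cK R n l) P (@xL R n l) 0 a
  = cK R n l (- 2^-1 * (Eden a)^-1)
    * mmap (cS R n l) (snocr (snocr (@xL R n l) (- cK R n l (yv a))) (cK R n l (yv a))) P.
Proof.
rewrite /integrand_lim -mulrA mulrC; congr (_ * _).
have y0 : cK R n l (zvar R a)^-1 - 0 != 0 by rewrite subr0 fmorph_eq0 invr_eq0 zvar_neq0.
have A0 : \prod_(b < n | b != a) (1 - cK R n l (zvar R b) * - cK R n l (zvar R a)^-1) != 0.
  by apply/prodf_neq0 => b _; apply: factorD_neq0.
have B0 : \prod_(b < n | b != a) (1 - cK R n l (zvar R b) * cK R n l (zvar R a)^-1) != 0.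
  by apply/prodf_neq0 => b ba; apply: factorB_neq0.
have zy : cK R n l (zvar R a) * cK R n l (zvar R a)^-1 = 1.
  by rewrite -rmorphM divff ?rmorph1 // zvar_neq0.
set rhs := cK R n l (_ * _); rewrite [Theta _ _](bigD1 a) //= (residue_scalar_alg zy (two_neq0L R n l) A0 B0).
by rewrite /rhs rmorph_scalar k_Eden.
Qed.

Lemma tofr_RK (P : {mpoly (SL R n)[l.+2]}) :
  tofr R n l (RK P) = \sum_a integrand_lim (cK R n l) P (@xL R n l) 0 a.
Proof.
rewrite /RK rmorph_sum; apply: eq_bigr => a _; rewrite integrand_limE -mul_mpolyC rmorphM; congr (_ * _).
rewrite rmorph_mmap; apply: eq_mmap => // j /=.
rewrite /snocr; case: unliftP => [i|] _ //.
by case: unliftP => [i'|] _; rewrite ?rmorphN // /xL /mu /= map_mpolyX.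
Qed.

End ResidueOperator.

Section ResidueAction.
Variables (R : realType) (n : nat).
Variables (act : Ui R -> skewA R n -> skewA R n).
Hypotheses (act_action : is_action act).

Lemma yE_sub_t_neq0 l (a : 'I_n) : cst (KzX R n l) (cK R n l (zvar R a)^-1) - Et R n l != 0.
Proof.
have y0 : cK R n l (zvar R a)^-1 - 0 != 0 by rewrite subr0 fmorph_eq0 invr_eq0 zvar_neq0.
apply: (@lim_neq0 _ _ (place_0 (KzX R n l)) _ _ y0).
by apply: limB; [apply: cst_0 | apply: Et_lim].
Qed.

Definition kE l : {rmorphism Kz R n -> KzXt R n l} := cst (KzX R n l) \o cK R n l.

Lemma Xp2_rhsE l (P : {mpoly (SL R n)[l.+2]}) :
  Xp2_rhs (map_mpoly (@SLval R n) P)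
  = \sum_a integrand_lim (kE l) P (@EX R n l) (Et R n l) a.
Proof.
apply: eq_bigr => a _.
have -> : (EK l (zvar R a))^-1 = kE l (zvar R a)^-1 by rewrite fmorphV.
apply: residue_simple.
exact: (@lim_integrand R n l _ _ (place_at (kE l (zvar R a)^-1)) (kE l) P (@EX R n l) (Et R n l) a
  (ratX (KzXt R n l)) (erefl _) (yE_sub_t_neq0 l a)).
Qed.

Lemma lim_Xp2_rhs l (P : {mpoly (SL R n)[l.+2]}) :
  lim (place_0 (KzX R n l)) (Xp2_rhs (map_mpoly (@SLval R n) P)) (tofr R n l (RK P)).
Proof.
rewrite Xp2_rhsE tofr_RK; apply: lim_sum => a _.
have y0 : cK R n l (zvar R a)^-1 - 0 != 0 by rewrite subr0 fmorph_eq0 invr_eq0 zvar_neq0.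
exact: (@lim_integrand_lim R n l _ _ (place_0 (KzX R n l)) (cK R n l) P (@xL R n l) 0 a y0 (@EX R n l) (Et R n l)
  (lim_EX (@cst_0 R n l)) (Et_lim R n l)).
Qed.

Lemma act_Xp2 (u : Ures R) l (P : skewA R n) (P' : {mpoly (SL R n)[l.+2]}) :
  Ures_val u = div_sq (@Xp_ge0 R) 0 -> lifts P P' ->
  act (('i * (-1) ^+ n.+1) *: Uspec u) P l = RK P'.
Proof.
move=> uE hP.
have := @act_Xp_ge0_sq _ _ _ act_action l (fun k => MkUres (Xp_ge0_sq_Ures R k)) (fun k => erefl) P.
rewrite -hP => /expands0P/expands_lim h.
have e := lim_unique h (lim_Xp2_rhs P').
apply: (@tofr_inj R n l); rewrite -[RHS]e.
by congr (tofr _ _ _ (act (_ *: _) P _)); apply: Uspec_eq; rewrite uE.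
Qed.

End ResidueAction.

(** * Polynomials with coefficients in a subring *)

Section CoefficientsIn.
Variables (K : comNzRingType) (S : K -> Prop) (l : nat).
Hypotheses (S1 : S 1) (SB : forall a b, S a -> S b -> S (a - b)) (SM : forall a b, S a -> S b -> S (a * b)).

Definition cin (p : {mpoly K[l]}) : Prop := forall m, S p@_m.

Lemma closed_S0 : S 0. Proof. by rewrite -(subrr 1); apply: SB. Qed.
Lemma closed_SD a b : S a -> S b -> S (a + b).
Proof. by move=> ha hb; rewrite -[b]opprK; apply: SB => //; rewrite -sub0r; apply: SB => //; apply: closed_S0. Qed.

Lemma closed_S_sum (I : Type) (r : seq I) (Pr : pred I) F : (forall i, Pr i -> S (F i)) -> S (\sum_(i <- r | Pr i) F i).
Proof. by move=> h; elim/big_ind: _ => //; [exact: closed_S0 | exact: closed_SD]. Qed.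

Lemma cinC c : S c -> cin c%:MP.
Proof. by move=> hc m; rewrite mcoeffC; case: (_ == _); rewrite ?mulr1 ?mulr0 //; apply: closed_S0. Qed.

Lemma cinX j : cin 'X_j.
Proof. by move=> m; rewrite mcoeffX; case: (_ == _) => //; apply: closed_S0. Qed.

Lemma cin0 : cin 0. Proof. by move=> m; rewrite mcoeff0; apply: closed_S0. Qed.
Lemma cin1 : cin 1. Proof. by rewrite -mpolyC1; apply: cinC. Qed.

Lemma cinD p q : cin p -> cin q -> cin (p + q).
Proof. by move=> hp hq m; rewrite mcoeffD; apply: closed_SD. Qed.

Lemma cinM p q : cin p -> cin q -> cin (p * q).
Proof. by move=> hp hq m; rewrite mcoeffM; apply: closed_S_sum => k _; apply: SM. Qed.

Lemma cinXn p k : cin p -> cin (p ^+ k).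
Proof. by move=> hp; elim: k => [|k IH]; [apply: cin1 | rewrite exprS; apply: cinM]. Qed.

Lemma cin_sum (I : Type) (r : seq I) (Pr : pred I) F : (forall i, Pr i -> cin (F i)) -> cin (\sum_(i <- r | Pr i) F i).
Proof. by move=> h; elim/big_ind: _ => //; [exact: cin0 | exact: cinD]. Qed.

Lemma cin_mmap (A : comNzRingType) k (f : A -> K) (x : 'I_k -> {mpoly K[l]}) (P : {mpoly A[k]}) :
  (forall c, S (f c)) -> (forall j, cin (x j)) -> cin (mmap (@mpolyC l K \o f) x P).
Proof.
move=> hf hx; apply: cin_sum => m _; apply: cinM; first by apply: cinC.
by rewrite /mmap1; elim/big_ind: _ => [||j _]; [exact: cin1 | exact: cinM | exact: cinXn].
Qed.

Definition ord_ge k (p : {mpoly K[l]}) : Prop := forall m, (mdeg m < k)%N -> p@_m = 0.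

Lemma ord_geM i j p q : ord_ge i p -> ord_ge j q -> ord_ge (i + j) (p * q).
Proof.
move=> hp hq m; rewrite mcoeffM => lt_m; rewrite big1 // => k /eqP mk.
have hm : (mdeg k.1 + mdeg k.2 < i + j)%N by rewrite -mdegD -mk.
have [h|h] := ltnP (mdeg k.1) i; first by rewrite hp // mul0r.
by rewrite hq ?mulr0 // -(ltn_add2l i); apply: leq_ltn_trans hm; rewrite leq_add2r.
Qed.

(** 1 - e is invertible as a power series: f is the sum of the e^j (1 - e) f for j < k plus e^k f,
    which has no terms of degree below k. *)
Lemma cin_cancel (e f : {mpoly K[l]}) : cin e -> ord_ge 1 e -> cin ((1 - e) * f) -> cin f.
Proof.
move=> he oe hf.
have step k : exists2 g, cin g & f = g + e ^+ k * f.
  elim: k => [|k [g hg {1}->]]; first by exists 0; [exact: cin0 | rewrite mul1r add0r].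
  exists (g + e ^+ k * ((1 - e) * f)); last by rewrite exprSr; ring.
  by apply: cinD => //; apply: cinM => //; apply: cinXn.
have oek k : ord_ge k (e ^+ k * f).
  elim: k => [|k IH]; first by move=> m.
  by rewrite exprS -mulrA -add1n; apply: ord_geM.
move=> m; have [g hg ->] := step (mdeg m).+1.
by rewrite mcoeffD oek // addr0.
Qed.

Lemma cin_cancel_prod (z : K) (r : seq 'I_l) f : S z ->
  cin ((\prod_(a <- r) (1 - 'X_a ^+ 2 * (z ^+ 2)%:MP)) * f) -> cin f.
Proof.
move=> hz; elim: r f => [|a r IH] f; first by rewrite big_nil mul1r.
rewrite big_cons [X in X * f]mulrC -mulrA => /IH; apply: cin_cancel.
  apply: cinM; first exact: cinXn (cinX a).
  by apply: cinC; rewrite expr2; apply: SM.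
have o0 p : ord_ge 0 p by [].
have oX : ord_ge 1 'X_a.
  move=> m; rewrite ltnS leqn0 mcoeffX => /eqP m0; case: eqP => // e.
  by move: m0; rewrite -e mdeg1.
by rewrite -[1%N]addn0 expr2 -mulrA; apply: ord_geM.
Qed.

End CoefficientsIn.

(** * The local ring of functions having a value at a point *)

Section ValueRing.
Variables (R : realType) (n m : nat) (v : 'I_n -> Kz R m).
Local Notation K := (Kz R n).
Local Notation hvv := (hv (tz R n) (evz v)).

Definition regv (c : K) : Prop := exists d, hvv c d.
Definition VRpred : {pred K} := fun c => `[< regv c >].

Lemma VRpredP c : reflect (regv c) (c \in VRpred).
Proof. exact: asboolP. Qed.

Lemma VRpred_subring : subring_closed VRpred.
Proof.
split; first by apply/VRpredP; exists 1; apply: hv1.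
  move=> c d /VRpredP[c' hc] /VRpredP[d' hd]; apply/VRpredP; exists (c' - d').
  by apply: hvB => //; apply: tz_eq0.
move=> c d /VRpredP[c' hc] /VRpredP[d' hd]; apply/VRpredP; exists (c' * d').
by apply: hvM => //; apply: tz_eq0.
Qed.

HB.instance Definition _ := GRing.isSubringClosed.Build K VRpred VRpred_subring.

Record VR : Type := MkVR { VRval : K; VRvalP : VRval \in VRpred }.

HB.instance Definition _ := [isSub for VRval].
HB.instance Definition _ := [Choice of VR by <:].
HB.instance Definition _ := [SubChoice_isSubComNzRing of VR by <:].

Lemma VRval_zmod : zmod_morphism VRval.
Proof. exact: (rmorphB (\val : VR -> K)). Qed.

Lemma VRval_monoid : monoid_morphism VRval.
Proof. by split; [exact: (rmorph1 (\val : VR -> K)) | exact: (rmorphM (\val : VR -> K))]. Qed.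

HB.instance Definition _ := GRing.isZmodMorphism.Build VR K VRval VRval_zmod.
HB.instance Definition _ := GRing.isMonoidMorphism.Build VR K VRval VRval_monoid.

Lemma VRval_inj : injective VRval.
Proof. exact: val_inj. Qed.

Definition liftV (c : K) : VR := insubd 0 c.

Lemma liftVK c : regv c -> VRval (liftV c) = c.
Proof. by move=> h; rewrite /liftV [LHS]insubdK //; apply/VRpredP. Qed.

Definition VRres (c : VR) : Kz R m := value v (VRval c).

Lemma hv_VR (c : VR) : hvv (VRval c) (VRres c).
Proof. by apply: value_exists; apply/VRpredP; case: c. Qed.

Lemma VRres_zmod : zmod_morphism VRres.
Proof. by move=> c d; apply: valueE; rewrite rmorphB; apply: hvB; try exact: tz_eq0; apply: hv_VR. Qed.

Lemma VRres_monoid : monoid_morphism VRres.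
Proof.
split=> [|c d]; apply: valueE; first by rewrite rmorph1; apply: hv1.
by rewrite rmorphM; apply: hvM; try exact: tz_eq0; apply: hv_VR.
Qed.

HB.instance Definition _ := GRing.isZmodMorphism.Build VR (Kz R m) VRres VRres_zmod.
HB.instance Definition _ := GRing.isMonoidMorphism.Build VR (Kz R m) VRres VRres_monoid.

Lemma VRresE c d : hvv c d -> VRres (liftV c) = d.
Proof. by move=> h; apply: valueE; rewrite liftVK //; exists d. Qed.

Lemma map_VRval_inj l : injective (map_mpoly VRval : {mpoly VR[l]} -> _).
Proof. exact: map_mpoly_inj VRval_inj. Qed.

Lemma regvB c d : regv c -> regv d -> regv (c - d).
Proof. by move=> [c' hc] [d' hd]; exists (c' - d'); apply: hvB => //; apply: tz_eq0. Qed.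

Lemma regvM c d : regv c -> regv d -> regv (c * d).
Proof. by move=> [c' hc] [d' hd]; exists (c' * d'); apply: hvM => //; apply: tz_eq0. Qed.

Lemma liftVP l (p : {mpoly K[l]}) : cin regv p -> exists q : {mpoly VR[l]}, map_mpoly VRval q = p.
Proof.
move=> h; exists (\sum_(k <- mpoly.msupp p) liftV p@_k *: 'X_[k]).
rewrite [RHS]mpolyE rmorph_sum; apply: eq_bigr => k _ /=.
by rewrite map_mpolyZ map_mpolyX /= liftVK.
Qed.

(** Serves for the two terms with a pole, once their common denominator [c] is taken out: if their
    sum vanishes on the divisor, it is divisible by [c] coefficient by coefficient. *)
Lemma VR_divisible l (c : K) (q : {mpoly VR[l]}) :
  (forall x : VR, VRres x = 0 -> regv (VRval x / c)) -> c != 0 ->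
  map_mpoly VRres q = 0 -> exists q' : {mpoly VR[l]}, map_mpoly VRval q = c%:MP * map_mpoly VRval q'.
Proof.
move=> hdiv c0 hq.
have [q' hq'] : exists q' : {mpoly VR[l]}, map_mpoly VRval q' = c^-1 *: map_mpoly VRval q.
  apply: liftVP => k; rewrite mcoeffZ mcoeff_map_mpoly mulrC; apply: hdiv.
  by have := congr1 (mcoeff k) hq; rewrite mcoeff_map_mpoly mcoeff0.
by exists q'; rewrite hq' mul_mpolyC scalerA divff // scale1r.
Qed.

End ValueRing.

Lemma frac_eq0 (F : fieldType) (x y : F) : y != 0 -> 0 = x / y -> x = 0.
Proof. by move=> y0 /esym/eqP; rewrite mulf_eq0 invr_eq0 (negbTE y0) orbF => /eqP. Qed.

Lemma cancel_factor (F : fieldType) (l x y : F) : l != 0 -> l * x / y / l = x / y.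
Proof. by move=> l0; rewrite mulrAC [l * x]mulrC mulfK. Qed.

Lemma cancel_factor_eq (F : fieldType) (l c x y : F) : l != 0 -> c * l = l * x / y -> c = x / y.
Proof. by move=> l0 h; apply: (mulIf l0); rewrite h; ring. Qed.

(** * The divisors attached to the last pair of parameters *)

Section LastPair.
Variables (R : realType) (n : nat).
Local Notation C := R[i].
Local Notation N := n.+2.
Local Notation K := (Kz R N).
Local Notation z := (zvar R (@ord_max n)).

Definition i0 : 'I_N := lift ord_max ord_max.
Definition i1 : 'I_N := ord_max.

(* The specialization of a link for e = true, the diagonal for e = false. *)
Definition veps (e : bool) (j : 'I_N) : Kz R n.+1 :=
  if unlift ord_max j is Some k then zvar R k else if e then - z else z.

Lemma veps0 e : veps e i0 = z. Proof. by rewrite /veps liftK. Qed.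
Lemma veps1 e : veps e i1 = (-1) ^+ e * z.
Proof. by rewrite /veps unlift_none; case: e; rewrite ?expr1 ?mulN1r ?expr0 ?mul1r. Qed.
Lemma vepsl e k : veps e (lift ord_max k) = zvar R k. Proof. by rewrite /veps liftK. Qed.

Lemma veps_neq0 e j : veps e j != 0.
Proof. by rewrite /veps; case: unliftP => [k|] _; [|case: e; rewrite ?oppr_eq0]; apply: zvar_neq0. Qed.

Definition ell (e : bool) : K := zvar R i0 - (-1) ^+ e * zvar R i1.

Section Divisibility.
Variable A : comNzRingType.
Variables (l : A) (I : Type).

Lemma cong_prod (r : seq I) (f g : I -> A) : (forall i, exists q, f i - g i = l * q) ->
  exists q, \prod_(i <- r) f i - \prod_(i <- r) g i = l * q.
Proof.
move=> h; elim: r => [|i r [q hq]]; first by exists 0; rewrite !big_nil subrr mulr0.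
have [q1 h1] := h i; rewrite !big_cons; exists (q1 * \prod_(j <- r) f j + g i * q).
by rewrite mulrDr mulrA -h1 mulrCA -hq; ring.
Qed.

Lemma cong_exp (a b : A) k : (exists q, a - b = l * q) -> exists q, a ^+ k - b ^+ k = l * q.
Proof. by move=> [q hq]; exists (q * \sum_(i < k) a ^+ (k.-1 - i) * b ^+ i); rewrite mulrA -hq subrXX. Qed.

End Divisibility.

Lemma cong_mmap (A B : comNzRingType) k (l : B) (f : A -> B) (x y : 'I_k -> B) (P : {mpoly A[k]}) :
  (forall j, exists q, x j - y j = l * q) -> exists q, mmap f x P - mmap f y P = l * q.
Proof.
move=> h; rewrite /mmap; elim: (mpoly.msupp P : seq _) => [|m r [q hq]].
  by exists 0; rewrite !big_nil subrr mulr0.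
have [q1 h1] : exists q, mmap1 x m - mmap1 y m = l * q.
  by apply: cong_prod => j; apply: cong_exp.
rewrite !big_cons; exists (f P@_m * q1 + q).
by rewrite mulrDr -hq mulrCA -h1; ring.
Qed.

Lemma veps_div e (p : {mpoly C[N]}) : evz (veps e) p = 0 ->
  exists q, p = ('X_i0 - (-1) ^+ e * 'X_i1) * q.
Proof.
move=> h0; pose w (j : 'I_N) : {mpoly C[n.+1]} :=
  if unlift ord_max j is Some k then 'X_k else (-1) ^+ e * 'X_ord_max.
(* [w] restricts polynomials to the divisor and [em] lifts them back. The composite only replaces
   X_i1 by (-1)^e X_i0, hence changes p by a multiple of the equation of the divisor, while the
   restriction of p is 0. *)
pose em (k : 'I_n.+1) : {mpoly C[N]} := 'X_(lift ord_max k).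
pose p' := mmap (@mpolyC n.+1 C) w p.
have p'0 : p' = 0.
  suff h : tz R n.+1 p' = evz (veps e) p by apply/eqP; rewrite -(@tz_eq0 R) h h0.
  rewrite rmorph_mmap; apply: eq_mmap => // j /=.
  rewrite /w /veps; case: unliftP => [k|] _ //.
  by case: (e); rewrite ?expr1 ?mulN1r ?rmorphN // expr0 mul1r.
have [q hq] : exists q, mmap (@mpolyC N C) (fun j => 'X_j) p
     - mmap (@mpolyC N C) (fun j => mmap (@mpolyC N C) em (w j)) p = ('X_i0 - (-1) ^+ e * 'X_i1) * q.
  apply: cong_mmap => j; rewrite /w; case: (unliftP ord_max j) => [k|] ->.
    by exists 0; rewrite mmapX mmap1U subrr mulr0.
  exists (- (-1) ^+ e); rewrite rmorphM rmorph_sign /= mmapX mmap1U /em -/i0 -/i1.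
  by case: e {h0 w p' p'0}; rewrite ?expr1 ?expr0; ring.
exists q; rewrite -hq mmap_id.
have -> : mmap (@mpolyC N C) (fun j => mmap (@mpolyC N C) em (w j)) p = mmap (@mpolyC N C) em p'.
  by rewrite /p' rmorph_mmap; apply: eq_mmap => // c /=; rewrite mmapC.
by rewrite p'0 rmorph0 subr0.
Qed.

Lemma tz_ell (e : bool) : tz R N ('X_i0 - (-1) ^+ e * 'X_i1) = ell e.
Proof. by rewrite rmorphB rmorphM rmorph_sign. Qed.

Lemma i01 : i1 != i0.
Proof. exact: neq_lift. Qed.

Lemma ell_neq0 e : ell e != 0.
Proof.
by rewrite /ell; case: e; rewrite ?expr1 ?expr0 ?mulN1r ?mul1r ?opprK; [apply: zvarD_neq0 | apply: zvarB_neq0 i01].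
Qed.

Lemma hv_div e (c : K) : hv (tz R N) (evz (veps e)) c 0 -> regv (veps e) (c / ell e).
Proof.
move=> [X [D [D0 -> /(frac_eq0 D0)/veps_div[q ->]]]].
exists (evz (veps e) q / evz (veps e) D), q, D; split=> //.
by rewrite rmorphM tz_ell; apply: cancel_factor; apply: ell_neq0.
Qed.

Lemma laurent_regv e c : laurent c -> regv (veps e) c.
Proof. by move=> h; apply: laurent_hv h; apply: veps_neq0. Qed.

(** As c has a value and the equation vanishes on the divisor, the numerator of their product
    vanishes there and is divisible by the equation. *)
Lemma laurent_div e (c : K) : laurent (c * ell e) -> regv (veps e) c -> laurent c.
Proof.
move=> [p [k hp]] [d hd].
have z0 : hv (tz R N) (evz (veps e)) (ell e) 0.
  have := hv_embed (tz R N) (evz (veps e)) ('X_i0 - (-1) ^+ e * 'X_i1).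
  rewrite tz_ell rmorphB rmorphM rmorph_sign /= !mmapX !mmap1U veps0 veps1 mulrA -expr2 sqrr_sign mul1r.
  by rewrite subrr.
have zk0 : (tz R N (\prod_j 'X_j)) ^+ k != 0 by rewrite expf_neq0 // -zprodE zprod_neq0.
have : evz (veps e) p = 0.
  apply: (hv_unique (@tz_eq0 R N) (hv_embed (tz R N) (evz (veps e)) p)).
  have -> : tz R N p = c * ell e * tz R N ((\prod_j 'X_j) ^+ k) by rewrite hp rmorphXn divfK.
  rewrite -(mul0r (evz (veps e) ((\prod_j 'X_j) ^+ k))) -(mulr0 d).
  exact: (hvM (hvM hd z0) (hv_embed _ _ _)).
move=> /veps_div[q hq]; exists q, k.
by apply: (cancel_factor_eq (ell_neq0 e)); rewrite hp hq rmorphM tz_ell.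
Qed.

End LastPair.

(** * Removal of the denominators *)

Section Denominators.
Variables (R : realType) (n : nat).
Local Notation N := n.+2.
Local Notation K := (Kz R N).

Lemma exists_perm (a b : 'I_N) : b != a -> exists s : {perm 'I_N}, s a = i0 n /\ s b = i1 n.
Proof.
move=> ba; pose s1 := tperm a (i0 n); pose b' := s1 b.
have b'0 : b' != i0 n by rewrite /b' -(tpermL a (i0 n)) (inj_eq perm_inj).
exists (s1 * tperm b' (i1 n))%g; rewrite !permM tpermL; split.
  by rewrite tpermD ?i01.
by rewrite -/b' tpermL.
Qed.

Lemma Kperm_fraction s p k :
  Kperm s (tz R N p / tz R N (\prod_j 'X_j) ^+ k) = tz R N (msym s p) / tz R N (\prod_j 'X_j) ^+ k.
Proof. by rewrite -zprodE fmorph_div rmorphXn /= Kperm_zprod (Kperm_tz s). Qed.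

Lemma laurent_Kperm s (c : K) : laurent (Kperm s c) -> laurent c.
Proof.
move=> [p [k h]]; exists (msym (s^-1)%g p), k; apply: (fmorph_inj (Kperm s)).
apply: etrans h _; apply: esym; rewrite [LHS]Kperm_fraction.
by rewrite -msymMm mulVg msym1m.
Qed.

Lemma Kperm_laurent s (c : K) : laurent c -> laurent (Kperm s c).
Proof. by move=> [p [k ->]]; exists (msym s p), k; apply: Kperm_fraction. Qed.

Definition lfac (j : 'I_N * 'I_N * bool) : K := 1 - (-1) ^+ j.2 * zvar R j.1.2 * yv R j.1.1.

Lemma laurent_zvar m (j : 'I_m) : laurent (zvar R j).
Proof. exact: (laurent_poly 'X_j). Qed.

Lemma laurent1 m : laurent (1 : Kz R m).
Proof. by rewrite -(rmorph1 (@zC R m)); apply: laurent_zC. Qed.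

Lemma laurentN m (c : Kz R m) : laurent c -> laurent (- c).
Proof. by move=> h; rewrite -mulN1r -(rmorphN1 (@zC R m)); apply: laurentM => //; apply: laurent_zC. Qed.

Lemma laurent_lfac j : laurent (lfac j).
Proof.
apply: laurentB; first exact: laurent1.
apply: laurentM; last exact: laurent_zvarV.
apply: laurentM; last exact: laurent_zvar.
by case: j.2; rewrite ?expr1 ?expr0; [apply: laurentN|]; apply: laurent1.
Qed.

Lemma lfac_ell_alg (F : fieldType) (c s za zb y : F) : za * y = 1 -> c * (1 - s * zb * y) * za = c * (za - s * zb).
Proof.
move=> h; rewrite -mulrA; congr (c * _); rewrite mulrBl mul1r -!mulrA [y * za]mulrC h mulr1 //.
Qed.

(* Some permutation moves the divisor z_a = +- z_b to z_n = +- z_n.+1, where c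
   is regular by assumption. *)
Lemma remove_factor (c : K) j : j.1.2 != j.1.1 -> laurent (c * lfac j) ->
  (forall s, regv (veps R j.2) (Kperm s c)) -> laurent c.
Proof.
case: j => [[a b] e] /= ba hl hr; have [s [sa sb]] := exists_perm ba.
apply: (@laurent_Kperm s); apply: (@laurent_div R n e _ _ (hr s)).
have <- : Kperm s (c * lfac (a, b, e)) * zvar R (i0 n) = Kperm s c * ell R n e.
  rewrite rmorphM /lfac rmorphB rmorph1 !rmorphM rmorph_sign /= /yv fmorphV /= !Kperm_zvar sa sb.
  by apply: lfac_ell_alg; rewrite divff // zvar_neq0.
by apply: laurentM; [apply: Kperm_laurent | apply: laurent_zvar].
Qed.

(** An invariant c has to be examined only along the last pair, with both signs, because
    permutations carry every other divisor there. The factors are then removed one at a time. *)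
Lemma remove_factors (c : K) (r : seq ('I_N * 'I_N * bool)) :
  (forall s, Kperm s c = c) -> (forall e, regv (veps R e) c) ->
  all (fun j => j.1.2 != j.1.1) r -> laurent (c * \prod_(j <- r) lfac j) -> laurent c.
Proof.
move=> cs hr; elim: r => [_|j r IH /= /andP[hj hall]]; first by rewrite big_nil mulr1.
rewrite big_cons [X in c * X]mulrC mulrA => h; apply: IH => //.
apply: (remove_factor hj h) => s; rewrite rmorphM /= cs; apply: regvM; first exact: hr.
by apply: laurent_regv; apply: Kperm_laurent; apply: laurent_prod => i _; apply: laurent_lfac.
Qed.

Lemma Eden_lfac (a : 'I_N) : Eden R a = \prod_(b < N | b != a) (lfac (a, b, false) * lfac (a, b, true)).
Proof. by apply: eq_bigr => b _; rewrite /lfac expr0 expr1; ring. Qed.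

Lemma laurent_Eden (a : 'I_N) : laurent (Eden R a).
Proof. by rewrite Eden_lfac; apply: laurent_prod => b _; apply: laurentM; apply: laurent_lfac. Qed.

Lemma remove_Eden (c : K) : (forall s, Kperm s c = c) -> (forall e, regv (veps R e) c) ->
  laurent (c * \prod_a Eden R a) -> laurent c.
Proof.
move=> cs hr h.
pose r := [seq j <- index_enum ('I_N * 'I_N * bool)%type | j.1.2 != j.1.1].
apply: (remove_factors (r := r) cs hr); first exact: filter_all.
rewrite big_filter; move: h; congr (laurent (c * _)).
transitivity (\prod_(i : 'I_N * 'I_N | i.2 != i.1) \prod_(e : bool) lfac (i, e)).
  transitivity (\prod_(a < N) \prod_(b < N | b != a) \prod_(e : bool) lfac (a, b, e)).
    by apply: eq_bigr => a _; rewrite Eden_lfac; apply: eq_bigr => b _; rewrite big_bool mulrC.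
  by rewrite pair_big_dep; apply: eq_bigr => [[a b]] _.
rewrite pair_big_dep; apply: eq_big => [[[a b] e]|[[a b] e] _] //=; exact: andbT.
Qed.

End Denominators.

Section PairEvaluation.
Variables (R : realType) (n l : nat).

Definition Gev (A : comNzRingType) (f : SL R n -> A) (x : 'I_l -> A) (y : A) (P : {mpoly (SL R n)[l.+2]}) : A :=
  mmap f (snocr (snocr x (- y)) y) P.

Lemma rmorph_Gev (A B : comNzRingType) (h : {rmorphism A -> B}) (f : {rmorphism SL R n -> A}) x y P :
  h (Gev f x y P) = Gev (h \o f) (h \o x) (h y) P.
Proof.
rewrite rmorph_mmap; apply: eq_mmap => // j /=; rewrite /snocr.
by case: unliftP => [i|] _ //; case: unliftP => [k|] _ //; rewrite rmorphN.
Qed.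

Lemma GevN (A : comNzRingType) (f : {rmorphism SL R n -> A}) x y P : mskew P -> Gev f x (- y) P = - Gev f x y P.
Proof.
move=> sP; rewrite /Gev opprK snocr_tperm mmap_skew // odd_tperm neq_lift expr1 mulN1r.
by [].
Qed.

Lemma eq_Gev (A : comNzRingType) (f f' : SL R n -> A) x x' y y' P :
  f =1 f' -> x =1 x' -> y = y' -> Gev f x y P = Gev f' x' y' P.
Proof.
move=> hf hx ->; apply: eq_mmap => // j; rewrite /snocr.
by case: unliftP => [i|] _ //; case: unliftP => [k|].
Qed.

(** Exchanging the equal arguments shows that twice the value is 0; the inverse of 2 lies in [SL]
    and reaches [A] through [f]. *)
Lemma mmap_skew_eq0 k (A : comNzRingType) (f : {rmorphism SL R n -> A}) (x : 'I_k -> A) (i j : 'I_k) P :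
  mskew P -> i != j -> x i = x j -> mmap f x P = 0.
Proof.
move=> sP ij xij; have := mmap_skew f x (tperm i j) sP.
have -> : x \o tperm i j = x.
  by apply: functional_extensionality_dep => r /=; case: tpermP => [->|->|].
rewrite odd_tperm ij expr1 mulN1r => /eqP; rewrite -subr_eq0 opprK -mulr2n -mulr_natl => /eqP h2.
have e : SLc n 2^-1 * SLc n 2 = 1 :> SL R n.
  have e1 : SLval (SLc n 2^-1 * SLc n 2) = 1 :> Kz R n.
    by rewrite rmorphM /= !SLcK -rmorphM mulVf ?rmorph1 // pnatr_eq0.
  apply: SLval_inj; rewrite e1; exact: esym (rmorph1 (@SLval R n)).
have e2 : SLc n 2 = 2 :> SL R n by apply: SLval_inj; rewrite SLcK !rmorph_nat.
by rewrite -[LHS]mul1r -(rmorph1 f) -e e2 rmorphM rmorph_nat -mulrA h2 mulr0.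
Qed.

End PairEvaluation.

Section ResidueSymmetry.
Variables (R : realType) (n l : nat) (P : {mpoly (SL R n)[l.+2]}).
Local Notation K := (Kz R n).

Definition Cn : {rmorphism K -> {mpoly K[l]}} := @mpolyC l K.
Definition SLn : {rmorphism SL R n -> {mpoly K[l]}} := Cn \o @SLval R n.
Definition kap (a : 'I_n) : K := - 2^-1 * (Eden R a)^-1.

Lemma RKE : RK P = \sum_a Cn (kap a) * Gev SLn (fun j => 'X_j) (Cn (yv R a)) P.
Proof.
apply: eq_bigr => a _; rewrite -mul_mpolyC; congr (_ * _); exact: eq_mmap.
Qed.

Lemma Kperm_SLval s (c : SL R n) : Kperm s (SLval c) = SLval c.
Proof. by case: (sym_laurentP (SLval c)) => h _; case: (h (SLvalP' c)) => _; apply. Qed.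

Lemma Kperm_Eden s (a : 'I_n) : Kperm s (Eden R a) = Eden R (s a).
Proof.
rewrite rmorph_prod [RHS](reindex_inj (@perm_inj _ s)) /=; apply: eq_big => b.
  by rewrite (inj_eq perm_inj).
by move=> _; rewrite rmorphB rmorph1 rmorphM !rmorphXn /= /yv fmorphV /= !Kperm_zvar.
Qed.

(** The coefficients of P are invariant, so permuting the parameters merely permutes the
    summands. *)
Lemma Kperm_RK s : map_mpoly (Kperm s) (RK P) = RK P.
Proof.
pose h : {rmorphism {mpoly K[l]} -> {mpoly K[l]}} := map_mpoly (Kperm s).
have hC c : h (Cn c) = Cn (Kperm s c) by rewrite /h /= map_mpolyC.
rewrite RKE -[LHS]/(h _) rmorph_sum [RHS](reindex_inj (@perm_inj _ s)); apply: eq_bigr => a _.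
apply: etrans (rmorphM h _ _) _; apply: (congr2 *%R).
  apply: etrans (hC _) (congr1 Cn _).
  by rewrite /kap rmorphM rmorphN !fmorphV rmorph_nat /= Kperm_Eden.
apply: etrans (rmorph_Gev h SLn _ _ P) (eq_Gev P _ _ _) => [c|j|].
- apply: etrans (hC _) (congr1 Cn _).
  exact: Kperm_SLval.
- by rewrite /h /= map_mpolyX.
apply: etrans (hC _) (congr1 Cn _).
by rewrite /yv fmorphV /= Kperm_zvar.
Qed.

Lemma Kperm_RK_coef s m : Kperm s (RK P)@_m = (RK P)@_m.
Proof. by rewrite -[in RHS](Kperm_RK s) mcoeff_map_mpoly. Qed.

Lemma sym_laurent_laurent (c : K) : sym_laurent c -> laurent c.
Proof. by case: (sym_laurentP c) => h _ /h[]. Qed.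

End ResidueSymmetry.

Section ResidueDenominator.
Variables (R : realType) (n l : nat) (P : {mpoly (SL R n.+2)[l.+2]}).
Local Notation K := (Kz R n.+2).

Lemma laurent_cin_Gev a : cin (@laurent R n.+2) (Gev (SLn R n.+2 l) (fun j => 'X_j) (Cn R n.+2 l (yv R a)) P).
Proof.
apply: cin_mmap => [| | |c|j].
- exact: laurent1.
- exact: laurentB.
- exact: laurentM.
- exact: sym_laurent_laurent (SLvalP' c).
have hy : cin (@laurent R n.+2) (Cn R n.+2 l (yv R a)).
  by apply: cinC; [exact: laurent1 | exact: laurentB | exact: laurent_zvarV].
rewrite /snocr; case: unliftP => [i|] _ //; case: unliftP => [k|] _.
  by apply: cinX; [exact: laurent1 | exact: laurentB].
by move=> m; rewrite mcoeffN; apply: laurentN; apply: hy.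
Qed.

Lemma Eden_neq0 m (a : 'I_m) : Eden R a != 0.
Proof.
apply/prodf_neq0 => b ba.
have -> : 1 - zvar R b ^+ 2 * yv R a ^+ 2 = (1 - zvar R b * (zvar R a)^-1) * (1 - - zvar R b * (zvar R a)^-1).
  by rewrite /yv; ring.
rewrite mulf_neq0 //; apply: oneB_div_neq0; rewrite ?zvar_neq0 //; first exact: zvarB_neq0.
by rewrite opprK; apply: zvarD_neq0.
Qed.

Lemma RK_denominator m : laurent ((RK P)@_m * \prod_a Eden R a).
Proof.
have -> : (RK P)@_m = \sum_a kap R a * (Gev (SLn R n.+2 l) (fun j => 'X_j) (Cn R n.+2 l (yv R a)) P)@_m.
  rewrite RKE; apply: etrans (raddf_sum (mcoeff m) _ _ _) _; apply: eq_bigr => a _; exact: mcoeffCM.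
rewrite mulr_suml; apply: laurent_sum => a _.
rewrite (bigD1 a) //= mulrACA.
have -> : kap R a * Eden R a = zC n.+2 (- 2^-1).
  rewrite /kap divfK ?Eden_neq0 //.
  by rewrite rmorphN (fmorphV (@zC R n.+2)) rmorph_nat.
apply: laurentM; last apply: laurentM.
- exact: laurent_zC.
- exact: laurent_cin_Gev.
by apply: laurent_prod => b _; apply: laurent_Eden.
Qed.

End ResidueDenominator.

Lemma big_ord_max_prod (A : comNzRingType) m (G : 'I_m.+1 -> A) :
  \prod_p G p = \prod_p G (lift ord_max p) * G ord_max.
Proof.
rewrite big_ord_recr /=; congr (_ * _); apply: eq_bigr => p _; congr G.
by apply: ord_inj; rewrite lift_max.
Qed.

Section PairPoleAlgebra.

Lemma common_factor2 (A : comNzRingType) (k0 k1 d c0 c1 g0 g1 x0 x1 : A) :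
  k0 = d * c0 -> k1 = d * c1 -> x0 = c0 * g0 -> x1 = c1 * g1 -> k0 * g0 + k1 * g1 = d * (x0 + x1).
Proof. by move=> -> -> -> ->; rewrite mulrDr !mulrA. Qed.

Lemma opposite_terms (A : comNzRingType) (r0 r1 a0 a1 b g0 g1 : A) :
  r0 = a0 * g0 -> r1 = a1 * g1 -> g0 = g1 -> a0 = - b -> a1 = b -> r0 + r1 = 0.
Proof. by move=> -> -> -> -> ->; rewrite mulNr addNr. Qed.

(** Since s^2 = 1, one has 1 - z1^2 / z0^2 = (z0 - s z1)(z0 + s z1) / z0^2. The factor that vanishes
    on the divisor is split off from the one that does not. *)
Lemma pole_alg0 (F : fieldType) (s z0 z1 c h : F) : s ^+ 2 = 1 -> z0 != 0 -> c != 0 ->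
  z0 - s * z1 != 0 -> z0 + s * z1 != 0 ->
  - h * (c * (1 - z1 ^+ 2 * (z0^-1) ^+ 2))^-1 = (z0 - s * z1)^-1 * (- h * (c^-1 * z0 ^+ 2 * (z0 + s * z1)^-1)).
Proof.
move=> s2 z00 c0 l0 m0.
have -> : 1 - z1 ^+ 2 * (z0^-1) ^+ 2 = (z0 - s * z1) * (z0 + s * z1) / z0 ^+ 2.
  rewrite (_ : (z0 - s * z1) * (z0 + s * z1) = z0 ^+ 2 - s ^+ 2 * z1 ^+ 2); last by ring.
  by rewrite s2; field.
by field; rewrite z00 c0 l0 m0.
Qed.

Lemma pole_alg1 (F : fieldType) (s z0 z1 c h : F) : s ^+ 2 = 1 -> z1 != 0 -> c != 0 ->
  z0 - s * z1 != 0 -> z0 + s * z1 != 0 ->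
  - h * (c * (1 - z0 ^+ 2 * (z1^-1) ^+ 2))^-1 = (z0 - s * z1)^-1 * (h * (c^-1 * z1 ^+ 2 * (z0 + s * z1)^-1)).
Proof.
move=> s2 z10 c0 l0 m0.
have -> : 1 - z0 ^+ 2 * (z1^-1) ^+ 2 = - ((z0 - s * z1) * (z0 + s * z1) / z1 ^+ 2).
  rewrite (_ : (z0 - s * z1) * (z0 + s * z1) = z0 ^+ 2 - s ^+ 2 * z1 ^+ 2); last by ring.
  by rewrite s2; field.
by rewrite [c * _]mulrN invrN mulrNN; field; rewrite z10 c0 l0 m0.
Qed.

Lemma one_sub_sq_neq0 (F : fieldType) (a b : F) : a != 0 -> a - b != 0 -> a + b != 0 -> 1 - b ^+ 2 * a^-1 ^+ 2 != 0.
Proof.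
move=> a0 ab ab'; rewrite (_ : _ - _ = (1 - b * a^-1) * (1 - - b * a^-1)); last by ring.
by rewrite mulf_neq0 //; apply: oneB_div_neq0; rewrite ?opprK.
Qed.

End PairPoleAlgebra.

(** * The poles along the last pair *)

Section PairPole.
Variables (R : realType) (n : nat) (e : bool).
Local Notation N := n.+2.
Local Notation K := (Kz R N).
Local Notation K' := (Kz R n.+1).
Local Notation z := (zvar R (@ord_max n)).
Local Notation v := (veps R e).
Local Notation s := ((-1) ^+ e).
Local Notation z_ := (zvar R).

Definition outer (k : 'I_n) : 'I_N := lift ord_max (lift ord_max k).
Definition outer_den (a : 'I_N) : K := \prod_(k < n) (1 - z_ (outer k) ^+ 2 * yv R a ^+ 2).
Definition half_ell : K := z_ (i0 n) + s * z_ (i1 n).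
(** What remains of [kap] at i0 and i1, up to a factor 1/2 or - 1/2, once the pole is removed. Both
    have the same value on the divisor, so [pole_coef0] and [pole_coef1] become opposite there. *)
Definition pole_fac (a : 'I_N) : K := (outer_den a)^-1 * z_ a ^+ 2 * half_ell^-1.
Definition pole_coef0 : K := - 2^-1 * pole_fac (i0 n).
Definition pole_coef1 : K := 2^-1 * pole_fac (i1 n).

Lemma outer_i0 k : outer k != i0 n.
Proof. by rewrite /outer /i0 (inj_eq (@lift_inj _ _)) eq_sym neq_lift. Qed.
Lemma outer_i1 k : outer k != i1 n.
Proof. by rewrite /outer /i1 eq_sym neq_lift. Qed.

Lemma prod_split (F : 'I_N -> K) : \prod_b F b = \prod_(k < n) F (outer k) * F (i0 n) * F (i1 n).
Proof. by rewrite big_ord_max_prod big_ord_max_prod. Qed.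

Lemma sum_split (V : zmodType) (F : 'I_N -> V) : \sum_b F b = \sum_(k < n) F (outer k) + F (i0 n) + F (i1 n).
Proof. by rewrite big_ord_max big_ord_max. Qed.

Lemma Eden_i0 : Eden R (i0 n) = outer_den (i0 n) * (1 - z_ (i1 n) ^+ 2 * yv R (i0 n) ^+ 2).
Proof.
rewrite /Eden big_mkcond prod_split eqxx /= mulr1 i01; congr (_ * _).
by apply: eq_bigr => k _; rewrite outer_i0.
Qed.

Lemma Eden_i1 : Eden R (i1 n) = outer_den (i1 n) * (1 - z_ (i0 n) ^+ 2 * yv R (i1 n) ^+ 2).
Proof.
rewrite /Eden big_mkcond prod_split eqxx /= mulr1 eq_sym i01; congr (_ * _).
by apply: eq_bigr => k _; rewrite outer_i1.
Qed.

Lemma outer_den_neq0 (a : 'I_N) : (forall k, outer k != a) -> outer_den a != 0.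
Proof.
move=> ha; apply/prodf_neq0 => k _; apply: one_sub_sq_neq0; first exact: zvar_neq0.
  exact: zvarB_neq0.
exact: zvarD_neq0.
Qed.

Lemma sign_sqr (F : comNzRingType) : (-1 : F) ^+ e ^+ 2 = 1.
Proof. exact: sqrr_sign. Qed.

Lemma half_ell_neq0 : half_ell != 0.
Proof.
by rewrite /half_ell; case: e; rewrite ?expr1 ?expr0 ?mulN1r ?mul1r; [apply: zvarB_neq0 (i01 n) | apply: zvarD_neq0].
Qed.

Lemma kap_i0 : kap R (i0 n) = (ell R n e)^-1 * pole_coef0.
Proof.
rewrite /kap Eden_i0; apply: pole_alg0; [exact: sign_sqr | exact: zvar_neq0 | | exact: ell_neq0 | exact: half_ell_neq0].
exact: outer_den_neq0 outer_i0.
Qed.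

Lemma kap_i1 : kap R (i1 n) = (ell R n e)^-1 * pole_coef1.
Proof.
rewrite /kap Eden_i1; apply: pole_alg1; [exact: sign_sqr | exact: zvar_neq0 | | exact: ell_neq0 | exact: half_ell_neq0].
exact: outer_den_neq0 outer_i1.
Qed.

Local Notation hvv := (hv (tz R N) (evz v)).

Lemma hv_yv a : hvv (yv R a) (v a)^-1.
Proof. by apply: hvV (veps_neq0 _ _ _) _; apply: hv_zvar. Qed.

Lemma hv_sq c d : hvv c d -> hvv (c ^+ 2) (d ^+ 2).
Proof. exact: hvX. Qed.

Lemma hv_fac b a : hvv (1 - z_ b ^+ 2 * yv R a ^+ 2) (1 - v b ^+ 2 * (v a)^-1 ^+ 2).
Proof. exact: (hvB (@tz_eq0 R N) (hv1 _ _) (hvM (hv_sq (hv_zvar _ _)) (hv_sq (hv_yv _)))). Qed.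

Definition outer_den_value : K' := \prod_(k < n) (1 - z_ (lift ord_max k) ^+ 2 * z^-1 ^+ 2).

Lemma v_sq a : a = i0 n \/ a = i1 n -> (v a) ^+ 2 = z ^+ 2.
Proof. by case=> ->; rewrite ?veps0 ?veps1 // exprMn sign_sqr mul1r. Qed.

Lemma hv_outer_den a : a = i0 n \/ a = i1 n -> hvv (outer_den a) outer_den_value.
Proof.
move=> ha; apply: hv_prod => k _; have := hv_fac (outer k) a.
by rewrite vepsl exprVn (v_sq ha) exprVn.
Qed.

Lemma outer_den_value_neq0 : outer_den_value != 0.
Proof.
apply/prodf_neq0 => k _; apply: one_sub_sq_neq0; first exact: zvar_neq0.
  by apply: zvarB_neq0; rewrite eq_sym neq_lift.
exact: zvarD_neq0.
Qed.

Definition pole_fac_value : K' := outer_den_value^-1 * z ^+ 2 * (z + z)^-1.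

Lemma hv_half_ell : hvv half_ell (z + z).
Proof.
have := hvD (@tz_eq0 R N) (hv_zvar v (i0 n)) (hvM (hvX e (hvN (hv1 (tz R N) (evz v)))) (hv_zvar v (i1 n))).
by rewrite veps0 veps1 mulrA -expr2 sign_sqr mul1r.
Qed.

Lemma hv_pole_fac a : a = i0 n \/ a = i1 n -> hvv (pole_fac a) pole_fac_value.
Proof.
move=> ha; apply: hvM; last by apply: hvV hv_half_ell; apply: zvarD_neq0.
apply: hvM; first by apply: hvV (hv_outer_den ha); exact: outer_den_value_neq0.
by have := hv_sq (hv_zvar v a); rewrite (v_sq ha).
Qed.

Lemma hv_half : hvv 2^-1 2^-1.
Proof.
have e2 m : zC m 2^-1 = 2^-1 :> Kz R m by apply: etrans (fmorphV (@zC R m) 2) _; rewrite rmorph_nat.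
exact: (eq_ind _ (fun c => hvv c 2^-1) (eq_ind _ (fun d => hvv _ d) (hv_zC v 2^-1) _ (e2 _)) _ (e2 _)).
Qed.

Lemma hv_pole_coef0 : hvv pole_coef0 (- 2^-1 * pole_fac_value).
Proof. by apply: hvM; [apply: hvN hv_half | apply: hv_pole_fac; left]. Qed.

Lemma hv_pole_coef1 : hvv pole_coef1 (2^-1 * pole_fac_value).
Proof. by apply: hvM; [exact: hv_half | apply: hv_pole_fac; right]. Qed.

Definition Edv (k : 'I_n) : K' := \prod_(b < N | b != outer k) (1 - v b ^+ 2 * (z_ (lift ord_max k))^-1 ^+ 2).

Lemma v_sub_neq0 k b : b != outer k -> z_ (lift ord_max k) - v b != 0.
Proof.
rewrite /veps /outer; case: (unliftP ord_max b) => [j|] -> h.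
  by apply: zvarB_neq0; move: h; rewrite (inj_eq (@lift_inj _ _)).
case: e; first by rewrite opprK; apply: zvarD_neq0.
by apply: zvarB_neq0; exact: neq_lift.
Qed.

Lemma v_add_neq0 k b : b != outer k -> z_ (lift ord_max k) + v b != 0.
Proof.
rewrite /veps /outer; case: (unliftP ord_max b) => [j|] -> h; first exact: zvarD_neq0.
case: e; last exact: zvarD_neq0.
by apply: zvarB_neq0; exact: neq_lift.
Qed.

Lemma Edv_neq0 k : Edv k != 0.
Proof.
apply/prodf_neq0 => b hb; apply: one_sub_sq_neq0; first exact: zvar_neq0.
  exact: v_sub_neq0.
exact: v_add_neq0.
Qed.

Definition kapv k : K' := - 2^-1 * (Edv k)^-1.

Lemma hv_kap k : hvv (kap R (outer k)) (kapv k).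
Proof.
apply: hvM; first exact: hvN hv_half.
apply: hvV; first exact: Edv_neq0.
by apply: hv_prod => b _; have := hv_fac b (outer k); rewrite vepsl.
Qed.

End PairPole.

Section PairPoleRing.
Variables (R : realType) (n : nat) (e : bool).
Local Notation N := n.+2.
Local Notation K := (Kz R N).
Local Notation K' := (Kz R n.+1).
Local Notation z := (zvar R (@ord_max n)).
Local Notation v := (veps R e).
Local Notation O := (VR (veps R e : 'I_N -> K')).

Definition SLO (c : SL R N) : O := liftV v (SLval c).

Lemma VRval_SLO c : VRval (SLO c) = SLval c.
Proof. by apply: liftVK; apply: laurent_regv; apply: sym_laurent_laurent (SLvalP' c). Qed.

Lemma SLO_zmod : zmod_morphism SLO.
Proof. by move=> c d; apply: VRval_inj; rewrite rmorphB /= !VRval_SLO rmorphB. Qed.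

Lemma SLO_monoid : monoid_morphism SLO.
Proof.
split=> [|c d]; apply: VRval_inj; first by rewrite VRval_SLO !rmorph1.
by rewrite rmorphM /= !VRval_SLO rmorphM.
Qed.

HB.instance Definition _ := GRing.isZmodMorphism.Build (SL R N) O SLO SLO_zmod.
HB.instance Definition _ := GRing.isMonoidMorphism.Build (SL R N) O SLO SLO_monoid.

Variable l : nat.

Definition CO : {rmorphism O -> {mpoly O[l]}} := @mpolyC l O.
Definition SLOX : {rmorphism SL R N -> {mpoly O[l]}} := CO \o SLO.
Definition valX : {rmorphism {mpoly O[l]} -> {mpoly K[l]}} := map_mpoly (@VRval R N n.+1 v).
Definition resX : {rmorphism {mpoly O[l]} -> {mpoly K'[l]}} := map_mpoly (@VRres R N n.+1 v).
Definition SLresX : {rmorphism SL R N -> {mpoly K'[l]}} := Cm R n l \o (@VRres R N n.+1 v \o SLO).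
Definition yO (a : 'I_N) : O := liftV v (yv R a).

Lemma valX_C c : valX (CO c) = Cn R N l (VRval c).
Proof. exact: map_mpolyC. Qed.

Lemma resX_C c : resX (CO c) = Cm R n l (VRres c).
Proof. exact: map_mpolyC. Qed.

Lemma valX_X j : valX 'X_j = 'X_j. Proof. exact: map_mpolyX. Qed.
Lemma resX_X j : resX 'X_j = 'X_j. Proof. exact: map_mpolyX. Qed.

Lemma valX_SLOX c : valX (SLOX c) = SLn R N l c.
Proof. by apply: etrans (valX_C _) (congr1 (Cn R N l) _); apply: VRval_SLO. Qed.

Lemma resX_SLOX c : resX (SLOX c) = SLresX c.
Proof. exact: resX_C. Qed.

Lemma val_yO a : VRval (yO a) = yv R a.
Proof. by apply: liftVK; exists (v a)^-1; apply: hv_yv. Qed.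

Lemma res_yO a : VRres (yO a) = (v a)^-1.
Proof. by apply: VRresE; apply: hv_yv. Qed.

Lemma valX_Gev x a (Q : {mpoly (SL R N)[l.+2]}) :
  valX (Gev SLOX x (CO (yO a)) Q) = Gev (SLn R N l) (valX \o x) (Cn R N l (yv R a)) Q.
Proof.
apply: etrans (rmorph_Gev valX SLOX x _ Q) (eq_Gev Q _ _ _) => [c|//|]; first exact: valX_SLOX.
by apply: etrans (valX_C _) (congr1 (Cn R N l) _); apply: val_yO.
Qed.

Lemma resX_Gev k (x : 'I_k -> {mpoly O[l]}) a (Q : {mpoly (SL R N)[k.+2]}) :
  resX (Gev SLOX x (CO (yO a)) Q) = Gev SLresX (resX \o x) (Cm R n l (v a)^-1) Q.
Proof.
apply: etrans (rmorph_Gev resX SLOX x _ Q) (eq_Gev Q _ _ _) => [c|//|]; first exact: resX_SLOX.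
by apply: etrans (resX_C _) (congr1 (Cm R n l) _); apply: res_yO.
Qed.

Definition pole_coef0O : O := liftV v (pole_coef0 R n e).
Definition pole_coef1O : O := liftV v (pole_coef1 R n e).
Definition kapO k : O := liftV v (kap R (outer k)).

(** The two summands that have a pole along the divisor, multiplied by its equation; [regO] collects
    the others. *)
Definition numO (x : 'I_l -> {mpoly O[l]}) (Q : {mpoly (SL R N)[l.+2]}) : {mpoly O[l]} :=
  CO pole_coef0O * Gev SLOX x (CO (yO (i0 n))) Q + CO pole_coef1O * Gev SLOX x (CO (yO (i1 n))) Q.

Definition regO (x : 'I_l -> {mpoly O[l]}) (Q : {mpoly (SL R N)[l.+2]}) : {mpoly O[l]} := \sum_k CO (kapO k) * Gev SLOX x (CO (yO (outer k))) Q.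

Local Notation XO := (fun j : 'I_l => 'X_j : {mpoly O[l]}).

Lemma RK_O (Q : {mpoly (SL R N)[l.+2]}) :
  RK Q = valX (regO XO Q) + Cn R N l (ell R n e)^-1 * valX (numO XO Q).
Proof.
have vG a : valX (Gev SLOX XO (CO (yO a)) Q) = Gev (SLn R N l) (fun j => 'X_j) (Cn R N l (yv R a)) Q.
  exact: etrans (valX_Gev XO a Q) (eq_Gev Q (fun c => erefl _) (fun j => valX_X j) (erefl _)).
have vc c : regv v c -> valX (CO (liftV v c)) = Cn R N l c.
  by move=> h; apply: etrans (valX_C _) (congr1 (Cn R N l) _); apply: liftVK.
have vk k : valX (CO (kapO k)) = Cn R N l (kap R (outer k)) by apply: vc; eexists; apply: hv_kap.
have v0 : valX (CO pole_coef0O) = Cn R N l (pole_coef0 R n e) by apply: vc; eexists; apply: hv_pole_coef0.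
have v1 : valX (CO pole_coef1O) = Cn R N l (pole_coef1 R n e) by apply: vc; eexists; apply: hv_pole_coef1.
rewrite RKE sum_split -addrA; apply: (congr2 +%R).
  apply: esym; rewrite rmorph_sum; apply: eq_bigr => k _.
  by apply: etrans (rmorphM valX _ _) _; apply: (congr2 *%R (vk k) (vG _)).
have k0 : Cn R N l (kap R (i0 n)) = Cn R N l (ell R n e)^-1 * Cn R N l (pole_coef0 R n e).
  exact: etrans (congr1 (Cn R N l) (kap_i0 R n e)) (rmorphM (Cn R N l) _ _).
have k1 : Cn R N l (kap R (i1 n)) = Cn R N l (ell R n e)^-1 * Cn R N l (pole_coef1 R n e).
  exact: etrans (congr1 (Cn R N l) (kap_i1 R n e)) (rmorphM (Cn R N l) _ _).
apply: etrans (common_factor2 k0 k1 _ _) (congr1 (fun w => Cn R N l (ell R n e)^-1 * w) (esym (rmorphD valX _ _))).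
  exact: etrans (rmorphM valX _ _) (congr2 *%R v0 (vG _)).
exact: etrans (rmorphM valX _ _) (congr2 *%R v1 (vG _)).
Qed.

Lemma VRres_div (x : O) : VRres x = 0 -> regv v (VRval x / ell R n e).
Proof. by move=> h; apply: hv_div; have := hv_VR x; rewrite h. Qed.

(* The terms of RK Q for i0 and i1 have opposite residues along ell = 0. *)
Lemma RK_pole (Q : {mpoly (SL R N)[l.+2]}) :
  Gev SLresX (fun j => 'X_j) (Cm R n l (v (i0 n))^-1) Q = Gev SLresX (fun j => 'X_j) (Cm R n l (v (i1 n))^-1) Q ->
  exists q : {mpoly O[l]}, valX (numO XO Q) = Cn R N l (ell R n e) * valX q /\ RK Q = valX (regO XO Q + q).
Proof.
move=> hG.
have h0 : resX (numO XO Q) = 0.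
  have rG a : resX (Gev SLOX XO (CO (yO a)) Q) = Gev SLresX (fun j => 'X_j) (Cm R n l (v a)^-1) Q.
    exact: etrans (resX_Gev XO a Q) (eq_Gev Q (fun c => erefl _) (fun j => resX_X j) (erefl _)).
  have r0 : resX (CO pole_coef0O) = - Cm R n l (2^-1 * pole_fac_value R n).
    apply: etrans (resX_C _) (etrans (congr1 (Cm R n l) (VRresE (hv_pole_coef0 R n e))) _).
    exact: etrans (congr1 (Cm R n l) (mulNr _ _)) (rmorphN (Cm R n l) _).
  have r1 : resX (CO pole_coef1O) = Cm R n l (2^-1 * pole_fac_value R n).
    exact: etrans (resX_C _) (congr1 (Cm R n l) (VRresE (hv_pole_coef1 R n e))).
  apply: etrans (rmorphD resX _ _) _.
  exact: (opposite_terms (etrans (rmorphM resX _ _) (congr2 *%R (erefl _) (rG _)))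
    (etrans (rmorphM resX _ _) (congr2 *%R (erefl _) (rG _))) hG r0 r1).
have [q hq] := VR_divisible VRres_div (ell_neq0 R n e) h0.
exists q; split; first exact: hq.
apply: etrans (RK_O Q) (etrans (congr1 (fun w => valX (regO XO Q) + w) _) (esym (rmorphD valX _ _))).
apply: etrans (congr1 (fun w => Cn R N l (ell R n e)^-1 * w) hq) (etrans (mulrA _ _ _) _).
apply: etrans (congr1 (fun w => w * valX q) (esym (rmorphM (Cn R N l) _ _))) _.
by apply: etrans (congr1 (fun w => Cn R N l w * valX q) (mulVf (ell_neq0 R n e))) _; rewrite rmorph1 mul1r.
Qed.

Lemma RK_regv (Q : {mpoly (SL R N)[l.+2]}) m :
  Gev SLresX (fun j => 'X_j) (Cm R n l (v (i0 n))^-1) Q = Gev SLresX (fun j => 'X_j) (Cm R n l (v (i1 n))^-1) Q ->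
  regv v (RK Q)@_m.
Proof.
move=> /RK_pole[q [_ ->]]; rewrite mcoeff_map_mpoly; exact: (ex_intro _ _ (hv_VR _)).
Qed.

End PairPoleRing.

Lemma prod_snocr_eq0 (A : comNzRingType) (c y a b : A) l (x : 'I_l -> A) : 1 - y ^+ 2 * c = 0 ->
  a * (\prod_j (1 - snocr x y j ^+ 2 * c)) * b = 0.
Proof. by move=> h; rewrite (big_snocr (fun v => 1 - v ^+ 2 * c)) h !mulr0 mul0r. Qed.

Section RegularSum.
Variables (R : realType) (n l : nat).
Local Notation N := n.+2.
Local Notation z := (zvar R (@ord_max n)).

Lemma SLresX_spec : SLresX R n true l =1 specX R n l.
Proof. by move=> c; apply: (congr1 (Cm R n l)); apply: VRresE; apply: hv_spec. Qed.

Lemma zVX_sq_factor k : 1 - (- zVX R n k) ^+ 2 * zX R n k ^+ 2 = 0.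
Proof. by rewrite sqrrN zVX2 subrr. Qed.

Lemma Gev_spec_eq0 (P : {mpoly (SL R n)[l.+1]}) (Q : {mpoly (SL R N)[l.+2]}) k (x : 'I_l -> {mpoly (Kz R n.+1)[k]}) :
  flink P Q -> Gev (specX R n k) x (zVX R n k) Q = 0.
Proof.
move=> PQ; exact: etrans (flinkX (snocr x (- zVX R n k)) PQ) (prod_snocr_eq0 _ _ _ (zVX_sq_factor k)).
Qed.

Lemma Gev_spec_neg_eq0 (P : {mpoly (SL R n)[l.+1]}) (Q : {mpoly (SL R N)[l.+2]}) k (x : 'I_l -> {mpoly (Kz R n.+1)[k]}) :
  mskew Q -> flink P Q -> Gev (specX R n k) x (- zVX R n k) Q = 0.
Proof. by move=> sQ PQ; apply: etrans (GevN _ _ _ sQ) _; rewrite (Gev_spec_eq0 x PQ) oppr0. Qed.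

Lemma Cm_veps0 e : Cm R n l (veps R e (i0 n))^-1 = zVX R n l.
Proof. by rewrite veps0. Qed.

Lemma Cm_veps1 e : Cm R n l (veps R e (i1 n))^-1 = (-1) ^+ e * zVX R n l.
Proof.
by rewrite veps1; case: e; rewrite ?expr1 ?expr0 ?mul1r // !mulN1r invrN (rmorphN (Cm R n l)).
Qed.

Local Notation X := (fun j : 'I_l => 'X_j : {mpoly (Kz R n.+1)[l]}).

(** For e = false the two arguments coincide. For e = true one is 1/z and the other - 1/z; each
    value is 0, because - 1/z annihilates a factor 1 - X^2 z^2 of the link and the value is odd in
    its argument. *)
Lemma pole_condition (P : {mpoly (SL R n)[l.+1]}) (Q : {mpoly (SL R N)[l.+2]}) e : mskew Q -> flink P Q ->
  Gev (SLresX R n e l) X (Cm R n l (veps R e (i0 n))^-1) Q = Gev (SLresX R n e l) X (Cm R n l (veps R e (i1 n))^-1) Q.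
Proof.
move=> sQ PQ; rewrite Cm_veps0 Cm_veps1; case: e; last by rewrite expr0 mul1r.
rewrite expr1 mulN1r.
apply: (etrans (y := 0)).
  exact: etrans (eq_Gev Q SLresX_spec (fun j => erefl _) (erefl _)) (Gev_spec_eq0 _ PQ).
apply: esym.
exact: etrans (eq_Gev Q SLresX_spec (fun j => erefl _) (erefl _)) (Gev_spec_neg_eq0 _ sQ PQ).
Qed.

Lemma sym_laurent_RK (P : {mpoly (SL R n)[l.+1]}) (Q : {mpoly (SL R N)[l.+2]}) : mskew Q -> flink P Q ->
  forall m, sym_laurent (RK Q)@_m.
Proof.
move=> sQ PQ m; apply/sym_laurentP; split; last by move=> s; apply: Kperm_RK_coef.
apply: remove_Eden; last exact: RK_denominator.
  by move=> s; apply: Kperm_RK_coef.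
by move=> e; apply: RK_regv; apply: pole_condition sQ PQ.
Qed.

End RegularSum.

(** * Adding one parameter *)

Section WidenField.
Variables (R : realType) (n : nat).
Local Notation C := R[i].
Local Notation K := (Kz R n).
Local Notation K' := (Kz R n.+1).

Definition wemb : {rmorphism {mpoly C[n]} -> {mpoly C[n.+1]}} :=
  mmap (@mpolyC n.+1 C) (fun j => 'X_(lift ord_max j)).

Definition wret : {rmorphism {mpoly C[n.+1]} -> {mpoly C[n]}} :=
  mmap (@mpolyC n C) (snocr (fun j => 'X_j) 1).

Lemma wret_C c : wret c%:MP = c%:MP. Proof. exact: mmapC. Qed.

Lemma wret_X j : wret 'X_(lift ord_max j) = 'X_j.
Proof. by rewrite /wret /= mmapX mmap1U /snocr liftK. Qed.

Lemma wret_X_max : wret 'X_ord_max = 1.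
Proof. by rewrite /wret /= mmapX mmap1U /snocr unlift_none. Qed.

Lemma wret_wemb p : wret (wemb p) = p.
Proof.
apply: etrans (rmorph_mmap wret _ _ p) (etrans (eq_mmap p _ _) (mmap_id p)) => [c|j].
  exact: wret_C.
exact: wret_X.
Qed.

(** Needed on the whole field, whereas [wid] is defined on [SL]: the single coefficients [kap] of
    the residue sum are not symmetric. *)
Definition widK (c : K) : K' := value (@vwid R n) c.

Lemma hv_widK c : hv (tz R n) (evz (@vwid R n)) c (widK c).
Proof. exact: (hv_retract wret_C wret_X). Qed.

Lemma widKE c d : hv (tz R n) (evz (@vwid R n)) c d -> widK c = d.
Proof. exact: valueE. Qed.

Lemma widK_is_zmod : zmod_morphism widK.
Proof. by move=> c d; apply: widKE; apply: hvB; try exact: tz_eq0; apply: hv_widK. Qed.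

Lemma widK_is_monoid : monoid_morphism widK.
Proof.
split=> [|c d]; first exact: widKE (hv1 _ _).
by apply: widKE; apply: hvM; try exact: tz_eq0; apply: hv_widK.
Qed.

HB.instance Definition _ := GRing.isZmodMorphism.Build K K' widK widK_is_zmod.
HB.instance Definition _ := GRing.isMonoidMorphism.Build K K' widK widK_is_monoid.

Lemma widK_tz p : widK (tz R n p) = tz R n.+1 (wemb p).
Proof.
apply: etrans (widKE (hv_embed _ _ p)) _.
apply: esym; exact: (rmorph_mmap (tz R n.+1)).
Qed.

Lemma widK_zvar j : widK (zvar R j) = zvar R (lift ord_max j).
Proof. exact: widKE (hv_zvar _ _). Qed.

Lemma rmorph_cross (A B : comNzRingType) (h : {rmorphism A -> B}) (a b c d : A) (a' b' d' : B) k :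
  a * b ^+ k = c * d -> h a = a' -> h b = b' -> h d = d' -> a' * b' ^+ k = h c * d'.
Proof. by move=> /(congr1 h) e <- <- <-; rewrite -rmorphXn -!rmorphM. Qed.

Lemma frac_cross (F : fieldType) (a b c d : F) : b != 0 -> d != 0 -> a / b = c / d -> a * d = c * b.
Proof. by move=> b0 d0 /eqP; rewrite eqr_div // => /eqP. Qed.

Lemma frac_cross' (F : fieldType) (a b c d : F) : b != 0 -> d != 0 -> a * d = c * b -> a / b = c / d.
Proof. by move=> b0 d0 h; apply/eqP; rewrite eqr_div //; apply/eqP. Qed.

(** The equality of fractions is cross-multiplied to an identity of polynomials in n + 1 variables,
    and setting the additional variable to 1 brings it back to n variables. *)
Lemma laurent_widK c : laurent (widK c) -> laurent c.
Proof.
move=> [p [k h]]; have [N [D [D0 cE]]] := fraction_exists c.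
have tD0 : tz R n D != 0 by rewrite tz_eq0.
have wD0 : tz R n.+1 (wemb D) != 0.
  rewrite tz_eq0; apply: contraNneq D0 => h0.
  by rewrite -[D]wret_wemb h0 rmorph0.
have zk m : tz R m (\prod_j 'X_j) ^+ k != 0 by rewrite expf_neq0 // -zprodE zprod_neq0.
have e : wemb N * (\prod_j 'X_j) ^+ k = p * wemb D.
  apply/eqP; rewrite -subr_eq0 -(@tz_eq0 R) rmorphB !rmorphM (rmorphXn (tz R n.+1)) subr_eq0; apply/eqP.
  apply: (frac_cross wD0 (zk _)).
  apply: etrans h; apply: etrans (congr2 (fun a b => a / b) (esym (widK_tz N)) (esym (widK_tz D))) _.
  exact: etrans (esym (fmorph_div (widK : {rmorphism K -> K'}) _ _)) (congr1 widK (esym cE)).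
exists (wret p), k; apply: etrans cE (frac_cross' tD0 (zk _) _).
have e2 : N * (\prod_j 'X_j) ^+ k = wret p * D.
  apply: (rmorph_cross e (wret_wemb N) _ (wret_wemb D)).
  apply: etrans (rmorph_prod wret _ _ _) _; rewrite big_ord_max_prod wret_X_max mulr1.
  by apply: eq_bigr => j _; rewrite wret_X.
apply: etrans (congr2 *%R (erefl _) (esym (rmorphXn (tz R n) _ _))) _.
exact: etrans (esym (rmorphM (tz R n) _ _)) (etrans (congr1 (tz R n) e2) (rmorphM (tz R n) _ _)).
Qed.

Lemma laurent_zvarN (j : 'I_n.+1) : laurent (- zvar R j)^-1.
Proof. by rewrite invrN; apply: laurentN; apply: laurent_zvarV. Qed.

End WidenField.

Lemma laurent_spec (R : realType) n (c : SL R n.+2) : laurent (spec c).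
Proof.
have [p [k h]] := sym_laurent_laurent (SLvalP' c).
pose w (j : 'I_n.+2) : {mpoly R[i][n.+1]} := if unlift ord_max j is Some k then 'X_k else - 'X_ord_max.
have ev q : evz (@vspec R n) q = tz R n.+1 (mmap (@mpolyC n.+1 R[i]) w q).
  apply: esym; apply: etrans (rmorph_mmap (tz R n.+1) _ _ q) (eq_mmap q (fun c => erefl _) _) => j.
  by rewrite /w /= /vspec; case: unliftP => [i|] _ //; rewrite rmorphN.
have pe : evz (@vspec R n) (\prod_j 'X_j) = \prod_j vspec R j.
  rewrite rmorph_prod; apply: eq_bigr => j _; exact: etrans (mmapX _ _ _) (mmap1U _ _).
have p0 : \prod_j vspec R j != 0 :> Kz R n.+1 by apply/prodf_neq0 => j _; apply: vspec_neq0.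
have -> : spec c = tz R n.+1 (mmap (@mpolyC n.+1 R[i]) w p) * (\prod_j (vspec R j)^-1) ^+ k.
  apply: valueE; rewrite h -ev prodfV exprVn.
  apply: hvM; first exact: hv_embed.
  apply: hvV; first by rewrite expf_neq0.
  by apply: hvX; rewrite -pe; apply: hv_embed.
apply: laurentM; first exact: laurent_poly.
apply: laurentX; apply: laurent_prod => j _; rewrite /vspec; case: unliftP => [i|] _; first exact: laurent_zvarV.
exact: laurent_zvarN.
Qed.

(** * The link identity for the sum of residues *)

Section LiftedSum.
Variables (R : realType) (n l : nat).
Local Notation K' := (Kz R n.+1).
Local Notation z := (zvar R (@ord_max n)).

Lemma snocr3_tperm (T : Type) (x : 'I_l -> T) (a b c : T) :
  snocr (snocr (snocr x a) b) c
  = snocr (snocr (snocr x c) b) a \o tperm ord_max (lift ord_max (lift ord_max ord_max)).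
Proof.
apply: functional_extensionality_dep => j /=.
case: (unliftP ord_max j) => [k|] ->; last by rewrite tpermL !snocr_lift_max !snocr_max.
rewrite snocr_lift_max; case: (unliftP ord_max k) => [i|] ->; last first.
  by rewrite tpermD ?(inj_eq (@lift_inj _ _)) ?neq_lift // 1?eq_sym ?neq_lift // !snocr_lift_max !snocr_max.
rewrite snocr_lift_max; case: (unliftP ord_max i) => [m|] ->; last by rewrite tpermR !snocr_max.
rewrite tpermD ?neq_lift // ?(inj_eq (@lift_inj _ _)) ?neq_lift //.
by rewrite !snocr_lift_max.
Qed.

Lemma Gev_snocr_flip (A : comNzRingType) m (f : {rmorphism SL R m -> A}) (x : 'I_l -> A) a y Q : mskew Q ->
  Gev f (snocr x a) y Q = - mmap f (snocr (snocr (snocr x y) (- y)) a) Q.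
Proof.
move=> sQ; rewrite /Gev snocr3_tperm mmap_skew // odd_tperm neq_lift expr1 mulN1r //.
Qed.

Lemma flip_factors (A : comNzRingType) (a c y w w' : A) (x : 'I_l -> A) : w = - w' ->
  - (a * (\prod_j (1 - snocr (snocr x y) (- y) j ^+ 2 * c)) * w)
  = a * (\prod_j (1 - x j ^+ 2 * c)) * ((1 - y ^+ 2 * c) ^+ 2 * w').
Proof.
move=> ->; rewrite (big_snocr (fun v => 1 - v ^+ 2 * c)) (big_snocr (fun v => 1 - v ^+ 2 * c)) sqrrN; ring.
Qed.

(** An exchange of variables moves 1/z to the last place, where the link applies; y and - y then
    each contribute a factor 1 - y^2 z^2. *)
Lemma Gev_flink (P : {mpoly (SL R n)[l.+2]}) (Q : {mpoly (SL R n.+2)[l.+3]}) (y : {mpoly K'[l]}) :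
  mskew P -> mskew Q -> flink P Q ->
  Gev (specX R n l) (snocr (fun j => 'X_j) (zVX R n l)) y Q
  = Cm R n l (z ^- n.+1) * (\prod_j (1 - 'X_j ^+ 2 * zX R n l ^+ 2))
      * ((1 - y ^+ 2 * zX R n l ^+ 2) ^+ 2 * Gev (widX R n l) (fun j => 'X_j) y P).
Proof.
move=> sP sQ PQ; apply: etrans (Gev_snocr_flip _ _ _ _ sQ) _.
apply: etrans (congr1 -%R (flinkX (snocr (snocr (fun j => 'X_j) y) (- y)) PQ)) _.
apply: flip_factors.
apply: etrans (GevN (widX R n l) (fun j => 'X_j) y sP).
by rewrite /Gev opprK.
Qed.

End LiftedSum.

Lemma cancel_injective (A : comNzRingType) (B : idomainType) (h : {rmorphism A -> B}) (e a b : A) :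
  injective h -> h e != 0 -> e * a = e * b -> a = b.
Proof. by move=> hi he /(congr1 h); rewrite !rmorphM => /(mulfI he)/hi. Qed.

Lemma rmorph_factor (A B : comNzRingType) (h : {rmorphism A -> B}) a b a' b' :
  h a = a' -> h b = b' -> h (1 - a ^+ 2 * b ^+ 2) = 1 - a' ^+ 2 * b' ^+ 2.
Proof. by move=> <- <-; rewrite rmorphB rmorph1 rmorphM !rmorphXn. Qed.

Lemma map_mpoly_ext (A B D : comNzRingType) k (g : {rmorphism A -> B}) (f : {rmorphism B -> D}) (h : {rmorphism A -> D})
  (p : {mpoly A[k]}) : (forall c, f (g c) = h c) -> map_mpoly f (map_mpoly g p) = map_mpoly h p.
Proof. by move=> e; apply/mpolyP => m; rewrite !mcoeff_map_mpoly; apply: e. Qed.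

Lemma regroup4 (A : comNzRingType) (e p c w s x : A) : s = e * p -> x = c * (w * s) -> x = e * (c * p * w).
Proof. by move=> -> ->; ring. Qed.

Lemma mulr_eq0r (A : comNzRingType) (a b : A) : b = 0 -> a * b = 0.
Proof. by move=> ->; rewrite mulr0. Qed.

Section GevFactor.
Variables (R : realType) (m l : nat) (Q : {mpoly (SL R m)[l.+3]}).
Hypothesis sQ : mskew Q.

(** The variable next to the pair (- y, y) is left free, so that splitting off y_0 + y_1 becomes the
    division of a univariate polynomial by a linear factor. *)
Definition Gevp (A : comNzRingType) (f : SL R m -> A) (x : 'I_l -> A) (y : A) : {poly A} :=
  Gev (polyC \o f) (snocr (polyC \o x) 'X) y%:P Q.

Lemma horner_Gevp (A : comNzRingType) (f : {rmorphism SL R m -> A}) x y a :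
  (Gevp f x y).[a] = Gev f (snocr x a) y Q.
Proof.
apply: etrans (rmorph_Gev (horner_eval a) (polyC \o f) _ _ Q) (eq_Gev Q _ _ _) => [c|j|].
- exact: hornerC.
- rewrite /= /snocr; case: unliftP => [k|] _; [exact: hornerC | exact: hornerX].
exact: hornerC.
Qed.

Lemma map_Gevp (A B : comNzRingType) (h : {rmorphism A -> B}) (f : {rmorphism SL R m -> A}) x y :
  map_poly h (Gevp f x y) = Gevp (h \o f) (h \o x) (h y).
Proof.
apply: etrans (rmorph_Gev (map_poly h) (polyC \o f) _ _ Q) (eq_Gev Q _ _ _) => [c|j|].
- exact: map_polyC.
- rewrite /= /snocr; case: unliftP => [k|] _; [exact: map_polyC | exact: map_polyX].
exact: map_polyC.
Qed.

Lemma Gev_repeat (A : comNzRingType) (f : {rmorphism SL R m -> A}) x y : Gev f (snocr x y) y Q = 0.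
Proof.
apply: (@mmap_skew_eq0 _ _ _ _ _ _ (lift ord_max (lift ord_max ord_max)) ord_max _ sQ).
  by rewrite eq_sym neq_lift.
by rewrite !snocr_lift_max !snocr_max.
Qed.

(* By skew-symmetry the value vanishes when y0 = - y1. *)
Lemma Gev_factor (A : comNzRingType) (B : idomainType) (h : {rmorphism A -> B}) (f : {rmorphism SL R m -> A}) x y0 y1 :
  Gevp (h \o f) (h \o x) (h y1) = 0 ->
  exists2 w, Gev f (snocr x y0) y1 Q = w * (y0 + y1) & h w = 0.
Proof.
move=> h0; have r1 : root (Gevp f x y1) (- y1).
  apply/rootP; rewrite horner_Gevp.
  have := GevN f (snocr x (- y1)) (- y1) sQ; rewrite opprK => ->.
  by rewrite Gev_repeat oppr0.
have /factor_theorem[p hp] := r1.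
exists p.[y0].
  by rewrite -horner_Gevp hp hornerM hornerXsubC opprK.
have : map_poly h p * map_poly h ('X - (- y1)%:P) = 0.
  apply: etrans (esym (rmorphM (map_poly h) _ _)) (etrans (congr1 (map_poly h) (esym hp)) _).
  exact: etrans (map_Gevp _ _ _ _) h0.
rewrite map_polyXsubC => /eqP; rewrite mulf_eq0 polyXsubC_eq0 orbF => /eqP hp0.
by rewrite -horner_map hp0 horner0.
Qed.

End GevFactor.

Lemma widK_yv (R : realType) n (k : 'I_n) : widK (yv R k) = (zvar R (lift ord_max k))^-1.
Proof. by apply: widKE; apply: hvV; [apply: zvar_neq0 | apply: hv_zvar]. Qed.

Section EvaluatedSum.
Variables (R : realType) (n l : nat) (P : {mpoly (SL R n)[l.+2]}) (Q : {mpoly (SL R n.+2)[l.+3]}).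
Hypotheses (sP : mskew P) (sQ : mskew Q) (PQ : flink P Q).
Local Notation N := n.+2.
Local Notation K := (Kz R N).
Local Notation K' := (Kz R n.+1).
Local Notation z := (zvar R (@ord_max n)).
Local Notation v := (veps R true).
Local Notation O := (VR (veps R true : 'I_N -> K')).
Local Notation XO k := (fun j : 'I_k => 'X_j : {mpoly O[k]}).
Local Notation XK k := (fun j : 'I_k => 'X_j : {mpoly K'[k]}).
Local Notation y0 k := (CO R n true k (yO R true (i0 n))).
Local Notation y1 k := (CO R n true k (yO R true (i1 n))).

(** 1/z is lifted to the function 1/z_i0 of the local ring, so that the substitution can be made
    before the reduction to the divisor. The two operations commute by [resX_evO]. *)
Definition evO : {rmorphism {mpoly O[l.+1]} -> {mpoly O[l]}} :=
  mmap (CO R n true l) (snocr (XO l) (y0 l)).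

Definition evK : {rmorphism {mpoly K'[l.+1]} -> {mpoly K'[l]}} :=
  mmap (Cm R n l) (snocr (XK l) (zVX R n l)).

Lemma resX_snocr j : resX R n true l (snocr (XO l) (y0 l) j) = snocr (XK l) (zVX R n l) j.
Proof.
rewrite /snocr; case: unliftP => [k|] _; first exact: resX_X.
apply: etrans (resX_C _ _) (etrans (congr1 (Cm R n l) (res_yO R true (i0 n))) _).
exact: Cm_veps0.
Qed.

Lemma resX_evO p : resX R n true l (evO p) = evK (resX R n true l.+1 p).
Proof.
apply: etrans (rmorph_mmap (resX R n true l) _ _ p) _.
apply: etrans (eq_mmap p _ _) (esym (mmap_map_mpoly (Cm R n l) (@VRres R N n.+1 v) _ p)) => [c|j].
  exact: resX_C.
exact: resX_snocr.
Qed.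

Lemma evO_C c : evO (CO R n true l.+1 c) = CO R n true l c.
Proof. exact: mmapC. Qed.

Lemma evO_Gev a :
  evO (Gev (SLOX R n true l.+1) (XO l.+1) (CO R n true l.+1 (yO R true a)) Q)
  = Gev (SLOX R n true l) (snocr (XO l) (y0 l)) (CO R n true l (yO R true a)) Q.
Proof.
apply: etrans (rmorph_Gev evO (SLOX R n true l.+1) _ _ Q) (eq_Gev Q _ _ _) => [c|j|].
- exact: evO_C.
- exact: etrans (mmapX _ _ _) (mmap1U _ _).
exact: evO_C.
Qed.

Definition ellO : O := liftV v (ell R n true).

Lemma val_ellO : VRval ellO = ell R n true.
Proof.
apply: liftVK; apply: regvB; first by eexists; apply: hv_zvar.
by apply: regvM; eexists; [apply: hvX; apply: hvN; apply: hv1 | apply: hv_zvar].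
Qed.

Lemma yO_sum : yO R true (i0 n) + yO R true (i1 n) = ellO * (yO R true (i0 n) * yO R true (i1 n)).
Proof.
apply: VRval_inj; apply: etrans (rmorphD (@VRval R N n.+1 v) _ _) _.
apply: esym; apply: etrans (rmorphM (@VRval R N n.+1 v) _ _) _.
apply: etrans (congr2 *%R val_ellO (rmorphM (@VRval R N n.+1 v) _ _)) _.
apply: etrans (congr2 (fun a b => ell R n true * (a * b)) (val_yO R true (i0 n)) (val_yO R true (i1 n))) _.
apply: etrans _ (congr2 +%R (esym (val_yO R true (i0 n))) (esym (val_yO R true (i1 n)))).
rewrite /ell expr1 mulN1r opprK /yv.
have := zvar_neq0 R (i0 n); have := zvar_neq0 R (i1 n).
move: (zvar R (i0 n)) (zvar R (i1 n)) => a b b0 a0.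
by rewrite mulrDl mulVKf // mulrCA mulfV // mulr1 addrC.
Qed.

Lemma Gevp_res_eq0 :
  Gevp Q (resX R n true l \o SLOX R n true l) (resX R n true l \o XO l) (resX R n true l (y1 l)) = 0.
Proof.
pose i : {rmorphism K' -> {poly {mpoly K'[l]}}} := polyC \o Cm R n l.
have h0 : Gev (i \o @spec R n) (snocr (polyC \o XK l) 'X) (i z^-1) Q = 0.
  apply: etrans (flink_eval i (snocr (snocr (polyC \o XK l) 'X) (- i z^-1)) PQ) (prod_snocr_eq0 _ _ _ _).
  by rewrite sqrrN -exprMn -rmorphM mulVf ?zvar_neq0 // rmorph1 expr1n subrr.
apply: etrans (eq_Gev Q _ _ _) (etrans (GevN (i \o @spec R n) _ _ sQ) (etrans (congr1 -%R h0) (oppr0 _))).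
- by move=> c; apply: (congr1 polyC); apply: etrans (resX_SLOX true l _) (SLresX_spec _ _).
- by move=> j; rewrite /snocr; case: unliftP => [k|] _ //; apply: (congr1 polyC); apply: resX_X.
apply: etrans (congr1 polyC (etrans (resX_C _ _) (congr1 (Cm R n l) (res_yO R true (i1 n))))) _.
apply: etrans (congr1 polyC (Cm_veps1 R n l true)) _.
by rewrite expr1 mulN1r rmorphN.
Qed.

(** After the substitution the summand of i0 has a repeated argument and vanishes. The summand of i1
    is divisible by y_0 + y_1, which is the equation of the divisor times y_0 y_1, and its cofactor
    vanishes on the divisor. Hence the quotient still vanishes there. *)
Lemma evO_pole (q : {mpoly O[l.+1]}) :
  valX R n true l.+1 (numO (XO l.+1) Q) = Cn R N l.+1 (ell R n true) * valX R n true l.+1 q ->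
  resX R n true l (evO q) = 0.
Proof.
move=> hq; have e1 : numO (XO l.+1) Q = CO R n true l.+1 ellO * q.
  apply: (@map_VRval_inj R N n.+1 v l.+1); apply: etrans hq (esym _).
  apply: etrans (rmorphM (valX R n true l.+1) _ _) (congr2 *%R _ (erefl _)).
  exact: etrans (valX_C _ _) (congr1 (Cn R N l.+1) val_ellO).
have [w hw w0] := Gev_factor sQ (y0 l) Gevp_res_eq0.
have e2 : evO (numO (XO l.+1) Q)
  = CO R n true l (pole_coef1O R n true) * (w * (y0 l + y1 l)).
  apply: etrans (rmorphD evO _ _) _; apply: etrans (congr2 +%R _ _) (add0r _).
    apply: etrans (rmorphM evO _ _) (etrans (congr2 *%R (erefl _) _) (mulr0 _)).
    exact: etrans (evO_Gev (i0 n)) (Gev_repeat sQ _ _ _).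
  exact: etrans (rmorphM evO _ _) (congr2 *%R (evO_C _) (etrans (evO_Gev (i1 n)) hw)).
have e3 : y0 l + y1 l = CO R n true l ellO * CO R n true l (yO R true (i0 n) * yO R true (i1 n)).
  apply: etrans (esym (rmorphD (CO R n true l) _ _)) _.
  exact: etrans (congr1 (CO R n true l) yO_sum) (rmorphM (CO R n true l) _ _).
have e4 : evO q = CO R n true l (pole_coef1O R n true) * CO R n true l (yO R true (i0 n) * yO R true (i1 n)) * w.
  apply: (@cancel_injective _ _ (valX R n true l) (CO R n true l ellO)).
  - exact: map_VRval_inj.
  - apply: (@eq_ind_r _ (Cn R N l (ell R n true)) (fun w => w != 0)).
      exact: (eq_ind_r (fun b => ~~ b) (ell_neq0 R n true) (mpolyC_eq0 _ (ell R n true))).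
    exact: etrans (valX_C _ _) (congr1 (Cn R N l) val_ellO).
  apply: etrans (etrans (congr2 *%R (esym (evO_C ellO)) (erefl _)) (esym (rmorphM evO _ _))) _.
  exact: regroup4 e3 (etrans (congr1 evO (esym e1)) e2).
apply: etrans (congr1 (resX R n true l) e4) _.
exact: etrans (rmorphM (resX R n true l) _ _) (mulr_eq0r _ w0).
Qed.

Local Notation yk k := (zvar R (lift ord_max k))^-1.

Lemma square_cancel (F : fieldType) (h E u : F) : u != 0 -> h * (E * u * u)^-1 * u ^+ 2 = h * E^-1.
Proof. by move=> u0; rewrite expr2 !invfM; move: (E^-1) => E'; field. Qed.

(** In the denominator belonging to k, the parameters z and - z each give 1 - z^2 / z_k^2. The
    square that cancels them is the one produced by [Gev_flink]. *)
Lemma kapv_widK (k : 'I_n) : kapv R true k * (1 - yk k ^+ 2 * z ^+ 2) ^+ 2 = widK (kap R k).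
Proof.
have u0 : 1 - yk k ^+ 2 * z ^+ 2 != 0.
  rewrite mulrC; apply: one_sub_sq_neq0; first exact: zvar_neq0.
    by apply: zvarB_neq0; exact: neq_lift.
  exact: zvarD_neq0.
pose E := \prod_(j < n | j != k) (1 - zvar R (lift ord_max j) ^+ 2 * yk k ^+ 2) : K'.
have -> : kapv R true k = - 2^-1 * (E * (1 - yk k ^+ 2 * z ^+ 2) * (1 - yk k ^+ 2 * z ^+ 2))^-1.
  congr (_ * _^-1); rewrite /Edv big_mkcond big_ord_max_prod big_ord_max_prod.
  rewrite -/(i0 n) -/(i1 n) !(eq_sym _ (outer k)) outer_i0 outer_i1 veps0 (v_sq R true (or_intror (erefl _))).
  rewrite ![z ^+ 2 * _]mulrC; congr (_ * _ * _); rewrite /E [RHS]big_mkcond.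
  apply: eq_bigr => j _; rewrite /outer !(inj_eq (@lift_inj _ _)) eq_sym.
  by case: eqP => // _; rewrite vepsl.
apply: etrans (square_cancel _ _ u0) _; apply: esym.
rewrite /kap rmorphM rmorphN !fmorphV rmorph_nat; congr (_ * _^-1).
rewrite rmorph_prod; apply: eq_bigr => j _.
exact: rmorph_factor (widK_zvar R j) (widK_yv R k).
Qed.

Lemma pull_factor (A : comNzRingType) (a c u b g : A) (x : A) : a * u = b -> x = c * (u * g) -> a * x = c * (b * g).
Proof. by move=> <- ->; ring. Qed.

Local Notation pre := (Cm R n l (z ^- n.+1) * (\prod_(j < l) (1 - 'X_j ^+ 2 * zX R n l ^+ 2))).

Lemma evO_reg :
  resX R n true l (evO (regO (XO l.+1) Q)) = pre * map_mpoly (@widK R n) (RK P).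
Proof.
pose h : {rmorphism {mpoly (Kz R n)[l]} -> {mpoly K'[l]}} := map_mpoly (@widK R n).
have hC c : h (Cn R n l c) = Cm R n l (widK c) by apply: map_mpolyC.
apply: etrans (congr1 (resX R n true l) (rmorph_sum evO _ _ _)) _.
apply: etrans (rmorph_sum (resX R n true l) _ _ _) _.
apply: etrans (esym (etrans (congr1 (fun w => pre * h w) (RKE P)) (etrans (congr1 (fun w => pre * w) (rmorph_sum h _ _ _)) (mulr_sumr _ _ _ _)))).
apply: eq_bigr => k _.
apply: etrans (etrans (congr1 (resX R n true l) (rmorphM evO _ _)) (rmorphM (resX R n true l) _ _)) _.
apply: etrans (congr2 *%R _ (erefl _)) _.
  apply: etrans (congr1 (resX R n true l) (evO_C _)) _.
  exact: etrans (resX_C _ _) (congr1 (Cm R n l) (VRresE (hv_kap R true k))).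
have rhs : h (Cn R n l (kap R k) * Gev (SLn R n l) (fun j => 'X_j) (Cn R n l (yv R k)) P)
  = Cm R n l (widK (kap R k)) * Gev (widX R n l) (XK l) (Cm R n l (yk k)) P.
  apply: etrans (rmorphM h _ _) (congr2 *%R (hC _) _).
  apply: etrans (rmorph_Gev h (SLn R n l) _ _ P) (eq_Gev P _ _ _) => [c|j|].
  - exact: hC.
  - exact: map_mpolyX.
  apply: etrans (hC _) (congr1 (Cm R n l) _).
  exact: widK_yv.
apply: etrans (congr1 (fun w => pre * w) (esym rhs)).
apply: (@pull_factor _ _ _ ((1 - Cm R n l (yk k) ^+ 2 * zX R n l ^+ 2) ^+ 2)); last first.
  apply: etrans (congr1 (resX R n true l) (evO_Gev (outer k))) _.
  apply: etrans (resX_Gev (snocr (XO l) (y0 l)) (outer k) Q) _.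
  apply: etrans (Gev_flink (Cm R n l (yk k)) sP sQ PQ); apply: eq_Gev.
  - exact: SLresX_spec.
  - exact: resX_snocr.
  by rewrite vepsl.
apply: etrans (congr1 (Cm R n l) (kapv_widK k)).
apply: esym; apply: etrans (rmorphM (Cm R n l) _ _) (congr2 *%R (erefl _) _).
exact: etrans (rmorphXn (Cm R n l) 2 _) (congr1 (fun w => w ^+ 2) (rmorph_factor (h := Cm R n l) (erefl _) (erefl _))).
Qed.

Lemma RK_link (Q' : {mpoly (SL R N)[l.+1]}) : map_mpoly (@SLval R N) Q' = RK Q ->
  mmap (specX R n l) (snocr (XK l) (zVX R n l)) Q' = pre * map_mpoly (@widK R n) (RK P).
Proof.
move=> hQ'; have [q [hq hR]] := RK_pole (pole_condition true sQ PQ).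
have e1 : map_mpoly (@SLO R n true) Q' = regO (XO l.+1) Q + q.
  apply: (@map_VRval_inj R N n.+1 v l.+1); apply: etrans hR; apply: etrans hQ'.
  exact: map_mpoly_ext (fun c => VRval_SLO true c).
have e2 : map_mpoly (@spec R n) Q' = resX R n true l.+1 (regO (XO l.+1) Q + q).
  apply: etrans (esym _) (congr1 (resX R n true l.+1) e1).
  by apply: map_mpoly_ext => c; apply: VRresE; apply: hv_spec.
apply: etrans (esym (mmap_map_mpoly (Cm R n l) (@spec R n) _ Q')) _.
apply: etrans (congr1 evK e2) _.
apply: etrans (esym (resX_evO _)) _.
apply: etrans (congr1 (resX R n true l) (rmorphD evO _ _)) _.
apply: etrans (rmorphD (resX R n true l) _ _) _.
exact: etrans (congr2 +%R evO_reg (evO_pole hq)) (addr0 _).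
Qed.

End EvaluatedSum.

Section SquaredRaising.
Variables (R : realType) (n : nat).

Lemma peel_factor (A : comNzRingType) (a b c m : A) : b * a = 1 -> b * (a * c * m) = c * m.
Proof. by move=> h; rewrite !mulrA h mul1r. Qed.

(** [sym_laurent_RK] concerns the second member of a link. For the first member the identity
    [RK_link] is divided by the product of the 1 - X_a^2 z^2, invertible as a power series in the
    X_a. The coefficients are thus Laurent polynomials in n + 1 parameters, and then in n. *)
Lemma sym_laurent_RK_of_link l (P : {mpoly (SL R n)[l.+2]}) (Q : {mpoly (SL R n.+2)[l.+3]}) :
  mskew P -> mskew Q -> flink P Q -> forall m, sym_laurent (RK P)@_m.
Proof.
move=> sP sQ PQ m; apply/sym_laurentP; split; last by move=> s; apply: Kperm_RK_coef.
apply: laurent_widK; have hQ := liftPK (sym_laurent_RK sQ PQ).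
have h := RK_link sP sQ PQ hQ.
pose S := @laurent R n.+1.
have S1 : S 1 by apply: laurent1.
have SB : forall a b, S a -> S b -> S (a - b) by exact: laurentB.
have SM : forall a b, S a -> S b -> S (a * b) by exact: laurentM.
have c1 : cin S (mmap (specX R n l) (snocr (fun j => 'X_j) (zVX R n l)) (liftP (RK Q))).
  apply: cin_mmap => // [c|j]; first exact: laurent_spec.
  rewrite /snocr; case: unliftP => [k|] _; first exact: cinX S1 SB k.
  by apply: (cinC S1 SB); apply: laurent_zvarV.
have c2 : cin S (Cm R n l (zvar R ord_max ^+ n.+1) * mmap (specX R n l) (snocr (fun j => 'X_j) (zVX R n l)) (liftP (RK Q))).
  by apply: (cinM S1 SB SM) c1; apply: (cinC S1 SB); apply: laurentX; apply: laurent_zvar.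
have c3 : cin S ((\prod_(a < l) (1 - 'X_a ^+ 2 * (zvar R ord_max ^+ 2)%:MP)) * map_mpoly (@widK R n) (RK P)).
  refine (eq_ind _ (fun w => cin S w) c2 _ _); apply: etrans (congr1 (fun w => _ * w) h) _.
  apply: etrans (peel_factor _ _ _) _.
    apply: etrans (esym (rmorphM (Cm R n l) _ _)) (etrans (congr1 (Cm R n l) _) (rmorph1 (Cm R n l))).
    by rewrite mulfV // expf_neq0 // zvar_neq0.
  apply: (congr2 *%R _ (erefl _)); apply: eq_bigr => a _.
  by apply: (congr1 (fun w => 1 - 'X_a ^+ 2 * w)); apply: (esym (rmorphXn (Cm R n l) 2 _)).
have := cin_cancel_prod S1 SB SM (laurent_zvar R ord_max) c3 m.
by rewrite mcoeff_map_mpoly.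
Qed.

Lemma flink_RK l (P : {mpoly (SL R n)[l.+2]}) (Q : {mpoly (SL R n.+2)[l.+3]}) :
  mskew P -> mskew Q -> flink P Q -> flink (liftP (RK P)) (liftP (RK Q)).
Proof.
move=> sP sQ PQ; apply/flinkE.
apply: etrans (RK_link sP sQ PQ (liftPK (sym_laurent_RK sQ PQ))) _.
apply: (congr2 *%R (erefl _)).
apply: etrans (congr1 (map_mpoly (@widK R n)) (esym (liftPK (sym_laurent_RK_of_link sP sQ PQ)))) _.
exact: (map_mpoly_ext (h := @wid R n)).
Qed.

Variables (act : Ui R -> skewA R n -> skewA R n) (act2 : Ui R -> skewA R n.+2 -> skewA R n.+2).
Hypotheses (act_action : is_action act) (act2_action : is_action act2).

Lemma good_Xp2 (u : Ures R) : Ures_val u = Udiv (Ux R true 0) 2 -> good act act2 (Uspec u).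
Proof.
move=> uE; have vE : Ures_val u = div_sq (@Xp_ge0 R) 0.
  have e0 : Xp_ge0 R 0 = Ux R true 0 by rewrite /Xp_ge0 expr0z scale1r.
  by rewrite uE /div_sq big_ord1 -[(0 - _)%N]/0%N -[nat_of_ord _]/0%N e0 /Udiv expr2.
(* Unlike for x_0^+, the normalizations for n and n + 2 agree. *)
have e2 : 'i * (-1) ^+ n.+3 = 'i * (-1) ^+ n.+1 :> R[i] by rewrite -addn2 exprD sqrrN expr1n mulr1.
apply: (goodZ_inv act_action act2_action (c := 'i * (-1) ^+ n.+1)).
  by rewrite mulf_neq0 ?neq0Ci // signr_eq0.
move=> P Q /linkP[P' [Q' [hP hQ PQ]]]; apply/linkP.
have sP l : mskew (P' l) by apply: lifts_skew (hP l).
have sQ l : mskew (Q' l) by apply: lifts_skew (hQ l).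
exists (fun l => liftP (RK (P' l.+2))), (fun l => liftP (RK (Q' l.+2))); split=> l.
- apply: etrans (liftPK (sym_laurent_RK_of_link (sP _) (sQ _) (PQ l.+2))) _.
  by apply: esym; apply: act_Xp2 vE _ => //; apply: hP.
- apply: etrans (liftPK (sym_laurent_RK (sQ _) (PQ l.+1))) _.
  by apply: esym; rewrite -e2; apply: act_Xp2 vE _ => //; apply: hQ.
exact: flink_RK (sP _) (sQ _) (PQ l.+2).
Qed.

End SquaredRaising.

Theorem proposition3p3 (R : realType) (n : nat)
    (act : Ui R -> skewA R n -> skewA R n)
    (act2 : Ui R -> skewA R n.+2 -> skewA R n.+2)
    (act_action : is_action act) (act2_action : is_action act2)
    (l : int) (P : skewA R n) (Q : skewA R n.+2) (g : Ui R) :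
  Chat l P -> Chat (l + 1) Q -> link P Q -> link (act g P) (act2 g Q).
Proof.
move=> _ _; apply: (goodU_gen (good := good act act2)).
- exact: goodD.
- exact: goodM.
- exact: goodZ.
- exact: good1.
- by split=> [|u uE]; [apply: Ures_T | apply: good_T].
- by split=> [|u uE]; [apply: Ures_T' | apply: good_T'].
- by move=> k k0; split=> [|u uE]; [apply: Ures_A | apply: good_Uta k0 uE].
- by case; split=> [|u uE]; [apply: Ures_x | apply: good_Xp0 | apply: Ures_x | apply: good_Xm0].
- by split=> [|u uE]; [apply: Ures_x | apply: good_Xm1].
by case; split=> [|u uE]; [apply: Ures_X | apply: good_Xp2 | apply: Ures_X | apply: good_Xm2].
Qed.
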